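(* Let the standing assumptions (1)--(4) of the context hold. Then there exists a closed extension $(\overline{L},D(\overline{L}))$ of $$Lu:=L^0u+\langle\mathbf{B},\nabla u\rangle,\qquad u\in D(L^0)_{0,b},$$ on $L^1(\mathbb{R}^d,\mu)$ satisfying the following properties: (i) $(\overline{L},D(\overline{L}))$ generates a sub-Markovian $C_0$-semigroup of contractions $(\overline{T}_t)_{t>0}$ on $L^1(\mathbb{R}^d,\mu)$. In particular, $(\overline{L},D(\overline{L}))$ is a closed extension of $\big(\tfrac12\sum_{i,j=1}^d a_{ij}\partial_{ij}+\sum_{i=1}^d g_i\partial_i,\ C_0^\infty(\mathbb{R}^d)\big)$ which is the generator of a $C_0$-semigroup on $L^1(\mathbb{R}^d,\mu)$ (a maximal extension). (ii) If $(V_n)_{n\ge1}$ is an increasing sequence of relatively compact open subsets of $\mathbb{R}^d$ with $\mathbb{R}^d=\bigcup_{n\ge1}V_n$, then $$\overline{G}_\alpha f:=\lim_{n\to\infty}\overline{G}^{V_n}_\alpha f=(\alpha-\overline{L})^{-1}f\quad\text{in }L^1(\mathbb{R}^d,\mu)$$ for all $f\in L^1(\mathbb{R}^d,\mu)$ and $\alpha>0$. In particular, $(\overline{G}_\alpha)_{\alpha>0}$ is a sub-Markovian $C_0$-resolvent of contractions on $L^1(\mathbb{R}^d,\mu)$ and has $(\overline{L},D(\overline{L}))$ as generator. (iii) $D(\overline{L})_b\subset D(\mathcal{E}^0)$ and $$\mathcal{E}^0(u,v)-\int_{\mathbb{R}^d}\langle\mathbf{B},\nabla u\rangle v\,d\mu=-\int_{\mathbb{R}^d}\overline{L}u\,v\,d\mu,\qquad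 u\in D(\overline{L})_b,\ v\in H^{1,2}_0(\mathbb{R}^d,\mu)_{0,b}.$$ Moreover, $\mathcal{E}^0(u,u)\le-\int_{\mathbb{R}^d}\overline{L}u\,u\,d\mu$ for all $u\in D(\overline{L})_b$.
   Context: Function spaces. For open $V\subset\mathbb{R}^d$, $H^{1,2}_0(V,\mu)$ is the closure of $C_0^\infty(V)$ (smooth functions with compact support in $V$) in $L^2(V,\mu)$ w.r.t. the norm $(\int_V u^2d\mu+\int_V\|\nabla u\|^2d\mu)^{1/2}$, and $H^{1,2}_{loc}(V,\mu)$ is the space of all $u$ with $u\chi\in H^{1,2}_0(V,\mu)$ for all $\chi\in C_0^\infty(V)$. For a space $\mathcal{A}$ of functions on $V$, $\mathcal{A}_0$ denotes the elements $u\in\mathcal{A}$ such that the support of $|u|\mu$ is a compact subset of $V$, $\mathcal{A}_b$ the (essentially) bounded elements, and $\mathcal{A}_{0,b}=\mathcal{A}_0\cap\mathcal{A}_b$. Standing assumptions ($d\ge1$): (1) $\mu=\rho\,dx$, $\rho=\varphi^2$ with $\varphi\in H^{1,2}_{loc}(\mathbb{R}^d)$, and $\mathrm{supp}(\mu)=\mathbb{R}^d$. (2) $A=(a_{ij})_{1\le i,j\le d}$ with $a_{ji}=a_{ij}\in H^{1,2}_{loc}(\mathbb{R}^d,\mu)$ is locally strictly elliptic: for every relatively compact $V$ there is $\nu_V>0$ with $\nu_V^{-1}\|\xi\|^2\le\langle A(x)\xi,\xi\rangle\le\nu_V\|\xi\|^2$ for all $\xi\in\mathbb{R}^d$, $x\in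 V$. (3) $\mathbf{G}=(g_1,\dots,g_d)\in L^2_{loc}(\mathbb{R}^d,\mathbb{R}^d,\mu)$. (4) $\int_{\mathbb{R}^d}\big(\tfrac12\sum_{i,j}a_{ij}\partial_{ij}u+\langle\mathbf{G},\nabla u\rangle\big)d\mu=0$ for all $u\in C_0^\infty(\mathbb{R}^d)$. Notation. $\beta^{\rho,A}=(\beta^{\rho,A}_1,\dots,\beta^{\rho,A}_d)$ with $\beta^{\rho,A}_i=\tfrac12\sum_{j=1}^d\big(\partial_ja_{ij}+a_{ij}\tfrac{\partial_j\rho}{\rho}\big)$, and $\mathbf{B}=\mathbf{G}-\beta^{\rho,A}\in L^2_{loc}(\mathbb{R}^d,\mathbb{R}^d,\mu)$. $(\mathcal{E}^0,D(\mathcal{E}^0))$ is the symmetric Dirichlet form obtained as closure in $L^2(\mathbb{R}^d,\mu)$ of $\mathcal{E}^0(u,v)=\tfrac12\int_{\mathbb{R}^d}\langle A\nabla u,\nabla v\rangle d\mu$, $u,v\in C_0^\infty(\mathbb{R}^d)$, and $(L^0,D(L^0))$ is its self-adjoint generator: $\mathcal{E}^0(u,v)=-\int L^0u\,v\,d\mu$ for $u\in D(L^0)$, $v\in D(\mathcal{E}^0)$. One has $L^0u+\langle\mathbf{B},\nabla u\rangle=\tfrac12\sum_{i,j}a_{ij}\partial_{ij}u+\langle\mathbf{G},\nabla u\rangle$ for $u\in C_0^\infty(\mathbb{R}^d)$. Local objects. For a relatively compact open $V\subset\mathbb{R}^d$, $(L^{0,V},D(L^{0,V}))$ is the self-adjoint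 generator on $L^2(V,\mu)$ of the Dirichlet form $\tfrac12\int_V\langle A\nabla u,\nabla v\rangle d\mu$, $u,v\in H^{1,2}_0(V,\mu)$. The operator $L^Vu=L^{0,V}u+\langle\mathbf{B},\nabla u\rangle$, $u\in D(L^{0,V})_b$, is closable on $L^1(V,\mu)$ and its closure $(\overline{L}^V,D(\overline{L}^V))$ generates a sub-Markovian $C_0$-semigroup of contractions on $L^1(V,\mu)$ with resolvent $\overline{G}^V_\alpha=(\alpha-\overline{L}^V)^{-1}$, $\alpha>0$. For $f\in L^1(\mathbb{R}^d,\mu)$ put $\overline{G}^V_\alpha f:=\overline{G}^V_\alpha(f1_V)$, extended by $0$ outside $V$. An operator semigroup $(S_t)_{t>0}$ is sub-Markovian if $0\le f\le1$ implies $0\le S_tf\le1$; a resolvent $(G_\alpha)_{\alpha>0}$ is sub-Markovian if $0\le f\le 1$ implies $0\le\alpha G_\alpha f\le1$. *)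

(* Defs.v *)
From HB Require Import structures.
From mathcomp Require Import all_boot all_order all_algebra.
From mathcomp Require Import all_classical all_reals all_analysis.
From mathcomp Require Import measurable_realfun.

Set Implicit Arguments.
Unset Strict Implicit.
Unset Printing Implicit Defensive.

Import Order.TTheory GRing.Theory Num.Theory.
Import numFieldNormedType.Exports.

Local Open Scope classical_set_scope.
Local Open Scope ring_scope.

Definition borel_mx_display : measure_display.
Proof. exact: default_measure_display. Qed.

Section borel_mx.
Variables (R : realType) (m n : nat).

Definition borel_mx : set (set 'M[R]_(m, n)) := <<s @open 'M[R]_(m, n) >>.

Let borel_mx0 : borel_mx set0. Proof. exact: sigma_algebra0. Qed.
Let borel_mxC A : borel_mx A -> borel_mx (~` A).
Proof. exact: sigma_algebraC. Qed.
Let borel_mx_bigcup (F : (set 'M[R]_(m, n))^nat) :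
  (forall i, borel_mx (F i)) -> borel_mx (\bigcup_i F i).
Proof. exact: sigma_algebra_bigcup. Qed.

HB.instance Definition _ := @isMeasurable.Build borel_mx_display
  'M[R]_(m, n) borel_mx borel_mx0 borel_mxC borel_mx_bigcup.
End borel_mx.

Section borel_rV.
Variables (R : realType) (n : nat).

Lemma open_rV_measurable (U : set 'rV[R]_n) : open U -> measurable U.
Proof. by move=> oU; exact: sub_sigma_algebra. Qed.

Lemma measurable_coord (i : 'I_n) :
  measurable_fun [set: 'rV[R]_n] (fun v : 'rV[R]_n => v ord0 i : R).
Proof.
apply: (measurability _ (RGenOpens.measurableE R)).
move=> _ [_ [a [b ->] <-]]; rewrite setTI; apply: open_rV_measurable.
apply: open_comp; last exact: interval_open.
by move=> v _; exact: coord_continuous.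
Qed.

Lemma measurable_fun_rV d (T : measurableType d) (f : T -> 'rV[R]_n) :
  (forall i, measurable_fun setT (fun t => f t ord0 i)) ->
  measurable_fun setT f.
Proof.
move=> mf.
have E : @measurable _ 'rV[R]_n = <<s @open 'rV[R]_n >> by [].
have := @measurability _ _ T 'rV[R]_n setT f (@open 'rV[R]_n) E.
apply => _ [U oU <-]; rewrite setTI.
pose B (p : 'rV[rat]_n * nat) : set 'rV[R]_n :=
  [set v | forall i, `|v ord0 i - ratr (p.1 ord0 i)| < p.2.+1%:R^-1].
have mB p : measurable (f @^-1` B p).
  have -> : f @^-1` B p = \bigcap_(i in [set: 'I_n])
     ((fun t => f t ord0 i) @^-1` ball (ratr (p.1 ord0 i) : R) p.2.+1%:R^-1).
    apply/seteqP; split => t /= H i; first by move=> _; rewrite /= /ball /= distrC; exact: H.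
    by have := H i I; rewrite /= /ball/= distrC.
  apply: fin_bigcap_measurable => // i _; rewrite -[X in measurable X]setTI.
  by apply: mf => //; exact: measurable_ball.
have -> : f @^-1` U = \bigcup_(p in [set p | B p `<=` U]) (f @^-1` B p).
  apply/seteqP; split => [t /= Ut|t [p /= pU]]; last exact: pU.
  have /nbhs_ballP[e /= e0 eU] := oU _ Ut.
  have e20 : 0 < e / 2 by rewrite divr_gt0.
  pose k := Num.truncn (e / 2)^-1.
  have ke : (k.+1%:R^-1 < e / 2 :> R).
    by rewrite invf_plt ?posrE// truncnS_gt.
  have k0 : 0 < k.+1%:R^-1 :> R by rewrite invr_gt0.
  have /choice[q qP] : forall i, exists q : rat, `|f t ord0 i - ratr q| < k.+1%:R^-1 :> R.
    move=> i; have tk : f t ord0 i - k.+1%:R^-1 < f t ord0 i + k.+1%:R^-1 by rewrite ltrD2l gtrN.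
    have [q] := rat_in_itvoo tk; rewrite in_itv /= => /andP[a b]; exists q.
    by rewrite distrC ltr_distl a b.
  exists (\row_i q i, k) => /=; last by move=> i /=; rewrite mxE.
  move=> v /= Bv; apply: eU; split => // i j; rewrite ord1 /ball /=.
  have := Bv j; rewrite mxE /= => vq; have fq := qP j.
  rewrite -(subrK (ratr (q j)) (f t ord0 j)) -addrA [e]splitr.
  rewrite (le_lt_trans (ler_normD _ _))// ltrD// ?(lt_trans fq)//.
  by rewrite distrC (lt_trans vq).
rewrite bigcup_mkcond.
apply: countable_bigcupT_measurable => // p; case: ifPn => // _.
Qed.

End borel_rV.

Section lebesgue_rV.
Variable R : realType.

Definition cons_rV n (p : measurableTypeR R * 'rV[R]_n) : 'rV[R]_n.+1 :=
  \row_i if unlift ord0 i is Some j then p.2 ord0 j else p.1.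

Lemma measurable_cons_rV n : measurable_fun setT (@cons_rV n).
Proof.
apply: measurable_fun_rV => i.
have -> : (fun p => @cons_rV n p ord0 i) =
    if unlift ord0 i is Some j then (fun p => p.2 ord0 j) else fst.
  by apply/funext => p; rewrite mxE; case: unlift.
case: unlift => [j|]; last exact: measurable_fst.
apply: (measurableT_comp (measurable_coord j)); exact: measurable_snd.
Qed.

Section step.
Variables (n : nat) (nu : {sigma_finite_measure set 'rV[R]_n -> \bar R}).

Definition lebesgue_step : set 'rV[R]_n.+1 -> \bar R :=
  pushforward ((lebesgue_measure : set (measurableTypeR R) -> \bar R) \x nu)%E
    (@cons_rV n).

Let step0 : lebesgue_step set0 = 0%E.
Proof. by rewrite /lebesgue_step /pushforward preimage_set0 measure0. Qed.

Let step_ge0 A : (0 <= lebesgue_step A)%E.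
Proof. by rewrite /lebesgue_step /pushforward; exact: measure_ge0. Qed.

Let preim_cons A : measurable A -> measurable (@cons_rV n @^-1` A).
Proof.
by move=> mA; rewrite -[X in measurable X]setTI; exact: measurable_cons_rV.
Qed.

Let step_sigma_additive : semi_sigma_additive lebesgue_step.
Proof.
move=> F mF tF mUF; rewrite /lebesgue_step /pushforward preimage_bigcup.
apply: measure_semi_sigma_additive.
- by move=> k; exact: preim_cons.
- apply/trivIsetP => /= i j _ _ ij; rewrite -preimage_setI.
  by move/trivIsetP : tF => /(_ _ _ _ _ ij) ->//; rewrite preimage_set0.
- by rewrite -preimage_bigcup; exact: preim_cons.
Qed.

HB.instance Definition _ := isMeasure.Build _ _ _ lebesgue_step
  step0 step_ge0 step_sigma_additive.

Let step_sigma_finite : sigma_finite setT lebesgue_step.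
Proof.
pose uncons (v : 'rV[R]_n.+1) : measurableTypeR R * 'rV[R]_n :=
  (v ord0 ord0, \row_j v ord0 (lift ord0 j)).
have consK : cancel (@cons_rV n) uncons.
  move=> [x v]; congr pair; first by rewrite mxE unlift_none.
  by apply/rowP => j; rewrite !mxE liftK.
have muncons : measurable_fun setT uncons.
  apply/measurable_fun_pairP; split; first exact: measurable_coord.
  apply: measurable_fun_rV => i.
  rewrite [X in measurable_fun _ X](_ : _ =
      fun v : 'rV[R]_n.+1 => v ord0 (lift ord0 i)).
    exact: measurable_coord.
  by apply/funext => v; rewrite /= mxE.
have /sigma_finiteP[F [FT ndF Foo]] :=
  sigma_finiteT (lebesgue_measure : set (measurableTypeR R) -> \bar R).
have /sigma_finiteP[G [GT ndG Goo]] := sigma_finiteT nu.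
exists (fun k => uncons @^-1` (F k `*` G k)).
  apply/seteqP; split => // v _.
  have [k _ Fk] : (\bigcup_k F k) (uncons v).1 by rewrite -FT.
  have [l _ Gl] : (\bigcup_l G l) (uncons v).2 by rewrite -GT.
  exists (maxn k l) => //; split.
    by move: Fk; exact/subsetPset/ndF/leq_maxl.
  by move: Gl; exact/subsetPset/ndG/leq_maxr.
move=> k; have [mF Fkoo] := Foo k; have [mG Gkoo] := Goo k; split.
  by rewrite -[X in measurable X]setTI; apply: muncons => //; exact: measurableX.
rewrite /lebesgue_step /pushforward -comp_preimage.
rewrite (_ : uncons \o _ = id) ?preimage_id ?product_measure1E//; last first.
  by apply/funext => p; exact: consK.
by rewrite lte_mul_pinfty// ge0_fin_numE.
Qed.

HB.instance Definition _ := Measure_isSigmaFinite.Build _ _ _ lebesgue_step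
  step_sigma_finite.

End step.

Fixpoint lebesgue_rV n : {sigma_finite_measure set 'rV[R]_n -> \bar R} :=
  match n with
  | 0 => \d_(0 : 'rV[R]_0)
  | n'.+1 => lebesgue_step (lebesgue_rV n')
  end.

End lebesgue_rV.

Section calculus.
Variables (R : realType) (d : nat).
Local Notation E := 'rV[R]_d.
Implicit Types (u : E -> R) (F : E -> E) (V : set E).

(* Euclidean inner product: the library norm on 'rV[R]_d is the sup norm. *)
Definition dotv (x y : E) : R := \sum_(i < d) x ord0 i * y ord0 i.

(* A xi for a row vector xi, i.e. (A xi)_i = \sum_j a_ij xi_j. *)
Definition mulv (A : 'M[R]_d) (xi : E) : E := xi *m A^T.

Definition pderiv (i : 'I_d) u : E -> R := 'D_(delta_mx ord0 i) u.

Definition grad u : E -> E := fun x => \row_i pderiv i u x.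

Definition pderivs (s : seq 'I_d) u : E -> R := foldr pderiv u s.

Definition smooth u := forall s : seq 'I_d,
  continuous (pderivs s u) /\
  forall i x, derivable (pderivs s u) x (delta_mx ord0 i).

(* C_0^oo(V); elements are functions on the whole space vanishing off V. *)
Definition test V : set (E -> R) := [set u | smooth u /\
  exists K : set E, [/\ compact K, K `<=` V & forall x, ~ K x -> u x = 0]].

Definition nondiv_op (A : E -> 'M[R]_d) (G : E -> E) u (x : E) : R :=
  2^-1 * (\sum_(i < d) \sum_(j < d) A x i j * pderiv i (pderiv j u) x)
  + dotv (G x) (grad u x).

Definition exhaustion (V : nat -> set E) :=
  [/\ forall n, open (V n) /\ precompact (V n),
      forall n, V n `<=` V n.+1 &
      \bigcup_n V n = setT].

End calculus.

(* Functions on V are represented by functions on the whole space of which only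
   the values on V matter, and elements of L^p(V, nu) by such functions, two of
   which are identified when equal nu-a.e. on V. *)
Section function_spaces.
Variables (R : realType) (d : nat).
Local Notation E := 'rV[R]_d.
Variable nu : {measure set E -> \bar R}.
Implicit Types (u f : E -> R) (V : set E).

Definition L1 V : set (E -> R) := [set f : E -> R | nu.-integrable V (EFin \o f)].

Definition L2 V : set (E -> R) := [set f : E -> R | measurable_fun V f /\
  nu.-integrable V (EFin \o (fun x => f x ^+ 2))].

Definition L1_cvg V (u_ : nat -> E -> R) u :=
  [/\ forall n, L1 V (u_ n), L1 V u &
      (fun n => \int[nu]_(x in V) (`|u_ n x - u x|)%:E)%E @ \oo --> 0%E].

Definition L2_cvg V (u_ : nat -> E -> R) u :=
  [/\ forall n, L2 V (u_ n), L2 V u &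
      (fun n => \int[nu]_(x in V) ((u_ n x - u x) ^+ 2)%:E)%E @ \oo --> 0%E].

Definition L2_loc_vec (F : E -> E) := forall i : 'I_d,
  measurable_fun setT (fun x => F x ord0 i) /\
  forall K, compact K -> L2 K (fun x => F x ord0 i).

Definition ess_bounded V u :=
  exists M : R, \forall x \ae nu, V x -> `|u x| <= M.

Definition msupp (m : set E -> \bar R) : set E :=
  [set x | forall U, open U -> U x -> (0 < m U)%E].

(* support of the measure |u| nu is compact *)
Definition compact_supp u :=
  compact (msupp (fun U => \int[nu]_(x in U) (`|u x|)%:E)%E).

(* u is in H^{1,2}_0(V, nu) and Du is its gradient, the L^2(V, nu)-limit of the
   gradients of test functions. *)
Definition H12_0_grad V u (Du : E -> E) :=
  [/\ L2 V u, forall i : 'I_d, L2 V (fun x => Du x ord0 i) &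
      exists u_ : nat -> E -> R, (forall n, test V (u_ n)) /\
      (fun n => \int[nu]_(x in V) ((u_ n x - u x) ^+ 2 +
         dotv (grad (u_ n) x - Du x) (grad (u_ n) x - Du x))%:E)%E
        @ \oo --> 0%E].

Definition H12_0 V : set (E -> R) := [set u | exists Du, H12_0_grad V u Du].

Definition H12_loc V : set (E -> R) :=
  [set u | forall chi, test V chi -> H12_0 V (fun x => u x * chi x)].

Definition H12_loc_grad V u (Du : E -> E) :=
  (forall i : 'I_d, measurable_fun V (fun x => Du x ord0 i)) /\
  forall chi, test V chi ->
    H12_0_grad V (fun x => u x * chi x)
      (fun x => chi x *: Du x + u x *: grad chi x).

(* A version of the gradient of u in H^{1,2}_loc(V, nu). *)
Definition wgrad V u : E -> E := get [set Du | H12_loc_grad V u Du].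

End function_spaces.

Section weak_derivative.
Variables (R : realType) (d : nat).
Local Notation E := 'rV[R]_d.
Local Notation leb := (lebesgue_rV R d).

Definition loc_integrable (f : E -> R) := measurable_fun setT f /\
  forall K, compact K -> leb.-integrable K (EFin \o f).

Definition is_weak_pderiv (i : 'I_d) (f g : E -> R) :=
  [/\ loc_integrable f, loc_integrable g &
      forall chi, test setT chi ->
        \int[leb]_x (f x * pderiv i chi x) = - \int[leb]_x (g x * chi x)].

Definition weak_pderiv (i : 'I_d) (f : E -> R) : E -> R :=
  get [set g | is_weak_pderiv i f g].

End weak_derivative.

Section coefficients.
Variables (R : realType) (d : nat).
Local Notation E := 'rV[R]_d.
Implicit Types (A : E -> 'M[R]_d) (mu : {measure set E -> \bar R}).
Implicit Types (rho : E -> R) (G : E -> E).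

Definition has_density mu rho := forall S : set E, measurable S ->
  mu S = (\int[lebesgue_rV R d]_(x in S) (rho x)%:E)%E.

Definition loc_strictly_elliptic A := forall V : set E, precompact V ->
  exists2 c : R, 0 < c & forall (x : E) (xi : E), V x ->
    c^-1 * dotv xi xi <= dotv (mulv (A x) xi) xi <= c * dotv xi xi.

Definition beta A mu rho : E -> E := fun x => \row_i
  (2^-1 * \sum_(j < d) (wgrad mu setT (fun y => A y i j) x ord0 j
                        + A x i j * (weak_pderiv j rho x / rho x))).

Definition Bfield A mu rho G : E -> E := fun x => G x - beta A mu rho x.

End coefficients.

(* A possibly unbounded operator T is given by its graph: T u f means that
   u is in D(T) and T u = f. *)
Section forms.
Variables (R : realType) (d : nat).
Local Notation E := 'rV[R]_d.
Variables (mu : {measure set E -> \bar R}) (A : E -> 'M[R]_d) (B : E -> E).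
Implicit Types (u v f g : E -> R) (V : set E).

Definition grad_form V (F H : E -> E) : R :=
  2^-1 * \int[mu]_(x in V) dotv (mulv (A x) (F x)) (H x).

Definition pre_form u v : R := grad_form setT (grad u) (grad v).

Definition form_approx u (u_ : nat -> E -> R) :=
  [/\ forall n, test setT (u_ n), L2_cvg mu setT u_ u &
      forall e : R, 0 < e -> exists N, forall m n, (N <= m)%N -> (N <= n)%N ->
        pre_form (u_ m \- u_ n) (u_ m \- u_ n) < e].

(* (E0, dom_E0) is the closure of (pre_form, C_0^oo) in L^2(mu). *)
Definition dom_E0 : set (E -> R) := [set u |
  exists u_ : nat -> E -> R, form_approx u u_].

Definition E0 u v : R := get [set e : R | exists u_ v_ : nat -> E -> R,
  [/\ form_approx u u_, form_approx v v_ &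
      (fun n => pre_form (u_ n) (v_ n)) @ \oo --> e]].

Definition form_generator V (D : set (E -> R)) (Q : (E -> R) -> (E -> R) -> R)
    u f :=
  [/\ D u, L2 mu V f &
      forall v, D v -> Q u v = - \int[mu]_(x in V) (f x * v x)].

Definition L0 u f := form_generator setT dom_E0 E0 u f.

(* L u = L^0 u + <B, grad u> on D(L^0)_{0,b} *)
Definition L_op u g := exists f,
  [/\ L0 u f, compact_supp mu u, ess_bounded mu setT u &
      g = fun x => f x + dotv (B x) (wgrad mu setT u x)].

Definition L0_loc V u f := form_generator V (H12_0 mu V)
  (fun v w => grad_form V (wgrad mu V v) (wgrad mu V w)) u f.

(* L^V u = L^{0,V} u + <B, grad u> on D(L^{0,V})_b *)
Definition L_loc V u g := exists f,
  [/\ L0_loc V u f, ess_bounded mu V u &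
      g = fun x => f x + dotv (B x) (wgrad mu V u x)].

Definition L1_closure V (T : (E -> R) -> (E -> R) -> Prop) u f :=
  exists u_ f_ : nat -> E -> R, [/\ forall n, T (u_ n) (f_ n),
    L1_cvg mu V u_ u & L1_cvg mu V f_ f].

(* (alpha - closure of L^V)^{-1} (f 1_V), extended by 0 off V *)
Definition G_loc V (alpha : R) f : E -> R :=
  get [set g | (forall x, ~ V x -> g x = 0) /\
    L1_closure V (L_loc V) g (fun x => alpha * g x - (f \_ V) x)].

End forms.

Section L1_operators.
Variables (R : realType) (d : nat).
Local Notation E := 'rV[R]_d.
Variable mu : {measure set E -> \bar R}.
Local Notation oper := ((E -> R) -> (E -> R) -> Prop).
Implicit Types (u v f g : E -> R) (L : oper).

Definition L1_operator L :=
  [/\ forall u f, L u f -> L1 mu setT u /\ L1 mu setT f,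
      forall u u' f f', L1 mu setT u' -> L1 mu setT f' ->
        u = u' %[ae mu] -> f = f' %[ae mu] -> L u f -> L u' f',
      forall u f f', L u f -> L u f' -> f = f' %[ae mu],
      L (cst 0) (cst 0) &
      forall (a : R) u v f g, L u f -> L v g ->
        L (fun x => a * u x + v x) (fun x => a * f x + g x)].

Definition closed_operator L := L1_operator L /\
  forall (u_ f_ : nat -> E -> R) u f, (forall n, L (u_ n) (f_ n)) ->
    L1_cvg mu setT u_ u -> L1_cvg mu setT f_ f -> L u f.

Definition extends L (L' : oper) := forall u f, L' u f -> L u f.

(* Linear contractions of L^1(mu); compatibility with a.e. equality follows
   from linearity and contractivity. *)
Definition L1_contraction (S : (E -> R) -> E -> R) :=
  [/\ forall f, L1 mu setT f -> L1 mu setT (S f),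
      forall (a : R) f g, L1 mu setT f -> L1 mu setT g ->
        S (fun x => a * f x + g x) = (fun x => a * S f x + S g x) %[ae mu] &
      forall f, L1 mu setT f ->
        (\int[mu]_x (`|S f x|)%:E <= \int[mu]_x (`|f x|)%:E)%E].

Definition sub_markovian (S : (E -> R) -> E -> R) := forall f, L1 mu setT f ->
  (\forall x \ae mu, 0 <= f x <= 1) -> \forall x \ae mu, 0 <= S f x <= 1.

Definition C0_contraction_semigroup (T : R -> (E -> R) -> E -> R) :=
  [/\ forall t, 0 < t -> L1_contraction (T t),
      forall s t f, 0 < s -> 0 < t -> L1 mu setT f ->
        T (s + t) f = T s (T t f) %[ae mu] &
      forall f, L1 mu setT f ->
        (\int[mu]_x (`|T t f x - f x|)%:E)%E @[t --> 0^'+] --> 0%E].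

Definition semigroup_generator (T : R -> (E -> R) -> E -> R) L :=
  forall u f, L u f <-> [/\ L1 mu setT u, L1 mu setT f &
    (\int[mu]_x (`|(T t u x - u x) / t - f x|)%:E)%E @[t --> 0^'+] --> 0%E].

(* S = (alpha - L)^{-1} *)
Definition is_resolvent_of L (alpha : R) (S : (E -> R) -> E -> R) :=
  (forall f, L1 mu setT f -> L (S f) (fun x => alpha * S f x - f x)) /\
  (forall u f, L u f -> S (fun x => alpha * u x - f x) = u %[ae mu]).

Definition C0_contraction_resolvent (G : R -> (E -> R) -> E -> R) :=
  [/\ forall a, 0 < a -> L1_contraction (fun f x => a * G a f x),
      forall a b f, 0 < a -> 0 < b -> L1 mu setT f ->
        (fun x => G a f x - G b f x) = (fun x => (b - a) * G a (G b f) x)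
          %[ae mu] &
      forall f, L1 mu setT f ->
        (\int[mu]_x (`|a * G a f x - f x|)%:E)%E @[a --> +oo%R] --> 0%E].

(* L is determined by G through L u = alpha u - G_alpha^{-1} u. *)
Definition resolvent_generator (G : R -> (E -> R) -> E -> R) L :=
  forall a, 0 < a -> forall u f, L u f <-> [/\ L1 mu setT u, L1 mu setT f &
    G a (fun x => a * u x - f x) = u %[ae mu]].

End L1_operators.

(* Main.v *)
(* On a relatively compact V one solves, by Lax-Milgram in H^{1,2}_0(V), the resolvent equation with the
 zero-order term eps |B|^2 u added; it makes the skew drift term bounded by the coercive part. Since B is
 mu-divergence free, the drift vanishes when tested against functions of u, which bounds u and eps |B|^2 u
 in L^1; letting eps -> 0 shows that alpha - L^V has dense range, and dissipativity in L^1 gives the local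
 resolvents. They are sub-Markovian and increase with V, so on L^1 they converge to a resolvent that does
 not depend on the exhaustion; Lbar is its generator and the semigroup is obtained from implicit Euler steps.
 For bounded u in D(Lbar), the energy estimate and the weak equation come from local solutions that
 converge strongly in energy after passing to midpoint-convex minimisers (Mazur's lemma). *)
Require Import Defs.
From HB Require Import structures.
From mathcomp Require Import all_boot all_order all_algebra.
From mathcomp Require Import all_classical all_reals all_analysis.
From mathcomp Require Import measurable_realfun.
From mathcomp Require Import ring lra.

Set Implicit Arguments.
Unset Strict Implicit.
Unset Printing Implicit Defensive.

Import Order.TTheory GRing.Theory Num.Theory.
Import numFieldNormedType.Exports.

Local Open Scope classical_set_scope.
Local Open Scope ring_scope.

(** The obstacle is that [B] is only locally square integrable: for u, v in H^{1,2}_0(V) the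
    integrand <B, grad u> v need not be integrable, so the drift is not a bounded form. The term eps
    |B|^2 forces |B| u into L^2; it is harmless in the limit because the maximum principle bounds u
    uniformly in eps while |B|^2 is integrable on V. A second gap remains: the solutions satisfy an
    equation whose right side contains <B, grad u>, which is only in L^1, whereas the symmetric
    generator has values in L^2. Yosida approximation shows that such solutions still belong to the
    L^1-closure of the local operator. Truncations like u^+ and sign u are replaced by smooth
    functions built from exp(-1/x), so that composites of test functions remain test functions and
    the chain rule passes to limits. Ellipticity is only local, so energy spaces are completed as
    pairs of a function and a gradient. These pairs are actual functions, not classes, and are
    matched with the chosen objects of the definitions through a.e. uniqueness of gradients. *)

Notation mfunT := (measurable_fun setT).
Notation mvec D := (forall i, mfunT (fun x => D x ord0 i)).
Tactic Notation "ext" ident(x) := apply/funext => x.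

Lemma eq_ler (R : numDomainType) (x y : R) : x = y -> x <= y. Proof. by move=> ->. Qed.

(** * Sequences that become arbitrarily small *)

Section to0.
Variable R : realType.
Implicit Types a b : nat -> R.

(* Eventual smallness from above; equivalent to convergence to 0 for nonnegative sequences. *)
Definition to0 a := forall e : R, 0 < e -> exists N, forall n, (N <= n)%N -> a n <= e.

Lemma to0_le a b : (forall n, a n <= b n) -> to0 b -> to0 a.
by move=> ab hb e /hb[N hN]; exists N => n /hN; apply: le_trans. Qed.

Lemma to0D a b : to0 a -> to0 b -> to0 (fun n => a n + b n).
move=> ha hb e e0; have e2 : 0 < e / 2 by rewrite divr_gt0.
have [N hN] := ha _ e2; have [M hM] := hb _ e2.
exists (N + M)%N => n nNM; rewrite [e]splitr lerD//.
 by apply: hN; rewrite (leq_trans _ nNM)// leq_addr.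
by apply: hM; rewrite (leq_trans _ nNM)// leq_addl.
Qed.

Lemma to0Z (c : R) a : 0 <= c -> to0 a -> to0 (fun n => c * a n).
move=> c0 ha e e0; have c1 : 0 < c + 1 by lra.
have [N hN] := ha (e / (c + 1)) (divr_gt0 e0 c1).
exists N => n /hN h; rewrite (@le_trans _ _ (c * (e / (c + 1))))//.
 by rewrite ler_wpM2l.
rewrite mulrCA ger_pMr// ler_pdivrMr// mul1r; lra.
Qed.

Lemma to0_sqr a b : (forall n, a n ^+ 2 <= b n) -> to0 b -> to0 a.
move=> ab hb e e0; have [N hN] := hb _ (exprn_gt0 2 e0).
exists N => n /hN h; rewrite leNgt; apply/negP => ea.
have : e ^+ 2 < a n ^+ 2 by rewrite ltr_pXn2r// nnegrE ltW// (lt_trans e0).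
by rewrite ltNge (le_trans (ab n) h).
Qed.

Lemma to0_cvg a : (forall n, 0 <= a n) -> to0 a -> a @ \oo --> (0 : R).
move=> a0 ha; apply/cvgrPdist_le => e e0; have [N hN] := ha _ e0.
by exists N => // n /= /hN; rewrite sub0r normrN ger0_norm.
Qed.

Lemma cvg_to0 a : a @ \oo --> (0 : R) -> to0 a.
move=> /cvgrPdist_le h e /h[N _ hN]; exists N => n /hN.
by rewrite sub0r normrN; apply: le_trans; exact: ler_norm.
Qed.

Lemma to0_cvgB a l : to0 (fun n => `|a n - l|) <-> a @ \oo --> l.
split=> h.
 apply/cvgrPdist_le => e /h[N hN]; exists N => // n /= /hN.
 by rewrite distrC.
by move=> e e0; move/cvgrPdist_le : h => /(_ _ e0)[N _ hN]; exists N => n /hN; rewrite distrC.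
Qed.

Lemma to0_inv : to0 (fun n => n.+1%:R^-1).
move=> e e0; exists (Num.truncn e^-1) => n hn.
rewrite invf_ple ?posrE//; apply/ltW/(lt_le_trans (truncnS_gt _)).
by rewrite ler_nat ltnS.
Qed.

Lemma to0_uniq a b x y : to0 (fun n => `|a n - x|) -> to0 (fun n => `|b n - y|) ->
 to0 (fun n => `|a n - b n|) -> x = y.
move=> ha hb hab; apply/eqP; rewrite -subr_eq0 -normr_le0.
apply/ler_addgt0Pr => e e0; rewrite add0r.
have := to0D (to0D ha hb) hab => /(_ _ e0)[N /(_ _ (leqnn N))]; apply: le_trans.
rewrite -[x - y](_ : (x - a N) + (b N - y) + (a N - b N) = _); last by ring.
by rewrite (le_trans (ler_normD _ _))// lerD// (le_trans (ler_normD _ _))// lerD// distrC.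
Qed.

Lemma to0_le_lim a (x c : R) b : to0 (fun n => `|a n - x|) -> to0 b ->
 (forall n, a n <= c + b n) -> x <= c.
move=> ha hb h; apply/ler_addgt0Pr => e e0.
have [N /(_ _ (leqnn N)) hN] := to0D ha hb e0.
have := h N; have := ler_norm (x - a N); rewrite distrC; lra.
Qed.

Lemma to0_shift a (f : nat -> nat) : (forall n, n <= f n)%N -> to0 a -> to0 (a \o f).
by move=> hf ha e /ha[N hN]; exists N => n /leq_trans nN; apply: hN; exact: nN.
Qed.

Lemma to0_cst0 : to0 (fun=> 0).
by move=> e e0; exists 0%N => n _; exact: ltW. Qed.


Lemma to0_sum (m : nat) (a : 'I_m -> nat -> R) : (forall i, to0 (a i)) -> to0 (fun n => \sum_(i < m) a i n).
elim: m a => [|m ih] a ha; first by under eq_fun do rewrite big_ord0; exact: to0_cst0.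
by under eq_fun do rewrite big_ord_recr /=; apply: to0D; [apply: ih => i; exact: ha|exact: ha].
Qed.

End to0.
Arguments to0_cst0 {R}.

(** * Real-valued integrals, integrable and square integrable functions *)

Section integrals.
Context d (T : measurableType d) (R : realType).
Variable mu : {measure set T -> \bar R}.
Implicit Types f g h : T -> R.

Definition Lint f := mu.-integrable setT (EFin \o f).
Definition Ig f : R := \int[mu]_x f x.
Definition LL2 f := mfunT f /\ Lint (fun x => f x ^+ 2).

Lemma Lint_meas f : Lint f -> mfunT f.
by move=> /measurable_int/measurable_EFinP. Qed.

Lemma Lint_dom f g : mfunT f -> (forall x, `|f x| <= g x) -> Lint g -> Lint f.
move=> mf fg ig; apply: (le_integrable measurableT _ _ ig).
 exact/measurable_EFinP.
by move=> x _ /=; rewrite lee_fin (le_trans (fg x))// ler_norm.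
Qed.

Lemma Lint_ae f g : mfunT g -> {ae mu, forall x, f x = g x} -> Lint f -> Lint g.
move=> mg fg /integrableP[mf foo]; apply/integrableP; split; first exact/measurable_EFinP.
rewrite (_ : (\int[mu]_x `|(EFin \o g) x|)%E = (\int[mu]_x `|(EFin \o f) x|)%E)//.
apply: ge0_ae_eq_integral => //.
- by apply: measurableT_comp => //; exact/measurable_EFinP.
- exact: measurableT_comp.
- by apply: filterS fg => x /= ->.
Qed.

Lemma Lint_abs f : Lint f -> Lint (fun x => `|f x|).
exact: integrable_norm. Qed.

(** Setting f to 0 wherever the bound fails changes it on a null set only and makes the domination
    pointwise. *)
Lemma Lint_ae_dom f g : mfunT f -> {ae mu, forall x, `|f x| <= g x} -> Lint g -> Lint f.
move=> mf fg ig; have mg := Lint_meas ig.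
pose h x := if `|f x| <= g x then f x else 0.
have mh : mfunT h.
 apply: measurable_fun_ifT => //; apply: measurable_fun_ler => //.
 exact: measurableT_comp.
apply: (@Lint_ae h) => //; first by apply: filterS fg => x; rewrite /h => ->.
apply: (Lint_dom mh _ (Lint_abs ig)) => x.
by rewrite /h; case: ifP => [/le_trans->//|]; rewrite ?ler_norm// normr0.
Qed.

Lemma Lint0 : Lint (fun=> 0).
exact: integrable0. Qed.

Lemma LintZ (c : R) f : Lint f -> Lint (fun x => c * f x).
move=> i; rewrite /Lint (_ : _ \o _ = fun x => (c%:E * (EFin \o f) x)%E); first exact: integrableZl.
by [].
Qed.

Lemma LintD f g : Lint f -> Lint g -> Lint (fun x => f x + g x).
move=> i j; rewrite /Lint (_ : _ \o _ = (EFin \o f) \+ (EFin \o g))%E; first exact: integrableD.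
by [].
Qed.

Lemma LintN f : Lint f -> Lint (fun x => - f x).
by move=> /(LintZ (-1)); rewrite (_ : (fun x => -1 * f x) = fun x => - f x)//; ext x; rewrite mulN1r. Qed.

Lemma LintB f g : Lint f -> Lint g -> Lint (fun x => f x - g x).
by move=> i /LintN j; exact: LintD. Qed.

Lemma Lint_sum (I : Type) (s : seq I) (F : I -> T -> R) :
 (forall i, Lint (F i)) -> Lint (fun x => \sum_(i <- s) F i x).
move=> h; elim: s => [|i s ih].
 by under eq_fun do rewrite big_nil; exact: Lint0.
by under eq_fun do rewrite big_cons; exact: LintD.
Qed.

Lemma IgZ (c : R) f : Lint f -> Ig (fun x => c * f x) = c * Ig f.
by move=> i; rewrite /Ig RintegralZl. Qed.

Lemma IgD f g : Lint f -> Lint g -> Ig (fun x => f x + g x) = Ig f + Ig g.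
by move=> i j; rewrite /Ig RintegralD. Qed.

Lemma IgB f g : Lint f -> Lint g -> Ig (fun x => f x - g x) = Ig f - Ig g.
by move=> i j; rewrite /Ig RintegralB. Qed.

Lemma IgN f : Lint f -> Ig (fun x => - f x) = - Ig f.
move=> i; rewrite -mulN1r -IgZ//; congr Ig; ext x; by rewrite mulN1r.
Qed.

Lemma Ig_cst0 : Ig (fun=> 0) = 0.
by rewrite /Ig /Rintegral integral0. Qed.

Lemma Ig_sum (I : Type) (s : seq I) (F : I -> T -> R) :
 (forall i, Lint (F i)) -> Ig (fun x => \sum_(i <- s) F i x) = \sum_(i <- s) Ig (F i).
move=> h; elim: s => [|i s ih].
 by under eq_fun do rewrite big_nil; rewrite Ig_cst0 big_nil.
by under eq_fun do rewrite big_cons; rewrite big_cons IgD ?ih//; exact: Lint_sum.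
Qed.

Lemma Ig_ge0 f : (forall x, 0 <= f x) -> 0 <= Ig f.
by move=> f0; apply: Rintegral_ge0. Qed.

Lemma Ig_le f g : Lint f -> Lint g -> (forall x, f x <= g x) -> Ig f <= Ig g.
by move=> i j fg; apply: le_Rintegral. Qed.

Lemma Ig_ae f g : Lint f -> mfunT g -> {ae mu, forall x, f x = g x} -> Ig f = Ig g.
move=> i mg fg; rewrite /Ig /Rintegral; congr fine; apply: ae_eq_integral => //.
- exact: measurable_int i.
- exact/measurable_EFinP.
- by apply: filterS fg => x /= ->.
Qed.

Lemma Ig_le_ae f g : Lint f -> Lint g -> {ae mu, forall x, f x <= g x} -> Ig f <= Ig g.
move=> i j fg; have mf := Lint_meas i; have mg := Lint_meas j.
(* The minimum of f and g equals f a.e. and lies below g everywhere, which reduces the claim to the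
   pointwise comparison. *)
have mm : mfunT (fun x => Num.min (f x) (g x)) by exact: measurable_minr.
have e : {ae mu, forall x, f x = Num.min (f x) (g x)}.
 by apply: filterS fg => x /min_idPl ->.
rewrite (Ig_ae i mm e); apply: Ig_le => //; first exact: Lint_ae i.
by move=> x; rewrite ge_min lexx orbT.
Qed.

Lemma Ig_ge0_ae f : Lint f -> {ae mu, forall x, 0 <= f x} -> 0 <= Ig f.
by move=> i h; rewrite -Ig_cst0; apply: Ig_le_ae => //; exact: Lint0. Qed.

Lemma Ig_abs f : Lint f -> `|Ig f| <= Ig (fun x => `|f x|).
by move=> i; exact: le_normr_Rintegral. Qed.

Lemma Ig_EFin f : Lint f -> (\int[mu]_x (f x)%:E)%E = (Ig f)%:E.
by move=> i; rewrite /Ig /Rintegral fineK//; exact: integrable_fin_num i.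
Qed.

Lemma Lint_fin f : mfunT f -> (forall x, 0 <= f x) ->
 (\int[mu]_x (f x)%:E < +oo)%E -> Lint f.
move=> mf f0 h; apply/integrableP; split; first exact/measurable_EFinP.
by under eq_integral do rewrite /= ger0_norm//.
Qed.

Lemma Ig_eq0 f : Lint f -> {ae mu, forall x, 0 <= f x} -> Ig f <= 0 -> {ae mu, forall x, f x = 0}.
move=> i f0 h; have mf := Lint_meas i.
have : (\int[mu]_x `|(EFin \o f) x| = 0)%E.
 have ia := Lint_abs i.
 rewrite (_ : (\int[mu]_x `|(EFin \o f) x|)%E = (Ig (fun x => `|f x|))%:E); last by rewrite -Ig_EFin.
 congr EFin; rewrite (@Ig_ae _ f)//.
  apply/le_anti; rewrite h /=; exact: Ig_ge0_ae.
 by apply: filterS f0 => x /ger0_norm.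
move/ae_eq_integral_abs => /(_ measurableT (measurable_int _ i)).
by apply: filterS => x /= /(_ I)[].
Qed.

Lemma Ig_dom f g : mfunT f -> Lint g -> (forall x, `|f x| <= g x) -> `|Ig f| <= Ig g.
move=> mf ig h; have i := Lint_dom mf h ig.
by apply: (le_trans (Ig_abs i)); apply: Ig_le => //; exact: Lint_abs.
Qed.

Lemma Ig_DCT (f_ : nat -> T -> R) f g : (forall n, mfunT (f_ n)) ->
 Lint g -> (forall n x, `|f_ n x| <= g x) -> (forall x, f_ ^~ x @ \oo --> f x) ->
 Lint f /\ (fun n => Ig (f_ n)) @ \oo --> Ig f.
move=> mf_ ig fg cf.
have mf : mfunT f by apply: measurable_fun_cvg mf_ _ => x _; by [].
have [] := @dominated_convergence _ _ _ mu setT measurableT (fun n => EFin \o f_ n)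
 (EFin \o f) (EFin \o g).
- by move=> n; exact/measurable_EFinP.
- exact/measurable_EFinP.
- by apply/aeW => x _; apply: cvg_EFin; [exact: nearW|exact: cf].
- by [].
- by apply/aeW => x n _ /=; rewrite lee_fin.
move=> i _ h; split=> //.
move: h; rewrite Ig_EFin// => /fine_cvg/=.
rewrite [X in X @ _ --> _ -> _](_ : _ = fun n => Ig (f_ n))//.
Qed.

Lemma Ig_fatou (f_ : nat -> T -> R) f (c : R) : (forall n, Lint (f_ n)) ->
 (forall n x, 0 <= f_ n x) -> mfunT f -> (forall x, 0 <= f x) ->
 {ae mu, forall x, f_ ^~ x @ \oo --> f x} ->
 (forall n, Ig (f_ n) <= c) -> Lint f /\ Ig f <= c.
move=> i_ f_0 mf f0 cf h.
have mE n : mfunT (EFin \o f_ n) by exact: (measurable_int _ (i_ n)).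
have f0' n x : [set: T] x -> (0 <= (EFin \o f_ n) x)%E by rewrite lee_fin.
have H0 := @fatou _ _ _ mu setT measurableT (fun n => EFin \o f_ n) mE f0'.
have cf' : {ae mu, forall x, [set: T] x -> (f x)%:E = limn_einf (fun n => (f_ n x)%:E)}.
 apply: filterS cf => x cx _; apply/esym.
 have ce : (fun n => (f_ n x)%:E) @ \oo --> (f x)%:E by apply: cvg_EFin => //; exact: nearW.
 by have [] := cvg_limn_einf_sup ce.
have H : (\int[mu]_x (f x)%:E <= c%:E)%E.
 rewrite (@ge0_ae_eq_integral _ _ _ mu setT _ (fun x => limn_einf (fun n => (f_ n x)%:E)))//.
 - apply: (le_trans H0); rewrite limn_einf_lim; apply: lime_le; first exact: is_cvg_einfs.
  apply: nearW => n; apply: (@le_trans _ _ (\int[mu]_x (f_ n x)%:E)%E).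
   by apply: ereal_inf_lbound; exists n => /=.
  by rewrite Ig_EFin// lee_fin.
 - exact/measurable_EFinP.
 - rewrite (_ : (fun x => _) = (fun x => - limn_esup (fun n => - (f_ n x)%:E))%E).
   apply: measurableT_comp => //; apply: measurable_fun_limn_esup => n.
   by apply: measurableT_comp => //; exact: mE.
  by [].
 - by move=> x _; rewrite lee_fin.
 - move=> x _; rewrite limn_einf_lim; apply: lime_ge; first exact: is_cvg_einfs.
  apply: nearW => n; apply: le_ereal_inf_tmp => _ [m /= _ <-]; by rewrite lee_fin.
have i : Lint f by apply: Lint_fin => //; apply: le_lt_trans H (ltry _).
by split=> //; rewrite -lee_fin -Ig_EFin.
Qed.

Lemma LL2_meas f : LL2 f -> mfunT f. Proof. by case. Qed.

Lemma LL2Z (c : R) f : LL2 f -> LL2 (fun x => c * f x).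
move=> [mf i]; split; first exact: measurable_funM.
by under eq_fun do rewrite exprMn; exact: LintZ.
Qed.

Lemma LL2_mul f g : LL2 f -> LL2 g -> Lint (fun x => f x * g x).
move=> [mf i] [mg j]; apply: (Lint_dom _ _ (LintD i j)); first exact: measurable_funM.
move=> x; rewrite normrM -(@real_normK _ (f x)) ?num_real// -(@real_normK _ (g x)) ?num_real//.
by have := sqr_ge0 (`|f x| - `|g x|); have := sqr_ge0 (`|f x| + `|g x|); nra.
Qed.

Lemma LL2D f g : LL2 f -> LL2 g -> LL2 (fun x => f x + g x).
move=> Lf Lg; split; first by apply: measurable_funD; [case: Lf|case: Lg].
rewrite (_ : (fun x => _) = fun x => f x ^+ 2 + g x ^+ 2 + 2 * (f x * g x)); last by ext x; ring.
apply: LintD; last exact/LintZ/LL2_mul.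
by apply: LintD; [case: Lf|case: Lg].
Qed.

Lemma LL2N f : LL2 f -> LL2 (fun x => - f x).
by move=> /(LL2Z (-1)); under eq_fun do rewrite mulN1r. Qed.

Lemma LL2B f g : LL2 f -> LL2 g -> LL2 (fun x => f x - g x).
by move=> Lf /LL2N; exact: LL2D. Qed.

Lemma LL20 : LL2 (fun=> 0).
by split=> //; under eq_fun do rewrite expr0n /=; exact: Lint0. Qed.

Lemma LL2_sum (I : Type) (s : seq I) (F : I -> T -> R) :
 (forall i, LL2 (F i)) -> LL2 (fun x => \sum_(i <- s) F i x).
move=> h; elim: s => [|i s ih].
 by under eq_fun do rewrite big_nil; exact: LL20.
by under eq_fun do rewrite big_cons; exact: LL2D.
Qed.

Lemma LL2_dom f g : mfunT f -> (forall x, `|f x| <= `|g x|) -> LL2 g -> LL2 f.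
move=> mf fg [mg i]; split=> //; apply: (Lint_dom _ _ i); first exact: measurable_funX.
by move=> x; rewrite normrX -[g x ^+ 2]ger0_norm ?sqr_ge0// normrX lerXn2r// nnegrE.
Qed.

Lemma LL2_ae f g : mfunT g -> {ae mu, forall x, f x = g x} -> LL2 f -> LL2 g.
move=> mg fg [mf i]; split=> //; apply: (Lint_ae _ _ i); first exact: measurable_funX.
by apply: filterS fg => x ->.
Qed.

Lemma discr_le (a b c : R) : 0 <= c -> (forall t, 0 <= a + 2 * t * b + t ^+ 2 * c) -> b ^+ 2 <= a * c.
move=> c_ge0 h; have a0 : 0 <= a by have := h 0; rewrite mulr0 mul0r expr0n /= mul0r !addr0.
have [c0|c0] := eqVneq c 0.
 have [->|b0] := eqVneq b 0; first by rewrite expr0n /= c0 mulr0.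
 (* For c = 0 the expression is affine in t, and this t gives it the value -1. *)
 have := h (- (a + 1) / (2 * b)); rewrite c0 mulr0 addr0.
 rewrite (_ : 2 * _ * b = - (a + 1)); last by field.
 lra.
have cp : 0 < c by rewrite lt_neqAle eq_sym c0.
have := h (- b / c); rewrite (_ : _ + _ = a - b ^+ 2 / c); last by field.
by rewrite subr_ge0 ler_pdivrMr.
Qed.

Lemma Ig_CS f g : LL2 f -> LL2 g ->
 Ig (fun x => f x * g x) ^+ 2 <= Ig (fun x => f x ^+ 2) * Ig (fun x => g x ^+ 2).
move=> Lf Lg; have ifg := LL2_mul Lf Lg; case: Lf => mf i; case: Lg => mg j.
apply: discr_le => [|t]; first by apply: Ig_ge0 => x; exact: sqr_ge0.
rewrite -!IgZ// -!IgD//; try (by repeat (apply: LintD || apply: LintZ)).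
apply: Ig_ge0 => x; rewrite (_ : _ + _ = (f x + t * g x) ^+ 2) ?sqr_ge0//; ring.
Qed.

Lemma Ig_tail h (e : R) : Lint h -> (forall x, 0 <= h x) -> 0 < e ->
 exists2 K : R, 0 < K & Ig (fun x => h x - Num.min (h x) K) <= e.
move=> i h0 e0; have mh := Lint_meas i.
have [] := @Ig_DCT (fun n x => h x - Num.min (h x) n.+1%:R) (fun=> 0) h _ i.
- by move=> n; apply: measurable_funB => //; exact: measurable_minr.
- move=> n x; rewrite ger0_norm; last by rewrite subr_ge0 ge_min lexx.
 by rewrite gerBl le_min h0 /=.
- move=> x; apply: cvg_near_cst; exists (Num.truncn (h x)) => // n /= hn.
 rewrite min_l ?subrr//; apply/ltW/(lt_le_trans (truncnS_gt _)).
 by rewrite ler_nat ltnS.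
move=> _; rewrite Ig_cst0 => /cvg_to0/(_ _ e0)[N hN].
by exists N.+1%:R => //; exact: hN.
Qed.

(** Uniform integrability: above a height K the function h costs at most M times its tail, below it
    at most K times the integral of w. This turns L^1-smallness of bounded factors into smallness of
    their products with a merely integrable h, without extracting a.e. convergent subsequences. *)
Lemma Ig_vanish h (M e : R) : Lint h -> (forall x, 0 <= h x) -> 0 <= M -> 0 < e ->
 exists2 del : R, 0 < del & forall w, (forall x, 0 <= w x <= M) -> Lint w ->
  Ig w <= del -> Lint (fun x => h x * w x) /\ Ig (fun x => h x * w x) <= e.
move=> i h0 M0 e0; have mh := Lint_meas i.
have e1 : 0 < e / 2 / (M + 1) by rewrite !divr_gt0//; lra.
have [K K0 hK] := Ig_tail i h0 e1.
exists (e / 2 / K); first by rewrite !divr_gt0.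
move=> w w0 iw hw; have mw := Lint_meas iw.
have ihm : Lint (fun x => h x - Num.min (h x) K).
 apply: (Lint_dom _ _ i); first by apply: measurable_funB => //; exact: measurable_minr.
 move=> x; rewrite ger0_norm; last by rewrite subr_ge0 ge_min lexx.
 by rewrite gerBl le_min h0 /= ltW.
have ihw : Lint (fun x => h x * w x).
 apply: (Lint_dom _ _ (LintZ M i)); first exact: measurable_funM.
 move=> x; have /andP[a b] := w0 x; rewrite ger0_norm ?mulr_ge0// mulrC ler_wpM2r//.
split=> //; apply: (@le_trans _ _ (Ig (fun x => M * (h x - Num.min (h x) K) + K * w x))).
 apply: Ig_le => //; first by apply: LintD; exact: LintZ.
 move=> x; have /andP[a b] := w0 x.
 have mK : Num.min (h x) K <= K by rewrite ge_min lexx orbT.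
 have mh' : Num.min (h x) K <= h x by rewrite ge_min lexx.
 nra.
rewrite IgD ?IgZ//; try exact: LintZ.
rewrite [e]splitr lerD//.
 rewrite (@le_trans _ _ (M * (e / 2 / (M + 1))))// ?ler_wpM2l//.
 rewrite mulrCA ger_pMr ?divr_gt0// ler_pdivrMr ?mul1r; lra.
by rewrite -ler_pdivlMl// mulrC.
Qed.

End integrals.

#[global] Hint Resolve LintD LintB LintZ LintN Lint_abs Lint0 LL2_mul LL2D LL2B LL2Z LL2N LL20
 measurable_funD measurable_funB measurable_funM measurable_funX measurable_cst
 mulr_ge0 addr_ge0 sqr_ge0 normr_ge0 divr_ge0 exprn_ge0 ltW mulr_gt0 divr_gt0 addr_gt0 ler01 ltr01 : side.
Ltac side := solve [auto 7 with side].

(** * Chain rule along a direction and the mean value inequality *)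

Section chain1.
Variable R : realType.

(** Along the line through x in direction v everything is a function of one real variable, so the
    real chain rule applies to h |-> u (h v + x) at h = 0. *)
Lemma is_derive_comp1 (V : normedModType R) (g : R -> R) (u : V -> R) x v (du dg : R) :
 is_derive x v u du -> is_derive (u x) 1 g dg -> is_derive x v (fun y => g (u y)) (dg * du).
move=> hu hg; pose phi (h : R) := u (h *: v + x).
have phi0 : phi 0 = u x by rewrite /phi scale0r add0r.
have dphi : is_derive (0 : R) 1 phi du.
 case: hu => du1 <-; split; first by have /derivable1P := du1.
 rewrite /derive (_ : (fun h : R => h^-1 *: ((phi \o shift 0) (h *: 1) - phi 0)) =
  fun h : R => h^-1 *: ((u \o shift x) (h *: v) - u x))//.
 by apply/funext => h /=; rewrite phi0 /shift /= addr0 /phi [h *: 1]mulr1.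
have dgphi : is_derive (0 : R) 1 (g \o phi) (dg * du).
 have d1 := @ex_derive _ _ _ _ _ _ _ dphi.
 have d2 : derivable g (phi 0) 1 by rewrite phi0; exact: ex_derive.
 split.
  apply/derivable1_diffP/differentiable_comp; exact/derivable1_diffP.
 rewrite -derive1E derive1_comp// phi0 !derive1E.
 by rewrite (@derive_val _ _ _ _ _ _ _ hg) (@derive_val _ _ _ _ _ _ _ dphi).
case: dgphi => d1 d2; split.
 by apply/derivable1P; exact: d1.
rewrite -d2 /derive (_ : (fun h : R => h^-1 *: ((g \o phi \o shift 0) (h *: 1) - (g \o phi) 0)) =
  fun h : R => h^-1 *: (((fun y => g (u y)) \o shift x) (h *: v) - g (u x)))//.
by apply/funext => h /=; rewrite phi0 /shift /= addr0 /phi [h *: 1]mulr1.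
Qed.

Lemma lipschitz_of_derive (f df : R -> R) C : (forall x : R, is_derive x (1 : R) f (df x)) ->
 (forall x, `|df x| <= C) -> forall x y, `|f x - f y| <= C * `|x - y|.
move=> h hC x y.
wlog xy : x y / x <= y.
 by move=> H; have [/H//|/ltW/H] := leP x y; rewrite distrC [`|y - x|]distrC.
have [|z _ E] := @MVT_segment R f df x y xy (fun z _ => h z).
 apply: continuous_subspaceT => z; apply: differentiable_continuous.
 by apply/derivable1_diffP; exact: (@ex_derive _ _ _ _ _ _ _ (h z)).
by rewrite distrC E normrM [`|y - x|]distrC ler_wpM2r.
Qed.

End chain1.

Lemma is_derive_cvg (R : realType) (V : normedModType R) (f : V -> R) x v (l : R) :
 (fun h : R => h^-1 *: (f (h *: v + x) - f x)) @ 0^' --> l -> is_derive x v f l.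
by move=> h; split; [apply/cvg_ex; exists l|apply/cvg_lim]. Qed.

(** * The flat functions x^{-k} exp(-1/x) *)

Section flat.
Variable R : realType.

(** The derivative of [flat k] is a combination of [flat k.+1] and [flat k.+2], so the whole family
    is handled by one induction on the order of differentiation. [flat 0] is the classical
    exp(-1/x), from which the bumps, cutoffs and truncations are built. *)
Definition flat k (x : R) : R := if 0 < x then x^-1 ^+ k * expR (- x^-1) else 0.

Lemma flat_ge0 k x : 0 <= flat k x.
by rewrite /flat; case: ifP => // x0; rewrite mulr_ge0 ?expR_ge0// exprn_ge0// invr_ge0 ltW. Qed.

Lemma flat_gt0 k x : 0 < x -> 0 < flat k x.
by move=> x0; rewrite /flat x0 mulr_gt0 ?expR_gt0// exprn_gt0// invr_gt0. Qed.

Lemma flat_le0 k x : x <= 0 -> flat k x = 0.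
by rewrite /flat leNgt => /negbTE ->. Qed.

(** With y = x^-1 this is y^k <= k! exp y, a single term of the exponential series. *)
Lemma flat_bound k x : flat k x <= k`!%:R.
rewrite /flat; case: ifP => // x0; have y0 : 0 < x^-1 by rewrite invr_gt0.
set y := x^-1 in y0 *; rewrite expRN ler_pdivrMr ?expR_gt0//.
case: k => [|k]; first by rewrite expr0 mul1r (le_trans _ (expR_ge1Dx _))// lerDl ltW.
rewrite -ler_pdivrMl ?ltr0n ?fact_gt0// mulrC.
by rewrite (le_trans _ (expR_ge1Dxn k (ltW y0)))// lerDr.
Qed.

Lemma flatS k x : flat k x = x * flat k.+1 x.
rewrite /flat; case: ifP => [x0|]; last by rewrite mulr0.
by rewrite exprS -mulrA [x * _]mulrA divff ?mul1r// gt_eqF.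
Qed.

Lemma is_derive_flat k (x : R) : is_derive x (1 : R) (flat k) (flat k.+2 x - k%:R * flat k.+1 x).
have [x0|x0|->] := ltgtP x 0.
- rewrite !flat_le0 ?(ltW x0)// mulr0 subr0.
 apply: (@near_eq_is_derive _ _ _ (cst 0)).
  near=> y; rewrite /= flat_le0//; apply/ltW; near: y; exact: lt_nbhsl.
- have xn0 : x != 0 by rewrite gt_eqF.
 have N : \near x, (fun y : R => y^-1 ^+ k * expR (- y^-1)) x = flat k x.
  near=> y; rewrite /flat ifT//; near: y; exact: lt_nbhsr.
 apply: (near_eq_is_derive N).
 have dV : is_derive x 1 (fun y : R => y^-1) (- x ^- 2).
  split; first by apply: derivableV => //; exact: derivable_id.
  rewrite deriveV//.
  by rewrite derive_id /GRing.scale/= mulr1.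
 have dN : is_derive x 1 (fun y : R => - y^-1) (x ^- 2).
  by apply: is_derive_eq; rewrite opprK.
 have dE := is_derive_comp1 dN (is_derive_expR _).
 have dX0 : is_derive x^-1 (1 : R) (fun y : R => y ^+ k) (k%:R * x^-1 ^+ k.-1).
  by split; [exact: exprn_derivable|rewrite -derive1E exp_derive1].
 have dX := is_derive_comp1 dV dX0.
 case: (is_deriveM dX dE) => d1 d2; split; first exact: d1.
 rewrite [LHS]d2.
 rewrite /flat x0 /GRing.scale /=; move: xn0; clear; case: k => [|k] xn0 /=.
  by rewrite !mul0r !mulr0 !addr0 subr0 expr0 !mul1r exprVn mulrC.
 by rewrite !exprS expr0; set P := x^-1 ^+ k; field.
(* At 0 the difference quotient [flat k h] / h equals [flat k.+1 h], that is h times [flat k.+2 h],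
   hence at most |h| (k+2)! in modulus. *)
apply: is_derive_cvg; rewrite !flat_le0// mulr0 subr0.
apply/cvgr0Pnorm_le => eps eps0.
have c0 : 0 < k.+2`!%:R :> R by rewrite ltr0n fact_gt0.
near=> h; have h0 : h != 0 by near: h; exact: nbhs_dnbhs_neq.
rewrite addr0 subr0 [h *: 1]mulr1 /GRing.scale /= flatS (flatS k.+1) mulKf// normrM.
rewrite [`|flat _ _|]ger0_norm ?flat_ge0//.
apply: (@le_trans _ _ (`|h| * k.+2`!%:R)); first by rewrite ler_wpM2l// flat_bound.
rewrite -ler_pdivlMr//; near: h; apply: dnbhs0_le; exact: divr_gt0.
Unshelve. all: by end_near. Qed.

End flat.

Section continuity.
Variables (T : topologicalType) (R : realType).
Implicit Types u v : T -> R.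

Lemma contD u v : continuous u -> continuous v -> continuous (fun x => u x + v x).
by move=> hu hv x; exact: (continuousD (hu x) (hv x)). Qed.

Lemma contM u v : continuous u -> continuous v -> continuous (fun x => u x * v x).
by move=> hu hv x; exact: (continuousM (hu x) (hv x)). Qed.

Lemma contV u : (forall x, u x != 0) -> continuous u -> continuous (fun x => (u x)^-1).
by move=> u0 hu x; exact: (continuousV (u0 x) (hu x)). Qed.

End continuity.

(** * Smooth functions on R^d *)

Section smooth.
Variables (R : realType) (d : nat).
Local Notation E := 'rV[R]_d.
Local Notation e i := (delta_mx ord0 i : E).
Implicit Types u v : E -> R.

(** Derivatives are counted from the inside out, so that stability under products, inverses and
    composition goes by induction on the order; the lists in [smooth] run from the outside in. *)
Fixpoint Ck k u : Prop := if k is k'.+1 then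
 continuous u /\ forall i, (forall x, derivable u x (e i)) /\ Ck k' (pderiv i u)
 else continuous u.

Lemma CkW k u : Ck k.+1 u -> Ck k u.
elim: k u => [|k ih] u; first by case.
by move=> [cu h]; split=> // i; have [dui cui] := h i; split=> //; exact: ih.
Qed.

Lemma Ck_cont k u : Ck k u -> continuous u.
by case: k => [|k]//= []. Qed.

Lemma smoothP u : smooth u <-> forall k, Ck k u.
split=> [su k|h s].
 elim: k u su => [|k ih] u su; first by have [] := su [::].
 split; first by have [] := su [::].
 move=> i; split; first by have [_] := su [::].
 apply: ih => s; have := su (rcons s i).
 by rewrite /pderivs foldr_rcons.
have : forall k, Ck k (pderivs s u).
 elim: s => [//|i s ih] k /=; by have [_ /(_ i)[]] := ih k.+1.
move=> hk; split; first exact: Ck_cont (hk 0%N).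
by move=> i; have [_ /(_ i)[]] := hk 1%N.
Qed.

Lemma smooth_cont u : smooth u -> continuous u.
by move=> /(_ [::])[]. Qed.

Lemma smooth_derivable u i x : smooth u -> derivable u x (e i).
by move=> /(_ [::])[_]; apply. Qed.

Lemma smooth_pderiv u i : smooth u -> smooth (pderiv i u).
by move=> /smoothP h; apply/smoothP => k; have [_ /(_ i)[]] := h k.+1. Qed.

Lemma is_derive_smooth u i x : smooth u -> is_derive x (e i) u (pderiv i u x).
by move=> su; apply: derivableP; exact: smooth_derivable. Qed.

Lemma pderivE u du i : (forall x, is_derive x (e i) u (du x)) -> pderiv i u = du.
by move=> h; ext x; exact: (@derive_val _ _ _ _ _ _ _ (h x)). Qed.

(* Stability of Ck under an operation whose derivative is expressed by the same operations. *)
Lemma Ck_step k u (du : 'I_d -> E -> R) : continuous u ->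
 (forall i x, is_derive x (e i) u (du i x)) -> (forall i, Ck k (du i)) -> Ck k.+1 u.
move=> cu hd hk; split=> // i; split; first by move=> x; exact: (@ex_derive _ _ _ _ _ _ _ (hd i x)).
by rewrite (pderivE (hd i)).
Qed.

Lemma Ck_cst k (c : R) : Ck k (fun=> c).
elim: k c => [|k ih] c; first exact: cst_continuous.
apply: (@Ck_step _ _ (fun _ _ => 0)) => //; first exact: cst_continuous.

Qed.

Lemma Ck_is_derive k u i x : Ck k.+1 u -> is_derive x (e i) u (pderiv i u x).
by move=> [_ /(_ i)[h _]]; apply: derivableP. Qed.

Lemma Ck_pderiv k u i : Ck k.+1 u -> Ck k (pderiv i u).
by move=> [_ /(_ i)[_ h]]. Qed.

Lemma CkD k u v : Ck k u -> Ck k v -> Ck k (fun x => u x + v x).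
elim: k u v => [|k ih] u v hu hv; first exact: (contD (Ck_cont hu) (Ck_cont hv)).
apply: (@Ck_step _ _ (fun i x => pderiv i u x + pderiv i v x)).
- exact: (contD (Ck_cont hu) (Ck_cont hv)).
- move=> i x; have := Ck_is_derive i x hu; have := Ck_is_derive i x hv => A B.
 exact: (is_deriveD B A).
- by move=> i; apply: ih; exact: Ck_pderiv.
Qed.

Lemma CkM k u v : Ck k u -> Ck k v -> Ck k (fun x => u x * v x).
elim: k u v => [|k ih] u v hu hv; first exact: (contM (Ck_cont hu) (Ck_cont hv)).
apply: (@Ck_step _ _ (fun i x => u x * pderiv i v x + v x * pderiv i u x)).
- exact: (contM (Ck_cont hu) (Ck_cont hv)).
- move=> i x; have := Ck_is_derive i x hu; have := Ck_is_derive i x hv => A B.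
 exact: (is_deriveM B A).
- by move=> i; apply: CkD; apply: ih; (exact: Ck_pderiv || exact: CkW).
Qed.

Lemma CkV k u : (forall x, u x != 0) -> Ck k u -> Ck k (fun x => (u x)^-1).
move=> u0; elim: k => [|k ih] hu; first exact: (contV u0 (Ck_cont hu)).
apply: (@Ck_step _ _ (fun i x => (- 1) * ((u x)^-1 * (u x)^-1) * pderiv i u x)).
- exact: (contV u0 (Ck_cont hu)).
- move=> i x; have [_ /(_ i)[/(_ x) h _]] := hu.
 split; first exact: derivableV.
 by rewrite deriveV// /GRing.scale /= -exprVn expr2 mulN1r.
- move=> i; apply: CkM; last exact: Ck_pderiv.
 by apply: CkM; [exact: Ck_cst|apply: CkM; apply: ih; exact: CkW].
Qed.

Lemma Ck_flat k m u : Ck m u -> Ck m (fun x => flat k (u x)).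
have cf j (x : R) : {for x, continuous (flat j)}.
 apply: differentiable_continuous; apply/derivable1_diffP.
 exact: (@ex_derive _ _ _ _ _ _ _ (is_derive_flat j x)).
elim: m k u => [|m ih] k u hu.
 by move=> x; apply: continuous_comp; [exact: (Ck_cont hu)|exact: cf].
apply: (@Ck_step _ _ (fun i x => (flat k.+2 (u x) + (- k%:R) * flat k.+1 (u x)) * pderiv i u x)).
- by move=> x; apply: continuous_comp; [exact: (Ck_cont hu)|exact: cf].
- move=> i x; have h := is_derive_comp1 (Ck_is_derive i x hu) (is_derive_flat k (u x)).
 by rewrite mulNr.
- move=> i; apply: CkM; last exact: Ck_pderiv.
 apply: CkD; first by apply: ih; exact: CkW.
 by apply: CkM; [exact: Ck_cst|apply: ih; exact: CkW].
Qed.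

Lemma Ck_coord k i : Ck k (fun x : E => x ord0 i).
case: k => [|k]; first exact: coord_continuous.
apply: (@Ck_step _ _ (fun j _ => (i == j)%:R)).
- exact: coord_continuous.
- move=> j x; apply: is_derive_cvg; apply: cvg_near_cst; near=> h.
 have h0 : h != 0 by near: h; exact: nbhs_dnbhs_neq.
 by rewrite !mxE eqxx /= addrK /GRing.scale /= mulrA mulVf// mul1r.
- by move=> j; exact: Ck_cst.
Unshelve. all: by end_near. Qed.

Lemma smooth_cst c : smooth (fun _ : E => c).
by apply/smoothP => k; exact: Ck_cst. Qed.

Lemma smoothD u v : smooth u -> smooth v -> smooth (fun x => u x + v x).
by move=> /smoothP hu /smoothP hv; apply/smoothP => k; exact: CkD. Qed.

Lemma smoothM u v : smooth u -> smooth v -> smooth (fun x => u x * v x).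
by move=> /smoothP hu /smoothP hv; apply/smoothP => k; exact: CkM. Qed.

Lemma smoothZ c u : smooth u -> smooth (fun x => c * u x).
by apply: smoothM; exact: smooth_cst. Qed.

Lemma smoothN u : smooth u -> smooth (fun x => - u x).
by move=> /(smoothZ (-1)); under eq_fun do rewrite mulN1r. Qed.

Lemma smoothB u v : smooth u -> smooth v -> smooth (fun x => u x - v x).
by move=> su /smoothN; exact: smoothD. Qed.

Lemma smoothV u : (forall x, u x != 0) -> smooth u -> smooth (fun x => (u x)^-1).
by move=> u0 /smoothP hu; apply/smoothP => k; exact: CkV. Qed.

Lemma smooth_flat k u : smooth u -> smooth (fun x => flat k (u x)).
by move=> /smoothP hu; apply/smoothP => m; exact: Ck_flat. Qed.

Lemma smooth_coord i : smooth (fun x : E => x ord0 i).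
by apply/smoothP => k; exact: Ck_coord. Qed.

Lemma smooth_prod (I : Type) (s : seq I) (F : I -> E -> R) :
 (forall i, smooth (F i)) -> smooth (fun x => \prod_(i <- s) F i x).
move=> h; elim: s => [|i s ih].
 by under eq_fun do rewrite big_nil; exact: smooth_cst.
by under eq_fun do rewrite big_cons; exact: smoothM.
Qed.

Lemma pderivD u v i x : smooth u -> smooth v ->
 pderiv i (fun y => u y + v y) x = pderiv i u x + pderiv i v x.
by move=> su sv; apply: deriveD; exact: smooth_derivable. Qed.

Lemma pderivM u v i x : smooth u -> smooth v ->
 pderiv i (fun y => u y * v y) x = u x * pderiv i v x + v x * pderiv i u x.
by move=> su sv; rewrite /pderiv deriveM//; exact: smooth_derivable. Qed.

Lemma pderivZ c u i x : smooth u -> pderiv i (fun y => c * u y) x = c * pderiv i u x.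
by move=> su; rewrite /pderiv deriveZ//; exact: smooth_derivable. Qed.

End smooth.

(** * Test functions, bumps and cutoffs *)

Section test_functions.
Variables (R : realType) (d : nat).
Local Notation E := 'rV[R]_d.
Local Notation e i := (delta_mx ord0 i : E).
Implicit Types (u v : E -> R) (V K : set E).

Lemma rV_compact_closed K : compact K -> closed K.
by apply: compact_closed; exact: norm_hausdorff. Qed.

Lemma pderiv_off u K i x : closed K -> (forall y, ~ K y -> u y = 0) -> ~ K x -> pderiv i u x = 0.
move=> cK u0 nKx; rewrite /pderiv (@near_eq_derive _ _ _ _ (cst 0)) ?derive_cst//.
have oK : open (~` K) by rewrite openC.
by near=> y; rewrite /= u0//; near: y; exact: open_nbhs_nbhs.
Unshelve. all: by end_near. Qed.

Lemma test_smooth V u : test V u -> smooth u. Proof. by case. Qed.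

Lemma testW V W u : V `<=` W -> test V u -> test W u.
by move=> VW [su [K [cK KV u0]]]; split=> //; exists K; split=> // x /KV/VW. Qed.

Lemma test0 V : test V (fun=> 0).
split; first exact: smooth_cst.
by exists set0; split=> //; exact: compact0.
Qed.

Lemma testD V u v : test V u -> test V v -> test V (fun x => u x + v x).
move=> [su [K [cK KV u0]]] [sv [L [cL LV v0]]]; split; first exact: smoothD.
exists (K `|` L); split; first exact: compactU.
 by move=> x [/KV|/LV].
by move=> x nKL; rewrite u0 ?v0 ?addr0// => ?; apply: nKL; [right|left].
Qed.

Lemma testMl V u v : test V u -> smooth v -> test V (fun x => u x * v x).
move=> [su [K [cK KV u0]]] sv; split; first exact: smoothM.
by exists K; split=> // x /u0 ->; rewrite mul0r.
Qed.

Lemma testZ V c u : test V u -> test V (fun x => c * u x).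
by move=> tu; under eq_fun do rewrite mulrC; apply: testMl => //; exact: smooth_cst. Qed.

Lemma test_sum V (I : Type) (s : seq I) (F : I -> E -> R) :
 (forall i, test V (F i)) -> test V (fun x => \sum_(i <- s) F i x).
move=> h; elim: s => [|i s ih].
 by under eq_fun do rewrite big_nil; exact: test0.
by under eq_fun do rewrite big_cons; exact: testD.
Qed.

Lemma test_pderiv V u i : test V u -> test V (pderiv i u).
move=> [su [K [cK KV u0]]]; split; first exact: smooth_pderiv.
exists K; split=> // x nK; apply: (@pderiv_off u K) => //; exact: rV_compact_closed.
Qed.

Lemma test_off V u x : test V u -> ~ V x -> u x = 0.
by move=> [_ [K [_ KV u0]]] nV; apply: u0 => /KV. Qed.

Lemma grad_off V u x : test V u -> ~ V x -> grad u x = 0.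
by move=> tu nV; apply/rowP => i; rewrite !mxE (test_off (test_pderiv i tu)). Qed.

(* F is allowed to depend on a second smooth function; only F(0,t)=0 matters for the support. *)
Lemma test_comp V (F : R -> R -> R) u v : test V u -> (forall t, F 0 t = 0) ->
 smooth (fun x => F (u x) (v x)) -> test V (fun x => F (u x) (v x)).
move=> [su [K [cK KV u0]]] F0 sF; split=> //.
by exists K; split=> // x /u0 ->.
Qed.

Lemma compact_supp_bounded u K : continuous u -> compact K -> (forall x, ~ K x -> u x = 0) ->
 exists2 M, 0 <= M & forall x, `|u x| <= M.
move=> cu cK u0.
have [[x Kx]|K0] := pselect (K !=set0); last first.
 by exists 0 => // x; rewrite u0 ?normr0// => Kx; apply: K0; exists x.
have [||c _ hc] := @EVT_max_rV _ _ (fun x => `|u x|) K _ cK.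
- by exists x.
- apply: continuous_subspaceT => y; apply: continuous_comp; [exact: cu|exact: norm_continuous].
exists `|u c| => // y; have [Ky|nK] := pselect (K y); first by apply: hc; rewrite inE.
by rewrite u0// normr0.
Qed.

Lemma test_bounded V u : test V u -> exists2 M, 0 <= M & forall x, `|u x| <= M.
by move=> [su [K [cK _ u0]]]; apply: (compact_supp_bounded (smooth_cont su) cK). Qed.

Definition cbox (c : E) (r : R) : set E := [set x | forall i, `|x ord0 i - c ord0 i| <= r].
Definition obox (c : E) (r : R) : set E := [set x | forall i, `|x ord0 i - c ord0 i| < r].

Lemma cbox_compact c r : compact (cbox c r).
rewrite (_ : cbox c r = [set v | forall i, `[c ord0 i - r, c ord0 i + r]%classic (v ord0 i)]).
 by apply: (@rV_compact R d (fun i => `[c ord0 i - r, c ord0 i + r]%classic)) => i; exact: segment_compact.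
by apply/seteqP; split => x /= h i; have := h i; rewrite in_itv /= ler_distl.
Qed.

(** Each coordinate contributes exp(-1/.) of the distances to the two faces of the box, so the
    product is positive exactly on [obox c r]. Differences are spelled as sums and multiples by -1
    to match [smoothD] and [smoothZ]. *)
Definition bump (c : E) (r : R) : E -> R := fun x =>
 \prod_(i < d) (flat 0 (r + (-1) * (x ord0 i + (- c ord0 i))) * flat 0 (r + (x ord0 i + (- c ord0 i)))).

Lemma smooth_bump c r : smooth (bump c r).
apply: smooth_prod => i; apply: smoothM; apply: smooth_flat; apply: smoothD; try exact: smooth_cst.
 by apply: smoothZ; apply: smoothD; [exact: smooth_coord|exact: smooth_cst].
by apply: smoothD; [exact: smooth_coord|exact: smooth_cst].
Qed.

Lemma bump_ge0 c r x : 0 <= bump c r x.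
by apply: prodr_ge0 => i _; rewrite mulr_ge0// flat_ge0. Qed.

Lemma bump_gt0 c r x : obox c r x -> 0 < bump c r x.
move=> h; apply: prodr_gt0 => i _; have := h i; rewrite ltr_norml => /andP[a b].
by apply: mulr_gt0; apply: flat_gt0; lra.
Qed.

Lemma bump_off c r x : ~ obox c r x -> bump c r x = 0.
move=> /existsNP[i /negP]; rewrite -leNgt ler_normr => h.
apply/eqP/prodf_eq0; exists i => //; rewrite mulf_eq0; apply/orP.
by case/orP: h => h; [left|right]; apply/eqP/flat_le0; lra.
Qed.

Lemma test_bump V c r : cbox c r `<=` V -> test V (bump c r).
move=> cV; split; first exact: smooth_bump.
exists (cbox c r); split=> //; first exact: cbox_compact.
move=> x nx; apply: bump_off => ox; apply: nx => i; apply: ltW; exact: ox.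
Qed.

Definition rbox_c (p : 'rV[rat]_d * nat) : E := \row_i ratr (p.1 ord0 i).
Definition rbox_r (p : 'rV[rat]_d * nat) : R := p.2.+1%:R^-1.
Definition rbump p := bump (rbox_c p) (rbox_r p).

Lemma rbox_exists V x : open V -> V x -> exists p,
 obox (rbox_c p) (rbox_r p) x /\ cbox (rbox_c p) (rbox_r p) `<=` V.
move=> oV Vx; have /nbhs_ballP[ep /= e0 eV] := oV _ Vx.
have e20 : 0 < ep / 3 by rewrite divr_gt0.
pose k := Num.truncn (ep / 3)^-1.
have ke : (k.+1%:R^-1 < ep / 3 :> R) by rewrite invf_plt ?posrE// truncnS_gt.
have k0 : 0 < k.+1%:R^-1 :> R by rewrite invr_gt0.
have /choice[q qP] : forall i, exists q : rat, `|x ord0 i - ratr q| < k.+1%:R^-1 :> R.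
 move=> i; have tk : x ord0 i - k.+1%:R^-1 < x ord0 i + k.+1%:R^-1 by rewrite ltrD2l gtrN.
 have [q] := rat_in_itvoo tk; rewrite in_itv /= => /andP[a b]; exists q.
 by rewrite distrC ltr_distl a b.
exists (\row_i q i, k); split.
 by move=> i /=; rewrite /rbox_c !mxE; exact: qP.
move=> v /= Bv; apply: eV; split=> // i j; rewrite ord1 /ball /=.
have := Bv j; rewrite /rbox_c /rbox_r !mxE /= => vq; have fq := qP j.
rewrite distrC -(subrK (ratr (q j)) (v ord0 j)) -addrA.
rewrite (le_lt_trans (ler_normD _ _))//.
have h : `|ratr (q j) - x 0 j| < k.+1%:R^-1 by rewrite distrC; exact: fq.
apply: (lt_le_trans (ler_ltD vq h)); move: ke; set z := _^-1; lra.
Qed.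

(* Smooth minorants of the indicator of an open set, converging to it pointwise. *)
Definition open_approx V (n : nat) : E -> R := fun x =>
 flat 0 (n.+1%:R * \sum_(k <- iota 0 n) (if unpickle k is Some p then
  (if `[< cbox (rbox_c p) (rbox_r p) `<=` V >] then rbump p x else 0) else 0)).

Lemma open_approx_test V n : test V (open_approx V n).
have ts : test V (fun x => \sum_(k <- iota 0 n) (if unpickle k is Some p then
  (if `[< cbox (rbox_c p) (rbox_r p) `<=` V >] then rbump p x else 0) else 0)).
 apply: test_sum => k; case: unpickle => [p|]; last exact: test0.
 case: asboolP => h; last exact: test0.
 exact: test_bump.
apply: (@test_comp V (fun s _ => flat 0 (n.+1%:R * s)) _ (fun=> 0) ts).
 by move=> t; rewrite mulr0 flat_le0.
by apply: smooth_flat; apply: smoothZ; exact: test_smooth ts.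
Qed.

Lemma open_approx01 V n x : 0 <= open_approx V n x <= 1.
by rewrite /open_approx flat_ge0 /=; exact: (flat_bound 0). Qed.

Lemma open_approx_cvg V x : open V -> open_approx V ^~ x @ \oo --> (\1_V x : R).
move=> oV; rewrite indicE.
have [Vx|nV] := pselect (V x); last first.
 rewrite memNset//; apply: cvg_near_cst; apply: nearW => n.
 exact: (test_off (open_approx_test V n) nV).
rewrite mem_set//; have [p [ox cV]] := rbox_exists oV Vx.
have b0 := bump_gt0 ox; set b := bump _ _ _ in b0.
apply/cvgrPdist_le => ep ep0.
near=> n.
have np : (pickle p < n)%N by near: n; exists (pickle p).+1.
have bS : b <= \sum_(k <- iota 0 n) (if unpickle k is Some p then
  (if `[< cbox (rbox_c p) (rbox_r p) `<=` V >] then rbump p x else 0) else 0).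
 rewrite (big_rem (pickle p)) /=; last by rewrite mem_iota add0n np.
 rewrite pickleK asboolT// lerDl sumr_ge0// => k _.
 by case: unpickle => // q; case: ifP => // _; exact: bump_ge0.
rewrite /open_approx; set s := \sum_(k <- _) _ in bS *.
have s0 : 0 < s by exact: lt_le_trans bS.
have n1 : 0 < n.+1%:R :> R by [].
have z0 : 0 < n.+1%:R * s by rewrite mulr_gt0.
rewrite ger0_norm; last by rewrite subr_ge0; exact: (flat_bound 0).
(* Uses 1 - exp (-1/z) <= 1/z, where z >= (n+1) b and b > 0 is the value at x of one fixed bump. *)
rewrite /flat z0 expr0 mul1r lerBlDr -lerBlDl.
apply: le_trans (expR_ge1Dx _); rewrite lerD2l lerN2.
rewrite invf_ple ?posrE// (@le_trans _ _ (n.+1%:R * b))// ?ler_wpM2l//.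
rewrite -ler_pdivrMr//; apply: ltW; rewrite -natr1 ltr_wpDr//; near: n; exact: nbhs_infty_gtr.
Unshelve. all: by end_near. Qed.

(** By compactness finitely many bumps supported in V have a sum s that is positive on K, hence at
    least some m > 0 there; a smooth step applied to s / m then equals 1 on K. *)
Lemma cutoff K V : compact K -> open V -> K `<=` V ->
 exists chi, [/\ test V chi, forall x, 0 <= chi x <= 1 & forall x, K x -> chi x = 1].
move=> cK oV KV.
have [s [ts s0 sK]] : exists s, [/\ test V s, forall x, 0 <= s x & forall x, K x -> 0 < s x].
 have := cK; rewrite compact_cover => /(_ _ [set p | cbox (rbox_c p) (rbox_r p) `<=` V]
  (fun p => [set x | 0 < rbump p x])) [].
 - move=> p _; apply: (@open_comp _ _ (rbump p) [set y | 0 < y]); last exact: open_gt.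
  by move=> x _; exact: (smooth_cont (@smooth_bump _ _)).
 - by move=> x /KV Vx; have [p [ox cV]] := rbox_exists oV Vx; exists p => //=; exact: bump_gt0.
 move=> D hD hK; exists (fun x => \sum_(p <- finmap.enum_fset D) if `[< cbox (rbox_c p) (rbox_r p) `<=` V >] then rbump p x else 0).
 split.
 - by apply: test_sum => p; case: asboolP => [h|_]; [exact: test_bump|exact: test0].
 - by move=> x; apply: sumr_ge0 => p _; case: ifP => // _; exact: bump_ge0.
 - move=> x /hK[p /= pD px]; rewrite (big_rem p) //=.
  rewrite asboolT; last by have := hD _ pD; rewrite inE.
  rewrite ltr_wpDr// sumr_ge0// => q _; case: ifP => // _; exact: bump_ge0.
have [m m0 hm] : exists2 m, 0 < m & forall x, K x -> m <= s x.
 have [[x Kx]|K0] := pselect (K !=set0); last first.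
  by exists 1 => // x Kx; exfalso; apply: K0; exists x.
 have [||c cK' hc] := @EVT_min_rV _ _ s K _ cK; first by exists x.
  by apply: continuous_subspaceT; exact: smooth_cont (test_smooth ts).
 by exists (s c); [apply: sK; rewrite inE in cK'|move=> y Ky; apply: hc; rewrite inE].
(* A smooth step, 0 for t <= 0 and 1 for t >= 1. The denominator is positive because t or 1 - t
   is. *)
pose th (t : R) := flat 0 t * (flat 0 t + flat 0 (1 - t))^-1.
have den t : 0 < flat 0 t + flat 0 (1 - t) :> R.
 have [t0|t0] := leP t 0; first by rewrite ltr_wpDl ?flat_ge0// flat_gt0//; lra.
 by rewrite ltr_wpDr ?flat_ge0// flat_gt0.
exists (fun x => th (m^-1 * s x)); split.
- apply: (@test_comp V (fun a _ => th (m^-1 * a)) s s ts).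
  by move=> t; rewrite mulr0 /th flat_le0// mul0r.
 have ss : smooth (fun x => m^-1 * s x) by apply: smoothZ; exact: test_smooth ts.
 apply: smoothM; first exact: smooth_flat.
 apply: smoothV => [x|]; first by rewrite gt_eqF.
 apply: smoothD; apply: smooth_flat => //.
 apply: smoothB => //; exact: smooth_cst.
- move=> x; rewrite /th mulr_ge0 ?flat_ge0 ?invr_ge0 ?(ltW (den _))//=.
 by rewrite ler_pdivrMr// mul1r lerDl flat_ge0.
- move=> x /hm h; rewrite /th [flat 0 (1 - _)]flat_le0 ?addr0 ?divff ?gt_eqF ?flat_gt0//.
  by rewrite mulr_gt0 ?invr_gt0// (lt_le_trans m0).
 by rewrite subr_le0 ler_pdivlMl// mulr1.
Qed.

End test_functions.

(** * Integration against a density *)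

Section density.
Context d (T : measurableType d) (R : realType).
Variables (nu mu : {measure set T -> \bar R}) (rho : T -> R).
Hypothesis rho0 : forall x, 0 <= rho x.
Hypothesis mrho : mfunT rho.
Hypothesis mu_rho : forall S, measurable S -> mu S = (\int[nu]_(x in S) (rho x)%:E)%E.

Import HBNNSimple.

(** The formula for [mu] gives indicators, linearity gives simple functions, and monotone
    convergence along simple approximations from below gives the rest. *)
Lemma ge0_integral_density (f : T -> R) : mfunT f -> (forall x, 0 <= f x) ->
 (\int[mu]_x (f x)%:E = \int[nu]_x (f x * rho x)%:E)%E.
move=> mf f0; have mEf : mfunT (EFin \o f) by exact/measurable_EFinP.
pose h := nnsfun_approx measurableT mEf.
have hf x : (h n x)%:E @[n --> \oo] --> (f x)%:E.
 have f0' y : [set: T] y -> (0 <= (EFin \o f) y)%E by rewrite lee_fin.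
 exact: (cvg_nnsfun_approx measurableT mEf f0').
have nd x : nondecreasing_seq (fun n => h n x).
 by move=> a b ab; exact/lefP/nd_nnsfun_approx.
have c1 : (\int[mu]_x (h n x)%:E @[n --> \oo] --> \int[mu]_x (f x)%:E)%E.
 rewrite (_ : (\int[mu]_x (f x)%:E)%E = (\int[mu]_x limn (fun n => (h n x)%:E))%E); last first.
  by apply: eq_integral => x _; apply/esym/cvg_lim => //; exact: hf.
 apply: (cvg_monotone_convergence measurableT) => //.
 - by move=> n; exact/measurable_EFinP.
 - by move=> n x _; rewrite lee_fin.
 - by move=> x _ a b ab; rewrite lee_fin nd.
have c2 : (\int[nu]_x (h n x * rho x)%:E @[n --> \oo] --> \int[nu]_x (f x * rho x)%:E)%E.
 rewrite (_ : (\int[nu]_x (f x * rho x)%:E)%E = (\int[nu]_x limn (fun n => (h n x * rho x)%:E))%E); last first.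
  apply: eq_integral => x _; apply/esym/cvg_lim => //.
  under eq_fun do rewrite EFinM; rewrite EFinM; apply: cvgeZr => //; exact: hf.
 apply: (cvg_monotone_convergence measurableT) => //.
 - by move=> n; apply/measurable_EFinP; exact: measurable_funM.
 - by move=> n x _; rewrite lee_fin mulr_ge0.
 - by move=> x _ a b ab; rewrite lee_fin ler_wpM2r// nd.
have E n : (\int[mu]_x (h n x)%:E = \int[nu]_x (h n x * rho x)%:E)%E.
 have hE x : h n x = \sum_(y \in range (h n)) (y * \1_(h n @^-1` [set y]) x) by exact: fimfunE.
 under eq_integral do rewrite hE -fsumEFin//.
 under [in RHS]eq_integral do rewrite hE fsbig_finite// mulr_suml -sumEFin -fsbig_finite//.
 rewrite !ge0_integral_fsum//.
 - apply: eq_fsbigr => y yh.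
  under eq_integral do rewrite EFinM.
  rewrite integralZl_indic_nnsfun// integral_indic// setIT mu_rho//.
  under [RHS]eq_integral do rewrite -mulrA EFinM.
  rewrite ge0_integralZl//.
  + congr (_ * _)%E; rewrite integral_mkcond; apply: eq_integral => x _.
   by rewrite patchE indicE; case: ifP => _; rewrite ?mul1r ?mul0r.
  + by apply/measurable_EFinP; exact: measurable_funM.
  + by move=> x _; rewrite lee_fin mulr_ge0.
  + by move: yh; rewrite inE => -[x _ <-]; rewrite lee_fin.
 - by move=> y; apply/measurable_EFinP; apply: measurable_funM => //; exact: measurable_funM.
 - by move=> y x _; rewrite EFinM mule_ge0 ?lee_fin// -lee_fin; exact: nnfun_muleindic_ge0.
 - by move=> y; apply/measurable_EFinP; exact: measurable_funM.
 - by move=> y x _; exact: nnfun_muleindic_ge0.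
have c3 : (\int[mu]_x (h n x)%:E @[n --> \oo] --> \int[nu]_x (f x * rho x)%:E)%E.
 by under eq_fun do rewrite E.
exact: (cvg_unique _ c1 c3).
Qed.

Lemma Lint_density (f : T -> R) : mfunT f ->
 Lint mu f <-> Lint nu (fun x => f x * rho x).
move=> mf; have mfr : mfunT (fun x => f x * rho x) by exact: measurable_funM.
have E : (\int[mu]_x (`|f x|)%:E = \int[nu]_x (`|f x * rho x|)%:E)%E.
 rewrite ge0_integral_density//; last exact: measurableT_comp.
 by apply: eq_integral => x _; rewrite normrM (ger0_norm (rho0 x)).
by split=> /integrableP[_ h]; apply/integrableP; split; try exact/measurable_EFinP;
 move: h; rewrite /= E.
Qed.

(** A signed f is reduced to the nonnegative functions |f| and |f| + f. *)
Lemma Ig_density (f : T -> R) : Lint mu f -> Ig mu f = Ig nu (fun x => f x * rho x).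
move=> i; have mf := Lint_meas i; have j := (Lint_density mf).1 i.
have ia := Lint_abs i; have ja : Lint nu (fun x => `|f x| * rho x).
 by apply/Lint_density => //; exact: measurableT_comp.
have E g : (forall x, 0 <= g x) -> Lint mu g -> Ig mu g = Ig nu (fun x => g x * rho x).
 move=> g0 ig; rewrite /Ig /Rintegral ge0_integral_density//; exact: Lint_meas ig.
have h : Ig mu (fun x => `|f x| + f x) = Ig nu (fun x => (`|f x| + f x) * rho x).
 apply: E; last exact: LintD.
 by move=> x; have := ler_norm (- f x); rewrite normrN; lra.
move: h; rewrite IgD// (E (fun x => `|f x|))//.
rewrite (_ : (fun x => (`|f x| + f x) * rho x) = fun x => `|f x| * rho x + f x * rho x); last by ext x; rewrite mulrDl.
by rewrite IgD// => /addrI.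
Qed.

End density.

(** * Lebesgue measure on R^d and integrals of partial derivatives *)

Section rV.
Variables (R : realType).
Local Notation leb := (lebesgue_rV R).

Lemma continuous_meas_rV d (f : 'rV[R]_d -> R) : continuous f -> mfunT f.
move=> cf; apply: (measurability _ (RGenOpens.measurableE R)).
move=> _ [_ [a [b ->] <-]]; rewrite setTI; apply: open_rV_measurable.
by apply: open_comp; [move=> x _; exact: cf|exact: interval_open].
Qed.

Lemma compact_meas_rV d (K : set 'rV[R]_d) : compact K -> measurable K.
move=> /rV_compact_closed cK; rewrite -[K]setCK; apply: measurableC.
by apply: open_rV_measurable; rewrite openC.
Qed.

Lemma compact_cbox d (K : set 'rV[R]_d) : compact K -> exists M : R, K `<=` cbox 0 M.
move=> cK; have [M hM] : exists M : R, forall x, K x -> `|x| <= M.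
 have [[x Kx]|K0] := pselect (K !=set0); last by exists 0 => x Kx; exfalso; apply: K0; exists x.
 have [||c _ hc] := @EVT_max_rV _ _ (fun x : 'rV[R]_d => `|x|) K _ cK; first by exists x.
  by apply: continuous_subspaceT; exact: norm_continuous.
 by exists `|c| => y Ky; apply: hc; rewrite inE.
exists M => x /hM h i; rewrite mxE subr0; apply: le_trans h.
rewrite {2}/Num.norm /= mx_normrE; exact: (le_bigmax _ (fun ij => `|x ij.1 ij.2|) (ord0, i)).
Qed.

Lemma leb_cbox d (M : R) : (leb d (cbox 0 M) < +oo)%E.
elim: d => [|d ih] /=.
 by rewrite diracE; case: (_ \in _); rewrite ltry.
rewrite /lebesgue_step /pushforward.
rewrite (_ : @cons_rV R d @^-1` cbox 0 M = `[- M, M]%classic `*` cbox 0 M).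
 rewrite product_measure1E//; last by apply: compact_meas_rV; exact: cbox_compact.
 by apply: lte_mul_pinfty => //; rewrite /= lebesgue_measure_itv /=; case: ifP => _; rewrite -?EFinB ?ltry// fin_numE.
apply/seteqP; split => [[t v] /= h|[t v] [/= ht hv] i].
 split; first by have := h ord0; rewrite !mxE unlift_none subr0 in_itv /= ler_norml.
 by move=> i; have := h (lift ord0 i); rewrite !mxE liftK.
rewrite !mxE; case: unliftP => [j _|_]; first by have := hv j; rewrite mxE.
by rewrite subr0 ler_norml; move: ht; rewrite /= in_itv.
Qed.

Lemma leb_compact d (K : set 'rV[R]_d) : compact K -> (leb d K < +oo)%E.
move=> cK; have [M KM] := compact_cbox cK; apply: le_lt_trans (leb_cbox d M).
apply: le_measure => //; rewrite inE; apply: compact_meas_rV => //; exact: cbox_compact.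
Qed.

Lemma Lint_indic d (T : measurableType d) (mu : {measure set T -> \bar R}) (A : set T) :
 measurable A -> (mu A < +oo)%E -> Lint mu (\1_A : T -> R).
move=> mA Aoo; apply/integrableP; split; first exact/measurable_EFinP.
rewrite (eq_integral (fun x => (\1_A x)%:E)); last first.
 by move=> t _; rewrite gee0_abs// lee_fin.
by rewrite integral_indic// setIT.
Qed.

Lemma Lint_bounded_supp d (T : measurableType d) (mu : {measure set T -> \bar R}) (A : set T)
  (f : T -> R) (M : R) : measurable A -> (mu A < +oo)%E -> mfunT f ->
 (forall x, `|f x| <= M) -> (forall x, ~ A x -> f x = 0) -> Lint mu f.
move=> mA Aoo mf fM f0; apply: (Lint_dom mf _ (LintZ M (Lint_indic mA Aoo))) => x.
rewrite indicE; have [Ax|nA] := pselect (A x); first by rewrite mem_set// mulr1.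
by rewrite f0// normr0 memNset// mulr0.
Qed.

Lemma cons_rV_cont2 d (t : R) : continuous (fun y : 'rV[R]_d => cons_rV (t, y)).
move=> y0 U /nbhs_ballP[e /= e0 eU]; apply/nbhs_ballP; exists e => //= y [_ h]; apply: eU.
split=> // i j; rewrite !mxE ord1; case: unlift => [k|]; first exact: h.
exact: ballxx.
Qed.

Lemma cons_rV_cont1 d (y : 'rV[R]_d) : continuous (fun t : R => cons_rV (t, y)).
move=> t0; apply/cvg_ballP => e e0; apply/nbhs_ballP; exists e => //= t h.
split=> // i j; rewrite !mxE; case: unlift => [k|//]; exact: ballxx.
Qed.

(** Induction on d along the recursive construction of the measure, with Fubini in the order that
    suits the direction. For the first coordinate the inner integral runs over that coordinate and
    vanishes by the fundamental theorem of calculus; for any other coordinate the inner integral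
    runs over a slice and vanishes by induction. *)
Lemma leb_div0 d (i : 'I_d) (M : R) (w dw : 'rV[R]_d -> R) : continuous dw ->
 (forall x, is_derive x (delta_mx ord0 i) w (dw x)) ->
 (forall x, ~ cbox 0 M x -> w x = 0) -> (forall x, ~ cbox 0 M x -> dw x = 0) ->
 (\int[leb d]_x (dw x)%:E = 0)%E.
elim: d i w dw => [[]//|d ih] i w dw cdw hd w0 dw0.
have [C C0 hC] := compact_supp_bounded cdw (@cbox_compact R d.+1 0 M) dw0.
have mdw := continuous_meas_rV cdw.
have Leb1 : Lint (leb d.+1) dw.
 apply: (@Lint_bounded_supp _ _ (leb d.+1) (cbox 0 M) dw C) => //.
 - by apply: compact_meas_rV; exact: cbox_compact.
 - exact: leb_cbox.
have mc := @measurable_cons_rV R d.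
pose m1 : {sigma_finite_measure set (measurableTypeR R) -> \bar R} := lebesgue_measure.
have mdwc : mfunT (EFin \o (dw \o @cons_rV R d)).
 by apply/measurable_EFinP; apply: measurableT_comp.
have int_prod : (m1 \x leb d)%E.-integrable setT (EFin \o (dw \o @cons_rV R d)).
 apply/integrableP; split=> //.
 move/integrableP : Leb1 => [_]; rewrite /= /lebesgue_step.
 rewrite ge0_integral_pushforward//.
 by apply/measurable_EFinP; exact: measurableT_comp.
have -> : (\int[leb d.+1]_x (dw x)%:E = \int[(m1 \x leb d)%E]_z (EFin \o (dw \o @cons_rV R d)) z)%E.
 rewrite /= /lebesgue_step integral_pushforward//.
 exact/measurable_EFinP.
case: (unliftP ord0 i) => [j|] ie.
 rewrite -integral12_prod_meas1//; apply: integral0_eq => t _; rewrite /fubini_F /=.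
 apply: (ih j (fun y => w (cons_rV (t, y)))).
 - by move=> y; apply: continuous_comp; [exact: cons_rV_cont2|exact: cdw].
 - move=> y; have [d1 d2] := hd (cons_rV (t, y)).
  have E : (fun h : R => h^-1 *: ((w \o shift (cons_rV (t, y))) (h *: delta_mx ord0 i) - w (cons_rV (t, y)))) =
   (fun h : R => h^-1 *: (((fun y => w (cons_rV (t, y))) \o shift y) (h *: delta_mx ord0 j) - w (cons_rV (t, y)))).
   apply/funext => h /=; congr (_ *: (w _ - _)); apply/rowP => k; rewrite !mxE eqxx /=.
   case: (unliftP ord0 k) => [l ->|->]; rewrite ie.
    by rewrite !mxE eqxx /= (inj_eq (@lift_inj _ _)).
   by rewrite -(inj_eq (@ord_inj _)) /= mulr0 add0r.
  by split; [move: d1; rewrite /derivable E|rewrite -d2 /derive E].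
 - by move=> y ny; apply: w0 => h; apply: ny => k; have := h (lift ord0 k); rewrite !mxE liftK.
 - by move=> y ny; apply: dw0 => h; apply: ny => k; have := h (lift ord0 k); rewrite !mxE liftK.
rewrite -integral21_prod_meas1//; apply: integral0_eq => y _; rewrite /fubini_G /=.
pose g (t : R) : R := w (cons_rV (t, y)); pose dg (t : R) : R := dw (cons_rV (t, y)).
have hg t : is_derive t (1 : R) g (dg t).
 have [d1 d2] := hd (cons_rV (t, y)).
 have E : (fun h : R => h^-1 *: ((w \o shift (cons_rV (t, y))) (h *: delta_mx ord0 i) - w (cons_rV (t, y)))) =
   (fun h : R => h^-1 *: ((g \o shift t) (h *: 1) - g t)).
  apply/funext => h /=; congr (_ *: (w _ - _)); apply/rowP => k; rewrite !mxE eqxx /=.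
  case: (unliftP ord0 k) => [l ->|->]; rewrite ie.
   by rewrite -(inj_eq (@ord_inj _)) /= mulr0 add0r.
  by rewrite eqxx.
 by split; [move: d1; rewrite /derivable E|rewrite /dg -d2 /derive E].
have cdg : continuous dg by move=> t; apply: continuous_comp; [exact: cons_rV_cont1|exact: cdw].
(* Since a exceeds |M|, both endpoints of [-a, a] already lie outside the box that carries w. *)
pose a : R := `|M| + 1; have a0 : 0 < a by rewrite ltr_wpDl.
have out t : a <= `|t| -> ~ cbox 0 M (cons_rV (t, y)).
 move=> at_ /(_ ord0); rewrite !mxE unlift_none subr0 => h.
 have := ler_norm M; rewrite /a in at_; lra.
pose I : set R := `[(- a), a]%classic.
transitivity (\int[lebesgue_measure]_(t in I) (dg t)%:E)%E.
 rewrite [RHS]integral_mkcond; apply: eq_integral => t _; rewrite patchE /I.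
 case: ifPn => //; rewrite notin_setE /= in_itv /= -ler_norml => /negP; rewrite -ltNge => ta.
 by rewrite dw0//; apply: out; exact: ltW.
have aa : - a < a by lra.
rewrite (@continuous_FTC2 R dg g (- a) a aa).
- rewrite /g !w0 ?subee//; apply: out; rewrite ?normrN ger0_norm//; exact: ltW.
- exact: continuous_subspaceT.
- have cg : continuous g.
  move=> t; apply: differentiable_continuous; apply/derivable1_diffP.
  exact: (@ex_derive _ _ _ _ _ _ _ (hg t)).
 split; first by move=> t _; exact: (@ex_derive _ _ _ _ _ _ _ (hg t)).
  by apply: cvg_at_right_filter; exact: cg.
 by apply: cvg_at_left_filter; exact: cg.
- by move=> t _; rewrite derive1E; exact: (@derive_val _ _ _ _ _ _ _ (hg t)).
Qed.

Lemma leb_test_div0 d (i : 'I_d) u : test setT u -> Ig (leb d) (pderiv i u) = 0.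
move=> tu; have [su [K [cK _ u0]]] := tu; have [M KM] := compact_cbox cK.
rewrite /Ig /Rintegral.
have h1 : continuous (pderiv i u) by exact: smooth_cont (smooth_pderiv i su).
have h2 x : is_derive x (delta_mx ord0 i) u (pderiv i u x) by exact: is_derive_smooth.
have h3 x : ~ cbox 0 M x -> u x = 0 by move=> nx; apply: u0 => /KM.
have h4 x : ~ cbox 0 M x -> pderiv i u x = 0.
 by move=> nx; apply: (@pderiv_off _ _ u K) => //; [exact: rV_compact_closed|move=> /KM].
by rewrite (leb_div0 h1 h2 h3 h4).
Qed.

End rV.

Lemma EFin_to0 (R : realType) (a : nat -> R) : (forall n, 0 <= a n) ->
 ((fun n => (a n)%:E) @ \oo --> 0%E) <-> to0 a.
move=> a0; split; first by move=> /fine_cvg/cvg_to0.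
by move=> /(to0_cvg a0) h; apply: cvg_EFin => //; exact: nearW.
Qed.

(** * Completeness for a pointwise gauge *)

Section riesz_fischer.
Context d (T : measurableType d) (R : realType) (m : nat).
Variable mu : {measure set T -> \bar R}.
Variable N : T -> R -> 'rV[R]_m -> R.

Lemma geo_cvg (a : nat -> R) (C : R) :
 (forall k, (a k.+1 - a k) ^+ 2 <= C * (2^-1 ^+ 2) ^+ k) -> cvgn a.
move=> h; have C0 : 0 <= C by have := h 0%N; rewrite expr0 mulr1; apply: le_trans; exact: sqr_ge0.
have b k : `|a k.+1 - a k| <= Num.sqrt C * 2^-1 ^+ k.
 rewrite -(@sqrtr_sqr _ (a k.+1 - a k)) -[X in _ <= _ * X]ger0_norm// -(@sqrtr_sqr _ (_ ^+ k)) -sqrtrM//.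
 by apply: ler_wsqrtr; rewrite exprAC.
have cv : cvgn (series (telescope a)).
 apply: normed_cvg; apply: (@series_le_cvg _ _ (geometric (Num.sqrt C) 2^-1)).
 - by move=> n /=.
 - by move=> n /=.
 - side.
 - by apply: is_cvg_geometric_series; rewrite ger0_norm// invf_lt1// ltr1n.
rewrite (_ : a = fun n => a 0%N + series (telescope a) n); last by ext n; exact: eq_sum_telescope.
by apply: is_cvgD => //; exact: is_cvg_cst.
Qed.

Hypothesis N_ge0 : forall x s xi, 0 <= N x s xi.
Hypothesis N_meas : forall u (D : T -> 'rV[R]_m), mfunT u ->
 mvec D ->
 mfunT (fun x => N x (u x) (D x)).
Hypothesis N_cont : forall x (s_ : nat -> R) (xi_ : nat -> 'rV[R]_m) (s : R) (xi : 'rV[R]_m),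
 s_ @ \oo --> s -> (forall i, (fun n => xi_ n ord0 i) @ \oo --> xi ord0 i) ->
 (fun n => N x (s_ n) (xi_ n)) @ \oo --> N x s xi.
(** The constant may depend on the point and on B: ellipticity is only local, and for the gauge |s|
    the estimate s^2 <= C |s| holds for bounded s only. *)
Hypothesis N_low : forall x (B : R), exists C, forall (s : R) (xi : 'rV[R]_m), N x s xi <= B ->
 s ^+ 2 <= C * N x s xi /\ forall i, xi ord0 i ^+ 2 <= C * N x s xi.

Variables (u_ : nat -> T -> R) (D_ : nat -> T -> 'rV[R]_m).
Hypothesis mu_ : forall n, mfunT (u_ n).
Hypothesis mD_ : forall n i, mfunT (fun x => D_ n x ord0 i).
Hypothesis iN : forall n k, Lint mu (fun x => N x (u_ n x - u_ k x) (D_ n x - D_ k x)).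
Hypothesis cauchyN : forall e : R, 0 < e -> exists K, forall n k, (K <= n)%N -> (K <= k)%N ->
 Ig mu (fun x => N x (u_ n x - u_ k x) (D_ n x - D_ k x)) <= e.

(** One argument serves L^1 and the weighted energy spaces, in which a function and its gradient
    must converge together and the gauge varies with the point. A fast subsequence converges a.e.,
    and Fatou carries the Cauchy bound to the limit. The two vanishing clauses keep limits supported
    in V when the sequence is. *)
Lemma riesz_fischer : exists (u : T -> R) (D : T -> 'rV[R]_m), [/\ mfunT u,
 mvec D,
 forall x, (forall n, u_ n x = 0) -> u x = 0,
 forall x, (forall n, D_ n x = 0) -> D x = 0 &
 forall e : R, 0 < e -> exists K, forall n, (K <= n)%N ->
  Lint mu (fun x => N x (u_ n x - u x) (D_ n x - D x)) /\
  Ig mu (fun x => N x (u_ n x - u x) (D_ n x - D x)) <= e].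
(* The rate 8^-k leaves room for the weights 4^k: the weighted increments still have summable
   integrals 2^-k. So a.e. the gauge of the increments decays like 4^-k, and the increments of u and
   D, controlled by its square root, are summable. *)
have /choice[M hM] : forall k, exists K, forall n k', (K <= n)%N -> (K <= k')%N ->
  Ig mu (fun x => N x (u_ n x - u_ k' x) (D_ n x - D_ k' x)) <= 8^-1 ^+ k.
 side.
pose s k := (k + \sum_(j < k.+1) M j)%N.
have sM k : (M k <= s k)%N by rewrite /s big_ord_recr /= addnA leq_addl.
have sk k : (k <= s k)%N by rewrite leq_addr.
have sS k : (M k <= s k.+1)%N.
 by apply: (leq_trans (sM k)); rewrite /s [X in (_ <= _ + X)%N]big_ord_recr /= leq_add// leq_addr.
pose dN k x := N x (u_ (s k.+1) x - u_ (s k) x) (D_ (s k.+1) x - D_ (s k) x).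
pose G K x := \sum_(k < K) 4 ^+ k * dN k x.
have iG K : Lint mu (G K) by apply: Lint_sum => k; apply: LintZ; exact: iN.
have p0 k x : 0 <= 4 ^+ k * dN k x by apply: mulr_ge0; [side|exact: N_ge0].
have G0 K x : 0 <= G K x by apply: sumr_ge0.
have IG K : Ig mu (G K) <= 2.
 rewrite Ig_sum; last by move=> k; apply: LintZ; exact: iN.
 apply: (@le_trans _ _ (\sum_(k < K) 2^-1 ^+ k)).
  apply: ler_sum => k _; rewrite IgZ; last exact: iN.
  rewrite (_ : 2^-1 = 4 * 8^-1 :> R); last by field.
  by rewrite exprMn ler_wpM2l//; apply: hM.
 have : \sum_(k < K) 2^-1 ^+ k = 2 - 2 * 2^-1 ^+ K :> R.
  elim: K => [|K ih]; first by rewrite big_ord0 expr0 mulr1 subrr.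
  by rewrite big_ord_recr /= ih exprS; field.
 by move=> ->; rewrite gerBl.
have ndG x : nondecreasing_seq (fun K => (G K x)%:E).
 by apply/nondecreasing_seqP => K; rewrite lee_fin /G big_ord_recr /= lerDl.
have bnd : {ae mu, forall x, exists B, forall k, dN k x <= B * (2^-1 ^+ 2) ^+ k}.
 have il : mu.-integrable setT (fun x => limn (fun K => (G K x)%:E)).
  have ml : mfunT (fun x => limn (fun K => (G K x)%:E)).
   apply: (@emeasurable_fun_cvg _ _ _ _ (fun K x => (G K x)%:E)).
    by move=> K; exact: (measurable_int _ (iG K)).
   by move=> x _; exact: ereal_nondecreasing_is_cvgn.
  apply/integrableP; split=> //.
  under eq_integral => x _.
   rewrite gee0_abs; last by apply: lime_ge; [exact: ereal_nondecreasing_is_cvgn|apply: nearW => K; rewrite lee_fin].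
   over.
  rewrite monotone_convergence//.
  - apply: (@le_lt_trans _ _ 2%:E); last exact: ltry.
   apply: lime_le; last by apply: nearW => K; rewrite Ig_EFin// lee_fin.
   apply: ereal_nondecreasing_is_cvgn; apply/nondecreasing_seqP => K.
   by rewrite !Ig_EFin// lee_fin; apply: Ig_le => // x; rewrite -lee_fin; apply/ndG.
  - by move=> K; exact: (measurable_int _ (iG K)).
  - by move=> K x _; rewrite lee_fin.
 apply: filterS (integrable_ae measurableT il) => x /(_ I) fx.
 exists (fine (limn (fun K => (G K x)%:E))) => k.
 have hk : ((G k.+1 x)%:E <= limn (fun K => (G K x)%:E))%E.
  by apply: lime_ge; [exact: ereal_nondecreasing_is_cvgn|exists k.+1 => // n /= kn; exact: ndG].
 rewrite (_ : 2^-1 ^+ 2 = 4^-1 :> R); last by field.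
 rewrite exprVn ler_pdivlMr// -lee_fin fineK//; apply: le_trans hk.
 by rewrite lee_fin /G big_ord_recr /= mulrC lerDr; apply: G0.
(* A limsup instead of a chosen limit: it is measurable, defined at every point, and 0 wherever all
   terms are 0. *)
pose u x := fine (limn_esup (fun k => (u_ (s k) x)%:E)).
pose D x := \row_i fine (limn_esup (fun k => (D_ (s k) x ord0 i)%:E)).
have mlim (f : nat -> T -> R) : (forall k, mfunT (f k)) ->
  mfunT (fun x => fine (limn_esup (fun k => (f k x)%:E))).
 move=> mf; apply: measurableT_comp => //.
 by apply: measurable_fun_limn_esup => k; exact/measurable_EFinP.
have limE (a : nat -> R) : cvgn a -> a @ \oo --> fine (limn_esup (fun k => (a k)%:E)).
 move=> /cvg_ex[l /= al].
 have : (fun k => (a k)%:E) @ \oo --> l%:E by apply: cvg_EFin => //; exact: nearW.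
 by move=> /cvg_limn_einf_sup[_ ->].
have lim0 (a : nat -> R) : (forall k, a k = 0) -> fine (limn_esup (fun k => (a k)%:E)) = 0.
 move=> a0; have c0 : a @ \oo --> (0 : R) by rewrite (_ : a = fun=> 0); [exact: cvg_cst|apply/funext].
 have /limE h : cvgn a by apply/cvg_ex; exists 0.
 exact: (cvg_unique _ h c0).
have mu' : mfunT u by apply: mlim => k.
have mD' i : mfunT (fun x => D x ord0 i).
 by under eq_fun do rewrite mxE; apply: (mlim (fun k x => D_ (s k) x ord0 i)) => k.
exists u, D; split=> //.
- by move=> x h; apply: lim0 => k.
- by move=> x h; apply/rowP => i; rewrite !mxE; apply: (lim0 (fun k => D_ (s k) x ord0 i)) => k; rewrite h mxE.
have conv : {ae mu, forall x, (fun k => u_ (s k) x) @ \oo --> u x /\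
  forall i, (fun k => D_ (s k) x ord0 i) @ \oo --> D x ord0 i}.
 apply: filterS bnd => x [B hB].
 have B0 : 0 <= B by have := hB 0%N; rewrite expr0 mulr1; apply: le_trans; exact: N_ge0.
 have [C hC] := N_low x B.
 have hdN k : dN k x <= B.
  apply: (le_trans (hB k)); rewrite ler_piMr// exprn_ile1////.
  by rewrite exprn_ile1// invf_le1// ler1n.
 have cb k t : t ^+ 2 <= C * dN k x -> t ^+ 2 <= `|C| * B * (2^-1 ^+ 2) ^+ k.
  move=> /le_trans; apply; rewrite (@le_trans _ _ (`|C| * dN k x))//.
   by apply: ler_wpM2r; [exact: N_ge0|exact: ler_norm].
  by rewrite -mulrA ler_wpM2l.
 split.
  apply: limE; apply: (@geo_cvg _ (`|C| * B)) => k.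
  by apply: cb; have [] := hC _ _ (hdN k).
 move=> i; rewrite mxE; apply: limE; apply: (@geo_cvg _ (`|C| * B)) => k.
 by apply: cb; have [_ /(_ i)] := hC _ _ (hdN k); rewrite !mxE.
move=> e e0; have [K hK] := cauchyN e0; exists K => n Kn.
(* Fatou runs along s (k + K), so that both indices are at least K and the Cauchy bound holds for
   every term. *)
apply: (@Ig_fatou _ _ _ mu (fun k x => N x (u_ n x - u_ (s (k + K)%N) x) (D_ n x - D_ (s (k + K)%N) x))) => //.
- apply: N_meas; first exact: measurable_funB.
 move=> i; rewrite (_ : (fun x => _) = fun x => D_ n x ord0 i - D x ord0 i); first exact: measurable_funB.
 by ext x; rewrite [LHS]mxE [X in _ + X]mxE.
- apply: filterS conv => x [cu cD]; apply: N_cont.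
  apply: cvgB; first exact: cvg_cst.
  by rewrite (cvg_shiftn K (fun k => u_ (s k) x)).
 move=> i; have -> : (D_ n x - D x) ord0 i = D_ n x ord0 i - D x ord0 i by rewrite [LHS]mxE [X in _ + X]mxE.
 under eq_fun do rewrite !mxE.
 apply: cvgB; first exact: cvg_cst.
 by rewrite (cvg_shiftn K (fun k => D_ (s k) x ord0 i)).
- by move=> k; apply: hK => //; rewrite (leq_trans _ (sk _))// leq_addl.
Qed.

End riesz_fischer.

Section L1complete.
Context d (T : measurableType d) (R : realType).
Variable mu : {measure set T -> \bar R}.

(** This is [riesz_fischer] for the gauge |s|, with a gradient of dimension 0. *)
Lemma L1_complete (u_ : nat -> T -> R) : (forall n, Lint mu (u_ n)) ->
 (forall e : R, 0 < e -> exists K, forall n k, (K <= n)%N -> (K <= k)%N ->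
  Ig mu (fun x => `|u_ n x - u_ k x|) <= e) ->
 exists2 u, Lint mu u & to0 (fun n => Ig mu (fun x => `|u_ n x - u x|)) /\
  forall x, (forall n, u_ n x = 0) -> u x = 0.
move=> iu hc.
have h1 (u : T -> R) (D : T -> 'rV[R]_0) : mfunT u ->
  mvec D -> mfunT (fun x => `|u x|).
 by move=> h _; exact: measurableT_comp.
have h2 (x : T) (s_ : nat -> R) (xi_ : nat -> 'rV[R]_0) (s : R) (xi : 'rV[R]_0) : s_ @ \oo --> s ->
  (forall i, (fun n => xi_ n ord0 i) @ \oo --> xi ord0 i) -> (fun n => `|s_ n|) @ \oo --> `|s|.
 by move=> hs _; exact: cvg_norm.
have h3 (x : T) (B : R) : exists C, forall (s : R) (xi : 'rV[R]_0), `|s| <= B ->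
  s ^+ 2 <= C * `|s| /\ forall i, xi ord0 i ^+ 2 <= C * `|s|.
 exists B => s xi sB; split; last by case.
 by rewrite -(@real_normK _ s) ?num_real// expr2 ler_wpM2r.
have h4 n k : Lint mu (fun x => `|u_ n x - u_ k x|) by apply: Lint_abs; side.
have [u [D [mu' _ u0 _ hu]]] := @riesz_fischer _ T R 0 mu (fun _ s _ => `|s|) (fun _ _ _ => normr_ge0 _)
 h1 h2 h3 u_ (fun _ _ => 0) (fun n => Lint_meas (iu n)) (fun _ i => match i with Ordinal _ h => ltac:(by []) end) h4 hc.
exists u; last by split=> // e /hu[K hK]; exists K => n /hK[].
have [K /(_ _ (leqnn K))[h _]] := hu 1 ltr01.
rewrite (_ : u = fun x => u_ K x - (u_ K x - u x)); last by ext x; ring.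
apply: LintB => //; apply: (Lint_dom _ _ h) => //.
by apply: measurable_funB => //; exact: Lint_meas.
Qed.

End L1complete.

(** * Density of test functions and the fundamental lemma *)

Section test_density.
Variables (R : realType) (d : nat).
Local Notation E := 'rV[R]_d.
Variable mu : {measure set E -> \bar R}.
Local Notation Lint := (Lint mu).

Import HBSimple.

Lemma abs_sub_bool (t : R) (b : bool) : 0 <= t <= 1 -> `|t - b%:R| <= 1.
by move=> /andP[t0 t1]; rewrite ler_norml; case: b => /=; apply/andP; split; lra. Qed.

Definition smooth01 (eta : E -> R) := smooth eta /\ forall x, 0 <= eta x <= 1.

(* The sets approximable by smooth functions form a sigma-algebra containing the open sets. *)
Lemma smooth_indic (h : E -> R) : Lint h -> (forall x, 0 <= h x) ->
 forall S, measurable S -> forall e : R, 0 < e ->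
 exists eta, smooth01 eta /\ Ig mu (fun x => h x * `|eta x - \1_S x|) <= e.
move=> ih h0 S mS.
pose P (S : set E) := measurable S /\ forall e : R, 0 < e ->
 exists eta, smooth01 eta /\ Ig mu (fun x => h x * `|eta x - \1_S x|) <= e.
have mh := Lint_meas ih.
have ib (g : E -> R) (M : R) : mfunT g -> (forall x, `|g x| <= M) -> Lint (fun x => h x * g x).
 move=> mg gM; apply: (Lint_dom _ _ (LintZ M ih)); first exact: measurable_funM.
 by move=> x; rewrite normrM (ger0_norm (h0 x)) mulrC ler_wpM2r.
have ms eta : smooth01 eta -> mfunT eta.
 by move=> [se _]; apply: continuous_meas_rV; exact: smooth_cont.
have i1 (eta : E -> R) S' : smooth01 eta -> measurable S' -> Lint (fun x => h x * `|eta x - \1_S' x|).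
 move=> se mS'; apply: (ib _ 1).
  by apply: measurableT_comp => //; apply: measurable_funB; [exact: ms|exact: measurable_indic].
 by move=> x; rewrite normr_id; have [_ /(_ x)] := se; exact: abs_sub_bool.
have PO U : open U -> P U.
 move=> oU; split; first exact: open_rV_measurable.
 move=> e e0; have [|||_] := @Ig_DCT _ _ _ mu (fun n x => h x * `|open_approx U n x - \1_U x|) (fun=> 0) h _ ih.
 - move=> n; apply: measurable_funM => //; apply: measurableT_comp => //; apply: measurable_funB.
   by apply: continuous_meas_rV; exact: smooth_cont (test_smooth (open_approx_test U n)).
  exact: measurable_indic (open_rV_measurable oU).
 - move=> n x; rewrite normrM normr_id (ger0_norm (h0 x)) ler_piMr//.
  exact: abs_sub_bool (open_approx01 U n x).
 - move=> x; rewrite -[X in _ --> X](mulr0 (h x)); apply: cvgM; first exact: cvg_cst.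
  have : (fun n => open_approx U n x - \1_U x) @ \oo --> (\1_U x : R) - \1_U x.
   by apply: cvgB; [exact: open_approx_cvg|exact: cvg_cst].
  by rewrite subrr => /cvg_norm; rewrite normr0.
 rewrite Ig_cst0 => /cvg_to0/(_ _ e0)[n /(_ _ (leqnn n)) hn].
 exists (open_approx U n); split=> //; split; first exact: test_smooth (open_approx_test U n).
 exact: open_approx01.
have P0 : P set0.
 split=> // e e0; exists (fun=> 0); split; first by split; [exact: smooth_cst|move=> x; rewrite lexx ler01].
 by under [X in Ig _ X]eq_fun do rewrite indic0 subrr normr0 mulr0; rewrite Ig_cst0 ltW.
have PC A : P A -> P (~` A).
 move=> [mA hA]; split; first exact: measurableC.
 move=> e /hA[eta [[se e01] he]]; exists (fun x => 1 - eta x); split.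
  split; first by apply: smoothB => //; exact: smooth_cst.
  by move=> x; have := e01 x; lra.
 rewrite (_ : (fun x => _) = fun x => h x * `|eta x - \1_A x|)//; ext x.
 by rewrite -(normrN (_ - \1_A x)) !indicE in_setC; congr (_ * `|_|); case: (x \in A) => /=; ring.
have PI A B : P A -> P B -> P (A `&` B).
 move=> [mA hA] [mB hB]; split; first exact: measurableI.
 move=> e e0; have e2 : 0 < e / 2 by rewrite divr_gt0.
 have [ea [sa ha]] := hA _ e2; have [eb [sb hb]] := hB _ e2.
 have sab : smooth01 (fun x => ea x * eb x).
  split; first by apply: smoothM; [case: sa|case: sb].
  move=> x; have [_ /(_ x)/andP[a1 a2]] := sa; have [_ /(_ x)/andP[b1 b2]] := sb.
  by rewrite mulr_ge0//= mulr_ile1.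
 exists (fun x => ea x * eb x); split=> //.
 apply: (@le_trans _ _ (Ig mu (fun x => h x * `|ea x - \1_A x| + h x * `|eb x - \1_B x|))).
  apply: Ig_le; [exact: i1 (measurableI _ _ mA mB)|by apply: LintD; exact: i1|].
  move=> x; rewrite -mulrDr ler_wpM2l//.
  have [_ /(_ x)/andP[a1 a2]] := sa; have [_ /(_ x)/andP[b1 b2]] := sb.
  rewrite !indicE in_setI; case: (x \in A); case: (x \in B) => /=; rewrite ?subr0.
  - rewrite (_ : ea x * eb x - 1 = (ea x - 1) * eb x + (eb x - 1)); last by ring.
   rewrite (le_trans (ler_normD _ _))// lerD2r normrM ler_piMr// ger0_norm//.
  - rewrite [`|_ * _|]ger0_norm ?mulr_ge0// [`|eb x|]ger0_norm//; have := normr_ge0 (ea x - 1); nra.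
  - rewrite [`|_ * _|]ger0_norm ?mulr_ge0// [`|ea x|]ger0_norm//; have := normr_ge0 (eb x - 1); nra.
  - by rewrite !ger0_norm ?mulr_ge0//; nra.
 by rewrite IgD; [rewrite [e]splitr lerD|exact: i1|exact: i1].
have PU A B : P A -> P B -> P (A `|` B).
 by move=> /PC a /PC b; rewrite -[A `|` B]setCK setCU; apply: PC; exact: PI.
have Pbig (F : (set E)^nat) : (forall n, P (F n)) -> P (\bigcup_n F n).
 move=> PF; pose U n := \bigcup_(k < n) F k.
 have PUn n : P (U n).
  elim: n => [|n ih1]; first by rewrite /U bigcup_mkord big_ord0.
  by rewrite /U bigcup_mkord big_ord_recr /= -bigcup_mkord; exact: PU.
 have mU : measurable (\bigcup_n F n) by apply: bigcup_measurable => k _; case: (PF k).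
 split=> // e e0; have e2 : 0 < e / 2 by rewrite divr_gt0.
 have mUn n : measurable (U n) by case: (PUn n).
 have [|||_] := @Ig_DCT _ _ _ mu (fun n x => h x * `|\1_(U n) x - \1_(\bigcup_n F n) x|) (fun=> 0) h _ ih.
 - move=> n; apply: measurable_funM => //; apply: measurableT_comp => //; apply: measurable_funB; exact: measurable_indic.
 - move=> n x; rewrite normrM normr_id (ger0_norm (h0 x)) ler_piMr//.
  by apply: abs_sub_bool; rewrite indicE; case: (_ \in _); rewrite ?lexx ler01.
 - move=> x; rewrite -[X in _ --> X](mulr0 (h x)); apply: cvgM; first exact: cvg_cst.
  apply: cvg_near_cst; have [[k _ Fk]|nF] := pselect ((\bigcup_n F n) x).
   exists k.+1 => // n /= kn; rewrite !indicE !mem_set ?subrr ?normr0//; first by exists k.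
   by exists k.
  apply: nearW => n; rewrite !indicE !memNset ?subrr ?normr0// => -[k kn Fk].
  by apply: nF; exists k.
 rewrite Ig_cst0 => /cvg_to0/(_ _ e2)[n /(_ _ (leqnn n)) hn].
 have [_ /(_ _ e2)[eta [se he]]] := PUn n; exists eta; split=> //.
 have i2 : Lint (fun x => h x * `|\1_(U n) x - \1_(\bigcup_n F n) x|).
  apply: (ib _ 1); first by apply: measurableT_comp => //; apply: measurable_funB; exact: measurable_indic.
  by move=> x; rewrite normr_id; apply: abs_sub_bool; rewrite indicE; case: (_ \in _); rewrite ?lexx ler01.
 apply: (@le_trans _ _ (Ig mu (fun x => h x * `|eta x - \1_(U n) x| + h x * `|\1_(U n) x - \1_(\bigcup_n F n) x|))).
  apply: Ig_le; [exact: i1|by apply: LintD => //; exact: i1|].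
  move=> x; rewrite -mulrDr ler_wpM2l// -[eta x - \1_(\bigcup_n F n) x](subrKA (\1_(U n) x)).
  exact: ler_normD.
 by rewrite IgD//; [rewrite [e]splitr lerD|exact: i1].
suff : (@measurable _ E) `<=` P by move=> /(_ S mS)[].
apply: smallest_sub; last by move=> U; exact: PO.
by split=> //; move=> A PA; rewrite setTD; exact: PC.
Qed.

Lemma smooth_simple (h : E -> R) (A : R -> set E) (s : seq R) (e : R) : Lint h ->
 (forall x, 0 <= h x) -> (forall y, measurable (A y)) -> 0 < e -> exists eta, smooth eta /\
 let F x := h x * `|\sum_(y <- s) y * \1_(A y) x - eta x| in Lint F /\ Ig mu F <= e.
move=> ih h0 mA; have mh := Lint_meas ih.
have i1 S eta : smooth01 eta -> measurable S -> Lint (fun x => h x * `|eta x - \1_S x|).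
 move=> [se e01] mS; apply: (Lint_dom _ _ ih).
  apply: measurable_funM => //; apply: measurableT_comp => //.
  by apply: measurable_funB; [apply: continuous_meas_rV; exact: smooth_cont|exact: measurable_indic].
 by move=> x; rewrite normrM normr_id (ger0_norm (h0 x)) ler_piMr//; apply: abs_sub_bool.
elim: s e => [|y s ihs] e e0.
 exists (fun=> 0); split; first exact: smooth_cst.
 rewrite /= (_ : (fun x => _) = fun=> 0).
  by split; [exact: Lint0|rewrite Ig_cst0 ltW].
 by ext x; rewrite big_nil subrr normr0 mulr0.
have e2 : 0 < e / 2 by rewrite divr_gt0.
have [eta [seta [i2 I2]]] := ihs _ e2.
have e3 : 0 < e / 2 / (`|y| + 1) by rewrite divr_gt0// ltr_wpDl.
have [th [sth I3]] := smooth_indic ih h0 (mA y) e3.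
have i3 := i1 _ _ sth (mA y).
exists (fun x => y * th x + eta x); split.
 by apply: smoothD => //; apply: smoothZ; case: sth.
pose G x := `|y| * (h x * `|th x - \1_(A y) x|) + h x * `|\sum_(y <- s) y * \1_(A y) x - eta x|.
have iG : Lint G by apply: LintD => //; exact: LintZ.
have FG x : `|h x * `|\sum_(y <- (y :: s)) y * \1_(A y) x - (y * th x + eta x)| | <= G x.
 rewrite normrM normr_id (ger0_norm (h0 x)) /G mulrCA -mulrDr ler_wpM2l// big_cons.
 rewrite -normrM; set a := \sum_(y <- s) _.
 rewrite (_ : y * _ + a - _ = - (y * (th x - \1_(A y) x)) + (a - eta x)); last by ring.
 by rewrite (le_trans (ler_normD _ _))// normrN.
have iF : Lint (fun x => h x * `|\sum_(y <- (y :: s)) y * \1_(A y) x - (y * th x + eta x)|).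
 apply: (Lint_dom _ FG iG); apply: measurable_funM => //; apply: measurableT_comp => //.
 apply: measurable_funB.
  by apply: measurable_sum => i; apply: measurable_funM => //; exact: measurable_indic.
 apply: continuous_meas_rV; apply: smooth_cont; apply: smoothD => //; apply: smoothZ; by case: sth.
split=> //; apply: (@le_trans _ _ (Ig mu G)).
 by apply: Ig_le => // x; apply: le_trans (FG x); exact: ler_norm.
rewrite IgD ?IgZ//; last exact: LintZ.
rewrite [e]splitr lerD// (@le_trans _ _ (`|y| * (e / 2 / (`|y| + 1))))// ?ler_wpM2l//.
by rewrite mulrCA ger_pMr// ler_pdivrMr ?mul1r; [lra|rewrite ltr_wpDl].
Qed.

Hypothesis mu_fin : forall K, compact K -> (mu K < +oo)%E.

Lemma Lint_csupp (f : E -> R) (K : set E) : compact K -> continuous f -> (forall x, ~ K x -> f x = 0) -> Lint f.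
move=> cK cf f0; have [M M0 hM] := compact_supp_bounded cf cK f0.
apply: (@Lint_bounded_supp _ _ _ mu K _ M) => //; [exact: compact_meas_rV|exact: mu_fin|exact: continuous_meas_rV].
Qed.

Lemma test_meas (V : set E) (u : E -> R) : test V u -> mfunT u.
by move=> tu; apply: continuous_meas_rV; exact: smooth_cont (test_smooth tu). Qed.

Lemma Lint_test (V : set E) (u : E -> R) : test V u -> Lint u.
by move=> [su [K [cK _ u0]]]; apply: (Lint_csupp cK _ u0); exact: smooth_cont. Qed.

Lemma LL2_test (V : set E) (u : E -> R) : test V u -> LL2 mu u.
move=> tu; split; first exact: test_meas tu.
by apply: (@Lint_test V); under eq_fun do rewrite expr2; apply: testMl => //; exact: test_smooth tu.
Qed.

(** Three errors of e / 3: damping f by a smooth minorant xi of the indicator of V, replacing f by a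
    simple function, and smoothing the latter in the weighted measure xi mu. The factor xi in the
    result puts its support inside V. *)
Lemma test_L1dense (V : set E) (f : E -> R) (e : R) : open V -> Lint f -> (forall x, ~ V x -> f x = 0) ->
 0 < e -> exists2 eta, test V eta & Ig mu (fun x => `|f x - eta x|) <= e.
move=> oV fi f0 e0; have e3 : 0 < e / 3 by rewrite divr_gt0.
have mf := Lint_meas fi.
have [n hn] : exists n, Ig mu (fun x => `|f x| * `|open_approx V n x - \1_V x|) <= e / 3.
 have [|||_] := @Ig_DCT _ _ _ mu (fun n x => `|f x| * `|open_approx V n x - \1_V x|) (fun=> 0) (fun x => `|f x|) _ (Lint_abs fi).
 - move=> n; apply: measurable_funM; apply: measurableT_comp => //; apply: measurable_funB.
   exact: test_meas (open_approx_test V n).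
  exact: measurable_indic (open_rV_measurable oV).
 - move=> n x; rewrite normrM !normr_id ler_piMr//.
  exact: abs_sub_bool (open_approx01 V n x).
 - move=> x; rewrite -[X in _ --> X](mulr0 `|f x|); apply: cvgM; first exact: cvg_cst.
  have : (fun n => open_approx V n x - \1_V x) @ \oo --> (\1_V x : R) - \1_V x.
   by apply: cvgB; [exact: open_approx_cvg|exact: cvg_cst].
  by rewrite subrr => /cvg_norm; rewrite normr0.
 by rewrite Ig_cst0 => /cvg_to0/(_ _ e3)[n /(_ _ (leqnn n)) hn]; exists n.
set xi := open_approx V n in hn; have txi : test V xi := open_approx_test V n.
have xi01 x : 0 <= xi x <= 1 := open_approx01 V n x.
have mxi := test_meas txi; have ixi := Lint_test txi.
have [g_ [ig_ _ gl1]] := approximation_sfun_integrable measurableT fi.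
have [g [ig hg]] : exists g : {sfun E >-> R}, Lint g /\ Ig mu (fun x => `|f x - g x|) <= e / 3.
 have /EFin_to0 gl2 : (fun n => (Ig mu (fun x => `|f x - g_ n x|))%:E) @ \oo --> 0%E.
  rewrite (_ : (fun n => _) = fun n => (\int[mu]_z `|(EFin \o f) z - (g_ n z)%:E|)%E)//.
  by ext k; rewrite -Ig_EFin//; apply: Lint_abs; apply: LintB => //; exact: ig_.
 have [N /(_ _ (leqnn N)) hN] := gl2 (fun n => Ig_ge0 _ (fun x => normr_ge0 _)) _ e3.
 by exists (g_ N); split; first exact: ig_.
(* the simple function is replaced, level set by level set, by a smooth function *)
have [eta [seta heta]] : exists eta, smooth eta /\ Lint (fun x => xi x * `|g x - eta x|) /\
  Ig mu (fun x => xi x * `|g x - eta x|) <= e / 3.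
 have gE x : g x = \sum_(y <- finmap.enum_fset (fset_set (range g))) y * \1_(g @^-1` [set y]) x.
  by rewrite [LHS]fimfunE fsbig_finite.
 have mA y : measurable (g @^-1` [set y]) by exact: measurable_funPTI.
 have [eta [se h]] := smooth_simple (finmap.enum_fset (fset_set (range g))) ixi (fun x => proj1 (andP (xi01 x))) mA e3.
 exists eta; split=> //; move: h; rewrite /= (_ : (fun x => xi x * `|_ - eta x|) = fun x => xi x * `|g x - eta x|)//.
 by ext x; rewrite gE.
exists (fun x => eta x * xi x).
 by under eq_fun do rewrite mulrC; exact: testMl.
case: heta => ihe heta.
have iA : Lint (fun x => `|f x| * `|xi x - \1_V x|).
 apply: (Lint_dom _ _ (Lint_abs fi)).
  apply: measurable_funM; apply: measurableT_comp => //; apply: measurable_funB => //.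
  exact: measurable_indic (open_rV_measurable oV).
 move=> x; rewrite normrM !normr_id ler_piMr//.
 exact: abs_sub_bool (xi01 x).
have iB : Lint (fun x => `|f x - g x|) by apply: Lint_abs; exact: LintB.
have ie : Lint (fun x => eta x * xi x).
 by apply: (@Lint_test V); under eq_fun do rewrite mulrC; exact: testMl.
apply: (@le_trans _ _ (Ig mu (fun x => `|f x| * `|xi x - \1_V x| + (`|f x - g x| + xi x * `|g x - eta x|)))).
 apply: Ig_le; [by apply: Lint_abs; exact: LintB|by repeat apply: LintD|].
 move=> x; have /andP[x0 x1] := xi01 x.
 rewrite (_ : f x - eta x * xi x = f x * (\1_V x - xi x) + (xi x * (f x - g x) + xi x * (g x - eta x))); last first.
  rewrite indicE; have [Vx|nV] := pselect (V x); first by rewrite mem_set//=; ring.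
  by rewrite memNset// f0//=; ring.
 rewrite (le_trans (ler_normD _ _))// lerD//; first by rewrite normrM (distrC (\1_V x)).
 rewrite (le_trans (ler_normD _ _))// !normrM (ger0_norm x0) lerD2r ler_piMl//.
rewrite !IgD//; last exact: LintD.
by rewrite (_ : e = e / 3 + (e / 3 + e / 3)) ?lerD//; by field.
Qed.

(** Smooth functions approximate indicators in L^1(|F xi| mu), so F xi integrates to 0 over every
    measurable set and vanishes a.e., for each test function xi. Letting xi run through the
    countably many rational bumps inside V leaves a single null set. *)
Lemma fundamental_lemma (V : set E) (F : E -> R) : open V -> mfunT F ->
 (forall u, test V u -> Lint (fun x => F x * u x) /\ Ig mu (fun x => F x * u x) = 0) ->
 {ae mu, forall x, V x -> F x = 0}.
move=> oV mF hF.
have key xi : test V xi -> {ae mu, forall x, F x * xi x = 0}.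
 move=> txi; have [iF _] := hF _ txi; have ia := Lint_abs iF.
 have : ae_eq mu setT (EFin \o (fun x => F x * xi x)) (cst 0%E).
  apply: integral_ae_eq => //.
  move=> S _ mS; rewrite integral0.
  have i1 : Lint (fun x => F x * xi x * \1_S x).
   apply: (Lint_dom _ _ ia); first by apply: measurable_funM; [exact: (Lint_meas iF)|exact: measurable_indic].
   by move=> x; rewrite normrM ler_piMr// indicE; case: (_ \in _); rewrite ?normr1 ?normr0.
  rewrite integral_mkcond (_ : (\int[mu]_x _)%E = (Ig mu (fun x => F x * xi x * \1_S x))%:E); last first.
   rewrite -Ig_EFin//; apply: eq_integral => x _; rewrite patchE indicE.
   by case: (_ \in _); rewrite ?mulr1 ?mulr0.
  congr EFin; apply/eqP; rewrite -normr_le0; apply/ler_addgt0Pr => e e0; rewrite add0r.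
  have [eta [[se e01] he]] := smooth_indic ia (fun x => normr_ge0 _) mS e0.
  have [i2 I2] := hF _ (testMl txi se).
  rewrite -[X in `|X|]subr0 -I2 -IgB//.
  apply: (le_trans _ he); apply: (@le_trans _ _ (Ig mu (fun x => `|F x * xi x * \1_S x - F x * (xi x * eta x)|))).
   by apply: Ig_abs; exact: LintB.
  apply: eq_ler; congr Ig; ext x.
  by rewrite mulrA -mulrBr normrM distrC.
 by apply: filterS => x /= /(_ I)[].
have : {ae mu, forall x k, if unpickle k is Some p then
 cbox (@rbox_c R d p) (@rbox_r R d p) `<=` V -> F x * @rbump R d p x = 0 :> R else True}.
 apply: ae_foralln => k; case: unpickle => [p|]; last exact: aeW.
 have [cV|nc] := pselect (cbox (@rbox_c R d p) (@rbox_r R d p) `<=` V); last by apply: aeW => x /nc.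
 by apply: filterS (key _ (test_bump cV)) => x.
apply: filterS => x hx Vx; have [p [ox cV]] := rbox_exists oV Vx.
have := hx (pickle p); rewrite pickleK => /(_ cV)/eqP; rewrite mulf_eq0 => /orP[/eqP//|].
by rewrite gt_eqF// bump_gt0.
Qed.

End test_density.

Section L2lim.
Context d (T : measurableType d) (R : realType).
Variable mu : {measure set T -> \bar R}.

Lemma LL2_bounded (M : R) (g f : T -> R) : mfunT g -> (forall x, `|g x| <= M) ->
 LL2 mu f -> LL2 mu (fun x => g x * f x).
move=> mg gM [mf fi]; split; first exact: measurable_funM.
apply: (Lint_dom _ _ (LintZ (M ^+ 2) fi)); first by apply: measurable_funX; exact: measurable_funM.
move=> x; rewrite ger0_norm ?sqr_ge0// exprMn ler_wpM2r ?sqr_ge0//.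
by rewrite -(real_normK (num_real (g x))) lerXn2r// nnegrE (le_trans _ (gM x)).
Qed.

Lemma L2_lim_mul (f_ : nat -> T -> R) f g : (forall n, LL2 mu (f_ n)) -> LL2 mu f -> LL2 mu g ->
 to0 (fun n => Ig mu (fun x => (f_ n x - f x) ^+ 2)) ->
 to0 (fun n => `|Ig mu (fun x => f_ n x * g x) - Ig mu (fun x => f x * g x)|).
move=> Lf_ Lf Lg h; apply: (@to0_sqr _ _ (fun n => Ig mu (fun x => g x ^+ 2) * Ig mu (fun x => (f_ n x - f x) ^+ 2))).
 move=> n; rewrite real_normK ?num_real// -IgB; [|side|side].
 rewrite (_ : (fun x => _) = fun x => (f_ n x - f x) * g x); last by ext x; ring.
 by rewrite mulrC; apply: Ig_CS => //; side.
by apply: to0Z => //; apply: Ig_ge0 => x; exact: sqr_ge0.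
Qed.

End L2lim.

(** * Square integrable vector fields and the H^{1,2} norm *)

Section vectors.
Variables (R : realType) (d : nat).
Local Notation E := 'rV[R]_d.
Variable mu : {measure set E -> \bar R}.
Implicit Types (u v : E -> R) (D F : E -> E).

Definition LLv D := forall i, LL2 mu (fun x => D x ord0 i).

Lemma dotvv_ge0 (x : E) : 0 <= dotv x x.
by apply: sumr_ge0 => i _; rewrite -expr2 sqr_ge0. Qed.

Lemma dotvC (x y : E) : dotv x y = dotv y x.
by apply: eq_bigr => i _; rewrite mulrC. Qed.

Lemma dotvDl (x y z : E) : dotv (x + y) z = dotv x z + dotv y z.
by rewrite /dotv -big_split /=; apply: eq_bigr => i _; rewrite mxE mulrDl. Qed.

Lemma dotvZl (a : R) (x z : E) : dotv (a *: x) z = a * dotv x z.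
by rewrite /dotv mulr_sumr; apply: eq_bigr => i _; rewrite mxE mulrA. Qed.

Lemma dotv0l (z : E) : dotv 0 z = 0.
by rewrite /dotv big1// => i _; rewrite mxE mul0r. Qed.

Lemma coord_le_dotv (x : E) i : x ord0 i ^+ 2 <= dotv x x.
rewrite /dotv (bigD1 i) //= -expr2 lerDl sumr_ge0// => j _; by rewrite -expr2 sqr_ge0.
Qed.

Lemma dotv_le2 (x y : E) : dotv (x + y) (x + y) <= 2 * dotv x x + 2 * dotv y y.
rewrite /dotv !mulr_sumr -big_split /=; apply: ler_sum => i _; rewrite mxE.
by have := sqr_ge0 (x ord0 i - y ord0 i); nra.
Qed.

Lemma Lint_dotv D F : LLv D -> LLv F -> Lint mu (fun x => dotv (D x) (F x)).
by move=> LD LF; apply: Lint_sum => i; side. Qed.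

Lemma LLv_lin (a : R) D F : LLv D -> LLv F -> LLv (fun x => a *: D x + F x).
move=> LD LF i; under eq_fun do rewrite !mxE.
side.
Qed.

Lemma LLvB D F : LLv D -> LLv F -> LLv (fun x => D x - F x).
by move=> LD LF i; under eq_fun do rewrite !mxE; side. Qed.

Definition q0 u D := Ig mu (fun x => u x ^+ 2 + dotv (D x) (D x)).

Lemma Lint_q0 u D : LL2 mu u -> LLv D -> Lint mu (fun x => u x ^+ 2 + dotv (D x) (D x)).
by move=> [_ Lu] LD; apply: LintD => //; exact: Lint_dotv. Qed.

Lemma q0_ge0 u D : 0 <= q0 u D.
by apply: Ig_ge0 => x; rewrite addr_ge0 ?sqr_ge0 ?dotvv_ge0. Qed.

Lemma q0D u v D F : LL2 mu u -> LLv D -> LL2 mu v -> LLv F ->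
 q0 (fun x => u x + v x) (fun x => D x + F x) <= 2 * q0 u D + 2 * q0 v F.
move=> Lu LD Lv LF; have i1 := Lint_q0 Lu LD; have i2 := Lint_q0 Lv LF.
rewrite /q0 -!IgZ// -IgD; [|side|side].
apply: Ig_le; [|side|].
 apply: Lint_q0; first side.
 by move=> i; under eq_fun do rewrite mxE; side.
move=> x; have h := dotv_le2 (D x) (F x); have := sqr_ge0 (u x - v x); nra.
Qed.

Lemma q0_tri u v w D F G : LL2 mu u -> LLv D -> LL2 mu v -> LLv F -> LL2 mu w -> LLv G ->
 q0 (fun x => u x - w x) (fun x => D x - G x) <=
 2 * q0 (fun x => u x - v x) (fun x => D x - F x) + 2 * q0 (fun x => v x - w x) (fun x => F x - G x).
move=> Lu LD Lv LF Lw LG.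
rewrite (_ : (fun x => u x - w x) = fun x => (u x - v x) + (v x - w x)); last by ext x; ring.
rewrite (_ : (fun x => D x - G x) = fun x => (D x - F x) + (F x - G x)); last first.
 by ext x; rewrite addrA subrK.
by apply: q0D; [side|exact: LLvB|side|exact: LLvB].
Qed.

Lemma q0_fst u D : LL2 mu u -> LLv D -> Ig mu (fun x => u x ^+ 2) <= q0 u D.
move=> Lu LD; apply: Ig_le => [||x]; [by case: Lu|exact: Lint_q0|by rewrite lerDl dotvv_ge0].
Qed.

Lemma q0_snd u D : LL2 mu u -> LLv D -> Ig mu (fun x => dotv (D x) (D x)) <= q0 u D.
by move=> Lu LD; apply: Ig_le => [||x]; [exact: Lint_dotv|exact: Lint_q0|rewrite lerDr sqr_ge0].
Qed.

Lemma q0_coord u D i : LL2 mu u -> LLv D -> Ig mu (fun x => D x ord0 i ^+ 2) <= q0 u D.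
move=> Lu LD; apply: le_trans (q0_snd Lu LD).
by apply: Ig_le => [||x]; [by case: (LD i)|exact: Lint_dotv|exact: coord_le_dotv].
Qed.

End vectors.

(** * The spaces H^{1,2}_0 and their chain rule *)

Section sobolev.
Variables (R : realType) (d : nat).
Local Notation E := 'rV[R]_d.
Variable mu : {measure set E -> \bar R}.
Local Notation LL2 := (LL2 mu).
Hypothesis mu_fin : forall K, compact K -> (mu K < +oo)%E.
Implicit Types (u v : E -> R) (D F : E -> E) (V U : set E).
Local Notation Q0 := (q0 mu).
Local Notation LLv := (LLv mu).

(* H^{1,2}_0(V) with functions and gradients extended by 0 to the whole space. *)
Definition Sob V u D := [/\ LL2 u, LLv D, forall x, ~ V x -> u x = 0 /\ D x = 0 &
 exists v_ : nat -> E -> R, (forall n, test V (v_ n)) /\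
  to0 (fun n => Q0 (fun x => v_ n x - u x) (fun x => grad (v_ n) x - D x))].

Lemma LLv_grad V u : test V u -> LLv (grad u).
by move=> tu i; under eq_fun do rewrite mxE; exact: (LL2_test mu_fin (test_pderiv i tu)).
Qed.

Lemma gradB u v x : smooth u -> smooth v -> grad (fun y => u y - v y) x = grad u x - grad v x.
by move=> su sv; apply/rowP => i; rewrite !mxE /pderiv deriveB//; exact: smooth_derivable.
Qed.

Lemma grad_lin (a : R) u v x : smooth u -> smooth v ->
 grad (fun y => a * u y + v y) x = a *: grad u x + grad v x.
move=> su sv; apply/rowP => i; rewrite !mxE pderivD//; last exact: smoothZ.
by rewrite pderivZ.
Qed.

Lemma Sob_test V u : test V u -> Sob V u (grad u).
move=> tu; split; [exact: (LL2_test mu_fin tu)|exact: LLv_grad tu| |].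
 by move=> x nV; rewrite (test_off tu nV) (grad_off tu nV).
exists (fun=> u); split=> // e e0; exists 0%N => n _.
rewrite /q0; under [X in Ig _ X]eq_fun do rewrite !subrr expr0n /= dotv0l addr0.
by rewrite Ig_cst0 ltW.
Qed.

Lemma Sob_W V U u D : V `<=` U -> Sob V u D -> Sob U u D.
move=> VU [Lu LD u0 [v_ [tv hv]]]; split=> //; first side.
by exists v_; split=> // n; exact: testW (tv n).
Qed.

Lemma Sob_lin V (a : R) u v D F : Sob V u D -> Sob V v F ->
 Sob V (fun x => a * u x + v x) (fun x => a *: D x + F x).
move=> [Lu LD u0 [u_ [tu hu]]] [Lv LF v0 [v_ [tv hv]]]; split.
- side.
- exact: LLv_lin.
- by move=> x nV; have [-> ->] := u0 x nV; have [-> ->] := v0 x nV; rewrite mulr0 addr0 scaler0 addr0.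
exists (fun n x => a * u_ n x + v_ n x); split; first by move=> n; apply: testD => //; exact: testZ.
apply: (to0_le _ (to0D (to0Z (_ : 0 <= 2 * a ^+ 2) hu) (to0Z (_ : 0 <= 2) hv))) => //; last first.
 by rewrite mulr_ge0// sqr_ge0.
move=> n; have Lun := LL2_test mu_fin (tu n); have Lvn := LL2_test mu_fin (tv n).
have Gun := LLv_grad (tu n); have Gvn := LLv_grad (tv n).
rewrite (_ : (fun x => a * u_ n x + v_ n x - _) = fun x => a * (u_ n x - u x) + (v_ n x - v x)); last first.
 by ext x; ring.
rewrite (_ : (fun x => grad _ x - _) = fun x => a *: (grad (u_ n) x - D x) + (grad (v_ n) x - F x)); last first.
 ext x; rewrite grad_lin; [|exact: test_smooth (tu n)|exact: test_smooth (tv n)].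
 by rewrite scalerBr opprD addrACA.
have L1 := LL2B Lun Lu; have L2 := LL2B Lvn Lv; have G1 := LLvB Gun LD; have G2 := LLvB Gvn LF.
apply: (le_trans (q0D (LL2Z a L1) (F := fun x => grad (v_ n) x - F x) (D := fun x => a *: (grad (u_ n) x - D x)) _ L2 G2)).
 by move=> i; under eq_fun do rewrite mxE; side.
rewrite lerD2r /q0 -!IgZ//; [|exact: Lint_q0|].
 apply: Ig_le; [| |move=> x].
 - apply: LintZ; apply: Lint_q0; first side.
  by move=> i; under eq_fun do rewrite mxE; side.
 - by apply: LintZ; exact: Lint_q0.
 - by rewrite dotvZl dotvC dotvZl le_eqVlt; apply/orP; left; apply/eqP; ring.
apply: Lint_q0; first side.
by move=> i; under eq_fun do rewrite mxE; side.
Qed.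

Lemma Sob0 V : Sob V (fun=> 0) (fun=> 0).
have := Sob_test (@test0 R d V); rewrite (_ : grad _ = fun=> 0)//.
by ext x; apply/rowP => i; rewrite !mxE /pderiv derive_cst.
Qed.

Lemma Sob_Z V (a : R) u D : Sob V u D -> Sob V (fun x => a * u x) (fun x => a *: D x).
move=> h; have := Sob_lin a h (Sob0 V).
by under eq_fun do rewrite addr0; under [X in Sob _ _ X]eq_fun do rewrite addr0.
Qed.

Lemma Sob_D V u v D F : Sob V u D -> Sob V v F -> Sob V (fun x => u x + v x) (fun x => D x + F x).
move=> h k; have := Sob_lin 1 h k.
by under eq_fun do rewrite mul1r; under [X in Sob _ _ X]eq_fun do rewrite scale1r.
Qed.

Lemma Sob_B V u v D F : Sob V u D -> Sob V v F -> Sob V (fun x => u x - v x) (fun x => D x - F x).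
move=> h k; have := Sob_lin (-1) k h.
by under eq_fun do rewrite mulN1r addrC; under [X in Sob _ _ X]eq_fun do rewrite scaleN1r addrC.
Qed.

Lemma Sob_L2 V u D : Sob V u D -> LL2 u. Proof. by case. Qed.
Lemma Sob_LLv V u D : Sob V u D -> LLv D. Proof. by case. Qed.
Lemma Sob_meas V u D : Sob V u D -> mfunT u. Proof. by case=> -[]. Qed.
Lemma Sob_off V u D x : Sob V u D -> ~ V x -> u x = 0. Proof. by case=> _ _ h _ /h[]. Qed.
Lemma Sob_offD V u D x : Sob V u D -> ~ V x -> D x = 0. Proof. by case=> _ _ h _ /h[]. Qed.

Lemma Sob_closed V (u_ : nat -> E -> R) (D_ : nat -> E -> E) u D :
 (forall n, Sob V (u_ n) (D_ n)) -> LL2 u -> LLv D -> (forall x, ~ V x -> u x = 0 /\ D x = 0) ->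
 to0 (fun n => Q0 (fun x => u_ n x - u x) (fun x => D_ n x - D x)) -> Sob V u D.
move=> Sn Lu LD u0 h; split=> //.
have /choice[v hv] : forall n, exists v, test V v /\
  Q0 (fun x => v x - u_ n x) (fun x => grad v x - D_ n x) <= n.+1%:R^-1.
 move=> n; have [_ _ _ [v_ [tv hv]]] := Sn n.
 have i0 : 0 < n.+1%:R^-1 :> R by [].
 by have [N /(_ _ (leqnn N)) hN] := hv _ i0; exists (v_ N).
exists v; split; first by move=> n; have [] := hv n.
apply: (to0_le _ (to0D (to0Z (_ : 0 <= 2) (@to0_inv R)) (to0Z (_ : 0 <= 2) h))) => // n.
have [tv hvn] := hv n; have [Lun LDn _ _] := Sn n.
apply: (le_trans (q0_tri (LL2_test mu_fin tv) (LLv_grad tv) Lun LDn Lu LD)).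
by rewrite lerD2r ler_wpM2l.
Qed.

Lemma Sob_ae V u D u' D' : Sob V u D -> mfunT u' ->
 mvec D' ->
 {ae mu, forall x, u x = u' x} -> {ae mu, forall x, D x = D' x} ->
 (forall x, ~ V x -> u' x = 0 /\ D' x = 0) -> Sob V u' D'.
move=> [Lu LD u0 [v_ [tv hv]]] mu' mD' eu eD u0'.
have Lu' : LL2 u' by exact: LL2_ae Lu.
have LD' : LLv D'.
 by move=> i; apply: (LL2_ae (mD' i) _ (LD i)); apply: filterS eD => x ->.
split=> //; exists v_; split=> //; apply: to0_le hv => n.
rewrite /q0 le_eqVlt; apply/orP; left; apply/eqP; apply/esym/Ig_ae.
- by apply: Lint_q0; [apply: LL2B => //; exact: (LL2_test mu_fin (tv n))|apply: LLvB => //; exact: LLv_grad (tv n)].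
- apply: (@Lint_meas _ _ _ mu); apply: Lint_q0; [apply: LL2B => //; exact: (LL2_test mu_fin (tv n))|apply: LLvB => //; exact: LLv_grad (tv n)].
- by apply: filterS2 eu eD => x -> ->.
Qed.

(* Chain rule for F(u1,u2); the support is governed by u1 through F(0,t)=0. *)
Record chain_fun (F Fs Ft : R -> R -> R) (C : R) : Prop := ChainFun {
 cf_C : 0 <= C;
 cf0 : forall t, F 0 t = 0;
 cft0 : forall t, Ft 0 t = 0;
 cf_meas : forall G, G = F \/ G = Fs \/ G = Ft -> forall u v : E -> R, mfunT u ->
  mfunT v -> mfunT (fun x => G (u x) (v x));
 cf_lip : forall G, G = F \/ G = Fs \/ G = Ft -> forall s t s' t',
  `|G s t - G s' t'| <= C * (`|s - s'| + `|t - t'|);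
 cf_bnd : forall s t, `|Fs s t| <= C /\ `|Ft s t| <= C;
 cf_smooth : forall u v : E -> R, smooth u -> smooth v -> smooth (fun x => F (u x) (v x));
 cf_der : forall (u v : E -> R) i x, smooth u -> smooth v ->
  pderiv i (fun y => F (u y) (v y)) x = Fs (u x) (v x) * pderiv i u x + Ft (u x) (v x) * pderiv i v x }.

Lemma sqr4 (a b c e : R) : (a + b + c + e) ^+ 2 <= 4 * (a ^+ 2 + b ^+ 2 + c ^+ 2 + e ^+ 2).
have := sqr_ge0 (a - b); have := sqr_ge0 (a - c); have := sqr_ge0 (a - e).
have := sqr_ge0 (b - c); have := sqr_ge0 (b - e); have := sqr_ge0 (c - e); nra.
Qed.

Lemma sqr_lip (C a b c : R) : 0 <= C -> 0 <= a -> 0 <= b -> 0 <= c -> a <= C * (b + c) ->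
 a ^+ 2 <= 2 * C ^+ 2 * (b ^+ 2 + c ^+ 2).
move=> C0 a0 b0 c0 h; apply: (@le_trans _ _ ((C * (b + c)) ^+ 2)).
 by rewrite lerXn2r ?nnegrE ?mulr_ge0 ?addr_ge0.
by rewrite exprMn; have := sqr_ge0 (b - c); have := sqr_ge0 C; nra.
Qed.

(** The approximants F (v_n, w_n) are test functions in V because F vanishes with its first
    argument. Their gradient error splits into four terms: bounded coefficients times the gradient
    errors of v_n and w_n, and coefficient errors times the fixed gradients D1 and D2. The bound C
    settles the first two, uniform integrability the last two. *)
Lemma Sob_chain V U u1 D1 u2 D2 (F Fs Ft : R -> R -> R) C : chain_fun F Fs Ft C ->
 Sob V u1 D1 -> Sob U u2 D2 ->
 Sob V (fun x => F (u1 x) (u2 x)) (fun x => Fs (u1 x) (u2 x) *: D1 x + Ft (u1 x) (u2 x) *: D2 x).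
move=> cf [L1 LD1 u10 [v_ [tv hv]]] [L2 LD2 u20 [w_ [tw hw]]].
have C0 := cf_C cf; have [mu1 i1] := L1; have [mu2 i2] := L2.
have isF : F = F \/ F = Fs \/ F = Ft by left.
have isFs : Fs = F \/ Fs = Fs \/ Fs = Ft by right; left.
have isFt : Ft = F \/ Ft = Fs \/ Ft = Ft by right; right.
have mF := cf_meas cf isF mu1 mu2; have mFs := cf_meas cf isFs mu1 mu2; have mFt := cf_meas cf isFt mu1 mu2.
have LF : LL2 (fun x => F (u1 x) (u2 x)).
 apply: (LL2_dom mF _ (LL2Z C L1)) => x.
 have := cf_lip cf isF (u1 x) (u2 x) 0 (u2 x); rewrite (cf0 cf) !subr0 subrr normr0 addr0.
 by rewrite normrM (ger0_norm C0).
have Lgs i : LL2 (fun x => Fs (u1 x) (u2 x) * D1 x ord0 i).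
 by apply: (LL2_bounded (M := C)) => // x; have [] := cf_bnd cf (u1 x) (u2 x).
have Lgt i : LL2 (fun x => Ft (u1 x) (u2 x) * D2 x ord0 i).
 by apply: (LL2_bounded (M := C)) => // x; have [] := cf_bnd cf (u1 x) (u2 x).
have LG : LLv (fun x => Fs (u1 x) (u2 x) *: D1 x + Ft (u1 x) (u2 x) *: D2 x).
 by move=> i; under eq_fun do rewrite !mxE; side.
split=> //.
 move=> x nV; have [-> ->] := u10 x nV.
 by rewrite (cf0 cf) (cft0 cf) scaler0 scale0r addr0.
have sv n := test_smooth (tv n); have sw n := test_smooth (tw n).
have tF n : test V (fun x => F (v_ n x) (w_ n x)).
 by apply: (test_comp (F := F) (v := w_ n) (tv n)); [exact: (cf0 cf)|apply: (cf_smooth cf)].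
exists (fun n x => F (v_ n x) (w_ n x)); split=> //.
have Lv n := LL2_test mu_fin (tv n); have Lw n := LL2_test mu_fin (tw n).
have Gv n := LLv_grad (tv n); have Gw n := LLv_grad (tw n).
pose qv n := Q0 (fun x => v_ n x - u1 x) (fun x => grad (v_ n) x - D1 x).
pose qw n := Q0 (fun x => w_ n x - u2 x) (fun x => grad (w_ n) x - D2 x).
have lipsq G : G = F \/ G = Fs \/ G = Ft -> forall n x,
  (G (v_ n x) (w_ n x) - G (u1 x) (u2 x)) ^+ 2 <= 2 * C ^+ 2 * ((v_ n x - u1 x) ^+ 2 + (w_ n x - u2 x) ^+ 2).
 move=> isG n x; have := cf_lip cf isG (v_ n x) (w_ n x) (u1 x) (u2 x).
 rewrite -(real_normK (num_real (_ - G _ _))) -(real_normK (num_real (v_ n x - _))) -(real_normK (num_real (w_ n x - _))).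
 by apply: sqr_lip.
have mG G : G = F \/ G = Fs \/ G = Ft -> forall n, mfunT (fun x => G (v_ n x) (w_ n x) - G (u1 x) (u2 x)).
 by move=> isG n; apply: measurable_funB; apply: (cf_meas cf isG) => //; [exact: test_meas (tv n)|exact: test_meas (tw n)].
have LdG G : G = F \/ G = Fs \/ G = Ft -> forall n, LL2 (fun x => G (v_ n x) (w_ n x) - G (u1 x) (u2 x)).
 move=> isG n; split; first side.
 apply: (Lint_dom _ _ (LintZ (2 * C ^+ 2) (LintD (LL2B (Lv n) L1).2 (LL2B (Lw n) L2).2))).
  side.
 by move=> x; rewrite ger0_norm ?sqr_ge0//; side.
have IdG G : G = F \/ G = Fs \/ G = Ft -> forall n,
  Ig mu (fun x => (G (v_ n x) (w_ n x) - G (u1 x) (u2 x)) ^+ 2) <= 2 * C ^+ 2 * (qv n + qw n).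
 move=> isG n; have k1 := (LL2B (Lv n) L1).2; have k2 := (LL2B (Lw n) L2).2.
 apply: (@le_trans _ _ (Ig mu (fun x => 2 * C ^+ 2 * ((v_ n x - u1 x) ^+ 2 + (w_ n x - u2 x) ^+ 2)))).
  by apply: Ig_le; [exact: (LdG _ isG n).2|apply: LintZ; side|side].
 rewrite IgZ; last side.
 rewrite ler_wpM2l ?mulr_ge0// IgD// lerD//; apply: q0_fst; by [side|exact: LLvB].
have hq : to0 (fun n => qv n + qw n) by exact: to0D.
(* the coefficients converge in L^2 and are bounded, hence converge against the fixed L^2 gradients *)
have van G (D : E -> E) i : G = Fs \/ G = Ft -> (forall s t, `|G s t| <= C) -> LLv D ->
  to0 (fun n => Ig mu (fun x => ((G (v_ n x) (w_ n x) - G (u1 x) (u2 x)) * D x ord0 i) ^+ 2)).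
 move=> isG GC LD e e0; have isG' : G = F \/ G = Fs \/ G = Ft by case: isG; [right; left|right; right].
 have C40 : 0 <= 4 * C ^+ 2 by rewrite mulr_ge0// sqr_ge0.
 have [del del0 hdel] := Ig_vanish (LD i).2 (fun x => sqr_ge0 _) C40 e0.
 have C20 : 0 <= 2 * C ^+ 2 by rewrite mulr_ge0// sqr_ge0.
 have [N hN] := to0Z C20 hq del0.
 exists N => n nN; under [X in Ig _ X]eq_fun do rewrite exprMn mulrC.
 apply: (proj2 (hdel _ _ _ _)).
 - move=> x; rewrite sqr_ge0 /= -(real_normK (num_real (_ - G _ _))).
  have := ler_normB (G (v_ n x) (w_ n x)) (G (u1 x) (u2 x)).
  have := GC (v_ n x) (w_ n x); have := GC (u1 x) (u2 x).
  set a := `|_ - _|; have a0 : 0 <= a by exact: normr_ge0.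
  move=> g1 g2 g3; have : a <= 2 * C by lra.
  by move=> h; rewrite (_ : 4 * C ^+ 2 = (2 * C) ^+ 2) ?lerXn2r ?nnegrE ?mulr_ge0//; ring.
 - exact: (LdG _ isG' n).2.
 - by apply: (le_trans (IdG _ isG' n)); side.
pose bnd n := 2 * C ^+ 2 * (qv n + qw n) + \sum_(i < d) 4 * (C ^+ 2 * qv n + C ^+ 2 * qw n +
 Ig mu (fun x => ((Fs (v_ n x) (w_ n x) - Fs (u1 x) (u2 x)) * D1 x ord0 i) ^+ 2) +
 Ig mu (fun x => ((Ft (v_ n x) (w_ n x) - Ft (u1 x) (u2 x)) * D2 x ord0 i) ^+ 2)).
apply: (@to0_le _ _ bnd); last first.
 apply: to0D; first by apply: to0Z => //; rewrite mulr_ge0// sqr_ge0.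
 apply: to0_sum => i; apply: to0Z => //; apply: to0D; first apply: to0D; first apply: to0D.
 - by apply: to0Z => //; exact: sqr_ge0.
 - by apply: to0Z => //; exact: sqr_ge0.
 - by apply: van => //; [left|move=> s t; have [] := cf_bnd cf s t].
 - by apply: van => //; [right|move=> s t; have [] := cf_bnd cf s t].
move=> n.
have Lc i : LL2 (fun x => (grad (fun y => F (v_ n y) (w_ n y)) x - (Fs (u1 x) (u2 x) *: D1 x + Ft (u1 x) (u2 x) *: D2 x)) ord0 i).
 by apply: (LLvB (LLv_grad (tF n)) LG).
rewrite /q0 IgD; [|exact: (LdG _ isF n).2|exact: (Lint_dotv Lc Lc)].
apply: lerD; first side.
rewrite /dotv Ig_sum; last side.
apply: ler_sum => i _.
have B1 : LL2 (fun x => Fs (v_ n x) (w_ n x) * (grad (v_ n) x - D1 x) ord0 i).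
 apply: (LL2_bounded (M := C)); [|by move=> x; have [] := cf_bnd cf (v_ n x) (w_ n x)|exact: (LLvB (Gv n) LD1)].
 by apply: (cf_meas cf isFs); [exact: test_meas (tv n)|exact: test_meas (tw n)].
have B2 : LL2 (fun x => Ft (v_ n x) (w_ n x) * (grad (w_ n) x - D2 x) ord0 i).
 apply: (LL2_bounded (M := C)); [|by move=> x; have [] := cf_bnd cf (v_ n x) (w_ n x)|exact: (LLvB (Gw n) LD2)].
 by apply: (cf_meas cf isFt); [exact: test_meas (tv n)|exact: test_meas (tw n)].
have bd2 G : (forall s t, `|G s t| <= C) -> forall x, `|G (v_ n x) (w_ n x) - G (u1 x) (u2 x)| <= 2 * C.
 move=> GC x; have := ler_normB (G (v_ n x) (w_ n x)) (G (u1 x) (u2 x)).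
 have := GC (v_ n x) (w_ n x); have := GC (u1 x) (u2 x); lra.
have B3 : LL2 (fun x => (Fs (v_ n x) (w_ n x) - Fs (u1 x) (u2 x)) * D1 x ord0 i).
 by apply: (LL2_bounded (M := 2 * C)) => //; [side|apply: bd2 => s t; have [] := cf_bnd cf s t].
have B4 : LL2 (fun x => (Ft (v_ n x) (w_ n x) - Ft (u1 x) (u2 x)) * D2 x ord0 i).
 by apply: (LL2_bounded (M := 2 * C)) => //; [side|apply: bd2 => s t; have [] := cf_bnd cf s t].
have sqb G (D : E -> E) v : (forall s t, `|G s t| <= C) -> LL2 (fun x => G (v_ n x) (w_ n x) * D x ord0 i) -> LLv D -> LL2 v ->
  Ig mu (fun x => (G (v_ n x) (w_ n x) * D x ord0 i) ^+ 2) <= C ^+ 2 * Q0 v D.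
 move=> GC LGD LD Lvv; apply: (@le_trans _ _ (C ^+ 2 * Ig mu (fun x => D x ord0 i ^+ 2))); last first.
  by rewrite ler_wpM2l ?sqr_ge0//; exact: q0_coord.
 rewrite -IgZ; last exact: (LD i).2.
 apply: Ig_le; [exact: LGD.2|apply: LintZ; exact: (LD i).2|move=> x].
 rewrite exprMn ler_wpM2r ?sqr_ge0// -(real_normK (num_real (G _ _))) lerXn2r//.
apply: (@le_trans _ _ (Ig mu (fun x => 4 * ((Fs (v_ n x) (w_ n x) * (grad (v_ n) x - D1 x) ord0 i) ^+ 2 +
  (Ft (v_ n x) (w_ n x) * (grad (w_ n) x - D2 x) ord0 i) ^+ 2 +
  ((Fs (v_ n x) (w_ n x) - Fs (u1 x) (u2 x)) * D1 x ord0 i) ^+ 2 +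
  ((Ft (v_ n x) (w_ n x) - Ft (u1 x) (u2 x)) * D2 x ord0 i) ^+ 2)))).
 apply: Ig_le; [side|apply: LintZ; apply: LintD; [apply: LintD; [apply: LintD|]|]; by [case: B1|case: B2|case: B3|case: B4]|].
 move=> x; rewrite -expr2; apply: le_trans (sqr4 _ _ _ _); rewrite !mxE (cf_der cf)//.
 apply: eq_ler; congr (_ ^+ 2); ring.
rewrite IgZ; last by apply: LintD; [apply: LintD; [apply: LintD|]|]; by [case: B1|case: B2|case: B3|case: B4].
rewrite ler_wpM2l// !IgD//; try (by [case: B1|case: B2|case: B3|case: B4]); last 2 first.
- by apply: LintD; [case: B1|case: B2].
- by apply: LintD; [apply: LintD|]; [case: B1|case: B2|case: B3].
rewrite !lerD2r lerD//.
 apply: (sqb Fs (fun x => grad (v_ n) x - D1 x)) => //; [by move=> s t; have [] := cf_bnd cf s t|exact: LLvB|side].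
apply: (sqb Ft (fun x => grad (w_ n) x - D2 x)) => //; [by move=> s t; have [] := cf_bnd cf s t|exact: LLvB|side].
Qed.

End sobolev.

(** * Complete semi-inner product spaces *)

Section hilbert.
Variables (R : realType) (W : lmodType R) (S : set W) (q : W -> W -> R).
Implicit Types x y z : W.

(* Completeness is expressed for the seminorm sqrt(q x x) on the subspace S; no quotient is taken. *)
Record semihilbert : Prop := SemiHilbert {
 sh0 : S 0;
 shP : forall a x y, S x -> S y -> S (a *: x + y);
 shC : forall x y, S x -> S y -> q x y = q y x;
 shL : forall a x y z, S x -> S y -> S z -> q (a *: x + y) z = a * q x z + q y z;
 sh_ge0 : forall x, S x -> 0 <= q x x }.

Definition qcauchy (z : nat -> W) := forall e : R, 0 < e -> exists N, forall n m,
 (N <= n)%N -> (N <= m)%N -> q (z n - z m) (z n - z m) <= e.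

Definition qcomplete := forall z : nat -> W, (forall n, S (z n)) -> qcauchy z ->
 exists2 w, S w & to0 (fun n => q (z n - w) (z n - w)).

Hypothesis H : semihilbert.

Lemma shD x y : S x -> S y -> S (x + y).
by move=> Sx Sy; rewrite -[x]scale1r; apply: shP. Qed.
Lemma shZ a x : S x -> S (a *: x).
by move=> Sx; rewrite -[_ *: _]addr0; apply: shP => //; exact: sh0. Qed.
Lemma shN x : S x -> S (- x).
by move=> Sx; rewrite -scaleN1r; exact: shZ. Qed.
Lemma shB x y : S x -> S y -> S (x - y).
by move=> Sx Sy; apply: shD => //; exact: shN. Qed.

Lemma q0l y : S y -> q 0 y = 0.
move=> Sy; have S0 := sh0 H; have := shL H 1 S0 S0 Sy.
by rewrite scale1r addr0 mul1r => /eqP; rewrite -subr_eq0 opprD addNKr oppr_eq0 => /eqP.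
Qed.
Lemma qDl x y z : S x -> S y -> S z -> q (x + y) z = q x z + q y z.
by move=> Sx Sy Sz; have := shL H 1 Sx Sy Sz; rewrite scale1r mul1r. Qed.
Lemma qZl a x z : S x -> S z -> q (a *: x) z = a * q x z.
by move=> Sx Sz; have := shL H a Sx (sh0 H) Sz; rewrite addr0 q0l// addr0. Qed.
Lemma qNl x z : S x -> S z -> q (- x) z = - q x z.
by move=> Sx Sz; rewrite -scaleN1r qZl// mulN1r. Qed.
Lemma qBl x y z : S x -> S y -> S z -> q (x - y) z = q x z - q y z.
by move=> Sx Sy Sz; rewrite qDl ?qNl//; exact: shN. Qed.
Lemma qDr x y z : S x -> S y -> S z -> q z (x + y) = q z x + q z y.
by move=> Sx Sy Sz; rewrite !(shC H Sz) ?qDl//; exact: shD. Qed.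
Lemma qZr a x z : S x -> S z -> q z (a *: x) = a * q z x.
by move=> Sx Sz; rewrite !(shC H Sz) ?qZl//; exact: shZ. Qed.
Lemma qBr x y z : S x -> S y -> S z -> q z (x - y) = q z x - q z y.
by move=> Sx Sy Sz; rewrite !(shC H Sz) ?qBl//; exact: shB. Qed.

Lemma qqD x y : S x -> S y -> q (x + y) (x + y) = q x x + 2 * q x y + q y y.
move=> Sx Sy; have Sxy := shD Sx Sy.
by rewrite qDl// !qDr// (shC H Sy Sx); ring.
Qed.
Lemma qqB x y : S x -> S y -> q (x - y) (x - y) = q x x - 2 * q x y + q y y.
move=> Sx Sy; have Sxy := shB Sx Sy.
by rewrite qBl// !qBr// (shC H Sy Sx); ring.
Qed.
Lemma qqZ a x : S x -> q (a *: x) (a *: x) = a ^+ 2 * q x x.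
by move=> Sx; rewrite qZl ?qZr//; [ring|exact: shZ]. Qed.
Lemma qqBC x y : S x -> S y -> q (x - y) (x - y) = q (y - x) (y - x).
by move=> Sx Sy; rewrite !qqB// (shC H Sx Sy); ring. Qed.

Lemma q_CS x y : S x -> S y -> q x y ^+ 2 <= q x x * q y y.
move=> Sx Sy; apply: discr_le => [|t]; first exact: sh_ge0.
have St := shZ t Sy; have := sh_ge0 H (shD Sx St).
by rewrite qqD// qqZ// qZr//; congr (_ <= _); ring.
Qed.

Definition qn x := Num.sqrt (q x x).

Lemma qn_triangle x y : S x -> S y -> qn (x + y) <= qn x + qn y.
move=> Sx Sy; have a0 := sh_ge0 H Sx; have b0 := sh_ge0 H Sy.
have s0 : 0 <= qn x + qn y by rewrite addr_ge0 ?sqrtr_ge0.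
rewrite -[leRHS]ger0_norm// -sqrtr_sqr ler_wsqrtr// qqD// sqrrD !sqr_sqrtr//.
have h : q x y <= qn x * qn y.
 apply: (le_trans (ler_norm _)).
 by rewrite -sqrtr_sqr /qn -sqrtrM// ler_wsqrtr//; exact: q_CS.
by rewrite mulr2n; lra.
Qed.

Lemma q_near x y : S x -> S y -> q x x <= 2 * q y y + 2 * q (x - y) (x - y).
move=> Sx Sy; set w := x - y; have Sw : S w := shB Sx Sy.
have -> : x = y + w by rewrite /w addrC subrK.
have := sh_ge0 H (shB Sy Sw); rewrite qqB// qqD//; lra.
Qed.

(* The common core of the Riesz representation theorem and of the Banach-Saks/Mazur argument:
 J is uniformly convex, so near-minimisers over decreasing midpoint-convex sets are Cauchy. *)
Lemma min_seq (J : W -> R) (C : nat -> set W) (m0 M : R) :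
 (forall x y, S x -> S y -> q (x - y) (x - y) <= 2 * J x + 2 * J y - 4 * J (2^-1 *: (x + y))) ->
 (forall n, C n `<=` S) -> (forall n, C n.+1 `<=` C n) ->
 (forall n x y, C n x -> C n y -> C n (2^-1 *: (x + y))) ->
 (forall n (e : R), 0 < e -> exists2 x, C n x & J x <= M + e) ->
 (forall x, S x -> m0 <= J x) ->
 exists z : nat -> W, [/\ forall n, C n (z n), qcauchy z,
  forall n, J (z n) <= M + n.+1%:R^-1 &
  forall n x, C n x -> J (z n) <= J x + n.+1%:R^-1].
move=> hJ CS Cdec Cmid Cex Jlb.
pose I n := inf (J @` C n).
have hasI n : has_inf (J @` C n).
 split; first by have [x Cx _] := Cex n 1 ltr01; exists (J x), x.
 by exists m0 => _ [x Cx <-]; apply: Jlb; exact: CS Cx.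
have Ile n x : C n x -> I n <= J x.
 by move=> Cx; apply: ge_inf; [case: (hasI n)|exists x].
have IM n : I n <= M.
 apply/ler_addgt0Pr => e /(Cex n)[x Cx]; apply: le_trans; side.
have Imono n m : (n <= m)%N -> I n <= I m.
 elim: m => [|m ih]; first by rewrite leqn0 => /eqP ->.
 rewrite leq_eqVlt => /predU1P[->//|/ih h]; apply: (le_trans h).
 apply: lb_le_inf; first by case: (hasI m.+1).
 by move=> _ [x Cx <-]; apply: Ile; exact: Cdec.
have /choice[z hz] : forall n, exists x, C n x /\ J x <= I n + n.+1%:R^-1.
 move=> n; have e0 : (0 : R) < n.+1%:R^-1 by [].
 have [_ [x Cx <-] hx] := inf_adherent e0 (hasI n).
 by exists x; split=> //; apply: ltW.
have Cz n m : (n <= m)%N -> C n (z m).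
 move=> nm; have : C m (z m) by have [] := hz m.
 elim: m nm {hz} (z m) => [|m ih]; first by rewrite leqn0 => /eqP ->.
 by rewrite leq_eqVlt => /predU1P[->//|/ih h] w /Cdec; side.
exists z; split.
- side.
- move=> e e0.
 (* The infima increase to their supremum s. Far enough out, both values of J are at most s + e / 16
    and the value at the midpoint is at least s - e / 16, so uniform convexity bounds the distance
    by e / 2. *)
 have [s [Is]] : exists s : R, (forall n, I n <= s) /\ forall e : R, 0 < e -> exists N, s - e < I N.
  have hs : has_sup (range I).
   by split; [exists (I 0%N), 0%N|exists M => _ [n _ <-]].
  exists (sup (range I)); split; first by move=> n; apply: ub_le_sup; [case: hs|exists n].
  by move=> e' e'0; have [_ [N _ <-] h] := sup_adherent e'0 hs; exists N.
 move=> /(_ (e / 16)) []; first by rewrite divr_gt0.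
 move=> N1 hN1; have [N2 hN2] := @to0_inv R (e / 16) ltac:(by rewrite divr_gt0).
 exists (N1 + N2)%N => n m hn hm.
 pose k := (N1 + N2)%N.
 have Sz l : S (z l) by apply: (CS l); have [] := hz l.
 apply: (le_trans (hJ _ _ (Sz n) (Sz m))).
 have hk : I N1 <= I k by apply: Imono; rewrite leq_addr.
 have hmid : I k <= J (2^-1 *: (z n + z m)) by apply: Ile; apply: Cmid; side.
 have [_ h1] := hz n; have [_ h2] := hz m.
 have g1 : n.+1%:R^-1 <= e / 16 by apply: hN2; rewrite (leq_trans _ hn)// leq_addl.
 have g2 : m.+1%:R^-1 <= e / 16 by apply: hN2; rewrite (leq_trans _ hm)// leq_addl.
 have i1 := Is n; have i2 := Is m; clear - hN1 hk hmid h1 h2 g1 g2 i1 i2 e0.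
 move: (I N1) (I k) (I n) (I m) (J _) (J _) (J _) (n.+1%:R^-1) (m.+1%:R^-1) hN1 hk hmid h1 h2 g1 g2 i1 i2 => *; lra.
- move=> n; have [_ h] := hz n; apply: (le_trans h); by rewrite lerD2r.
- move=> n x Cx; have [_ h] := hz n; apply: (le_trans h); by rewrite lerD2r Ile.
Qed.

Lemma par x y : S x -> S y ->
 q (x - y) (x - y) = 2 * q x x + 2 * q y y - 4 * q (2^-1 *: (x + y)) (2^-1 *: (x + y)).
move=> Sx Sy; rewrite qqB// qqZ ?qqD//; last exact: shD.
by field.
Qed.

(** Applied to sets of approximate solutions, this supplies a strongly Cauchy sequence with
    controlled energy, in the place of weak compactness followed by convex combinations. The
    convexity needed is the parallelogram identity [par]. *)
Lemma mazur (C : nat -> set W) (M : R) :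
 (forall n, C n `<=` S) -> (forall n, C n.+1 `<=` C n) ->
 (forall n x y, C n x -> C n y -> C n (2^-1 *: (x + y))) ->
 (forall n (e : R), 0 < e -> exists2 x, C n x & q x x <= M + e) ->
 exists z : nat -> W, [/\ forall n, C n (z n), qcauchy z & forall n, q (z n) (z n) <= M + n.+1%:R^-1].
move=> CS Cdec Cmid Cex.
have [||z [? ? ? _]] := @min_seq (fun x => q x x) C 0 M _ CS Cdec Cmid Cex.
- by move=> x y Sx Sy; rewrite par.
- exact: sh_ge0.
- by exists z.
Qed.

Lemma q_lim (z : nat -> W) w y : (forall n, S (z n)) -> S w -> S y ->
 to0 (fun n => q (z n - w) (z n - w)) -> to0 (fun n => `|q (z n) y - q w y|).
move=> Sz Sw Sy h; apply: (@to0_sqr _ _ (fun n => q y y * q (z n - w) (z n - w))); last first.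
 by apply: to0Z => //; exact: sh_ge0.
move=> n; rewrite -qBl// real_normK ?num_real// mulrC.
by apply: q_CS => //; exact: shB.
Qed.

Hypothesis Hc : qcomplete.

(** The representing vector minimises J x = q x x - 2 l x. The linear part cancels in the midpoint
    inequality, so J inherits the uniform convexity of q, and [min_seq] is used with all sets equal
    to S. *)
Lemma riesz (l : W -> R) (K : R) :
 (forall a x y, S x -> S y -> l (a *: x + y) = a * l x + l y) ->
 (forall x, S x -> l x ^+ 2 <= K * q x x) ->
 exists2 w, S w & forall x, S x -> q w x = l x.
move=> lL lb; have S0 := sh0 H.
have l0 : l 0 = 0.
 by have := lL 1 0 0 S0 S0; rewrite scale1r addr0 mul1r; lra.
have lD x y : S x -> S y -> l (x + y) = l x + l y.
 by move=> Sx Sy; have := lL 1 x y Sx Sy; rewrite scale1r mul1r.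
have lZ a x : S x -> l (a *: x) = a * l x.
 by move=> Sx; have := lL a x 0 Sx S0; rewrite addr0 l0 addr0.
pose J x := q x x - 2 * l x.
have Jlb x : S x -> - `|K| <= J x.
 move=> Sx; rewrite /J; have := lb x Sx; have := sh_ge0 H Sx.
 set t := q x x; set b := l x => t0 hb.
 have hb' : b ^+ 2 <= `|K| * t by apply: (le_trans hb); rewrite ler_wpM2r// ler_norm.
 have := normr_ge0 K; move: `|K| hb' => k hb' k0; have [t1|t1] := eqVneq t 0.
  have : b ^+ 2 <= 0 by move: hb'; rewrite t1 mulr0.
  nra.
 have := sqr_ge0 (t - b); nra.
have [|||||z [Sz Cz hz hmin]] := @min_seq J (fun=> S) (- `|K|) (inf (J @` S)) _ _ _ _ _ Jlb.
- move=> x y Sx Sy; rewrite /J par// lZ ?lD//; last exact: shD.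
 by lra.
- by move=> _ x.
- by move=> _ x.
- by move=> _ x y Sx Sy; apply: shZ; exact: shD.
- move=> _ e e0.
 have hI : has_inf (J @` S).
  by split; [exists (J 0), 0|exists (- `|K|) => _ [x Sx <-]; side].
 by have [_ [x Sx <-] /ltW hx] := inf_adherent e0 hI; exists x.
have [w Sw hw] := Hc Sz Cz; exists w => // x Sx.
(* first variation: J(z_n) <= J(z_n + t x) + 1/n gives |q(z_n,x) - l x| small *)
apply/eqP; rewrite -subr_eq0 -sqrf_eq0 eq_le sqr_ge0 andbT.
have key n : (q (z n) x - l x) ^+ 2 <= n.+1%:R^-1 * (q x x + 1).
 (* This is the optimal step along x, except for the + 1, which avoids dividing by 0 when x has
    seminorm 0. *)
 have := hmin n (z n - ((q (z n) x - l x) / (q x x + 1)) *: x).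
 set t := _ / _; move=> /(_ (shB (Sz n) (shZ t Sx))).
 have qx := sh_ge0 H Sx.
 rewrite /J qqB ?qqZ ?qZr//; [|exact: shZ].
 have -> : l (z n - t *: x) = l (z n) - t * l x.
  by rewrite addrC -[- (t *: x)]scaleNr lL// mulNr addrC.
 have tE : t * (q x x + 1) = q (z n) x - l x by rewrite /t divfK// gt_eqF//; lra.
 move=> h; have i0 : 0 < n.+1%:R^-1 :> R by [].
 move: tE h i0; set b := q (z n) x; set c := q x x in qx *; set L := l x; set i := _^-1; set a := q _ _.
 move=> tE h i0; have h' : 2 * t * (b - L) <= t ^+ 2 * c + i by lra.
 have h2 : t ^+ 2 * (c + 1) <= i by move: h'; rewrite -tE; nra.
 by rewrite -tE exprMn; nra.
have h1 : to0 (fun n => (q (z n) x - l x) ^+ 2).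
 apply: (to0_le key); rewrite (_ : (fun n => _) = fun n => (q x x + 1) * n.+1%:R^-1).
  by apply: to0Z; [have := sh_ge0 H Sx; lra|exact: to0_inv].
 by ext n; rewrite mulrC.
have h2 := q_lim Sz Sw Sx hw.
have h3 : to0 (fun n => `|q (z n) x - l x|).
 by apply: to0_sqr h1 => n; rewrite real_normK ?num_real.
have -> : q w x = l x.
 by apply: (to0_uniq h2 h3); move=> e e0; exists 0%N => n _; rewrite subrr normr0 ltW.
by rewrite subrr expr0n.
Qed.

(* q + s with s skew is coercive; solved by a damped contraction iteration. *)
Lemma lax_milgram (s : W -> W -> R) (l : W -> R) (K L : R) : 0 <= K ->
 (forall a x y, S x -> S y -> l (a *: x + y) = a * l x + l y) ->
 (forall x, S x -> l x ^+ 2 <= L * q x x) ->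
 (forall a x y z, S x -> S y -> S z -> s (a *: x + y) z = a * s x z + s y z) ->
 (forall a x y z, S x -> S y -> S z -> s z (a *: x + y) = a * s z x + s z y) ->
 (forall x, S x -> s x x = 0) ->
 (forall x y, S x -> S y -> s x y ^+ 2 <= K * q x x * q y y) ->
 exists2 w, S w & forall x, S x -> q w x + s w x = l x.
move=> K0 lL lb sLl sLr sxx sb.
have /choice[G hG] : forall u, exists w, S u -> S w /\ forall x, S x -> q w x = l x - s u x.
 move=> u; have [Su|nSu] := pselect (S u); last by exists 0.
 have [|x Sx|w Sw hw] := @riesz (fun x => l x - s u x) (2 * L + 2 * (K * q u u)).
 - by move=> a x y Sx Sy; rewrite lL// sLr//; ring.
 - have := lb x Sx; have := sb u x Su Sx; have := sqr_ge0 (l x + s u x).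
  rewrite mulrDl -!mulrA => A B C; nra.
 by exists w => _.
(* Skewness removes the cross term, so T contracts the squared seminorm by the factor (1 - r)^2 +
   r^2 K. This r minimises it, with value 1 - r. *)
pose r := (1 + K)^-1; have K1 : 0 < 1 + K by lra.
have r0 : 0 < r by rewrite invr_gt0.
have rK : r * (1 + K) = 1 by rewrite mulVf// gt_eqF.
pose T u := (1 - r) *: u + r *: G u.
have ST u : S u -> S (T u).
 by move=> Su; have [SG _] := hG u Su; apply: shD; exact: shZ.
pose z n := iter n T 0.
have Sz n : S (z n) by elim: n => [|n ih] /=; [exact: sh0|exact: ST].
have con u v : S u -> S v -> q (T u - T v) (T u - T v) <= (1 - r) * q (u - v) (u - v).
 move=> Su Sv; have [SGu hGu] := hG u Su; have [SGv hGv] := hG v Sv.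
 set x := u - v; have Sx : S x by exact: shB.
 set g := G u - G v; have Sg : S g by exact: shB.
 have gE y : S y -> q g y = - s x y.
  move=> Sy; rewrite qBl// hGu// hGv//.
  have := sLl (-1) v u y Sv Su Sy; rewrite scaleN1r addrC -/x mulN1r => ->; ring.
 have -> : T u - T v = (1 - r) *: x + r *: g.
  by rewrite /T /x /g !scalerBr opprD addrACA.
 rewrite qqD ?qqZ//; try exact: shZ.
 rewrite qZl ?qZr//; [|exact: shZ].
 rewrite (shC H Sx Sg) gE// sxx// oppr0 !mulr0 addr0.
 have gg : q g g <= K * q x x.
  have h1 := gE g Sg; have h2 := sb x g Sx Sg; have h3 := sh_ge0 H Sg; have h4 := sh_ge0 H Sx.
  have h5 : q g g ^+ 2 <= K * q x x * q g g by rewrite {1}h1 sqrrN.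
  have [h6|h6] := eqVneq (q g g) 0; first by rewrite h6 mulr_ge0.
  have gp : 0 < q g g by rewrite lt_neqAle eq_sym h6.
  by rewrite -(ler_pM2r gp) -expr2.
 have h4 := sh_ge0 H Sx.
 apply: (@le_trans _ _ ((1 - r) ^+ 2 * q x x + r ^+ 2 * (K * q x x))).
  by rewrite lerD2l ler_wpM2l// sqr_ge0.
 rewrite mulrA -mulrDl ler_wpM2r//.
 have -> : (1 - r) ^+ 2 + r ^+ 2 * K = 1 - 2 * r + r * (r * (1 + K)) by ring.
 by rewrite rK; lra.
have th0 : 0 <= 1 - r by rewrite -rK; nra.
pose t := Num.sqrt (1 - r).
have t0 : 0 <= t by exact: sqrtr_ge0.
have t1 : t < 1 by rewrite -sqrtr1 ltr_sqrt//; lra.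
have conN u v : S u -> S v -> qn (T u - T v) <= t * qn (u - v).
 by move=> Su Sv; rewrite /qn /t -sqrtrM// ler_wsqrtr// con.
pose M := qn (z 1%N - z 0%N).
have M0 : 0 <= M by exact: sqrtr_ge0.
have step n : qn (z n.+1 - z n) <= t ^+ n * M.
 elim: n => [|n ih]; first by rewrite expr0 mul1r.
 apply: (le_trans (conN _ _ (Sz n.+1) (Sz n))).
 by rewrite exprS -mulrA ler_wpM2l.
have tele n k : qn (z (n + k)%N - z n) <= t ^+ n * M * (1 - t ^+ k) / (1 - t).
 elim: k => [|k ih]; first by rewrite addn0 subrr /qn q0l ?sqrtr0 ?expr0 ?subrr ?mulr0 ?mul0r//; exact: sh0.
 rewrite -(subrK (z (n + k)%N) (z (n + k.+1)%N)) -addrA.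
 apply: (le_trans (qn_triangle _ _)); [exact: shB|exact: shB|].
 have h1 := step (n + k)%N; rewrite -addnS in h1.
 apply: (le_trans (lerD h1 ih)).
 have tn : 1 - t != 0 by rewrite gt_eqF// subr_gt0.
 rewrite exprD exprS le_eqVlt; apply/orP; left; apply/eqP; by field.
have cz : qcauchy z.
 have bnd n m : (n <= m)%N -> qn (z m - z n) <= t ^+ n * (M / (1 - t)).
  move=> /subnKC <-; apply: (le_trans (tele _ _)).
  rewrite -!mulrA ler_wpM2l ?exprn_ge0// ler_wpM2l//.
  by rewrite ler_piMl ?invr_ge0 ?gerBl ?exprn_ge0//; lra.
 have t0' : to0 (fun n => (t ^+ n * (M / (1 - t))) ^+ 2).
  rewrite (_ : (fun n => _) = fun n => (M / (1 - t)) ^+ 2 * (t ^+ 2) ^+ n).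
   apply: to0Z; first exact: sqr_ge0.
   by apply: cvg_to0; apply: cvg_expr; rewrite ger0_norm ?sqr_ge0// expr_lt1.
  by ext n; rewrite exprMn mulrC exprAC.
 move=> e /t0'[N hN]; exists N => n m hn hm.
 wlog nm : n m hn hm / (n <= m)%N.
  by move=> h; have [/h|/ltnW/h] := leqP n m => [->//|h']; rewrite qqBC// h'.
 rewrite qqBC//; apply: le_trans (hN n hn).
 rewrite -(sqr_sqrtr (sh_ge0 H (shB (Sz m) (Sz n)))) lerXn2r ?nnegrE ?sqrtr_ge0//; last exact: bnd.
 by rewrite mulr_ge0 ?exprn_ge0// divr_ge0//; lra.
have [w Sw hw] := Hc Sz cz; exists w => // x Sx.
have Twz : to0 (fun n => q (z n - T w) (z n - T w)).
 have h : to0 (fun n => q (z n.+1 - T w) (z n.+1 - T w)).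
  apply: (to0_le _ hw) => n; apply: (le_trans (con _ _ (Sz n) Sw)).
  rewrite ler_piMl//; [by apply: sh_ge0 => //; exact: shB|lra].
 by move=> e /h[N hN]; exists N.+1 => -[//|n] /hN.
(* The iterates converge to w and to T w alike; being a fixed point of T up to the seminorm means
   that w and G w pair equally with every x. *)
have E : q w x = q (T w) x.
 apply: (to0_uniq (q_lim Sz Sw Sx hw) (q_lim Sz (ST _ Sw) Sx Twz)).
 by move=> e e0; exists 0%N => n _; rewrite subrr normr0 ltW.
have [SG hGw] := hG w Sw; have := hGw x Sx.
move: E; rewrite qDl ?qZl//; try exact: shZ.
move=> E hGx; have : r * (q w x - q (G w) x) = 0 by move: E; lra.
by move/eqP; rewrite mulf_eq0 gt_eqF//= subr_eq0 hGx => /eqP ->; ring.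
Qed.

End hilbert.

(** * Contraction semigroups from implicit Euler steps *)

Section hille_yosida.
Variables (R : realType) (T : Type) (S : set (T -> R)) (N : (T -> R) -> R).
Implicit Types x y u v f g : T -> R.

Record seminormed : Prop := SemiNormed {
 sn0 : S (fun=> 0);
 snP : forall (a : R) x y, S x -> S y -> S (fun s => a * x s + y s);
 snZ : forall (a : R) x, S x -> N (fun s => a * x s) = `|a| * N x;
 snD : forall x y, S x -> S y -> N (fun s => x s + y s) <= N x + N y }.

Definition ncauchy (z : nat -> T -> R) := forall e : R, 0 < e -> exists k, forall n m,
 (k <= n)%N -> (k <= m)%N -> N (fun s => z n s - z m s) <= e.

Definition ncomplete := forall z : nat -> T -> R, (forall n, S (z n)) -> ncauchy z ->
 exists2 w, S w & to0 (fun n => N (fun s => z n s - w s)).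

Hypothesis H : seminormed.

Lemma snSZ (a : R) x : S x -> S (fun s => a * x s).
by move=> Sx; have := snP H a Sx (sn0 H); under eq_fun do rewrite addr0. Qed.
Lemma snSB x y : S x -> S y -> S (fun s => x s - y s).
by move=> Sx Sy; have := snP H (-1) Sy Sx; under eq_fun do rewrite mulN1r addrC. Qed.
Lemma N0 : N (fun=> 0) = 0.
by have := snZ H 0 (sn0 H); under eq_fun do rewrite mul0r; rewrite normr0 mul0r. Qed.
Lemma NC x y : S x -> S y -> N (fun s => x s - y s) = N (fun s => y s - x s).
move=> Sx Sy; have := snZ H (-1) (snSB Sy Sx); rewrite normrN1 mul1r => <-.
by congr N; ext s; ring.
Qed.
Lemma N_ge0 x : S x -> 0 <= N x.
move=> Sx; have := snD H Sx (snSZ (-1) Sx); rewrite (snZ H)// normrN1.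
by under [X in N X]eq_fun do rewrite mulN1r subrr; rewrite N0; lra.
Qed.
Lemma NBD x y : S x -> S y -> N (fun s => x s - y s) <= N x + N y.
move=> Sx Sy; have := snD H Sx (snSZ (-1) Sy); rewrite (snZ H)// normrN1 mul1r.
by under [X in N X]eq_fun do rewrite mulN1r.
Qed.
Lemma Ntri z x y : S x -> S y -> S z ->
 N (fun s => x s - y s) <= N (fun s => x s - z s) + N (fun s => z s - y s).
move=> Sx Sy Sz; rewrite (_ : (fun s => x s - y s) = fun s => (x s - z s) + (z s - y s)).
 by apply: snD => //; exact: snSB.
by ext s; ring.
Qed.
Lemma N_le x y : S x -> S y -> N x <= N y + N (fun s => x s - y s).
move=> Sx Sy; rewrite [X in N X <= _](_ : x = fun s => y s + (x s - y s)).
 by apply: snD => //; exact: snSB.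
by ext s; ring.
Qed.

Definition neq x y := N (fun s => x s - y s) = 0.

Lemma null_le x : S x -> N x <= 0 -> N x = 0.
by move=> Sx h; apply/le_anti; rewrite h N_ge0. Qed.
Lemma neq_refl x : neq x x.
by rewrite /neq; under eq_fun do rewrite subrr; exact: N0. Qed.
Lemma neq_sym x y : S x -> S y -> neq x y -> neq y x.
by move=> Sx Sy; rewrite /neq NC. Qed.
Lemma neq_trans y x z : S x -> S y -> S z -> neq x y -> neq y z -> neq x z.
move=> Sx Sy Sz h1 h2; apply: null_le; first exact: snSB.
by rewrite (le_trans (Ntri Sx Sz Sy))// h1 h2.
Qed.
Lemma null_comb (a : R) x y : S x -> S y -> N x = 0 -> N y = 0 -> N (fun s => a * x s + y s) = 0.
move=> Sx Sy h1 h2; apply: null_le; first exact: snP.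
by rewrite (le_trans (snD H (snSZ a Sx) Sy))// (snZ H)// h1 h2.
Qed.
Lemma neqN x y : S x -> S y -> neq x y -> N x = N y.
move=> Sx Sy h; apply/le_anti/andP; split.
 by rewrite (le_trans (N_le Sx Sy))// h addr0.
by rewrite (le_trans (N_le Sy Sx))// NC// h addr0.
Qed.
Lemma neq_small x y : S x -> S y -> (forall e : R, 0 < e -> N (fun s => x s - y s) <= e) -> neq x y.
by move=> Sx Sy h; apply: null_le; [exact: snSB|apply/ler_addgt0Pr => e e0; rewrite add0r h].
Qed.

(* J h = (1 - h L)^{-1} *)
Variables (L : (T -> R) -> (T -> R) -> Prop) (J : R -> (T -> R) -> T -> R).
Hypothesis LS : forall u g, L u g -> S u /\ S g.
Hypothesis Lneq : forall u u' g g', S u' -> S g' -> neq u u' -> neq g g' -> L u g -> L u' g'.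
Hypothesis LP : forall (a : R) u v f g, L u f -> L v g ->
 L (fun s => a * u s + v s) (fun s => a * f s + g s).
Hypothesis JS : forall (h : R) f, 0 < h -> S f -> S (J h f).
Hypothesis JP : forall (h a : R) x y, 0 < h -> S x -> S y ->
 neq (J h (fun s => a * x s + y s)) (fun s => a * J h x s + J h y s).
Hypothesis JN : forall (h : R) x, 0 < h -> S x -> N (J h x) <= N x.
Hypothesis LJ : forall (h : R) f, 0 < h -> S f -> L (J h f) (fun s => h^-1 * (J h f s - f s)).
Hypothesis JL : forall (h : R) u g, 0 < h -> L u g -> neq (J h (fun s => - h * g s + u s)) u.
Hypothesis Ldense : forall f (e : R), S f -> 0 < e ->
 exists u g, L u g /\ N (fun s => f s - u s) <= e.
Hypothesis Hc : ncomplete.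

Lemma JNB (h : R) x y : 0 < h -> S x -> S y -> N (fun s => J h x s - J h y s) <= N (fun s => x s - y s).
move=> h0 Sx Sy; have := JP (-1) h0 Sy Sx.
rewrite (_ : (fun s => -1 * y s + x s) = fun s => x s - y s); last by ext s; ring.
rewrite (_ : (fun s => -1 * J h y s + J h x s) = fun s => J h x s - J h y s); last by ext s; ring.
have S1 := JS h0 (snSB Sx Sy); have S2 := snSB (JS h0 Sx) (JS h0 Sy).
by move=> /(neqN S1 S2) <-; apply: JN => //; exact: snSB.
Qed.

(** Since J maps u - h g back to u, linearity isolates the increment of one Euler step. *)
Lemma J_sub (h : R) u g : 0 < h -> L u g -> neq (fun s => J h u s - u s) (fun s => h * J h g s).
move=> h0 Lu; have [Su Sg] := LS Lu; have Ju := JS h0 Su; have Jg := JS h0 Sg.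
have e1 := JL h0 Lu; have e2 := JP (- h) h0 Sg Su.
have Sp := snP H (- h) Sg Su; have Jp := JS h0 Sp.
have := null_comb (-1) (snSB Jp (snP H (- h) Jg Ju)) (snSB Jp Su) e2 e1.
by rewrite /neq => <-; congr N; ext s; ring.
Qed.

Lemma J_step (h : R) u g : 0 < h -> L u g -> N (fun s => J h u s - u s) <= h * N g.
move=> h0 Lu; have [Su Sg] := LS Lu; have Ju := JS h0 Su; have Jg := JS h0 Sg.
rewrite (neqN (snSB Ju Su) (snSZ h Jg) (J_sub h0 Lu)) (snZ H)// gtr0_norm//.
by rewrite ler_pM2l//; side.
Qed.

Lemma L_J (h : R) u g : 0 < h -> L u g -> L (J h u) (J h g).
move=> h0 Lu; have [Su Sg] := LS Lu; have Ju := JS h0 Su; have Jg := JS h0 Sg.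
apply: (Lneq Ju Jg (neq_refl _) _ (LJ h0 Su)).
have := null_comb h^-1 (snSB (snSB Ju Su) (snSZ h Jg)) (sn0 H) (J_sub h0 Lu) N0.
by rewrite /neq => <-; congr N; ext s; field; rewrite gt_eqF.
Qed.

(** One step of size h against two of size j = h / 2. With y, G, K the double half steps of u, g, v
    one has u = y - h G + j^2 K, and J h sends y - h G to y; what remains is j^2 J h K. The local
    error is quadratic in h on the domain of L^2, so over about t / h steps it accumulates to
    O(h). *)
Lemma J_half (h : R) u g v : 0 < h -> L u g -> L g v ->
 N (fun s => J h u s - J (h / 2) (J (h / 2) u) s) <= (h / 2) ^+ 2 * N v.
move=> h0 Lu Lg; set j := h / 2; have j0 : 0 < j by rewrite divr_gt0.
have [Su Sg] := LS Lu; have [_ Sv] := LS Lg.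
have Lp := L_J j0 Lu; have Ly := L_J j0 Lp; have LG := L_J j0 Lg; have LGG := L_J j0 LG.
set p := J j u in Lp Ly *; set y := J j p in Ly *.
set g1 := J j g in Lp Ly LG LGG; set G := J j g1 in Ly LGG; set k1 := J j v in LG LGG; set K := J j k1 in LGG.
have [Sp Sg1] := LS Lp; have [Sy SG] := LS Ly; have [_ Sk1] := LS LG; have [_ SK] := LS LGG.
have e1 : neq (fun s => p s - u s) (fun s => j * g1 s) := J_sub j0 Lu.
have e2 : neq (fun s => y s - p s) (fun s => j * G s) := J_sub j0 Lp.
have e3 : neq (fun s => G s - g1 s) (fun s => j * K s) := J_sub j0 LG.
have e4 := JL h0 Ly.
pose w s := - h * G s + y s; have Sw : S w by exact: snP.
pose u' s := j ^+ 2 * K s + w s; have Su' : S u' by exact: snP.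
have e5 : neq u u'.
 have n12 := null_comb 1 (snSB (snSB Sp Su) (snSZ j Sg1)) (snSB (snSB Sy Sp) (snSZ j SG)) e1 e2.
 have S12 := snP H 1 (snSB (snSB Sp Su) (snSZ j Sg1)) (snSB (snSB Sy Sp) (snSZ j SG)).
 have S3 := snSB (snSB SG Sg1) (snSZ j SK).
 have n123 := null_comb (- j) S3 S12 e3 n12.
 have := null_comb (-1) (snP H (- j) S3 S12) (sn0 H) n123 N0.
 rewrite /neq => <-; congr N; ext s; rewrite /u' /w /j; by field.
have e6 := JP (j ^+ 2) h0 SK Sw.
have SJK := JS h0 SK; have SJw := JS h0 Sw; have SJu' := JS h0 Su'; have SJu := JS h0 Su.
have e7 : neq (J h u) (J h u').
 apply: null_le; first exact: snSB.
 by rewrite (le_trans (JNB h0 Su Su'))// e5.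
have Sq := snP H (j ^+ 2) SJK Sy.
have e8 : neq (J h u) (fun s => j ^+ 2 * J h K s + y s).
 have := null_comb 1 (snSB SJu' (snP H (j ^+ 2) SJK SJw)) (snSB SJw Sy) e6 e4.
 have S9 := snP H 1 (snSB SJu' (snP H (j ^+ 2) SJK SJw)) (snSB SJw Sy).
 move=> e9; have := null_comb 1 S9 (snSB SJu SJu') e9 e7.
 by rewrite /neq => <-; congr N; ext s; ring.
rewrite (le_trans (Ntri SJu Sy Sq))// e8 add0r.
rewrite (_ : (fun s => _) = fun s => j ^+ 2 * J h K s); last by ext s; ring.
rewrite (snZ H)// ger0_norm ?sqr_ge0// ler_pM2l ?exprn_gt0//.
by rewrite (le_trans (JN h0 SK))// (le_trans (JN j0 Sk1))// JN.
Qed.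

Lemma iterS_ n (h : R) x : 0 < h -> S x -> S (iter n (J h) x).
by move=> h0 Sx; elim: n => [//|n ih] /=; side. Qed.

Lemma iterB n (h : R) x y : 0 < h -> S x -> S y ->
 N (fun s => iter n (J h) x s - iter n (J h) y s) <= N (fun s => x s - y s).
move=> h0 Sx Sy; elim: n => [//|n ih] /=.
by apply: le_trans ih; apply: JNB => //; exact: iterS_.
Qed.

Lemma iterN n (h : R) x : 0 < h -> S x -> N (iter n (J h) x) <= N x.
move=> h0 Sx; elim: n => [//|n ih] /=.
by apply: le_trans ih; apply: JN => //; exact: iterS_.
Qed.

Lemma iterL n (h : R) u g : 0 < h -> L u g -> L (iter n (J h) u) (iter n (J h) g).
by move=> h0 Lu; elim: n => [//|n ih] /=; exact: L_J. Qed.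

Lemma iterP n (h a : R) x y : 0 < h -> S x -> S y ->
 neq (iter n (J h) (fun s => a * x s + y s)) (fun s => a * iter n (J h) x s + iter n (J h) y s).
move=> h0 Sx Sy; elim: n => [|n ih]; first exact: neq_refl.
have S1 := iterS_ n h0 Sx; have S2 := iterS_ n h0 Sy; have S3 := iterS_ n h0 (snP H a Sx Sy).
rewrite /=; apply: (neq_trans _ _ _ _ (JP a h0 S1 S2)).
- side.
- by apply: JS => //; exact: snP.
- by apply: snP => //; side.
- apply: null_le; first by apply: snSB; apply: JS => //; exact: snP.
 by rewrite (le_trans (JNB h0 S3 (snP H a S1 S2)))// ih.
Qed.

Lemma iter_step n (h : R) u g : 0 < h -> L u g ->
 N (fun s => iter n (J h) u s - u s) <= n%:R * h * N g.
move=> h0 Lu; have [Su Sg] := LS Lu; elim: n => [|n ih].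
 by rewrite !mul0r; under [X in N X]eq_fun do rewrite subrr; rewrite N0.
have Sn := iterS_ n h0 Su; have Sn1 := iterS_ n.+1 h0 Su.
rewrite (le_trans (Ntri Sn1 Su Sn))//.
rewrite (_ : n.+1%:R * _ * _ = h * N g + n%:R * h * N g); last by rewrite -natr1; ring.
rewrite lerD//.
apply: (le_trans (J_step h0 (iterL n h0 Lu))).
by rewrite ler_pM2l// iterN.
Qed.

Lemma iter_half n (h : R) u g v : 0 < h -> L u g -> L g v ->
 N (fun s => iter n (J h) u s - iter (n * 2) (J (h / 2)) u s) <= n%:R * (h / 2) ^+ 2 * N v.
move=> h0; have j0 : 0 < h / 2 by rewrite divr_gt0.
elim: n u g v => [|n ih] u g v Lu Lg.
 by rewrite !mul0r /=; under [X in N X]eq_fun do rewrite subrr; rewrite N0.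
have [Su Sg] := LS Lu; have [_ Sk] := LS Lg.
rewrite mulSn addnC !iterSr iterD /=.
set w := J (h / 2) (J (h / 2) u).
have Lw : L w (J (h / 2) (J (h / 2) g)) by do 2 apply: L_J => //.
have Lv' : L (J (h / 2) (J (h / 2) g)) (J (h / 2) (J (h / 2) v)) by do 2 apply: L_J => //.
have [Sw _] := LS Lw; have SJ := JS h0 Su.
rewrite (le_trans (Ntri (iterS_ n h0 SJ) (iterS_ (n * 2) j0 Sw) (iterS_ n h0 Sw)))//.
rewrite (_ : n.+1%:R * _ * _ = n%:R * (h / 2) ^+ 2 * N v + (h / 2) ^+ 2 * N v); last by rewrite -natr1; ring.
rewrite addrC lerD//.
 apply: (le_trans (ih _ _ _ Lw Lv')); rewrite ler_wpM2l//.
  side.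
 have Sk1 := JS j0 Sk; by rewrite (le_trans (JN j0 Sk1))// JN.
by apply: (le_trans (iterB n h0 SJ Sw)); exact: (J_half h0 Lu Lg).
Qed.

Definition hk (k : nat) : R := 2^-1 ^+ k.
Definition nk (k : nat) (t : R) : nat := Num.truncn (t / hk k).
(** Dyadic steps make each refinement a halving, to which [J_half] applies. The part of t beyond the
    last full step is dropped. *)
Definition euler (k : nat) (t : R) f := iter (nk k t) (J (hk k)) f.

Lemma hk0 k : 0 < hk k. Proof. by rewrite exprn_gt0. Qed.
Lemma hkS k : hk k.+1 = hk k / 2. Proof. by rewrite /hk exprSr. Qed.
Lemma nk_le k t : 0 <= t -> (nk k t)%:R * hk k <= t.
move=> t0; rewrite -ler_pdivlMr ?hk0// /nk truncn_le// divr_ge0// ltW// hk0//.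
Qed.
Lemma nk_gt k t : t < (nk k t).+1%:R * hk k.
by rewrite -ltr_pdivrMr ?hk0// /nk truncnS_gt. Qed.
Lemma nk_double k t : 0 <= t -> nk k.+1 t = (nk k t * 2)%N \/ nk k.+1 t = (nk k t * 2).+1.
move=> t0; have a1 := nk_le k t0; have a2 := nk_gt k t.
have b1 := nk_le k.+1 t0; have b2 := nk_gt k.+1 t.
have l1 : (nk k t * 2 < (nk k.+1 t).+1)%N.
 rewrite -(ltr_nat R) -(ltr_pM2r (hk0 k.+1)); apply: le_lt_trans b2.
 by rewrite natrM hkS; lra.
have l2 : (nk k.+1 t < (nk k t).+1 * 2)%N.
 rewrite -(ltr_nat R) -(ltr_pM2r (hk0 k.+1)); apply: (le_lt_trans b1).
 by rewrite natrM hkS; lra.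
by move: l1 l2; rewrite mulSn ltnS leq_eqVlt => /predU1P[<-|l1]; [left|
 rewrite addSn addSn add0n !ltnS => l2; right; apply/eqP; rewrite eqn_leq l1 l2].
Qed.

Lemma eulerS k t f : S f -> S (euler k t f).
by move=> Sf; apply: iterS_ => //; exact: hk0. Qed.
Lemma eulerB k t x y : S x -> S y -> N (fun s => euler k t x s - euler k t y s) <= N (fun s => x s - y s).
by move=> Sx Sy; apply: iterB => //; exact: hk0. Qed.

(** Refining the mesh costs the halving error of [iter_half], plus one extra half step when the new
    number of steps is odd. *)
Lemma euler_step k t u g v : 0 <= t -> L u g -> L g v ->
 N (fun s => euler k.+1 t u s - euler k t u s) <= (t * N v + N g) * hk k.
move=> t0 Lu Lg; have [Su Sg] := LS Lu; have [_ Sv] := LS Lg.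
have h0 := hk0 k; have h1 := hk0 k.+1.
have Ng := N_ge0 Sg; have Nv := N_ge0 Sv.
set n := nk k t; set y := iter (n * 2) (J (hk k.+1)) u.
have Sy : S y by exact: iterS_.
have A : N (fun s => euler k.+1 t u s - y s) <= hk k.+1 * N g.
 rewrite /euler /y; have [->|->] := nk_double k t0.
  by under [X in N X]eq_fun do rewrite subrr; rewrite N0 mulr_ge0// ltW.
 rewrite /= (le_trans (J_step h1 (iterL _ h1 Lu)))//.
 by rewrite ler_pM2l// iterN.
have B : N (fun s => y s - euler k t u s) <= n%:R * (hk k / 2) ^+ 2 * N v.
 rewrite NC//; last exact: eulerS.
 by rewrite /y hkS; exact: (iter_half n h0 Lu Lg).
apply: (le_trans (Ntri (eulerS _ _ Su) (eulerS _ _ Su) Sy)).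
apply: (le_trans (lerD A B)); rewrite hkS.
have := nk_le k t0; rewrite -/n => C.
have C' : n%:R * (hk k / 2) ^+ 2 * N v <= t * hk k / 4 * N v.
 by rewrite ler_wpM2r// (_ : _ * _ = n%:R * hk k * (hk k / 4)) -?[leRHS]mulrA ?ler_wpM2r//; [rewrite divr_ge0// ltW|field].
have C'' : 0 <= t * hk k * N v by rewrite !mulr_ge0// ltW.
have D : 0 <= hk k * N g by rewrite mulr_ge0// ltW.
lra.
Qed.

Lemma nlim_uniq (z : nat -> T -> R) x y : (forall n, S (z n)) -> S x -> S y ->
 to0 (fun n => N (fun s => z n s - x s)) -> to0 (fun n => N (fun s => z n s - y s)) -> neq x y.
move=> Sz Sx Sy hx hy; apply: neq_small => // e e0.
have [k /(_ _ (leqnn k)) hk_] := to0D hx hy e0.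
by apply: le_trans hk_; rewrite (le_trans (Ntri Sx Sy (Sz k)))// NC.
Qed.

Lemma geo_cauchy (z : nat -> T -> R) (C : R) : (forall n, S (z n)) -> 0 <= C ->
 (forall n, N (fun s => z n.+1 s - z n s) <= C * hk n) ->
 forall n m, (n <= m)%N -> N (fun s => z m s - z n s) <= 2 * C * hk n.
move=> Sz C0 hz n m /subnKC <-; move: (m - n)%N => k.
suff : N (fun s => z (n + k)%N s - z n s) <= 2 * C * (hk n - hk (n + k)).
 move=> /le_trans; apply; rewrite ler_wpM2l ?mulr_ge0//.
 by rewrite gerBl ltW// hk0.
elim: k => [|k ih].
 by rewrite addn0 subrr mulr0; under [X in N X]eq_fun do rewrite subrr; rewrite N0.
rewrite (le_trans (Ntri (Sz _) (Sz n) (Sz (n + k)%N)))// addnS.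
apply: (le_trans (lerD (hz _) ih)); rewrite hkS; lra.
Qed.

Lemma ncauchy_approx (z : nat -> T -> R) : (forall n, S (z n)) ->
 (forall e : R, 0 < e -> exists w : nat -> T -> R, [/\ forall n, S (w n), ncauchy w &
  forall n, N (fun s => z n s - w n s) <= e]) -> ncauchy z.
move=> Sz h e e0; have e3 : 0 < e / 3 by rewrite divr_gt0.
have [w [Sw cw zw]] := h _ e3; have [k hk_] := cw _ e3.
exists k => n m hn hm.
rewrite (le_trans (Ntri (Sz n) (Sz m) (Sw n)))//.
have h1 := zw n; have h2 := Ntri (Sw n) (Sz m) (Sw m); have h3 := hk_ n m hn hm.
have := zw m; rewrite NC// => h4; lra.
Qed.

(** For u in the domain of L, the vector J h u lies in the domain of L^2, because its image J h g is
    again in the range of J. It is close to u for small h; the + 1 in the choice of h covers a null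
    g. *)
Lemma L2dense f (e : R) : S f -> 0 < e ->
 exists u g v, [/\ L u g, L g v & N (fun s => f s - u s) <= e].
move=> Sf e0; have e2 : 0 < e / 2 by rewrite divr_gt0.
have [u [g [Lu fu]]] := Ldense Sf e2; have [Su Sg] := LS Lu.
have Ng := N_ge0 Sg; pose h := e / 2 / (N g + 1).
have h0 : 0 < h by rewrite !divr_gt0//; lra.
exists (J h u), (J h g), (fun s => h^-1 * (J h g s - g s)); split; [exact: L_J|side|].
have SJ := JS h0 Su.
rewrite (le_trans (Ntri Sf SJ Su))// [e]splitr lerD// NC//.
rewrite (le_trans (J_step h0 Lu))// /h mulrAC ler_pdivrMr; last by lra.
by rewrite ler_wpM2l//; lra.
Qed.

Lemma euler_cauchy t f : 0 <= t -> S f -> ncauchy (fun k => euler k t f).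
move=> t0 Sf; apply: ncauchy_approx; first by move=> n; exact: eulerS.
move=> e e0; have [u [g [v [Lu Lg fu]]]] := L2dense Sf e0.
have [Su Sg] := LS Lu; have [_ Sv] := LS Lg.
exists (fun k => euler k t u); split; first by move=> n; exact: eulerS.
 move=> e' e'0; set C := t * N v + N g.
 have C0 : 0 <= C by rewrite addr_ge0 ?mulr_ge0 ?N_ge0.
 have hC : to0 (fun n => 2 * C * hk n).
  apply: to0Z; first by rewrite mulr_ge0.
  by apply: cvg_to0; apply: cvg_expr; rewrite ger0_norm// invf_lt1// ltr1n.
 have [k hk_] := hC _ e'0; exists k => n m hn hm.
 have A := @geo_cauchy (fun k => euler k t u) C (fun n => eulerS n t Su) C0 (fun n => euler_step n t0 Lu Lg).
 have [nm|/ltnW mn] := leqP n m.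
  by rewrite NC; [apply: (le_trans (A _ _ nm)); side|exact: eulerS|exact: eulerS].
 by apply: (le_trans (A _ _ mn)); side.
by move=> n; apply: (le_trans (eulerB _ _ Sf Su)).
Qed.

(** A limit is chosen for each f, so linearity and the semigroup law hold up to seminorm 0. *)
Definition sg (t : R) f : T -> R := get [set w | S w /\ to0 (fun n => N (fun s => euler n t f s - w s))].

Lemma sgP t f : 0 <= t -> S f -> S (sg t f) /\ to0 (fun n => N (fun s => euler n t f s - sg t f s)).
move=> t0 Sf; rewrite /sg; apply: (@getPex _ [set w | S w /\ to0 (fun n => N (fun s => euler n t f s - w s))]).
by have [w Sw hw] := Hc (fun n => eulerS n t Sf) (euler_cauchy t0 Sf); exists w.
Qed.

Lemma N_lim_le (z : nat -> T -> R) w (c : R) b : (forall n, S (z n)) -> S w ->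
 to0 (fun n => N (fun s => z n s - w s)) -> to0 b -> (forall n, N (z n) <= c + b n) -> N w <= c.
move=> Sz Sw hz hb h; apply/ler_addgt0Pr => e e0.
have [k /(_ _ (leqnn k)) hk_] := to0D hz hb e0.
rewrite (le_trans (N_le Sw (Sz k)))// NC//; have := h k; lra.
Qed.

Lemma sgN t f : 0 <= t -> S f -> N (sg t f) <= N f.
move=> t0 Sf; have [Sg hg] := sgP t0 Sf.
apply: (N_lim_le (fun n => eulerS n t Sf) Sg hg to0_cst0) => n.
by rewrite addr0; apply: iterN => //; exact: hk0.
Qed.

Lemma sg_lin t (a : R) x y : 0 <= t -> S x -> S y ->
 neq (sg t (fun s => a * x s + y s)) (fun s => a * sg t x s + sg t y s).
move=> t0 Sx Sy; have [Sgx hx] := sgP t0 Sx; have [Sgy hy] := sgP t0 Sy.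
have Sxy := snP H a Sx Sy; have [Sg hg] := sgP t0 Sxy.
apply: (nlim_uniq (fun n => eulerS n t Sxy)) => //; first exact: snP.
apply: (to0_le _ (to0D (to0Z (normr_ge0 a) hx) hy)) => n.
have Ex := eulerS n t Sx; have Ey := eulerS n t Sy; have Exy := eulerS n t Sxy.
have Sc := snP H a Ex Ey.
rewrite (le_trans (Ntri Exy (snP H a Sgx Sgy) Sc))// (iterP _ _ (hk0 n) Sx Sy) add0r.
rewrite (_ : (fun s => _) = fun s => a * (euler n t x s - sg t x s) + (euler n t y s - sg t y s)); last first.
 by ext s; rewrite /euler; ring.
rewrite (le_trans (snD H _ _))//; [by apply: snSZ; exact: snSB|exact: snSB|].
by rewrite (snZ H)//; exact: snSB.
Qed.

Lemma sgB t x y : 0 <= t -> S x -> S y -> N (fun s => sg t x s - sg t y s) <= N (fun s => x s - y s).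
move=> t0 Sx Sy; have := sg_lin (-1) t0 Sy Sx.
rewrite (_ : (fun s => -1 * y s + x s) = fun s => x s - y s); last by ext s; ring.
rewrite (_ : (fun s => -1 * sg t y s + sg t x s) = fun s => sg t x s - sg t y s); last by ext s; ring.
have Sxy := snSB Sx Sy; have [Sg _] := sgP t0 Sxy.
have [Sgx _] := sgP t0 Sx; have [Sgy _] := sgP t0 Sy.
by move=> /(neqN Sg (snSB Sgx Sgy)) <-; exact: sgN.
Qed.

Lemma nk_add k s t : 0 <= s -> 0 <= t ->
 nk k (s + t) = (nk k s + nk k t)%N \/ nk k (s + t) = (nk k s + nk k t).+1.
move=> s0 t0; have st0 : 0 <= s + t by rewrite addr_ge0.
have a1 := nk_le k s0; have a2 := nk_gt k s; have b1 := nk_le k t0; have b2 := nk_gt k t.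
have c1 := nk_le k st0; have c2 := nk_gt k (s + t); have h0 := hk0 k.
have l1 : (nk k s + nk k t < (nk k (s + t)).+1)%N.
 rewrite -(ltr_nat R) -(ltr_pM2r h0); apply: le_lt_trans c2.
 by rewrite natrD; lra.
have l2 : (nk k (s + t) < (nk k s).+1 + (nk k t).+1)%N.
 rewrite -(ltr_nat R) -(ltr_pM2r h0); apply: (le_lt_trans c1).
 by rewrite natrD; lra.
by move: l1 l2; rewrite ltnS leq_eqVlt => /predU1P[<-|l1]; [left|
 rewrite addSn addnS !ltnS => l2; right; apply/eqP; rewrite eqn_leq l1 l2].
Qed.

(** The step counts for s + t and for s followed by t differ by at most one, and one step moves a
    vector of the domain by at most [hk n] times the norm of its image. Density and contractivity
    extend the identity to all f. *)
Lemma sg_add s t f : 0 <= s -> 0 <= t -> S f -> neq (sg (s + t) f) (sg s (sg t f)).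
move=> s0 t0 Sf; have st0 : 0 <= s + t by rewrite addr_ge0.
have [Stf _] := sgP t0 Sf; have [Sst _] := sgP st0 Sf; have [Sstf _] := sgP s0 Stf.
apply: neq_small => // e e0; have e2 : 0 < e / 2 by rewrite divr_gt0.
have [u [g [Lu fu]]] := Ldense Sf e2; have [Su Sg] := LS Lu.
have [Stu htu] := sgP t0 Su; have [Sstu hstu] := sgP st0 Su; have [Ssu hsu] := sgP s0 Stu.
have E : neq (sg (s + t) u) (sg s (sg t u)).
 apply: (nlim_uniq (fun n => eulerS n (s + t) Su) Sstu Ssu hstu).
 have h1 : to0 (fun n => N g * hk n).
  apply: to0Z; first exact: N_ge0.
  by apply: cvg_to0; apply: cvg_expr; rewrite ger0_norm// invf_lt1// ltr1n.
 apply: (to0_le _ (to0D h1 (to0D htu hsu))) => n.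
 have Et := eulerS n t Su; have Est := eulerS n (s + t) Su; have Ess := eulerS n s Et.
 have Eg := eulerS n s Stu.
 rewrite (le_trans (Ntri Est Ssu Ess))// lerD//.
  have -> : euler n s (euler n t u) = iter (nk n s + nk n t) (J (hk n)) u by rewrite iterD.
  rewrite /euler; have [->|->] := nk_add n s0 t0.
   under [X in N X]eq_fun do rewrite subrr; rewrite N0 mulr_ge0 ?N_ge0// ltW// hk0//.
  rewrite mulrC (le_trans (J_step (hk0 n) (iterL _ (hk0 n) Lu)))//.
  by rewrite ler_pM2l ?hk0// iterN// hk0.
 by rewrite (le_trans (Ntri Ess Ssu Eg))// lerD2r; exact: eulerB.
rewrite (le_trans (Ntri Sst Sstf Sstu))// [e]splitr lerD//.
 by rewrite (le_trans (sgB st0 Sf Su)).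
rewrite (le_trans (Ntri Sstu Sstf Ssu))// E add0r.
by rewrite (le_trans (sgB s0 Stu Stf))// (le_trans (sgB t0 Su Sf))// NC.
Qed.

Lemma sg_step t u g : 0 <= t -> L u g -> N (fun s => sg t u s - u s) <= t * N g.
move=> t0 Lu; have [Su Sg] := LS Lu; have [Stu htu] := sgP t0 Su.
apply: (N_lim_le (fun n => snSB (eulerS n t Su) Su) (snSB Stu Su) _ to0_cst0).
 apply: to0_le htu => n; rewrite (_ : (fun s => _) = fun s => euler n t u s - sg t u s)//.
 by ext s; ring.
move=> n; rewrite addr0 (le_trans (iter_step _ (hk0 n) Lu))// ler_wpM2r ?N_ge0//.
exact: nk_le.
Qed.

Lemma sg_cont f (e : R) : S f -> 0 < e ->
 exists2 del : R, 0 < del & forall t, 0 <= t <= del -> N (fun s => sg t f s - f s) <= e.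
move=> Sf e0; have e3 : 0 < e / 3 by rewrite divr_gt0.
have [u [g [Lu fu]]] := Ldense Sf e3; have [Su Sg] := LS Lu.
have Ng := N_ge0 Sg.
exists (e / 3 / (N g + 1)); first by rewrite !divr_gt0//; lra.
move=> t /andP[t0 ht]; have [Stf _] := sgP t0 Sf; have [Stu _] := sgP t0 Su.
have h1 := sgB t0 Sf Su; have h2 := sg_step t0 Lu.
have h3 := Ntri Stf Sf Stu; have h4 := Ntri Stu Sf Su.
have h5 : t * N g <= e / 3.
 rewrite (@le_trans _ _ (e / 3 / (N g + 1) * N g))// ?ler_wpM2r//.
 by rewrite mulrAC ler_pdivrMr//; lra.
by move: h4; rewrite [X in _ <= _ + X]NC// => h4; lra.
Qed.

(** The remainder is a sum of terms h (J^m g - g). Each is small once g is close to some u' of the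
    domain, and comparing g with u' before and after the iteration gives the factor 2. In this way
    differentiability at 0 is reached for every u in the domain of L, not only of L^2. *)
Lemma iter_gen n (h : R) u g u' g' : 0 < h -> L u g -> L u' g' ->
 N (fun s => iter n (J h) u s - u s - n%:R * h * g s) <=
 n%:R * h * (2 * N (fun s => g s - u' s) + n%:R * h * N g').
move=> h0 Lu Lg; have [Su Sg] := LS Lu; have [Su' Sg'] := LS Lg.
have Ng' := N_ge0 Sg'.
have key m : N (fun s => iter m (J h) g s - g s) <= 2 * N (fun s => g s - u' s) + m%:R * h * N g'.
 have Sm := iterS_ m h0 Sg; have Sm' := iterS_ m h0 Su'.
 have h1 := Ntri Sm Sg Sm'; have h2 := Ntri Sm' Sg Su'.
 have h3 := iterB m h0 Sg Su'; have h4 := iter_step m h0 Lg.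
 by move: h2; rewrite [X in _ <= _ + X]NC// => h2; lra.
elim: n => [|n ih].
 rewrite !mul0r (_ : (fun s => _) = fun=> 0) ?N0//.
 by apply/funext => s /=; ring.
have Sn := iterS_ n h0 Su; have Sng := iterS_ n.+1 h0 Sg; have Sn1 := iterS_ n.+1 h0 Su.
have e1 := J_sub h0 (iterL n h0 Lu).
have A : N (fun s => iter n.+1 (J h) u s - iter n (J h) u s - h * g s) <= h * N (fun s => iter n.+1 (J h) g s - g s).
 have S1 := snSB (snSB Sn1 Sn) (snSZ h Sg); have S2 := snSZ h (snSB Sng Sg).
 rewrite (@neqN _ (fun s => h * (iter n.+1 (J h) g s - g s)))//.
  by rewrite (snZ H) ?gtr0_norm//; exact: snSB.
 rewrite /neq -e1; congr N; apply/funext => s /=; ring.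
rewrite (_ : (fun s => _) = fun s => (iter n.+1 (J h) u s - iter n (J h) u s - h * g s) +
 (iter n (J h) u s - u s - n%:R * h * g s)); last first.
 by ext s; rewrite -natr1; ring.
apply: (le_trans (snD H _ _)).
- exact: (snSB (snSB Sn1 Sn) (snSZ h Sg)).
- exact: (snSB (snSB Sn Su) (snSZ _ Sg)).
have B' : h * N (fun s => iter n.+1 (J h) g s - g s) <= h * (2 * N (fun s => g s - u' s) + n.+1%:R * h * N g').
 by rewrite ler_pM2l.
have C : n%:R * h * (n%:R * h * N g') <= n%:R * h * (n.+1%:R * h * N g').
 by rewrite ler_wpM2l ?mulr_ge0 ?(ltW h0)// ler_wpM2r// ler_wpM2r ?(ltW h0)// ler_nat.
move: A B' ih C; rewrite -!(natr1 n); set a := n%:R; lra.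
Qed.

Lemma sg_gen_bound t u g u' g' : 0 <= t -> L u g -> L u' g' ->
 N (fun s => sg t u s - u s - t * g s) <= t * (2 * N (fun s => g s - u' s) + t * N g').
move=> t0 Lu Lg; have [Su Sg] := LS Lu; have [Su' Sg'] := LS Lg.
have Ng := N_ge0 Sg; have Ng' := N_ge0 Sg'; have Nd := N_ge0 (snSB Sg Su').
have [Stu htu] := sgP t0 Su.
have h1 : to0 (fun n => N g * hk n).
 apply: to0Z => //.
 by apply: cvg_to0; apply: cvg_expr; rewrite ger0_norm// invf_lt1// ltr1n.
have SE n : S (fun s => euler n t u s - u s - t * g s).
 by apply: snSB; [apply: snSB => //; exact: eulerS|exact: snSZ].
apply: (N_lim_le SE _ _ h1).
- by apply: snSB; [exact: snSB|exact: snSZ].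
- apply: to0_le htu => n; rewrite (_ : (fun s => _) = fun s => euler n t u s - sg t u s)//.
 by ext s; ring.
move=> n; have := iter_gen (nk n t) (hk0 n) Lu Lg; rewrite -/(euler n t u).
have a1 := nk_le n t0; have a2 := nk_gt n t; set c := (nk n t)%:R * hk n in a1 *.
have a3 : t - c <= hk n by move: a2; rewrite -natr1 mulrDl mul1r -/c; lra.
move=> B; rewrite (_ : (fun s => _) = fun s => (euler n t u s - u s - c * g s) + (c - t) * g s); last first.
 by ext s; ring.
apply: (le_trans (snD H _ _)); [|exact: snSZ|].
 by apply: snSB; [apply: snSB => //; exact: eulerS|exact: snSZ].
rewrite (snZ H)//; apply: lerD.
 apply: (le_trans B); rewrite ler_pM// ?addr_ge0 ?mulr_ge0 ?(ltW (hk0 n))//.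
 by rewrite lerD2l ler_wpM2r.
by rewrite mulrC ler_wpM2l// distrC ger0_norm// subr_ge0.
Qed.

Lemma sg_gen u g (e : R) : L u g -> 0 < e -> exists2 del : R, 0 < del & forall t, 0 < t <= del ->
 N (fun s => (sg t u s - u s) / t - g s) <= e.
move=> Lu e0; have [Su Sg] := LS Lu; have e4 : 0 < e / 4 by rewrite divr_gt0.
have [u' [g' [Lg fu]]] := Ldense Sg e4; have [Su' Sg'] := LS Lg.
have Ng' := N_ge0 Sg'.
exists (e / 4 / (N g' + 1)); first by rewrite !divr_gt0//; lra.
move=> t /andP[t0 ht]; have t0' := ltW t0; have [Stu _] := sgP t0' Su.
rewrite (_ : (fun s => _) = fun s => t^-1 * (sg t u s - u s - t * g s)); last first.
 by ext s; field; rewrite gt_eqF.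
rewrite (snZ H); last by apply: snSB; [exact: snSB|exact: snSZ].
rewrite gtr0_norm ?invr_gt0// ler_pdivrMl//.
apply: (le_trans (sg_gen_bound t0' Lu Lg)); rewrite ler_pM2l//.
have h5 : t * N g' <= e / 4.
 rewrite (@le_trans _ _ (e / 4 / (N g' + 1) * N g'))// ?ler_wpM2r//.
 by rewrite mulrAC ler_pdivrMr//; lra.
lra.
Qed.

(** Maximality of the generator. With w = (1 - L)^{-1} (u - f), the difference z = u - w has
    derivative z at 0 along the semigroup, so (1 + t) N z <= N (T_t z) + t e <= N z + t e, which
    forces z to be null. *)
Lemma gen_sg u f : S u -> S f ->
 (forall e : R, 0 < e -> exists2 del : R, 0 < del & forall t, 0 < t <= del ->
  N (fun s => (sg t u s - u s) / t - f s) <= e) -> L u f.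
move=> Su Sf h; have Suf := snSB Su Sf.
pose w := J 1 (fun s => u s - f s).
have Lw := LJ ltr01 Suf; rewrite invr1 -/w in Lw; have [Sw Sw'] := LS Lw.
have Sz := snSB Su Sw.
have nz : N (fun s => u s - w s) = 0.
 apply: null_le => //; apply/ler_addgt0Pr => e e0; rewrite add0r.
 have e2 : 0 < e / 2 by rewrite divr_gt0.
 have [d1 d10 h1] := h _ e2; have [d2 d20 h2] := sg_gen Lw e2.
 pose t := Num.min d1 d2; have t0 : 0 < t by rewrite lt_min d10.
 have t0' := ltW t0.
 have {}h1 := h1 t; have {}h2 := h2 t.
 have {}h1 : N (fun s => (sg t u s - u s) / t - f s) <= e / 2 by apply: h1; rewrite t0 ge_min lexx.
 have {}h2 : N (fun s => (sg t w s - w s) / t - (1 * (w s - (u s - f s)))) <= e / 2.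
  by apply: h2; rewrite t0 ge_min lexx orbT.
 have [Stu _] := sgP t0' Su; have [Stw _] := sgP t0' Sw.
 have S1 : S (fun s => (sg t u s - u s) / t - f s).
  by under eq_fun do rewrite mulrC; apply: snSB => //; apply: snSZ; exact: snSB.
 have S2 : S (fun s => (sg t w s - w s) / t - 1 * (w s - (u s - f s))).
  by under eq_fun do rewrite mulrC; apply: snSB => //; apply: snSZ; exact: snSB.
 have h3 := NBD S1 S2.
 have h4 : N (fun s => (1 + t) * (u s - w s)) <= N (fun s => sg t u s - sg t w s) + t * e.
  rewrite (le_trans (N_le (snSZ (1 + t) Sz) (snSB Stu Stw)))// lerD2l.
  rewrite (_ : (fun s => _) = fun s => - t * ((sg t u s - u s) / t - f s - ((sg t w s - w s) / t - 1 * (w s - (u s - f s))))); last first.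
   by ext s; field; rewrite gt_eqF.
  rewrite (snZ H) ?normrN ?gtr0_norm ?ler_pM2l//; [lra|exact: snSB].
 have h5 := sgB t0' Su Sw.
 move: h4; rewrite (snZ H)// gtr0_norm; last by lra.
 set a := N _ in h5 *; set b := N _ in h5 *; rewrite -/b => h4.
 have : t * b <= t * e by lra.
 by rewrite ler_pM2l.
apply: (Lneq Su Sf _ _ Lw); first exact: neq_sym.
rewrite /neq -nz NC//; congr N; ext s; ring.
Qed.

End hille_yosida.

(** * Exhaustion by balls of the sup norm *)

Section exhausting.
Variables (R : realType) (d : nat).
Local Notation E := 'rV[R]_d.

Definition balln (n : nat) : set E := [set x | `|x| < n.+1%:R].

Lemma open_balln n : open (balln n).
by apply: (@open_comp _ _ (fun x : E => `|x|) [set y | y < n.+1%:R]) => [x _|]; [exact: norm_continuous|side]. Qed.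

Lemma coord_le_norm (x : E) i : `|x ord0 i| <= `|x|.
rewrite [leRHS]/Num.norm /= mx_normrE; exact: (le_bigmax _ (fun ij => `|x ij.1 ij.2|) (ord0, i)). Qed.

Lemma norm_cbox (M : R) (x : E) : 0 <= M -> cbox 0 M x -> `|x| <= M.
move=> M0 h; rewrite [leLHS]/Num.norm /= mx_normrE; apply/bigmax_leP; split=> // -[i j] _ /=.
by have := h j; rewrite (ord1 i) mxE subr0.
Qed.

Lemma balln_cbox n : balln n `<=` cbox 0 n.+1%:R.
by move=> x xn i; rewrite mxE subr0 (le_trans (coord_le_norm x i))// ltW. Qed.

Lemma compact_balln K : compact K -> exists n, K `<=` balln n.
move=> /compact_cbox[M KM]; exists (Num.truncn `|M|) => x /KM xM; rewrite /balln /=.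
apply: le_lt_trans (truncnS_gt `|M|); apply: norm_cbox => // i; exact: le_trans (xM i) (ler_norm M).
Qed.

Lemma ballnS m n : (m <= n)%N -> balln m `<=` balln n.
by move=> mn x /= h; rewrite /balln /= (lt_le_trans h)// ler_nat. Qed.

Lemma in_balln x : exists n, balln n x.
by exists (Num.truncn `|x|); rewrite /balln /= truncnS_gt. Qed.

Lemma precompact_balln n : precompact (balln n).
rewrite precompactE; apply: (@subclosed_compact _ _ (cbox 0 n.+1%:R)).
- exact: closed_closure.
- exact: cbox_compact.
- rewrite [X in _ `<=` X]((closure_id _).1 (rV_compact_closed (@cbox_compact _ _ _ _))).
 by apply: closure_subset; exact: balln_cbox.
Qed.

Lemma precompact_sub (V : set E) : precompact V -> exists2 K, compact K & V `<=` K.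
by rewrite precompactE => h; exists (closure V) => //; exact: subset_closure. Qed.

End exhausting.

(** * The L^1 seminorm *)

Section L1_norm.
Context d (T : measurableType d) (R : realType).
Variable mu : {measure set T -> \bar R}.
Implicit Types f g h : T -> R.
Local Notation Lint := (Lint mu).
Local Notation N1 f := (Ig mu (fun x => `|f x|)).

Lemma N1D f g : Lint f -> Lint g -> Ig mu (fun x => `|f x + g x|) <= N1 f + N1 g.
move=> i j; rewrite -IgD; [|side|side].
apply: Ig_le => [||x]; [side|side|exact: ler_normD].
Qed.

Lemma N1_tri g f h : Lint f -> Lint g -> Lint h ->
 Ig mu (fun x => `|f x - h x|) <= Ig mu (fun x => `|f x - g x|) + Ig mu (fun x => `|g x - h x|).
move=> i j k; have := N1D (LintB i j) (LintB j k).
by under eq_fun do rewrite addrA subrK.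
Qed.

Lemma N1C f g : Ig mu (fun x => `|f x - g x|) = Ig mu (fun x => `|g x - f x|).
by under eq_fun do rewrite distrC. Qed.

Lemma N1Z (t : R) f : Lint f -> Ig mu (fun x => `|t * f x|) = `|t| * N1 f.
by move=> i; under eq_fun do rewrite normrM; rewrite IgZ//; side. Qed.

Lemma N1_le f g : Lint f -> Lint g -> N1 f <= N1 g + Ig mu (fun x => `|f x - g x|).
by move=> i j; have := N1D j (LintB i j); under eq_fun do rewrite addrCA subrr addr0.
Qed.

Lemma N1_ge0 f : 0 <= N1 f. Proof. exact: Ig_ge0. Qed.

Lemma N1_eq0 f g : Lint f -> Lint g -> Ig mu (fun x => `|f x - g x|) <= 0 -> {ae mu, forall x, f x = g x}.
move=> i j h; have ij := Lint_abs (LintB i j).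
have : {ae mu, forall x, `|f x - g x| = 0} by apply: (Ig_eq0 ij) => //; exact: aeW.
by apply: filterS => x /eqP; rewrite normr_eq0 subr_eq0 => /eqP.
Qed.

Lemma N1_ae f g : Lint f -> Lint g -> {ae mu, forall x, f x = g x} -> Ig mu (fun x => `|f x - g x|) = 0.
move=> i j e; rewrite -[RHS](Ig_cst0 mu); apply: Ig_ae => //; first side.
by apply: filterS e => x ->; rewrite subrr normr0.
Qed.

End L1_norm.

Section restrictions.
Variables (R : realType) (d : nat).
Local Notation E := 'rV[R]_d.
Implicit Types (f : E -> R) (V : set E).

Lemma restrict_off V f x : ~ V x -> (f \_ V) x = 0.
by move=> nV; rewrite patchE memNset. Qed.

Lemma restrict_in V f x : V x -> (f \_ V) x = f x.
by move=> Vx; rewrite patchE mem_set. Qed.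

Lemma restrict_abs V f x : `|(f \_ V) x| <= `|f x|.
by have [/restrict_in ->//|/restrict_off ->] := pselect (V x); rewrite normr0. Qed.
End restrictions.

(** * Functions on V as functions extended by zero *)

Section restriction.
Variables (R : realType) (d : nat).
Local Notation E := 'rV[R]_d.
Variable nu : {measure set E -> \bar R}.
Hypothesis nu_fin : forall K, compact K -> (nu K < +oo)%E.
Implicit Types (u v f g h : E -> R) (D F H : E -> E) (V U : set E).
Local Notation Sob := (Sob nu).

Definition rv V D : E -> E := fun x => (\1_V x : R) *: D x.

Lemma rv_in V D x : V x -> rv V D x = D x.
by move=> Vx; rewrite /rv indicE mem_set// scale1r. Qed.

Lemma rv_off V D x : ~ V x -> rv V D x = 0.
by move=> nV; rewrite /rv indicE memNset// scale0r. Qed.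

Lemma rv_coord V D i : (fun x => rv V D x ord0 i) = (fun x => D x ord0 i) \_ V.
ext x; have [Vx|nV] := pselect (V x); first by rewrite rv_in// restrict_in.
by rewrite rv_off// restrict_off// mxE.
Qed.

Lemma restrict_op V (op : R -> R) f : op 0 = 0 -> (fun x => op (f x)) \_ V = fun x => op ((f \_ V) x).
by move=> o0; ext x; have [Vx|nV] := pselect (V x); [rewrite !restrict_in|rewrite !restrict_off].
Qed.

Section on_V.
Variable V : set E.
Hypothesis oV : open V.
Let mV : measurable V := open_rV_measurable oV.

Lemma L1_on f : L1 nu V f <-> Lint nu (f \_ V).
by rewrite /L1 /Lint /= -restrict_EFin; exact: integrable_mkcond. Qed.

Lemma L2_on f : L2 nu V f <-> LL2 nu (f \_ V).
rewrite /L2 /LL2 /= -(restrict_op _ (op := fun t => t ^+ 2)) ?expr0n//.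
by split=> -[/(measurable_restrictT _ mV) m i]; split => //; apply/L1_on.
Qed.

Lemma L2_vec_on D : (forall i, L2 nu V (fun x => D x ord0 i)) <-> LLv nu (rv V D).
by split=> h i; [rewrite rv_coord; exact/L2_on|apply/L2_on; have := h i; rewrite rv_coord]. Qed.

Lemma H12_Sob u D : H12_0_grad nu V u D <-> Sob V (u \_ V) (rv V D).
have key (v_ : nat -> E -> R) : (forall n, test V (v_ n)) -> LL2 nu (u \_ V) -> LLv nu (rv V D) ->
  (fun n => \int[nu]_(x in V) ((v_ n x - u x) ^+ 2 + dotv (grad (v_ n) x - D x) (grad (v_ n) x - D x))%:E)%E @ \oo --> 0%E <->
  to0 (fun n => q0 nu (fun x => v_ n x - (u \_ V) x) (fun x => grad (v_ n) x - rv V D x)).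
 move=> tv Lu LD; rewrite -EFin_to0; last by move=> n; exact: q0_ge0.
 have -> : (fun n => (q0 nu (fun x => v_ n x - (u \_ V) x) (fun x => grad (v_ n) x - rv V D x))%:E) =
  (fun n => \int[nu]_(x in V) ((v_ n x - u x) ^+ 2 + dotv (grad (v_ n) x - D x) (grad (v_ n) x - D x))%:E)%E => //.
 ext n; rewrite -Ig_EFin; last first.
  by apply: Lint_q0; [exact: LL2B (LL2_test nu_fin (tv n)) Lu|exact: LLvB (LLv_grad nu_fin (tv n)) LD].
 rewrite [RHS]integral_mkcond; apply: eq_integral => x _; rewrite [RHS]patchE.
 have [Vx|nV] := pselect (V x); first by rewrite mem_set// restrict_in// rv_in.
 by rewrite memNset// restrict_off// rv_off// (test_off (tv n) nV) (grad_off (tv n) nV) !subr0 expr0n dotv0l addr0.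
split.
 move=> [/L2_on Lu /L2_vec_on LD [v_ [tv hv]]]; split=> //.
  by move=> x nV; rewrite restrict_off ?rv_off.
 by exists v_; split=> //; exact/key.
move=> [Lu LD _ [v_ [tv hv]]]; split; [exact/L2_on|exact/L2_vec_on|].
by exists v_; split=> //; exact/key.
Qed.

Lemma L1_cvg_on (u_ : nat -> E -> R) u : L1_cvg nu V u_ u <->
 [/\ forall n, Lint nu (u_ n \_ V), Lint nu (u \_ V) & to0 (fun n => Ig nu (fun x => `|(u_ n \_ V) x - (u \_ V) x|))].
have key : (forall n, Lint nu (u_ n \_ V)) -> Lint nu (u \_ V) ->
  (fun n => \int[nu]_(x in V) (`|u_ n x - u x|)%:E)%E = (fun n => (Ig nu (fun x => `|(u_ n \_ V) x - (u \_ V) x|))%:E).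
 move=> i j; ext n; rewrite -Ig_EFin; last side.
 rewrite [LHS]integral_mkcond; apply: eq_integral => x _; rewrite [LHS]patchE.
 have [Vx|nV] := pselect (V x); first by rewrite mem_set// !restrict_in.
 by rewrite memNset// !restrict_off// subrr normr0.
split=> [[i /L1_on j h]|[i j h]].
 have i' n : Lint nu (u_ n \_ V) by exact/L1_on.
 by split=> //; apply/EFin_to0; [move=> n; exact: N1_ge0|rewrite -key].
split; [by move=> n; exact/L1_on|exact/L1_on|].
by rewrite key//; apply/EFin_to0 => // n; exact: N1_ge0.
Qed.
End on_V.

Lemma restrictT f : f \_ setT = f. Proof. exact: patch_setT. Qed.

Lemma rvT D : rv setT D = D. Proof. by ext x; rewrite rv_in. Qed.

Lemma H12_SobT u D : H12_0_grad nu setT u D <-> Sob setT u D.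
by have := H12_Sob openT u D; rewrite restrictT rvT. Qed.

(* Countably many rational boxes cover the complement of the support. *)
Lemma compact_supp_ae u : LL2 nu u -> {ae nu, forall x, ~ msupp (fun U => \int[nu]_(x in U) (`|u x|)%:E)%E x -> u x = 0}.
move=> Lu; set K := msupp _.
pose N (p : 'rV[rat]_d * nat) := exists U, [/\ open U, cbox (rbox_c R p) (rbox_r R p) `<=` U & (\int[nu]_(x in U) (`|u x|)%:E = 0)%E].
have h : {ae nu, forall x, forall k, forall p : 'rV[rat]_d * nat, unpickle k = Some p -> N p -> cbox (rbox_c R p) (rbox_r R p) x -> u x = 0}.
 apply: ae_foralln => k; case e: (unpickle k : option ('rV[rat]_d * nat)%type) => [p|]; last by apply: aeW.
 have [[U [oU pU U0]]|nN] := pselect (N p); last by apply: aeW => x _ [<-].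
 have mU := open_rV_measurable oU; have mu' : measurable_fun U (EFin \o u).
  by apply/measurable_EFinP; apply: measurable_funTS; exact: Lu.1.
 have [h _] := ae_eq_integral_abs nu mU mu'; have : ae_eq nu U (EFin \o u) (cst 0%E) by apply: h.
 by apply: filterS => x hx q [<-] _ /pU/hx[].
apply: filterS h => x hx nK.
have [U [oU Ux U0]] : exists U, [/\ open U, U x & (\int[nu]_(x in U) (`|u x|)%:E = 0)%E].
 apply: contrapT => nU; apply: nK => U oU Ux; rewrite lt0e integral_ge0// andbT.
 by apply/eqP => e; apply: nU; exists U.
have [p [op pU]] := rbox_exists oU Ux.
by apply: (hx (pickle p) p (pickleK p)); [exists U|by move=> i; side].
Qed.
End restriction.

(** * Weak gradients and their uniqueness *)

Section logarithmic_derivative.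
Variables (R : realType) (d : nat).
Local Notation E := 'rV[R]_d.
Variable mu : {measure set E -> \bar R}.
Local Notation LL2 := (LL2 mu).
Hypothesis mu_fin : forall K, compact K -> (mu K < +oo)%E.
(** The logarithmic derivative of the measure, grad rho / rho for mu = rho dx. Lebesgue measure is
    the case b = 0, applied later to phi itself. *)
Variable b : 'I_d -> E -> R.
Hypothesis bL2 : forall i chi, test setT chi -> LL2 (fun x => chi x * b i x).
Hypothesis b_ibp : forall i u, test setT u -> Ig mu (pderiv i u) = - Ig mu (fun x => u x * b i x).
Implicit Types (u v eta chi : E -> R) (D F : E -> E) (V U : set E).
Local Notation Q0 := (q0 mu).
Local Notation LLv := (LLv mu).
Local Notation T := (setT : set E).

Local Notation SobM V u D chi := (Sob mu V (fun x => u x * chi x) (fun x => chi x *: D x + u x *: grad chi x)).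

(** A gradient by duality, through integration by parts against mu. It is determined a.e. by u,
    which the definition as a limit of gradients does not show by itself; this is the closability of
    the gradient. *)
Definition WG u D := [/\ mfunT u, mvec D,
 forall chi, test T chi -> LL2 (fun x => chi x * u x) /\ forall i, LL2 (fun x => chi x * D x ord0 i) &
 forall i eta, test T eta -> Ig mu (fun x => D x ord0 i * eta x) =
  - Ig mu (fun x => u x * (pderiv i eta x + b i x * eta x))].

Lemma cut1 V eta : open V -> test V eta -> exists chi, [/\ test V chi, forall x, 0 <= chi x <= 1,
 forall x, chi x * eta x = eta x & forall i x, chi x * pderiv i eta x = pderiv i eta x].
move=> oV [seta [K [cK KV e0]]]; have [chi [tchi c01 cK1]] := cutoff cK oV KV.
exists chi; split=> // [x|i x]; have [Kx|nK] := pselect (K x).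
- by rewrite cK1// mul1r.
- by rewrite e0// mulr0.
- by rewrite cK1// mul1r.
- by rewrite (pderiv_off i (rV_compact_closed cK) e0 nK) mulr0.
Qed.

Lemma LL2_loc_mul u v : (forall chi, test T chi -> LL2 (fun x => chi x * u x)) ->
 (forall chi, test T chi -> LL2 (fun x => chi x * v x)) ->
 forall eta, test T eta -> Lint mu (fun x => u x * v x * eta x).
move=> Lu Lv eta te; have [chi [tc _ ce _]] := cut1 openT te.
rewrite (_ : (fun x => _) = fun x => (chi x * u x) * (eta x * v x)); first side.
by ext x; rewrite -{1}(ce x); ring.
Qed.

Lemma LL2_loc_cst chi : test T chi -> LL2 (fun x => chi x * 1).
by move=> tc; under eq_fun do rewrite mulr1; exact: (LL2_test mu_fin tc). Qed.

Lemma loc_Lint u eta : (forall chi, test T chi -> LL2 (fun x => chi x * u x)) -> test T eta ->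
 Lint mu (fun x => u x * eta x).
move=> Lu te; have := LL2_loc_mul Lu LL2_loc_cst te.
by under eq_fun do rewrite mulr1.
Qed.

Lemma WG_int u D eta i : WG u D -> test T eta -> [/\ Lint mu (fun x => D x ord0 i * eta x),
 Lint mu (fun x => u x * pderiv i eta x) & Lint mu (fun x => u x * (b i x * eta x))].
move=> [_ _ Lu _] te; have Lu1 chi (tc : test T chi) := (Lu chi tc).1.
split.
- by apply: loc_Lint te => chi tc; have [_] := Lu _ tc.
- by apply: loc_Lint => //; exact: test_pderiv.
- by under eq_fun do rewrite mulrA; exact: (LL2_loc_mul Lu1 (fun chi tc => bL2 i tc) te).
Qed.

Lemma WG_Lint2 u D eta i : WG u D -> test T eta -> Lint mu (fun x => u x * (pderiv i eta x + b i x * eta x)).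
by move=> h te; have [_ i2 i3] := WG_int i h te; under eq_fun do rewrite mulrDr; side. Qed.

Lemma WG_uniq U u D u' D' : open U -> WG u D -> WG u' D' ->
 {ae mu, forall x, U x -> u x = u' x} -> {ae mu, forall x, U x -> D x = D' x}.
move=> oU h h' uu.
have hi i : {ae mu, forall x, U x -> D x ord0 i - D' x ord0 i = 0}.
 have [mu_ mD _ hD] := h; have [mu'_ mD' _ hD'] := h'.
 have mDD : mfunT (fun x => D x ord0 i - D' x ord0 i) by exact: measurable_funB.
 refine (fundamental_lemma oU mDD _) => eta te.
 have te' : test T eta by exact: testW te.
 have [i1 i2 i3] := WG_int i h te'; have [i1' i2' i3'] := WG_int i h' te'.
 under eq_fun do rewrite mulrBl.
 split; first side.
 rewrite IgB// hD// hD'// (@Ig_ae _ _ _ mu (fun x => u x * _) (fun x => u' x * (pderiv i eta x + b i x * eta x))) ?subrr//.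
 - exact: WG_Lint2 h te'.
 - exact: Lint_meas (WG_Lint2 i h' te').
 - apply: filterS uu => x ux; have [/ux ->//|nU] := pselect (U x).
  have := grad_off te nU => /rowP/(_ i); rewrite !mxE => ->.
  by rewrite (test_off te nU) mulr0 addr0 !mulr0.
have := @filter_forall _ _ _ _ (ae_filter_ringOfSetsType mu) hi; apply: filterS => x hx Ux; apply/rowP => i.
by apply/eqP; rewrite -subr_eq0; apply/eqP; side.
Qed.

Lemma WG_test u : test T u -> WG u (grad u).
move=> tu; have su := test_smooth tu; split.
- exact: test_meas tu.
- by move=> i; under eq_fun do rewrite mxE; exact: test_meas (test_pderiv i tu).
- move=> chi tc; split; first exact: (LL2_test mu_fin (testMl tc su)).
 by move=> i; under eq_fun do rewrite mxE; exact: (LL2_test mu_fin (testMl tc (smooth_pderiv i su))).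
move=> i eta te; have se := test_smooth te.
have := b_ibp i (testMl tu se).
rewrite (_ : pderiv i _ = fun x => u x * pderiv i eta x + eta x * pderiv i u x); last first.
 by ext x; exact: pderivM.
have i1 : Lint mu (fun x => u x * pderiv i eta x) by exact: (Lint_test mu_fin (testMl tu (smooth_pderiv i se))).
have i2 : Lint mu (fun x => eta x * pderiv i u x) by exact: (Lint_test mu_fin (testMl te (smooth_pderiv i su))).
have i3 : Lint mu (fun x => u x * eta x * b i x).
 have := LL2_loc_mul (u := u) (v := b i) _ (fun chi tc => bL2 i tc) te.
 rewrite (_ : (fun x => _) = fun x => u x * eta x * b i x); last by ext x; ring.
 by apply=> chi tc; exact: (LL2_test mu_fin (testMl tc su)).
rewrite IgD// => h.
under eq_fun do rewrite mxE mulrC.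
rewrite [in RHS](_ : (fun x => _) = fun x => u x * pderiv i eta x + u x * eta x * b i x); last by ext x; ring.
by rewrite IgD// opprD -h addKr.
Qed.

(** One sequence of test functions that converges after multiplication by every cutoff. Elements of
    the domain of E^0 have such a sequence, while their gradients are controlled in L^2 only
    locally. *)
Definition LocS u D := [/\ mfunT u, mvec D,
 forall chi, test T chi -> LL2 (fun x => chi x * u x) /\ forall i, LL2 (fun x => chi x * D x ord0 i) &
 exists v_ : nat -> E -> R, (forall n, test T (v_ n)) /\ forall chi, test T chi ->
  to0 (fun n => Q0 (fun x => chi x * (v_ n x - u x)) (fun x => chi x *: (grad (v_ n) x - D x)))].

Lemma LLvZ chi D : (forall i, LL2 (fun x => chi x * D x ord0 i)) -> LLv (fun x => chi x *: D x).
by move=> h i; under eq_fun do rewrite mxE. Qed.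

Lemma LocS_WG u D : LocS u D -> WG u D.
move=> [mu_ mD LuD [v_ [tv hv]]]; split=> // i eta te.
have [chi [tc _ ce cpe]] := cut1 openT te.
have [Lcu LcD] := LuD _ tc.
have Lv n : LL2 (fun x => chi x * v_ n x) := LL2_test mu_fin (testMl tc (test_smooth (tv n))).
have LDv n : LL2 (fun x => chi x * pderiv i (v_ n) x).
 exact: (LL2_test mu_fin (testMl tc (smooth_pderiv i (test_smooth (tv n))))).
have L1 n : LL2 (fun x => chi x * (v_ n x - u x)).
 by under eq_fun do rewrite mulrBr; side.
have L2 n : LLv (fun x => chi x *: (grad (v_ n) x - D x)).
 move=> j; under eq_fun do rewrite !mxE mulrBr; apply: LL2B => //.
 exact: (LL2_test mu_fin (testMl tc (smooth_pderiv j (test_smooth (tv n))))).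
have t1 : to0 (fun n => Ig mu (fun x => (chi x * v_ n x - chi x * u x) ^+ 2)).
 apply: to0_le (hv _ tc) => n; apply: le_trans (q0_fst (L1 n) (L2 n)).
 by under eq_fun do rewrite -mulrBr.
have t2 : to0 (fun n => Ig mu (fun x => (chi x * pderiv i (v_ n) x - chi x * D x ord0 i) ^+ 2)).
 apply: to0_le (hv _ tc) => n; apply: le_trans (q0_coord i (L1 n) (L2 n)).
 by under [X in _ <= Ig _ X]eq_fun do rewrite !mxE mulrBr.
have Le : LL2 eta := LL2_test mu_fin te.
have Lw : LL2 (fun x => pderiv i eta x + eta x * b i x).
 by apply: LL2D; [exact: (LL2_test mu_fin (test_pderiv i te))|side].
have := L2_lim_mul LDv (LcD i) Le t2; have := L2_lim_mul Lv Lcu Lw t1.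
have e1 w : (fun x => chi x * w x * eta x) = fun x => w x * eta x.
 by ext x; rewrite mulrAC ce mulrC.
have e2 w : (fun x => chi x * w x * (pderiv i eta x + eta x * b i x)) = fun x => w x * (pderiv i eta x + b i x * eta x).
 by ext x; rewrite -[in RHS]cpe -[in RHS]ce; ring.
rewrite !e1 !e2 => h1 h2.
have h1' : to0 (fun n => `|- Ig mu (fun x => v_ n x * (pderiv i eta x + b i x * eta x)) - - Ig mu (fun x => u x * (pderiv i eta x + b i x * eta x))|).
 by apply: to0_le h1 => n; rewrite e2 -opprD normrN.
apply: (to0_uniq h2 h1') => e e0; exists 0%N => n _.
have [_ _ _ hn] := WG_test (tv n); have := hn i _ te.
by under eq_fun do rewrite mxE; rewrite e1 => ->; rewrite subrr normr0 ltW.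
Qed.

Lemma Sob_LocS V u D : Sob mu V u D -> LocS u D.
move=> [Lu LD u0 [v_ [tv hv]]]; split.
- exact: LL2_meas Lu.
- by move=> i; exact: LL2_meas (LD i).
- move=> chi tc; have [M M0 hM] := test_bounded tc; have mc := test_meas tc.
 by split=> [|i]; apply: (LL2_bounded (M := M)).
exists v_; split; first by move=> n; exact: testW (tv n).
move=> chi tc; have [M M0 hM] := test_bounded tc; have mc := test_meas tc.
apply: (to0_le _ (to0Z (sqr_ge0 M) hv)) => n.
have L1 := LL2B (LL2_test mu_fin (tv n)) Lu; have L2 := LLvB (LLv_grad mu_fin (tv n)) LD.
rewrite /q0 -IgZ; last exact: Lint_q0.
apply: Ig_le; [|apply: LintZ; exact: Lint_q0|].
 apply: Lint_q0; first exact: (LL2_bounded (M := M)).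
 by apply: LLvZ => i; exact: (LL2_bounded (M := M)).
move=> x; rewrite dotvZl dotvC dotvZl exprMn mulrA -expr2 -mulrDr ler_wpM2r//.
 by rewrite addr_ge0 ?sqr_ge0 ?dotvv_ge0.
by rewrite -(real_normK (num_real (chi x))) lerXn2r.
Qed.

Lemma Sob_WG V u D : Sob mu V u D -> WG u D. Proof. by move=> /Sob_LocS/LocS_WG. Qed.

Lemma LocS_cut V u D chi : LocS u D -> test V chi ->
 SobM V u D chi.
move=> [mu_ mD LuD [v_ [tv hv]]] tc; have tc' : test T chi by exact: testW tc.
have sc := test_smooth tc.
have Luc : LL2 (fun x => u x * chi x).
 by under eq_fun do rewrite mulrC; have [] := LuD _ tc'.
have LDc : LLv (fun x => chi x *: D x + u x *: grad chi x).
 move=> i; under eq_fun do rewrite !mxE; apply: LL2D; first by have [_] := LuD _ tc'.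
 by under eq_fun do rewrite mulrC; have [] := LuD _ (test_pderiv i tc').
split=> // [x nV|]; first by rewrite (test_off tc nV) (grad_off tc nV) mulr0 scale0r scaler0 addr0.
exists (fun n x => v_ n x * chi x); split.
 by move=> n; under eq_fun do rewrite mulrC; exact: testMl (test_smooth (tv n)).
have Lm eta n : test T eta -> LL2 (fun x => eta x * (v_ n x - u x)).
 move=> te; under eq_fun do rewrite mulrBr; apply: LL2B; last by have [] := LuD _ te.
 exact: (LL2_test mu_fin (testMl te (test_smooth (tv n)))).
have Lg eta n : test T eta -> LLv (fun x => eta x *: (grad (v_ n) x - D x)).
 move=> te j; under eq_fun do rewrite !mxE mulrBr; apply: LL2B; last by have [_] := LuD _ te.
 exact: (LL2_test mu_fin (testMl te (smooth_pderiv j (test_smooth (tv n))))).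
have h2 := to0_sum (fun i : 'I_d => hv _ (test_pderiv i tc')).
apply: (to0_le _ (to0D (to0Z (_ : 0 <= 2) (hv _ tc')) (to0Z (_ : 0 <= 2) h2))) => // n.
rewrite (_ : (fun x => v_ n x * chi x - _) = fun x => chi x * (v_ n x - u x) + (fun=> 0) x); last first.
 by apply/funext => x /=; ring.
rewrite (_ : (fun x => _ - _) = fun x => chi x *: (grad (v_ n) x - D x) + (v_ n x - u x) *: grad chi x); last first.
 ext x; apply/rowP => i; rewrite !mxE pderivM//; first by ring.
 exact: test_smooth (tv n).
have Lz : LLv (fun x => (v_ n x - u x) *: grad chi x).
 by move=> i; under eq_fun do rewrite !mxE mulrC; exact: Lm (test_pderiv i tc').
apply: (le_trans (q0D (Lm _ n tc') (Lg _ n tc') (@LL20 _ _ _ mu) Lz)).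
rewrite lerD2l ler_wpM2l// /q0.
under eq_fun do rewrite expr0n /= add0r /dotv.
rewrite Ig_sum; last side.
apply: ler_sum => i _; apply: le_trans (q0_fst (Lm _ n (test_pderiv i tc')) (Lg _ n (test_pderiv i tc'))).
apply: eq_ler; congr Ig; ext x; rewrite !mxE; ring.
Qed.

Lemma WG_cut u D chi : WG u D -> test T chi -> WG (fun x => u x * chi x) (fun x => chi x *: D x + u x *: grad chi x).
move=> h tc; have [mu_ mD LuD hD] := h; have mc := test_meas tc; have sc := test_smooth tc.
split.
- exact: measurable_funM.
- move=> i; under eq_fun do rewrite !mxE.
 by apply: measurable_funD; apply: measurable_funM => //; exact: test_meas (test_pderiv i tc).
- move=> eta te; split.
  rewrite (_ : (fun x => _) = fun x => eta x * chi x * u x); last by ext x; ring.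
  by have [] := LuD _ (testMl te sc).
 move=> i; rewrite (_ : (fun x => _) = fun x => eta x * chi x * D x ord0 i + eta x * pderiv i chi x * u x); last first.
  by ext x; rewrite !mxE; ring.
 by apply: LL2D; [have [_] := LuD _ (testMl te sc)|have [] := LuD _ (testMl te (smooth_pderiv i sc))].
move=> i eta te; have se := test_smooth te.
have tce : test T (fun x => chi x * eta x) by exact: testMl.
have t2 : test T (fun x => eta x * pderiv i chi x) by exact: testMl (smooth_pderiv i sc).
have [i1 i2 i3] := WG_int i h tce; have := hD i _ tce.
have j1 : Lint mu (fun x => u x * (eta x * pderiv i chi x)) by apply: loc_Lint t2 => xi tx; have [] := LuD _ tx.
have -> : (fun x => (chi x *: D x + u x *: grad chi x) ord0 i * eta x) =
  fun x => D x ord0 i * (chi x * eta x) + u x * (eta x * pderiv i chi x).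
 by ext x; rewrite !mxE; ring.
have -> : (fun x => u x * chi x * (pderiv i eta x + b i x * eta x)) =
  fun x => u x * (pderiv i (fun x => chi x * eta x) x + b i x * (chi x * eta x)) - u x * (eta x * pderiv i chi x).
 by ext x; rewrite pderivM//; ring.
rewrite IgD// IgB//; last exact: WG_Lint2 h tce.
by move=> ->; rewrite opprB addrC.
Qed.

(** Local membership gives a separate gradient for each cutoff. The gradients F n of u X_n, with X_n
    = 1 on [balln n], agree a.e. on smaller balls by [WG_uniq], so a limsup over n is a measurable
    field that coincides a.e. with F n on [balln n]. *)
Lemma WG_glue u : (forall chi, test T chi -> exists D, Sob mu T (fun x => u x * chi x) D) ->
 exists D, WG u D /\ forall V chi, test V chi ->
  SobM T u D chi.
move=> hu.
have /choice[X hX] : forall n, exists chi, test T chi /\ forall x, balln n x -> chi x = 1.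
 move=> n; have [chi [tc _ c1]] := cutoff (@cbox_compact R d 0 n.+1%:R) openT (fun x _ => I).
 by exists chi; split=> // x /balln_cbox/c1.
have /choice[F hF] : forall n, exists F, Sob mu T (fun x => u x * X n x) F.
 by move=> n; apply: hu; have [] := hX n.
have mu_ : mfunT u.
 apply: (@measurable_fun_cvg _ _ _ _ (fun n x => u x * X n x)); first by move=> n; exact: Sob_meas (hF n).
 move=> x _; have [N xN] := in_balln x.
 apply/to0_cvgB => e e0; exists N => n Nn; have [_ ->] := hX n; first by rewrite mulr1 subrr normr0 ltW.
 exact: ballnS Nn _ xN.
pose D x := \row_i fine (limn_esup (fun n => (F n x ord0 i)%:E)) : E.
have DE : {ae mu, forall x, forall n, balln n x -> D x = F n x}.
 have : {ae mu, forall x, forall n, forall m, balln n x -> (n <= m)%N -> F m x = F n x}.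
  apply: ae_foralln => n; apply: ae_foralln => m; have [nm|mn] := leqP n m; last by apply: aeW => x _.
  have := WG_uniq (@open_balln R d n) (Sob_WG (hF m)) (Sob_WG (hF n)).
  case.
   apply: aeW => x xn; have [_ ->//] := hX n; have [_ ->//] := hX m; exact: ballnS nm _ xn.
  by move=> N [mN N0 hN]; exists N; split=> // x /= hx; apply: hN => /= h; apply: hx => /h.
 apply: filterS => x hx n xn; apply/rowP => i; rewrite mxE.
 have : (fun k => (F k x ord0 i)%:E) @ \oo --> (F n x ord0 i)%:E.
  apply: cvg_EFin; first exact: nearW.
  by apply/to0_cvgB => e e0; exists n => k nk /=; rewrite (hx n k xn nk) subrr normr0 ltW.
 by move=> /cvg_limn_einf_sup[_ ->].
have mD i : mfunT (fun x => D x ord0 i).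
 under eq_fun do rewrite mxE; apply: measurableT_comp => //.
 apply: measurable_fun_limn_esup => k; apply/measurable_EFinP; have [_ LF _ _] := hF k; exact: LL2_meas (LF i).
have supp eta : test T eta -> exists n, forall x, ~ balln n x -> eta x = 0 /\ forall i, pderiv i eta x = 0.
 move=> [_ [K [cK _ e0]]]; have [n Kn] := compact_balln cK; exists n => x nb.
 have nK : ~ K x by move=> /Kn.
 by split=> [|i]; [side|exact: pderiv_off (rV_compact_closed cK) e0 nK].
have WD : WG u D.
 split=> //.
  move=> eta te; have [n hn] := supp _ te; have [tX X1] := hX n.
  have [_ _ LL _] := Sob_WG (hF n); have [l1 l2] := LL _ te; split.
   rewrite (_ : (fun x => _) = fun x => eta x * (u x * X n x))//.
   ext x; have [/X1 ->|/hn[-> _]] := pselect (balln n x); by rewrite ?mulr1 ?mul0r.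
  move=> i; apply: (LL2_ae _ _ (l2 i)); first by apply: measurable_funM => //; exact: test_meas te.
  apply: filterS DE => x /(_ n) hx.
  by have [/hx ->|/hn[-> _]] := pselect (balln n x); rewrite ?mul0r.
 move=> i eta te; have [n hn] := supp _ te; have [tX X1] := hX n.
 have W := Sob_WG (hF n); have [_ _ _ hW] := W; have [i1 _ _] := WG_int i W te.
 rewrite -(@Ig_ae _ _ _ mu _ _ i1).
 - rewrite hW//; congr (- Ig _ _); ext x.
  have [/X1 ->|/hn[-> ->]] := pselect (balln n x); by rewrite ?mulr1 ?mulr0 ?addr0 ?mulr0.
 - by apply: measurable_funM => //; exact: test_meas te.
 - apply: filterS DE => x /(_ n) hx.
  by have [/hx ->|/hn[-> _]] := pselect (balln n x); rewrite ?mulr0.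
exists D; split=> // V chi tc; have tc' : test T chi by exact: testW tc.
have [G hG] := hu _ tc'; have W := WG_cut WD tc'; have [m1 m2 _ _] := W.
apply: (Sob_ae mu_fin hG) => //; first exact: aeW.
have := WG_uniq openT (Sob_WG hG) W (aeW _ (fun x _ => erefl)).
by apply: filterS => x /(_ I).
by move=> x /(_ I).
Qed.


Local Notation Sob := (Sob mu).

Definition Sloc V u D := forall chi, test V chi -> SobM V u D chi.

Lemma H12_Sloc V u D : open V -> H12_loc_grad mu V u D <->
 (forall i, measurable_fun V (fun x => D x ord0 i)) /\ Sloc V u D.
move=> oV; have key chi : test V chi -> H12_0_grad mu V (fun x => u x * chi x) (fun x => chi x *: D x + u x *: grad chi x) <->
  SobM V u D chi.
 move=> tc; apply: (iff_trans (H12_Sob mu_fin oV _ _)).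
 rewrite (_ : (fun x => u x * chi x) \_ V = fun x => u x * chi x); last first.
  ext x; have [Vx|nV] := pselect (V x); first by rewrite restrict_in.
  by rewrite restrict_off// (test_off tc nV) mulr0.
 rewrite (_ : rv V _ = fun x => chi x *: D x + u x *: grad chi x)//.
 ext x; have [Vx|nV] := pselect (V x); first by rewrite rv_in.
 by rewrite rv_off// (test_off tc nV) (grad_off tc nV) scale0r scaler0 addr0.
by split=> -[mD h]; split=> // chi tc; apply/key => //; side.
Qed.

Lemma Sloc_uniq V u D u' D' : open V -> Sloc V u D -> Sloc V u' D' -> {ae mu, forall x, V x -> u x = u' x} ->
 {ae mu, forall x, V x -> D x = D' x}.
(* Countably many cutoffs suffice: at each point of V some [open_approx V n] is nonzero and can be
   cancelled. *)
move=> oV h h' uu; have : {ae mu, forall x, forall n, open_approx V n x *: D x = open_approx V n x *: D' x}.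
 apply: ae_foralln => n; have tn := open_approx_test V n.
 have e : {ae mu, forall x, setT x -> u x * open_approx V n x = u' x * open_approx V n x}.
  apply: filterS uu => x hx _; have [/hx ->//|nV] := pselect (V x); by rewrite (test_off tn nV) !mulr0.
 have := WG_uniq openT (Sob_WG (h _ tn)) (Sob_WG (h' _ tn)) e.
 apply: filterS2 uu => x hu /(_ I); have [/hu ->|nV] := pselect (V x); first exact: addIr.
 by rewrite (test_off tn nV) !scale0r.
apply: filterS => x hx Vx; have := open_approx_cvg (x := x) oV; rewrite indicE mem_set// => c.
have [n n0] : exists n, open_approx V n x != 0.
 apply: contrapT => nn; have e : open_approx V ^~ x = fun=> 0.
  by ext n; apply/eqP; apply/negP => /negP k; apply: nn; exists n.
 have c0 : (fun _ : nat => 0 : R) @ \oo --> (0 : R) by exact: cvg_cst.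
 rewrite e in c; have k : (true%:R : R) = 0 by exact: (cvg_unique _ c c0).
 by move/eqP: k; rewrite oner_eq0.
exact: (scalerI n0 (hx n)).
Qed.

(** [wgrad] is a choice: once one gradient is exhibited the chosen field is a gradient too, and
    uniqueness identifies the two a.e. on V. *)
Lemma wgradP V u D : open V -> (forall i, measurable_fun V (fun x => D x ord0 i)) -> Sloc V u D ->
 H12_loc_grad mu V u (wgrad mu V u) /\ {ae mu, forall x, V x -> wgrad mu V u x = D x}.
move=> oV mD S; have e : exists D', H12_loc_grad mu V u D' by exists D; apply/H12_Sloc.
have h : H12_loc_grad mu V u (wgrad mu V u) := getPex e.
split=> //; have [_ S'] := (H12_Sloc u (wgrad mu V u) oV).1 h.
by apply: (Sloc_uniq oV S' S); apply: aeW.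
Qed.

Lemma LocS_Sloc V u D : LocS u D -> Sloc V u D.
by move=> L chi tc; exact: (LocS_cut L tc). Qed.

Lemma Sob_Sloc V u u' D D' : Sob V u D -> (forall x, V x -> u x = u' x) -> (forall x, V x -> D x = D' x) -> Sloc V u' D'.
move=> S eu eD chi tc; have := LocS_Sloc (Sob_LocS S) tc.
rewrite (_ : (fun x => u x * chi x) = fun x => u' x * chi x); last first.
 ext x; have [/eu ->//|nV] := pselect (V x); by rewrite (test_off tc nV) !mulr0.
rewrite (_ : (fun x => _ + _) = fun x => chi x *: D' x + u' x *: grad chi x)//.
ext x; have [Vx|nV] := pselect (V x); first by rewrite eu ?eD.
by rewrite (test_off tc nV) (grad_off tc nV) !scale0r !scaler0.
Qed.

Lemma H12_loc_WG u : H12_loc mu setT u -> exists D, [/\ WG u D, Sloc setT u D,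
 H12_loc_grad mu setT u (wgrad mu setT u) & {ae mu, forall x, wgrad mu setT u x = D x}].
move=> hu; have h chi : test setT chi -> exists D, Sob setT (fun x => u x * chi x) D.
 by move=> /hu[D /H12_SobT S]; exists D; side.
have [D [W S]] := WG_glue h; have S' : Sloc setT u D by move=> chi; exact: S.
have [_ mD _ _] := W; have [k1 k2] := wgradP openT mD S'; exists D; split=> //.
by apply: filterS k2 => x; exact.
Qed.
End logarithmic_derivative.

(** * Smooth functions of one variable acting on H^{1,2}_0 *)

Section one_variable.
Variables (R : realType) (d : nat).
Local Notation E := 'rV[R]_d.
Implicit Types (F f G g : R -> R).

(** The class of smooth F that act on H^{1,2}_0 by u |-> F u: the bounded derivative f controls the
    gradient, and its Lipschitz bound is what the passage to limits in [Sob_chain] uses. Members of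
    this class replace absolute values, signs and positive parts. *)
Definition cfun F f := [/\ forall u : E -> R, smooth u -> smooth (fun x => F (u x)),
 forall s : R, is_derive s (1 : R) F (f s) &
 exists2 C : R, (forall s, `|f s| <= C) & forall s t, `|f s - f t| <= C * `|s - t|].

Lemma cfun_id : cfun (fun s => s) (fun=> 1).
split=> // [s|]; first exact: is_derive_id.
by exists 1 => [s|s t]; rewrite ?normr1// subrr normr0.
Qed.

Lemma cfunD F f G g : cfun F f -> cfun G g -> cfun (fun s => F s + G s) (fun s => f s + g s).
move=> [sF dF [C C1 C2]] [sG dG [C' C1' C2']]; split.
- by move=> u su; apply: smoothD; [exact: sF|exact: sG].
- by move=> s; exact: is_deriveD.
exists (C + C') => [s|s t]; first by rewrite (le_trans (ler_normD _ _))// lerD.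
by rewrite opprD addrACA (le_trans (ler_normD _ _))// mulrDl lerD.
Qed.

Lemma cfunZ (a : R) F f : cfun F f -> cfun (fun s => a * F s) (fun s => a * f s).
move=> [sF dF [C C1 C2]]; split.
- by move=> u su; apply: smoothZ; exact: sF.
- by move=> s; have := @is_deriveZ _ _ _ F a s 1 (f s) (dF s).
exists (`|a| * C) => [s|s t]; first by rewrite normrM ler_wpM2l.
by rewrite -mulrBr normrM -mulrA ler_wpM2l.
Qed.

Lemma cfun_aff (r k : R) F f : cfun F f -> cfun (fun s => F (r * s + k)) (fun s => r * f (r * s + k)).
move=> [sF dF [C C1 C2]]; have C0 : 0 <= C by apply: le_trans (C1 0).
split.
- move=> u su; apply: (sF (fun x => r * u x + k)); apply: smoothD; last exact: smooth_cst.
 exact: smoothZ.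
- move=> s; rewrite mulrC; apply: (@is_derive_comp1 _ _ F (fun t => r * t + k)) => //.
 have h := @is_deriveD _ _ _ (fun t : R => r * t) (cst k) s 1 _ _ (@is_deriveZ _ _ _ id r s 1 1 _) _.
 by have := h _ (is_derive_id _ _) (is_derive_cst _ _ _); rewrite addr0 /GRing.scale /= mulr1.
exists ((`|r| + `|r| ^+ 2) * C) => [s|s t].
 rewrite normrM mulrDl ler_wpDr// ?mulr_ge0// ler_wpM2l//.
rewrite -mulrBr normrM mulrDl mulrDl ler_wpDl// ?mulr_ge0//.
rewrite expr2 -!mulrA ler_wpM2l// (le_trans (C2 _ _))// mulrCA ler_wpM2l//.
by rewrite opprD addrACA subrr addr0 -mulrBr normrM.
Qed.

Lemma lip_continuous F (C : R) : (forall s t, `|F s - F t| <= C * `|s - t|) -> continuous F.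
move=> h s; apply/cvgrPdist_le => e e0; near=> t.
apply: (le_trans (h _ _)); apply: (@le_trans _ _ ((`|C| + 1) * `|s - t|)).
 by rewrite ler_wpM2r// (le_trans (ler_norm C))// lerDl.
rewrite mulrC -ler_pdivlMr//.
by near: t; apply: cvgr_dist_le; [side|rewrite divr_gt0// ltr_wpDl].
Unshelve. all: by end_near. Qed.

Lemma cfun_lip F f : cfun F f -> exists2 C : R, 0 <= C & forall s t,
 [/\ `|f s| <= C, `|F s - F t| <= C * `|s - t| & `|f s - f t| <= C * `|s - t|].
move=> [_ dF [C C1 C2]]; exists C; first by apply: le_trans (C1 0).
by move=> s t; split=> //; exact: (lipschitz_of_derive dF).
Qed.

Lemma cfun_meas F f : cfun F f -> mfunT F /\ mfunT f.
move=> /cfun_lip[C _ h]; split; apply: continuous_measurable_fun; apply: (@lip_continuous _ C) => s t; by have [] := h s t.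
Qed.

Lemma cfun_pderiv F f (u : E -> R) i x : cfun F f -> smooth u ->
 pderiv i (fun y => F (u y)) x = f (u x) * pderiv i u x.
move=> [_ dF _] su; have h := is_derive_comp1 (is_derive_smooth i x su) (dF (u x)).
by rewrite /pderiv derive_val.
Qed.

Variable mu : {measure set E -> \bar R}.
Hypothesis mu_fin : forall K, compact K -> (mu K < +oo)%E.

Lemma Sob_comp V u D F f : cfun F f -> F 0 = 0 -> Sob mu V u D ->
 Sob mu V (fun x => F (u x)) (fun x => f (u x) *: D x).
move=> cF F0 S; have [C C0 hC] := cfun_lip cF; have [mF mf] := cfun_meas cF.
have cf : @chain_fun R d (fun s _ => F s) (fun s _ => f s) (fun _ _ => 0) C.
 split.
 - side.
 - side.
 - by [].
 - by move=> G [|[|]] -> u' v' mu' mv' //; apply: measurableT_comp.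
 - move=> G [|[|]] -> s t s' t'; have [_ h1 h2] := hC s s'.
  + by rewrite (le_trans h1)// ler_wpM2l// lerDl.
  + by rewrite (le_trans h2)// ler_wpM2l// lerDl.
  + by rewrite subrr normr0 mulr_ge0//.
 - by move=> s t; have [] := hC s s; rewrite normr0.
 - by move=> u' v' su' _; have [h _ _] := cF; exact: h.
 - by move=> u' v' i x su' _; rewrite mul0r addr0; exact: cfun_pderiv.
have := Sob_chain mu_fin cf S S.
by under [X in Sob _ _ _ X -> _]eq_fun do rewrite scale0r addr0.
Qed.

(** The composite vanishes wherever u1 does: there the argument is - G (u2) - m <= 0, where F is 0.
    Hence it is an admissible test function on the smaller set V although u2 does not vanish off
    V. *)
Lemma Sob_comp_diff V U u1 D1 u2 D2 F f G g (m : R) : cfun F f -> cfun G g ->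
 (forall s, s <= 0 -> F s = 0 /\ f s = 0) -> (forall t, - m <= G t) ->
 Sob mu V u1 D1 -> Sob mu U u2 D2 ->
 Sob mu V (fun x => F (u1 x - G (u2 x) - m))
  (fun x => f (u1 x - G (u2 x) - m) *: (D1 x - g (u2 x) *: D2 x)).
move=> cF cG F0 Gm S1 S2; have [C C0 hC] := cfun_lip cF; have [mF mf] := cfun_meas cF.
have [K K0 hK] := cfun_lip cG; have [mG mg] := cfun_meas cG.
have neg t : 0 - G t - m <= 0 by have := Gm t; lra.
have z t : F (0 - G t - m) = 0 /\ f (0 - G t - m) = 0 by exact: F0 (neg t).
have arg s t s' t' : `|(s - G t - m) - (s' - G t' - m)| <= `|s - s'| + K * `|t - t'|.
 have [_ h _] := hK t t'; rewrite (_ : _ - _ = (s - s') - (G t - G t')); last by ring.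
 by rewrite (le_trans (ler_normB _ _))// lerD2l.
(* The first term serves the Lipschitz bounds of F and f; the other two serve the product of f and g
   and its size. *)
pose L := C * (1 + K) + C * K * (1 + K) + C * K.
have L1 : C * (1 + K) <= L by rewrite /L -addrA lerDl addr_ge0 ?mulr_ge0 ?addr_ge0.
have arg' (h : R -> R) s t s' t' : (forall a b, `|h a - h b| <= C * `|a - b|) ->
  `|h (s - G t - m) - h (s' - G t' - m)| <= C * (1 + K) * (`|s - s'| + `|t - t'|).
 move=> hh; apply: (le_trans (hh _ _)); rewrite -mulrA ler_wpM2l// (le_trans (arg _ _ _ _))//.
 have := normr_ge0 (s - s'); have := normr_ge0 (t - t'); nra.
have cf : @chain_fun R d (fun s t => F (s - G t - m)) (fun s t => f (s - G t - m)) (fun s t => - (f (s - G t - m) * g t)) L.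
 have marg (u v : E -> R) : mfunT u -> mfunT v -> mfunT (fun x : E => u x - G (v x) - m).
  move=> mu' mv'; apply: measurable_funB => //; apply: measurable_funB => //; exact: measurableT_comp mv'.
 have n2 (s t s' t' : R) : 0 <= `|s - s'| + `|t - t'| :> R by rewrite addr_ge0.
 split.
 - by rewrite /L !addr_ge0 ?mulr_ge0 ?addr_ge0.
 - by move=> t; case: (z t).
 - by move=> t; have [_ ->] := z t; rewrite mul0r oppr0.
 - move=> H [|[|]] -> u v mu' mv'.
  + by apply: (measurableT_comp mF); exact: marg.
  + by apply: (measurableT_comp mf); exact: marg.
  + apply: measurableT_comp => //; apply: measurable_funM; last exact: measurableT_comp mv'.
   by apply: (measurableT_comp mf); exact: marg.
 - move=> H [|[|]] -> s t s' t'.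
  + apply: le_trans (ler_wpM2r (n2 _ _ _ _) L1); apply: (arg' F) => a b; by have [] := hC a b.
  + apply: le_trans (ler_wpM2r (n2 _ _ _ _) L1); apply: (arg' f) => a b; by have [] := hC a b.
  + have h1 : `|f (s - G t - m) - f (s' - G t' - m)| <= C * (1 + K) * (`|s - s'| + `|t - t'|).
    by apply: arg' => a b; have [] := hC a b.
   have [gt' _ gl] := hK t t'; have [fb _ _] := hC (s' - G t' - m) 0.
   rewrite opprK addrC (_ : _ - _ = (f (s' - G t' - m) - f (s - G t - m)) * g t + f (s' - G t' - m) * (g t' - g t)); last by ring.
   apply: (le_trans (ler_normD _ _)); rewrite !normrM (distrC (f _)) (distrC (g t')).
   apply: (@le_trans _ _ (C * (1 + K) * (`|s - s'| + `|t - t'|) * K + C * (K * `|t - t'|))).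
    by rewrite lerD// ler_pM.
   rewrite /L; have a0 := normr_ge0 (s - s'); have b0 := normr_ge0 (t - t').
   have p1 : 0 <= C * (1 + K) * (`|s - s'| + `|t - t'|) by rewrite !mulr_ge0 ?addr_ge0.
   have p2 : 0 <= C * K * `|s - s'| by rewrite !mulr_ge0.
   rewrite -subr_ge0 (_ : _ - _ = C * (1 + K) * (`|s - s'| + `|t - t'|) + C * K * `|s - s'|); first by rewrite addr_ge0.
   by ring.
 - move=> s t; have [f1 _ _] := hC (s - G t - m) 0; have [g1 _ _] := hK t 0; split.
   apply: (le_trans f1); apply: le_trans L1; by rewrite mulrDr mulr1 lerDl mulr_ge0.
  rewrite normrN normrM; apply: (@le_trans _ _ (C * K)); first by rewrite ler_pM.
  by rewrite /L lerDr !addr_ge0 ?mulr_ge0 ?addr_ge0.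
 - move=> u v su sv; have [hF _ _] := cF; have [hG _ _] := cG.
  exact: (hF _ (smoothB (smoothB su (hG _ sv)) (smooth_cst m))).
 - move=> u v i x su sv; have [hF _ _] := cF; have [hG _ _] := cG.
  have s1 : smooth (fun y : E => u y - G (v y)) := smoothB su (hG _ sv).
  have s2 : smooth (fun y : E => u y - G (v y) - m) := smoothB s1 (smooth_cst m).
  rewrite (cfun_pderiv i x cF s2).
  rewrite mulNr -mulrA -mulrBr; congr (_ * _).
  have e1 := is_derive_smooth i x su.
  have e2 : is_derive x (delta_mx ord0 i) (fun y => G (v y)) (g (v x) * pderiv i v x).
   by have [_ dG _] := cG; exact: is_derive_comp1 (is_derive_smooth i x sv) (dG (v x)).
  have e3 := is_deriveB (is_deriveB e1 e2) (@is_derive_cst _ _ _ m x (delta_mx ord0 i)).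
  by rewrite /pderiv derive_val subr0.
have := Sob_chain mu_fin cf S1 S2.
rewrite (_ : (fun x => _ *: _ + _) = fun x => f (u1 x - G (u2 x) - m) *: (D1 x - g (u2 x) *: D2 x))//.
by ext x; rewrite scalerBr scaleNr scalerA.
Qed.

(** s exp(-1/s) for s > 0: a smooth stand-in for the positive part. Its derivative [psi] has values
    in [0, 1] and is positive exactly for s > 0, like the indicator it replaces. *)
Definition Psi (s : R) := s * flat 0 s.
Definition psi (s : R) := flat 0 s + flat 1 s.

Lemma psi_ge0 s : 0 <= psi s. Proof. by rewrite addr_ge0 ?flat_ge0. Qed.
Lemma psi_le0 s : s <= 0 -> psi s = 0. Proof. by move=> s0; rewrite /psi !flat_le0// addr0. Qed.
Lemma psi_gt0 s : 0 < s -> 0 < psi s. Proof. by move=> s0; rewrite /psi addr_gt0 ?flat_gt0. Qed.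
Lemma Psi_le0 s : s <= 0 -> Psi s = 0. Proof. by move=> s0; rewrite /Psi flat_le0// mulr0. Qed.

Lemma psi_le1 s : psi s <= 1.
have [s0|s0] := leP s 0; first by rewrite psi_le0.
rewrite /psi /flat s0 expr0 expr1 -mulrDl expRN ler_pdivrMr ?expR_gt0// mul1r.
exact: expR_ge1Dx.
Qed.

Lemma cfun_Psi : cfun Psi psi.
split.
- by move=> u su; apply: smoothM => //; exact: smooth_flat.
- move=> s; have := @is_deriveM _ _ id (flat 0) s 1 1 _ _ (is_derive_flat 0 s).
 rewrite mul0r subr0 /GRing.scale /= mulr1 -flatS addrC; apply.
(* 6 = 3! bounds [flat 3], the derivative of [psi]. *)
exists 6%:R => [s|s t].
 by rewrite ger0_norm ?psi_ge0// (le_trans (psi_le1 s))// ler1n.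
apply: (@lipschitz_of_derive _ psi (flat 3)) => {s t} s.
 have := @is_deriveD _ _ _ (flat 0) (flat 1) s 1 _ _ (is_derive_flat 0 s) (is_derive_flat 1 s).
 by rewrite mul0r subr0 mul1r addrCA addrN addr0.
by rewrite ger0_norm ?flat_ge0//; exact: flat_bound.
Qed.

Lemma cfun_psi : cfun psi (flat 3).
split.
- by move=> u su; apply: smoothD; exact: smooth_flat.
- move=> s; have := @is_deriveD _ _ _ (flat 0) (flat 1) s 1 _ _ (is_derive_flat 0 s) (is_derive_flat 1 s).
 by rewrite mul0r subr0 mul1r addrCA addrN addr0.
(* The derivative of [flat 3] is [flat 5] - 3 [flat 4], bounded by 5! + 3 * 4!. *)
exists (5`!%:R + 3 * 4`!%:R) => [s|s t].
 rewrite ger0_norm ?flat_ge0// (le_trans (flat_bound 3 s))// -natrM -natrD ler_nat//.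
apply: (lipschitz_of_derive (is_derive_flat 3)) => {s t} s.
rewrite (le_trans (ler_normB _ _))// normrM !ger0_norm ?flat_ge0//.
by rewrite lerD ?flat_bound// ler_wpM2l// flat_bound.
Qed.

(* a smooth truncation from below at - c which is the identity on [0, +oo[ *)
Definition trunc (c t : R) := t + c * Psi (- c^-1 * t + 0).
Definition dtrunc (c t : R) := 1 + c * (- c^-1 * psi (- c^-1 * t + 0)).

Lemma cfun_trunc c : cfun (trunc c) (dtrunc c).
by apply: cfunD; [exact: cfun_id|apply: cfunZ; apply: cfun_aff; exact: cfun_Psi]. Qed.

Lemma trunc_ge0 c t : 0 < c -> 0 <= t -> trunc c t = t /\ dtrunc c t = 1.
move=> c0 t0; have h : - c^-1 * t + 0 <= 0 by rewrite addr0 mulNr oppr_le0 mulr_ge0// invr_ge0 ltW.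
by rewrite /trunc /dtrunc Psi_le0// psi_le0// !mulr0 !addr0.
Qed.

(** For t < 0 put y = - t / c; the truncation equals - c y (1 - exp(-1/y)), and y (1 - exp(-1/y)) <=
    1. *)
Lemma trunc_ge c t : 0 < c -> - c <= trunc c t.
move=> c0; have [t0|t0] := leP 0 t.
 by have [-> _] := trunc_ge0 c0 t0; rewrite (le_trans _ t0)// oppr_le0 ltW.
rewrite /trunc /Psi addr0; set y := - c^-1 * t.
have y0 : 0 < y by rewrite /y mulNr -mulrN mulr_gt0 ?invr_gt0// oppr_gt0.
have -> : t = - c * y by rewrite /y mulrA mulrNN divff ?mul1r ?gt_eqF.
rewrite /flat y0 expr0 mul1r mulNr.
have h : y * (1 - expR (- y^-1)) <= 1.
 rewrite -ler_pdivlMl// mulr1 lerBlDr; have := expR_ge1Dx (- y^-1); lra.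
have : c * (y * (1 - expR (- y^-1))) <= c by rewrite -[leRHS]mulr1 ler_wpM2l// ltW.
by rewrite mulrBr mulr1 mulrBr; lra.
Qed.

(* smooth approximations of the sign function and of the absolute value *)
Definition sgnr (r s : R) := psi (r * s + 0) + (- 1) * psi (- r * s + 0).
Definition dsgnr (r s : R) := r * flat 3 (r * s + 0) + (-1) * (- r * flat 3 (- r * s + 0)).
Definition absr (r s : R) := r^-1 * (Psi (r * s + 0) + Psi (- r * s + 0)).

Lemma cfun_sgnr r : cfun (sgnr r) (dsgnr r).
by apply: cfunD; [|apply: cfunZ]; apply: cfun_aff; exact: cfun_psi. Qed.

Lemma cfun_absr (r : R) : 0 < r -> cfun (absr r) (sgnr r).
move=> r0; have := cfunZ r^-1 (cfunD (cfun_aff r 0 cfun_Psi) (cfun_aff (- r) 0 cfun_Psi)).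
rewrite (_ : (fun s => r^-1 * (r * psi _ + _)) = sgnr r)//.
by ext s; rewrite /sgnr mulrDr !mulrA mulrN mulVf ?gt_eqF// mul1r.
Qed.

Lemma sgnr0 (r : R) : sgnr r 0 = 0. Proof. by rewrite /sgnr !mulr0 addr0 mulN1r subrr. Qed.
Lemma absr0 (r : R) : absr r 0 = 0. Proof. by rewrite /absr !mulr0 addr0 Psi_le0// addr0 mulr0. Qed.

Lemma dsgnr_ge0 (r s : R) : 0 <= r -> 0 <= dsgnr r s.
by move=> r0; rewrite /dsgnr mulN1r mulNr opprK addr_ge0// mulr_ge0 ?flat_ge0. Qed.

Lemma sgnr_bound (r s : R) : 0 <= r -> `|sgnr r s| <= 1.
move=> r0; rewrite /sgnr !addr0 mulN1r mulNr.
have [s0|s0] := leP 0 s.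
 by rewrite (@psi_le0 (- _)) ?oppr_le0 ?mulr_ge0// subr0 ger0_norm ?psi_ge0 ?psi_le1.
rewrite psi_le0 ?mulr_ge0_le0// ?(ltW s0)// sub0r normrN ger0_norm ?psi_ge0 ?psi_le1//.
Qed.

Lemma sgnr_pos (r s : R) : 0 <= r -> 0 <= s -> sgnr r s = psi (r * s).
move=> r0 s0; have e : psi (- (r * s)) = 0 by rewrite psi_le0// oppr_le0 mulr_ge0.
by rewrite /sgnr !addr0 mulN1r mulNr e subr0.
Qed.

Lemma sgnrN (r s : R) : sgnr r (- s) = - sgnr r s.
by rewrite /sgnr !addr0 !mulN1r !mulNr !mulrN opprK opprB. Qed.

Lemma psi_near (x : R) : 0 < x -> x - 1 <= x * psi x.
move=> x0; rewrite /psi /flat x0 expr0 expr1 mul1r.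
have h := expR_ge1Dx (- x^-1).
have h2 : 0 <= x^-1 * expR (- x^-1) by rewrite mulr_ge0 ?expR_ge0// invr_ge0 ltW.
have -> : x - 1 = x * (1 - x^-1) by rewrite mulrBr mulr1 divff ?gt_eqF.
by rewrite ler_wpM2l ?(ltW x0)//; lra.
Qed.

Lemma sgnr_near (r s : R) : 0 < r -> `|s| - r^-1 <= s * sgnr r s.
move=> r0; have key (y : R) : 0 <= y -> y - r^-1 <= y * psi (r * y).
 rewrite le_eqVlt => /orP[/eqP<-|y0]; first by rewrite sub0r mul0r oppr_le0 invr_ge0 ltW.
 have := psi_near (mulr_gt0 r0 y0); rewrite -mulrA -[X in X <= _]mulr1 => h.
 rewrite -(ler_pM2l r0) (le_trans _ h)// mulr1 mulrBr divff ?gt_eqF//.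
wlog s0 : s / 0 <= s => [H|].
 have [/H//|/ltW s0] := leP 0 s; have := H (- s); rewrite oppr_ge0 => /(_ s0).
 by rewrite sgnrN mulrNN normrN.
by rewrite sgnr_pos ?(ltW r0)// ger0_norm//; exact: key.
Qed.

(* sqh is bounded, and equals s ^+ 2 / 2 up to higher order near 0 *)
Definition sqh (s : R) := 2^-1 * (s * s * (1 + s * s)^-1).
Definition dsqh (s : R) := s * ((1 + s * s)^-1 * (1 + s * s)^-1).

Lemma sqh_den (s : R) : 0 < 1 + s * s.
by rewrite ltr_pwDl// -expr2 sqr_ge0. Qed.

Lemma sqh_q (s : R) : 0 < (1 + s * s)^-1 <= 1 /\ s * s * (1 + s * s)^-1 <= 1.
have h := sqh_den s; rewrite invr_gt0 h /= invf_le1// lerDl -expr2 sqr_ge0; split=> //.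
by rewrite ler_pdivrMr ?mul1r ?expr2// lerDr.
Qed.

Lemma cfun_sqh : cfun sqh dsqh.
have dsq (s : R) : is_derive s (1 : R) (fun t : R => 1 + t * t) (s + s).
 have [d1 d2] := is_deriveD (is_derive_cst (1 : R) s 1) (is_deriveM (is_derive_id s (1 : R)) (is_derive_id s (1 : R))).
 by split; [exact: d1|rewrite [LHS]d2 add0r /GRing.scale /= mulr1].
have dq (s : R) : is_derive s (1 : R) (fun t : R => (1 + t * t)^-1) (- (s + s) * ((1 + s * s)^-1 * (1 + s * s)^-1)).
 have n0 : 1 + s * s != 0 by rewrite gt_eqF// sqh_den.
 have dV : is_derive (1 + s * s) (1 : R) (fun y : R => y^-1) (- (1 + s * s) ^- 2).
  split; first by apply: derivableV => //; exact: derivable_id.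
  by rewrite deriveV// derive_id /GRing.scale/= mulr1.
 have [d1 d2] := is_derive_comp1 (dsq s) dV.
 by split; [exact: d1|rewrite [LHS]d2 -exprVn expr2 mulrC mulrN mulNr].
split.
- move=> u su; apply: smoothZ; apply: smoothM; first exact: smoothM.
 apply: smoothV; first by move=> x; rewrite gt_eqF// sqh_den.
 by apply: smoothD; [exact: smooth_cst|exact: smoothM].
- move=> s; have [d1 d2] := is_deriveZ 2^-1 (is_deriveM (is_deriveM (is_derive_id s (1 : R)) (is_derive_id s (1 : R))) (dq s)).
 split; first exact: d1.
 rewrite [LHS]d2 /GRing.scale /= /dsqh; have n0 : 1 + s * s != 0 by rewrite gt_eqF// sqh_den.
 by rewrite (_ : (id * id) s = s * s)//; field.
(* With q = (1 + s^2)^-1 and a = s^2 q, both in [0, 1], the derivative q^2 - 4 a q^2 of [dsqh] is at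
   most 5 in modulus. *)
exists 5 => [s|s t].
 have [/andP[q0 q1] q2] := sqh_q s; rewrite /dsqh mulrA normrM.
 have : `|s * (1 + s * s)^-1| <= 1.
  rewrite normrM (gtr0_norm q0) ler_pdivrMr ?sqh_den// mul1r.
  rewrite -expr2 -(real_normK (num_real s)); have := sqr_ge0 (`|s| - 1); have := normr_ge0 s; nra.
 by rewrite (gtr0_norm q0) => h; rewrite (@le_trans _ _ 1) ?ler1n// mulr_ile1// ltW.
apply: (@lipschitz_of_derive _ dsqh (fun s => (1 + s * s)^-1 ^+ 2 - 4 * (s * s * (1 + s * s)^-1) * (1 + s * s)^-1 ^+ 2)) => {s t} s.
 have [d1 d2] := is_deriveM (is_derive_id s (1 : R)) (is_deriveM (dq s) (dq s)).
 split; [exact: d1|rewrite [LHS]d2 /GRing.scale /=].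
 by rewrite (_ : (_ * _) s = (1 + s * s)^-1 * (1 + s * s)^-1)//; ring.
have [/andP[q0 q1] q2] := sqh_q s; have q3 : 0 <= s * s * (1 + s * s)^-1 by rewrite mulr_ge0 ?(ltW q0)// -expr2 sqr_ge0.
move: q0 q1 q2 q3; move: (s * s * _) => a; move: (1 + s * s)^-1 => q q0 q1 a1 a0.
have q2 : 0 <= q ^+ 2 <= 1 by rewrite sqr_ge0 expr_le1// ltW.
by rewrite ler_norml; nra.
Qed.

(* bounded odd approximations of the identity *)
Definition ident (k : nat) (s : R) := k.+1%:R * dsqh (k.+1%:R^-1 * s + 0).
Definition sqhk (k : nat) (s : R) := k.+1%:R ^+ 2 * sqh (k.+1%:R^-1 * s + 0).

Lemma cfun_ident k : cfun (sqhk k) (ident k).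
have := cfunZ (k.+1%:R ^+ 2) (cfun_aff k.+1%:R^-1 0 cfun_sqh).
have -> // : (fun s => k.+1%:R ^+ 2 * (k.+1%:R^-1 * dsqh (k.+1%:R^-1 * s + 0))) = ident k.
by ext s; rewrite /ident expr2 -mulrA mulVKf// pnatr_eq0.
Qed.

Lemma sqhk0 k : sqhk k 0 = 0. Proof. by rewrite /sqhk mulr0 addr0 /sqh !mul0r mulr0 mulr0. Qed.

Lemma ident_le k (s : R) : `|ident k s| <= `|s|.
rewrite /ident /dsqh addr0; set y := k.+1%:R^-1 * s; have [/andP[q0 q1] _] := sqh_q y.
have -> : s = k.+1%:R * y by rewrite /y mulrA divff ?mul1r.
rewrite mulrA [in leLHS]normrM ler_piMr// ger0_norm ?mulr_ge0 ?(ltW q0)//.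
by rewrite mulr_ile1// ltW.
Qed.

Lemma ident_cvg (s : R) : ident k s @[k --> \oo] --> s.
have c1 : (fun k => k.+1%:R^-1 * s) @ \oo --> (0 : R).
 by rewrite -[X in _ --> X](mul0r s); apply: cvgM; [exact: cvg_harmonic|exact: cvg_cst].
have c2 : (fun k => (1 + (k.+1%:R^-1 * s) * (k.+1%:R^-1 * s))^-1) @ \oo --> (1 : R).
 rewrite -[X in _ --> X]invr1; apply: cvgV; first exact: oner_neq0.
 rewrite -[X in _ --> X]addr0; apply: cvgD; first exact: cvg_cst.
 by rewrite -[X in _ --> X](mulr0 0); exact: cvgM.
rewrite (_ : ident^~ s = fun k => s * ((1 + (k.+1%:R^-1 * s) * (k.+1%:R^-1 * s))^-1 * (1 + (k.+1%:R^-1 * s) * (k.+1%:R^-1 * s))^-1)).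
 rewrite -[X in _ --> X]mulr1; apply: cvgM; first exact: cvg_cst.
 by rewrite -[X in _ --> X]mulr1; exact: cvgM.
by ext k; rewrite /ident /dsqh addr0 !mulrA divff ?mul1r.
Qed.

End one_variable.

(** * Coefficients, drift and exhaustions *)

Section quadratic_forms.
Variables (R : realType) (d : nat).
Local Notation E := 'rV[R]_d.
Implicit Types (x y z : E) (M : 'M[R]_d).

Definition aform M x y : R := dotv (mulv M x) y.

Lemma aformE M x y : aform M x y = \sum_(i < d) \sum_(j < d) x ord0 j * M i j * y ord0 i.
rewrite /aform /dotv; apply: eq_bigr => i _; rewrite /mulv mxE mulr_suml.
by apply: eq_bigr => j _; rewrite mxE.
Qed.

Lemma aformDl M x y z : aform M (x + y) z = aform M x z + aform M y z.
by rewrite /aform /mulv mulmxDl dotvDl. Qed.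

Lemma aformZl M (a : R) x z : aform M (a *: x) z = a * aform M x z.
by rewrite /aform /mulv -scalemxAl dotvZl. Qed.

Lemma aform0l M z : aform M 0 z = 0.
by rewrite /aform /mulv mul0mx dotv0l. Qed.

Lemma aformC M x y : (forall i j, M j i = M i j) -> aform M x y = aform M y x.
move=> sM; rewrite !aformE exchange_big /=; apply: eq_bigr => i _; apply: eq_bigr => j _.
by rewrite sM; ring.
Qed.

End quadratic_forms.

Lemma cvg_osum (R : realType) (m : nat) (f : 'I_m -> nat -> R) (l : 'I_m -> R) :
 (forall i, f i @ \oo --> l i) -> (fun n => \sum_(i < m) f i n) @ \oo --> \sum_(i < m) l i.
elim: m f l => [|m ih] f l h.
 by rewrite big_ord0; under eq_fun do rewrite big_ord0; exact: cvg_cst.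
by rewrite big_ord_recr; under eq_fun do rewrite big_ord_recr; apply: cvgD; [apply: ih => i; side|side].
Qed.

Record coefs (R : realType) (d : nat) (mu : {measure set 'rV[R]_d -> \bar R}) (A : 'rV[R]_d -> 'M[R]_d) : Prop := Coefs {
 cf_fin : forall K, compact K -> (mu K < +oo)%E;
 cf_sym : forall x i j, A x j i = A x i j;
 cf_measA : forall i j, mfunT (fun x => A x i j);
 cf_ell : loc_strictly_elliptic A }.

(** What is used of B: local square integrability, measurability, and zero divergence with respect
    to mu, tested on C_0^oo. The zero field is a drift too, which makes the symmetric theory a
    special case. *)
Record drift (R : realType) (d : nat) (mu : {measure set 'rV[R]_d -> \bar R}) (B : 'rV[R]_d -> 'rV[R]_d) : Prop := Drift {
 dr_loc : forall i chi, test setT chi -> LL2 mu (fun x => chi x * B x ord0 i);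
 dr_meas : mvec B;
 dr_div : forall u, test setT u -> Ig mu (fun x => dotv (B x) (grad u x)) = 0 }.


Section exhaustions.
Variables (R : realType) (d : nat).
Local Notation E := 'rV[R]_d.

Lemma exhaustion_mono (V : nat -> set E) m n : exhaustion V -> (m <= n)%N -> V m `<=` V n.
move=> [_ VS _]; elim: n => [|n ih]; first by rewrite leqn0 => /eqP ->.
by rewrite leq_eqVlt => /orP[/eqP ->//|]; rewrite ltnS => /ih h x /h; exact: VS.
Qed.

Lemma exhaustion_compact (V : nat -> set E) K : exhaustion V -> compact K -> exists N, K `<=` V N.
move=> eV cK; have [oV _ UV] := eV.
have := cK; rewrite compact_cover => /(_ nat setT V) [].
- by move=> n _; have [] := oV n.
- by move=> x _; have : setT x by []; rewrite -UV => -[n _ Vn]; exists n.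
move=> D _ hD; exists (\max_(i <- finmap.enum_fset D) i)%N => x /hD[i /= iD Vi].
apply: (exhaustion_mono eV _ Vi).
by rewrite (big_rem i) //= leq_maxl.
Qed.

Lemma exhaustion_balln : exhaustion (@balln R d).
split=> [n|n|]; first by split; [exact: open_balln|exact: precompact_balln].
 exact: ballnS.
by apply/seteqP; split => // x _; have [n xn] := in_balln x; exists n.
Qed.

End exhaustions.




(** * The form with coefficients A on relatively compact sets *)

Section operator.
Variables (R : realType) (d : nat).
Local Notation E := 'rV[R]_d.
Variable mu : {measure set E -> \bar R}.
Variable A : E -> 'M[R]_d.
Hypothesis hA : coefs mu A.
Let mu_fin := cf_fin hA.
Let A_sym := cf_sym hA.
Let mA := cf_measA hA.
Let A_ell := cf_ell hA.
Implicit Types (u v f g h chi eta : E -> R) (D F H : E -> E) (V U : set E).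
Local Notation Q0 := (q0 mu).
Local Notation LLv := (LLv mu).
Local Notation Lint := (Lint mu).
Local Notation Ig := (Ig mu).
Local Notation LL2 := (LL2 mu).
Local Notation Sob := (Sob mu).
Local Notation N1 f := (Ig (fun x => `|f x|)).
Local Notation L1cv f_ f := (to0 (fun n => Ig (fun x => `|f_ n x - f x|))).
Local Notation aeq f g := ({ae mu, forall x, f x = g x}).
Local Notation a x := (aform (A x)).

Definition Ef F H := 2^-1 * Ig (fun x => a x (F x) (H x)).
Definition bdd v := exists M : R, forall x, `|v x| <= M.

Lemma a_ge0 x (xi : E) : 0 <= a x xi xi.
have [n xn] := in_balln x.
have [c c0 h] := A_ell (@precompact_balln R d n); have /andP[h1 _] := h x xi xn.
by apply: le_trans h1; rewrite mulr_ge0 ?invr_ge0 ?(ltW c0)// dotvv_ge0.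
Qed.

Lemma a_C x (xi eta : E) : a x xi eta = a x eta xi. Proof. exact: aformC. Qed.

Lemma a_Dr x (xi eta z : E) : a x z (xi + eta) = a x z xi + a x z eta.
by rewrite a_C aformDl !(a_C x z). Qed.

Lemma a_Zr x (t : R) (xi z : E) : a x z (t *: xi) = t * a x z xi.
by rewrite a_C aformZl (a_C x z). Qed.

Lemma a_abs x (xi eta : E) : `|a x xi eta| <= 2^-1 * (a x xi xi + a x eta eta).
have h1 := a_ge0 x (xi + eta); have h2 := a_ge0 x (xi + (-1) *: eta); move: h1 h2.
rewrite !aformDl !a_Dr !aformZl !a_Zr (a_C x eta xi) ler_norml.
move: (a x xi xi) (a x xi eta) (a x eta eta) => p q r h1 h2; apply/andP; split; lra.
Qed.

Lemma a_meas F H : mvec F ->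
 mvec H ->
 mfunT (fun x => a x (F x) (H x)).
move=> mF mH; under eq_fun do rewrite aformE.
apply: measurable_sum => i; apply: measurable_sum => j.
by apply: measurable_funM => //; exact: measurable_funM.
Qed.

Lemma LLv_meas F i : LLv F -> mfunT (fun x => F x ord0 i).
by move=> /(_ i)[]. Qed.

Lemma Lint_a V F H : precompact V -> LLv F -> LLv H -> (forall x, ~ V x -> F x = 0) ->
 Lint (fun x => a x (F x) (H x)).
move=> pV LF LH F0; have [c c0 hc] := A_ell pV.
apply: (Lint_dom (a_meas (fun i => LLv_meas i LF) (fun i => LLv_meas i LH))) (LintZ (2^-1 * c) (LintD (Lint_dotv LF LF) (Lint_dotv LH LH))) => x.
have [Vx|nV] := pselect (V x); last by rewrite F0// aform0l normr0 !mulr_ge0 ?addr_ge0 ?dotvv_ge0 ?(ltW c0)//.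
apply: (le_trans (a_abs _ _ _)); rewrite -mulrA ler_wpM2l// mulrDr.
by have /andP[_ h1] := hc x (F x) Vx; have /andP[_ h2] := hc x (H x) Vx; exact: lerD.
Qed.

Lemma Lint_ar V F H : precompact V -> LLv F -> LLv H -> (forall x, ~ V x -> H x = 0) ->
 Lint (fun x => a x (F x) (H x)).
by move=> pV LF LH H0; under eq_fun do rewrite a_C; exact: Lint_a pV LH LF H0. Qed.

Lemma EfC F H : Ef F H = Ef H F.
by rewrite /Ef; under eq_fun do rewrite a_C. Qed.

Lemma Ef_ge0 F : 0 <= Ef F F.
by rewrite mulr_ge0// Ig_ge0// => x; exact: a_ge0. Qed.

Lemma Ef_linl V (t : R) F G H : precompact V -> LLv F -> LLv G -> LLv H ->
 (forall x, ~ V x -> H x = 0) ->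
 Ef (fun x => t *: F x + G x) H = t * Ef F H + Ef G H.
move=> pV LF LG LH H0; rewrite /Ef; under eq_fun do rewrite aformDl aformZl.
have i1 := Lint_ar pV LF LH H0; have i2 := Lint_ar pV LG LH H0.
rewrite IgD//; last side.
by rewrite IgZ//; ring.
Qed.

Lemma Ef_Bl V F G H : precompact V -> LLv F -> LLv G -> LLv H -> (forall x, ~ V x -> H x = 0) ->
 Ef (fun x => F x - G x) H = Ef F H - Ef G H.
move=> pV LF LG LH H0; have := Ef_linl (-1) pV LG LF LH H0.
by under [X in Ef X _]eq_fun do rewrite scaleN1r addrC; move=> ->; ring.
Qed.

Lemma ev_finite V : open V -> precompact V -> (mu V < +oo)%E.
move=> oV /precompact_sub[K cK VK]; apply: le_lt_trans (mu_fin cK).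
by apply: le_measure => //; rewrite inE; [exact: open_rV_measurable|exact: compact_meas_rV].
Qed.

Lemma Lint_1 V : open V -> precompact V -> Lint (\1_V : E -> R).
by move=> oV pV; apply: Lint_indic; [exact: open_rV_measurable|exact: ev_finite]. Qed.

Lemma LL2_Lint V u : open V -> precompact V -> LL2 u -> (forall x, ~ V x -> u x = 0) -> Lint u.
move=> oV pV [mu' iu] u0; apply: (Lint_dom mu' _ (LintD (Lint_1 oV pV) iu)) => x.
rewrite indicE; have [Vx|nV] := pselect (V x); last by rewrite memNset// u0// normr0 expr0n /=.
by rewrite mem_set//= -(real_normK (num_real (u x))); have := sqr_ge0 (`|u x| - 1); have := normr_ge0 (u x); nra.
Qed.

Lemma bdd_Lint V u : open V -> precompact V -> mfunT u -> bdd u ->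
 (forall x, ~ V x -> u x = 0) -> Lint u.
move=> oV pV mu' [M hM] u0.
exact: (Lint_bounded_supp (open_rV_measurable oV) (ev_finite oV pV) mu' hM u0).
Qed.

Lemma Lint_mul_bdd g v : Lint g -> mfunT v -> bdd v -> Lint (fun x => g x * v x).
move=> ig mv [M hM]; apply: (Lint_dom _ _ (LintZ M (Lint_abs ig))).
 by apply: measurable_funM => //; exact: Lint_meas ig.
by move=> x; rewrite normrM mulrC ler_wpM2r.
Qed.

Lemma LL2_mul_bdd g v : LL2 g -> mfunT v -> bdd v -> LL2 (fun x => g x * v x).
by move=> Lg mv [M hM]; under eq_fun do rewrite mulrC; exact: (LL2_bounded (M := M)). Qed.

(** * Dissipativity and comparison with a divergence-free drift *)

Section with_drift.
Variable B : E -> E.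
Hypothesis hB : drift mu B.
Let B_loc := dr_loc hB.
Let B_meas := dr_meas hB.
Let B_div := dr_div hB.

Definition BV V x : E := (\1_V x : R) *: B x.

Lemma LLv_BV V : open V -> precompact V -> LLv (BV V).
move=> oV /precompact_sub[K cK VK] i; have [chi [tc c01 c1]] := cutoff cK openT (fun x _ => I).
apply: (LL2_dom _ _ (B_loc i tc)) => [|x].
 by under eq_fun do rewrite mxE; apply: measurable_funM => //; exact: measurable_indic (open_rV_measurable oV).
rewrite mxE indicE; have [Vx|nV] := pselect (V x).
 by rewrite mem_set//= c1//; side.
by rewrite memNset// mul0r normr0.
Qed.

Lemma BV_dotv V D x : (~ V x -> D x = 0) -> dotv (B x) (D x) = dotv (BV V x) (D x).
move=> D0; rewrite /BV dotvZl indicE; have [Vx|nV] := pselect (V x).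
 by rewrite mem_set// mul1r.
by rewrite D0// memNset// mul0r dotvC dotv0l.
Qed.

Lemma Lint_BD V D : open V -> precompact V -> LLv D -> (forall x, ~ V x -> D x = 0) ->
 Lint (fun x => dotv (B x) (D x)).
move=> oV pV LD D0; under eq_fun => x do rewrite (BV_dotv (V := V) (fun nV => D0 x nV)).
exact: Lint_dotv (LLv_BV oV pV) LD.
Qed.

Lemma Lint_BDv V D v : open V -> precompact V -> LLv D -> (forall x, ~ V x -> D x = 0) ->
 mfunT v -> bdd v -> Lint (fun x => dotv (B x) (D x) * v x).
by move=> oV pV LD D0 mv bv; apply: Lint_mul_bdd => //; exact: Lint_BD oV pV LD D0. Qed.

(* the support of v localizes D *)
Lemma Lint_BDv' V D v : open V -> precompact V -> LLv D -> mfunT v -> bdd v ->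
 (forall x, ~ V x -> v x = 0) -> Lint (fun x => dotv (B x) (D x) * v x).
move=> oV pV LD mv bv v0.
rewrite (_ : (fun x => _) = fun x => dotv (BV V x) (D x) * v x).
 by apply: Lint_mul_bdd => //; exact: Lint_dotv (LLv_BV oV pV) LD.
ext x; rewrite /BV dotvZl indicE; have [Vx|nV] := pselect (V x).
 by rewrite mem_set// mul1r.
by rewrite v0// !mulr0.
Qed.

Lemma div_Sob V u D : open V -> precompact V -> Sob V u D -> Ig (fun x => dotv (B x) (D x)) = 0.
move=> oV pV [Lu LD u0 [v_ [tv hv]]].
under eq_fun => x do rewrite (BV_dotv (V := V) (fun nV => (u0 x nV).2)).
have LB := LLv_BV oV pV.
have tvT n : test setT (v_ n) := testW (fun x _ => I) (tv n).
have e n : \sum_(i < d) Ig (fun x => grad (v_ n) x ord0 i * BV V x ord0 i) = 0.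
 rewrite -[RHS](B_div (tvT n)) -Ig_sum; last by move=> i; apply: LL2_mul => //; exact: (LLv_grad mu_fin (tv n)).
 congr Ig; ext x.
 rewrite (BV_dotv (V := V)); last by move=> nV; exact: grad_off (tv n) nV.
 by rewrite /dotv; apply: eq_bigr => i _; rewrite mulrC.
have hd n i : LL2 (fun x => grad (v_ n) x ord0 i) := LLv_grad mu_fin (tv n) i.
have lim i : to0 (fun n => `|Ig (fun x => grad (v_ n) x ord0 i * BV V x ord0 i) - Ig (fun x => D x ord0 i * BV V x ord0 i)|).
 apply: L2_lim_mul => //; apply: to0_le hv => n.
 have := q0_coord i (LL2B (LL2_test mu_fin (tv n)) Lu) (LLvB (LLv_grad mu_fin (tv n)) LD).
 by under eq_fun do rewrite mxE [X in _ + X]mxE.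
have -> : Ig (fun x => dotv (BV V x) (D x)) = \sum_(i < d) Ig (fun x => D x ord0 i * BV V x ord0 i).
 rewrite -Ig_sum; last side.
 by congr Ig; ext x; apply: eq_bigr => i _; rewrite mulrC.
have L := to0_sum lim.
apply/eqP; rewrite -normr_eq0 eq_le normr_ge0 andbT; apply/ler_addgt0Pr => t t0; rewrite add0r.
have [N /(_ _ (leqnn N)) hN] := L _ t0; apply: le_trans hN.
set p := (X in `|X|); have -> : p = - (\sum_(i < d) Ig (fun x => grad (v_ N) x ord0 i * BV V x ord0 i) - p).
 by rewrite e sub0r opprK.
by rewrite normrN /p -sumrB ler_norm_sum.
Qed.

Lemma div_comp V u D (F f : R -> R) : open V -> precompact V -> cfun d F f -> F 0 = 0 -> Sob V u D ->
 Ig (fun x => dotv (B x) (D x) * f (u x)) = 0.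
move=> oV pV cF F0 S; rewrite -[RHS](div_Sob oV pV (Sob_comp mu_fin cF F0 S)).
by congr Ig; ext x; rewrite [in RHS]dotvC dotvZl dotvC mulrC.
Qed.

(** The weak equation for minus the operator. Test functions are bounded because <B, D> and g are
    only integrable. *)
Definition weq V D g := forall v F, Sob V v F -> bdd v ->
 Ef D F - Ig (fun x => dotv (B x) (D x) * v x) = Ig (fun x => g x * v x).

Lemma bdd_sgnr (r : R) u : 0 <= r -> bdd (fun x => sgnr r (u x)).
by move=> r0; exists 1 => x; exact: sgnr_bound. Qed.

(** The equation is tested with [sgnr r (u x)]. The drift drops out because [sgnr r] is the
    derivative of [absr r], the form part is nonnegative because [sgnr r] is nondecreasing, and u
    times this test function is at least |u| - 1 / r. *)
Lemma dissip V u D g (al : R) : open V -> precompact V -> 0 < al -> Sob V u D -> Lint g ->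
 weq V D g -> al * Ig (fun x => `|u x|) <= Ig (fun x => `|al * u x + g x|).
move=> oV pV al0 S ig hw.
have iu : Lint u := LL2_Lint oV pV (Sob_L2 S) (fun x => Sob_off S).
have i1 := Lint_1 oV pV; have m0 : 0 <= Ig \1_V by apply: Ig_ge0.
apply/ler_addgt0Pr => e e0.
(* r makes the loss al * r^-1 * mu V at most e; the + 1 covers the case mu V = 0. *)
pose r : R := al * (Ig \1_V + 1) / e.
have r0 : 0 < r by rewrite !mulr_gt0 ?invr_gt0// ltr_wpDl.
have r0' := ltW r0.
have cs := cfun_sgnr d r; have Sv := Sob_comp mu_fin cs (sgnr0 r) S.
have bs := bdd_sgnr u r0'.
have ms : mfunT (fun x => sgnr r (u x)) := Sob_meas Sv.
have := hw _ _ Sv bs.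
rewrite (div_comp oV pV (cfun_absr d r0) (absr0 r) S) subr0 => hE.
have gs0 : 0 <= Ig (fun x => g x * sgnr r (u x)).
 rewrite -hE mulr_ge0// Ig_ge0// => x; rewrite a_Zr mulr_ge0 ?a_ge0//; exact: dsgnr_ge0.
have iau : Lint (fun x => al * u x + g x) by apply: LintD => //; side.
have igs : Lint (fun x => g x * sgnr r (u x)) by exact: Lint_mul_bdd.
have ius : Lint (fun x => u x * sgnr r (u x)) by exact: Lint_mul_bdd.
have h1 : al * Ig (fun x => u x * sgnr r (u x)) <= Ig (fun x => `|al * u x + g x|).
 apply: (@le_trans _ _ (Ig (fun x => (al * u x + g x) * sgnr r (u x)))).
  rewrite (_ : (fun x => (al * u x + g x) * _) = fun x => al * (u x * sgnr r (u x)) + g x * sgnr r (u x)); last by ext x; ring.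
  by rewrite IgD//; [rewrite IgZ// lerDl|side].
 apply: Ig_le; [exact: Lint_mul_bdd|side|move=> x].
 by rewrite (le_trans (ler_norm _))// normrM ler_piMr// sgnr_bound.
have h2 : Ig (fun x => `|u x|) - r^-1 * Ig \1_V <= Ig (fun x => u x * sgnr r (u x)).
 rewrite -IgZ// -IgB; [|side|side].
 apply: Ig_le => //; first side.
 move=> x; rewrite indicE; have [Vx|nV] := pselect (V x).
  by rewrite mem_set// mulr1; exact: sgnr_near.
 by rewrite (Sob_off S nV) normr0 sub0r memNset// mulr0 oppr0 mul0r.
have h3 : al * (r^-1 * Ig \1_V) <= e.
 have p0 : 0 < Ig \1_V + 1 by rewrite ltr_wpDl.
 have -> : al * (r^-1 * Ig \1_V) = e * (Ig \1_V / (Ig \1_V + 1)).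
  by rewrite /r; field; rewrite !gt_eqF.
 by rewrite ler_piMr ?(ltW e0)// ler_pdivrMr ?mul1r ?lerDl.
have := ler_wpM2l (ltW al0) h2; rewrite mulrBr; move: h1 h3; lra.
Qed.

(** A weak maximum principle across two sets. The test function v = psi (u1 - trunc m (u2) - m) is
    a.e. positive exactly where u1 > u2 + m, and it vanishes off V because the truncation stays
    above - m; the margin m > 0 is what allows a smooth truncation. Form and drift leave the
    integral of h v nonnegative, while h < 0 wherever v > 0, so v = 0. *)
Lemma cmp V U u1 D1 u2 D2 h (m : R) : open V -> precompact V -> precompact U -> 0 < m ->
 Sob V u1 D1 -> Sob U u2 D2 -> {ae mu, forall x, 0 <= u2 x} -> Lint h ->
 (forall v F, Sob V v F -> bdd v -> (forall x, 0 <= v x) ->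
  Ef (fun x => D1 x - D2 x) F - Ig (fun x => dotv (B x) (D1 x - D2 x) * v x) <= Ig (fun x => h x * v x)) ->
 {ae mu, forall x, u2 x + m < u1 x -> h x < 0} ->
 {ae mu, forall x, u1 x <= u2 x + m}.
move=> oV pV pU m0 S1 S2 u20 ih hw hneg.
have cT := cfun_trunc d m; have gT (t : R) : - m <= trunc m t by exact: trunc_ge.
have z1 (s : R) : s <= 0 -> psi s = 0 /\ flat 3 s = 0 by move=> s0; rewrite psi_le0// flat_le0.
have z2 (s : R) : s <= 0 -> Psi s = 0 /\ psi s = 0 by move=> s0; rewrite psi_le0// Psi_le0.
have Sp := Sob_comp_diff mu_fin (cfun_psi R d) cT z1 gT S1 S2.
have SP := Sob_comp_diff mu_fin (cfun_Psi R d) cT z2 gT S1 S2.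
set w := fun x => u1 x - trunc m (u2 x) - m in Sp SP.
pose v x := psi (w x).
have v0 x : 0 <= v x by exact: psi_ge0.
have bv : bdd v by exists 1 => x; rewrite ger0_norm// psi_le1.
have mv : mfunT v := Sob_meas Sp.
have LD := LLvB (Sob_LLv S1) (Sob_LLv S2).
have tr1 : {ae mu, forall x, trunc m (u2 x) = u2 x /\ dtrunc m (u2 x) = 1}.
 by apply: filterS u20 => x ux; exact: trunc_ge0.
have := hw _ _ Sp bv v0.
have iP := Lint_BD oV pV (Sob_LLv SP) (fun=> Sob_offD SP).
have -> : Ig (fun x => dotv (B x) (D1 x - D2 x) * psi (u1 x - trunc m (u2 x) - m)) = 0.
 rewrite -[RHS](div_Sob oV pV SP); apply/esym/Ig_ae => //.
  apply: measurable_funM => //; apply: measurable_sum => i.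
  by apply: measurable_funM => //; exact: LLv_meas.
 by apply: filterS tr1 => x [_ ->]; rewrite scale1r [in LHS]dotvC dotvZl dotvC mulrC.
rewrite subr0 => hE.
have iE := Lint_ar pV LD (Sob_LLv Sp) (fun=> Sob_offD Sp).
have E0 : 0 <= Ef (fun x => D1 x - D2 x) (fun x => flat 3 (u1 x - trunc m (u2 x) - m) *: (D1 x - dtrunc m (u2 x) *: D2 x)).
 rewrite mulr_ge0// Ig_ge0_ae//; apply: filterS tr1 => x [_ ->].
 by rewrite scale1r a_Zr mulr_ge0 ?flat_ge0 ?a_ge0.
have hv0 : 0 <= Ig (fun x => h x * v x) by exact: le_trans E0 hE.
have pos : {ae mu, forall x, 0 < v x -> h x < 0}.
 apply: filterS2 tr1 hneg => x [e _] hx vx; apply: hx.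
 have [//|le] := ltP (u2 x + m) (u1 x); move: vx; rewrite /v psi_le0 ?ltxx// /w e; lra.
have ihv : Lint (fun x => h x * v x) by exact: Lint_mul_bdd.
have : {ae mu, forall x, - (h x * v x) = 0}.
 apply: Ig_eq0; first side.
  apply: filterS pos => x hx; rewrite oppr_ge0.
  have [vx|vx] := ltP 0 (v x); first by rewrite mulr_le0_ge0// ltW// hx.
  by rewrite (_ : v x = 0) ?mulr0//; apply/eqP; rewrite eq_le vx v0.
 by rewrite IgN// oppr_le0.
move=> hz; apply: filterS3 hz pos tr1 => x hz hp [e _].
have [//|lt] := leP (u1 x) (u2 x + m).
have vx : 0 < v x by apply: psi_gt0; rewrite /w e; lra.
move/eqP: hz; rewrite oppr_eq0 mulf_eq0 (lt_eqF (hp vx)) (gt_eqF vx); by [].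
Qed.

(** * Lax-Milgram with the zero-order term eps |B|^2 *)

Section lax_milgram_eps.
Variables (V : set E) (al ep : R).
Hypotheses (oV : open V) (pV : precompact V) (al0 : 0 < al) (ep0 : 0 < ep).
Local Notation W := ((E -> R^o) * (E -> E))%type.
Local Notation wt x := (al + ep * dotv (B x) (B x)).

(** With |B| u square integrable, the integrand <B, Du> v is integrable and the drift becomes a
    bounded skew form for the scalar product [qW]. *)
Definition SW : set W := [set w | Sob V w.1 w.2 /\ forall i, LL2 (fun x => B x ord0 i * w.1 x)].
Definition gauge x (s : R) (xi : E) : R := wt x * s ^+ 2 + 2^-1 * a x xi xi.
Definition qW (w z : W) : R := Ig (fun x => wt x * (w.1 x * z.1 x) + 2^-1 * a x (w.2 x) (z.2 x)).

Lemma wt_gt0 x : 0 < wt x.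
by rewrite ltr_wpDr// mulr_ge0 ?dotvv_ge0// ltW. Qed.

Lemma wt_meas : mfunT (fun x => wt x).
apply: measurable_funD => //; apply: measurable_funM => //.
by apply: measurable_sum => i; exact: measurable_funM.
Qed.

Lemma W1 (t : R) (w z : W) x : (t *: w + z).1 x = t * w.1 x + z.1 x. Proof. by []. Qed.
Lemma W2 (t : R) (w z : W) x : (t *: w + z).2 x = t *: w.2 x + z.2 x. Proof. by []. Qed.

Lemma Lint_wt u v : LL2 u -> LL2 v -> (forall i, LL2 (fun x => B x ord0 i * u x)) ->
 (forall i, LL2 (fun x => B x ord0 i * v x)) -> Lint (fun x => wt x * (u x * v x)).
move=> Lu Lv Bu Bv.
rewrite (_ : (fun x => _) = fun x => al * (u x * v x) + ep * \sum_(i < d) (B x ord0 i * u x) * (B x ord0 i * v x)).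
 apply: LintD; first side.
 by apply: LintZ; apply: Lint_sum => i; side.
ext x; rewrite mulrDl -mulrA; congr (_ + _ * _); rewrite /dotv mulr_suml.
by apply: eq_bigr => i _; ring.
Qed.

Lemma Lint_qW w z : SW w -> SW z -> Lint (fun x => wt x * (w.1 x * z.1 x) + 2^-1 * a x (w.2 x) (z.2 x)).
move=> [S1 B1] [S2 B2]; apply: LintD; first exact: (Lint_wt (Sob_L2 S1) (Sob_L2 S2) B1 B2).
by apply: LintZ; exact: Lint_a pV (Sob_LLv S1) (Sob_LLv S2) (fun=> Sob_offD S1).
Qed.

Lemma qWE w z : SW w -> SW z -> qW w z = Ig (fun x => wt x * (w.1 x * z.1 x)) + Ef w.2 z.2.
move=> [S1 B1] [S2 B2]; have ia := Lint_a pV (Sob_LLv S1) (Sob_LLv S2) (fun=> Sob_offD S1).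
rewrite /qW IgD; [|exact: (Lint_wt (Sob_L2 S1) (Sob_L2 S2) B1 B2)|side].
by rewrite IgZ.
Qed.

Lemma SW_lin (t : R) (w z : W) : SW w -> SW z -> SW (t *: w + z).
move=> [S1 B1] [S2 B2]; split; first exact: (Sob_lin mu_fin t S1 S2).
move=> i; rewrite (_ : (fun x => _) = fun x => t * (B x ord0 i * w.1 x) + B x ord0 i * z.1 x).
 side.
by ext x; rewrite /= mulrDr mulrCA.
Qed.

Lemma semihilbert_qW : semihilbert SW qW.
split.
- split; first exact: (Sob0 mu_fin V).
 by move=> i; under eq_fun do rewrite mulr0; side.
- exact: SW_lin.
- move=> w z _ _; congr Ig; ext x; by rewrite a_C [w.1 x * _]mulrC.
- move=> t w z y Sw Sz Sy; rewrite /qW -IgZ ?Lint_qW// -IgD ?Lint_qW//; last by apply: LintZ; exact: Lint_qW.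
 congr Ig; ext x.
 by rewrite W1 W2 aformDl aformZl; ring.
- move=> w _; apply: Ig_ge0 => x; apply: addr_ge0; first by rewrite mulr_ge0 ?(ltW (wt_gt0 x))// -expr2 sqr_ge0.
 by rewrite mulr_ge0// a_ge0.
Qed.

Lemma gauge_ge0 x s xi : 0 <= gauge x s xi.
by apply: addr_ge0; apply: mulr_ge0; rewrite ?sqr_ge0 ?a_ge0 ?(ltW (wt_gt0 x)). Qed.

Lemma gauge_fst x s xi : al * s ^+ 2 <= gauge x s xi /\ ep * dotv (B x) (B x) * s ^+ 2 <= gauge x s xi.
rewrite /gauge mulrDl; have := a_ge0 x xi; have p : 0 <= ep * dotv (B x) (B x) * s ^+ 2.
 by apply: mulr_ge0; [apply: mulr_ge0; [side|exact: dotvv_ge0]|exact: sqr_ge0].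
have p2 : 0 <= al * s ^+ 2 by rewrite mulr_ge0 ?sqr_ge0// ltW.
move: (ep * _ * _) (al * _) (a x xi xi) p p2 => X Y Z; split; lra.
Qed.

Lemma gauge_snd x s xi : a x xi xi <= 2 * gauge x s xi.
have -> : 2 * gauge x s xi = 2 * (wt x * s ^+ 2) + a x xi xi by rewrite /gauge; field.
by rewrite lerDr; apply: mulr_ge0 => //; apply: mulr_ge0; [exact: ltW (wt_gt0 x)|exact: sqr_ge0].
Qed.

Lemma gauge_meas u D : mfunT u -> mvec D ->
 mfunT (fun x => gauge x (u x) (D x)).
move=> mu' mD; apply: measurable_funD.
 by apply: measurable_funM; [exact: wt_meas|side].
by apply: measurable_funM => //; exact: a_meas.
Qed.

Lemma gauge_cont x (s_ : nat -> R) (xi_ : nat -> E) (s : R) (xi : E) : s_ @ \oo --> s ->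
 (forall i, (fun n => xi_ n ord0 i) @ \oo --> xi ord0 i) -> (fun n => gauge x (s_ n) (xi_ n)) @ \oo --> gauge x s xi.
move=> hs hxi; apply: cvgD; first by apply: cvgM; [exact: cvg_cst|exact: cvgM].
apply: cvgM; first exact: cvg_cst.
under eq_fun do rewrite aformE; rewrite aformE.
apply: cvg_osum => i; apply: cvg_osum => j.
by apply: cvgM => //; apply: cvgM => //; exact: cvg_cst.
Qed.

Lemma gauge_low x (C : R) : exists K, forall (s : R) (xi : E), gauge x s xi <= C ->
 s ^+ 2 <= K * gauge x s xi /\ forall i, xi ord0 i ^+ 2 <= K * gauge x s xi.
have [n xn] := in_balln x; have [c' c'0 hc'] := A_ell (@precompact_balln R d n).
exists (al^-1 + 2 * c') => s xi _; have g0 := gauge_ge0 x s xi.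
have [g1 _] := gauge_fst x s xi; have g2 := gauge_snd x s xi.
split=> [|i]; rewrite mulrDl.
 by rewrite ler_wpDr ?mulr_ge0 ?(ltW c'0)// ler_pdivlMl.
rewrite ler_wpDl ?mulr_ge0 ?invr_ge0 ?(ltW al0)// (le_trans (coord_le_dotv xi i))//.
have /andP[h _] := hc' x xi xn; rewrite mulrAC -ler_pdivrMr// mulrC.
exact: le_trans h g2.
Qed.

(** [riesz_fischer] completes function and gradient as one pair. Ellipticity on V turns convergence
    in [qW] into convergence in H^{1,2}, and the weight ep |B|^2 keeps |B| u square integrable in
    the limit. *)
Lemma qcomplete_qW : qcomplete SW qW.
move=> z Sz cz; have [c c0 hc] := A_ell pV.
have Sob_z n : Sob V (z n).1 (z n).2 by have [] := Sz n.
have Sb n k : SW (z n - z k).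
 have := SW_lin (-1) (Sz k) (Sz n); rewrite (_ : -1 *: _ + _ = z n - z k)//.
 by rewrite scaleN1r addrC.
have [|||||||u [D [mu' mD u0 D0 hlim]]] := @riesz_fischer _ _ _ d mu gauge gauge_ge0 _ _ _ (fun n => (z n).1) (fun n => (z n).2).
- exact: gauge_meas.
- exact: gauge_cont.
- exact: gauge_low.
- by move=> n; exact: Sob_meas (Sob_z n).
- by move=> n i; exact: LLv_meas (Sob_LLv (Sob_z n)).
- by move=> n k; exact: (Lint_qW (Sb n k) (Sb n k)).
- side.
have [N hN] := hlim 1 ltr01; have [iN _] := hN N (leqnn N).
have uV x : ~ V x -> u x = 0 by move=> nV; apply: u0 => n; exact: Sob_off (Sob_z n) nV.
have DV x : ~ V x -> D x = 0 by move=> nV; apply: D0 => n; exact: Sob_offD (Sob_z n) nV.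
have mdu n : mfunT (fun x => (z n).1 x - u x).
 by apply: measurable_funB => //; exact: Sob_meas (Sob_z n).
have mdD n i : mfunT (fun x => ((z n).2 x - D x) ord0 i).
 under eq_fun do rewrite mxE [X in _ + X]mxE; apply: measurable_funB => //; exact: LLv_meas (Sob_LLv (Sob_z n)).
have Ldu : LL2 (fun x => (z N).1 x - u x).
 split=> //; apply: (Lint_dom _ _ (LintZ al^-1 iN)); first side.
 by move=> x; rewrite ger0_norm ?sqr_ge0// ler_pdivlMl//; have [] := gauge_fst x ((z N).1 x - u x) ((z N).2 x - D x).
have dDle n x : dotv ((z n).2 x - D x) ((z n).2 x - D x) <= 2 * c * gauge x ((z n).1 x - u x) ((z n).2 x - D x).
 have [Vx|nV] := pselect (V x).
  have /andP[h _] := hc x ((z n).2 x - D x) Vx; have := gauge_snd x ((z n).1 x - u x) ((z n).2 x - D x) => g2.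
  by rewrite mulrAC -ler_pdivrMr// mulrC; exact: le_trans h g2.
 by rewrite DV// (Sob_offD (Sob_z n) nV) subrr dotv0l !mulr_ge0 ?(ltW c0)// gauge_ge0.
have LdD : LLv (fun x => (z N).2 x - D x).
 move=> i; split => //.
 apply: (Lint_dom _ _ (LintZ (2 * c) iN)); first side.
 by move=> x; rewrite ger0_norm ?sqr_ge0// (le_trans (coord_le_dotv _ i)).
have Lu : LL2 u.
 have := LL2B (Sob_L2 (Sob_z N)) Ldu; by under eq_fun do rewrite subKr.
have LD : LLv D.
 move=> i; have := LLvB (Sob_LLv (Sob_z N)) LdD i.
 by under eq_fun do rewrite subKr.
have SD : Sob V u D.
 apply: (Sob_closed mu_fin Sob_z Lu LD); first side.
 have K0 : 0 <= al^-1 + 2 * c by rewrite addr_ge0 ?mulr_ge0 ?invr_ge0 ?(ltW al0) ?(ltW c0).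
 have hlim' : to0 (fun n => Ig (fun x => gauge x ((z n).1 x - u x) ((z n).2 x - D x))).
  by move=> e e0; have [K hK] := hlim e e0; exists K => n Kn; have [] := hK n Kn.
 move=> e e0; have [M hM] := to0Z K0 hlim' e0; have [M' hM'] := hlim 1 ltr01.
 exists (maxn M M') => n; rewrite geq_max => /andP[Mn Mn']; apply: le_trans (hM n Mn).
 have [iNn _] := hM' n Mn'.
 rewrite -IgZ//; apply: Ig_le; [|side|move=> x].
  by apply: Lint_q0; [apply: LL2B => //; exact: Sob_L2 (Sob_z n)|apply: LLvB => //; exact: Sob_LLv (Sob_z n)].
 rewrite mulrDl lerD//.
 by rewrite ler_pdivlMl//; have [] := gauge_fst x ((z n).1 x - u x) ((z n).2 x - D x).
have Bu i : LL2 (fun x => B x ord0 i * u x).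
 have Bd : LL2 (fun x => B x ord0 i * ((z N).1 x - u x)).
  split; first exact: measurable_funM.
  apply: (Lint_dom _ _ (LintZ ep^-1 iN)); first by apply: measurable_funX; exact: measurable_funM.
  move=> x; rewrite ger0_norm ?sqr_ge0// ler_pdivlMl// exprMn.
  have [_ h] := gauge_fst x ((z N).1 x - u x) ((z N).2 x - D x); apply: le_trans h.
  by rewrite mulrA ler_wpM2r ?sqr_ge0// ler_wpM2l ?(ltW ep0)// coord_le_dotv.
 have [_ Bz] := Sz N; have := LL2B (Bz i) Bd.
 by under eq_fun do rewrite -mulrBr subKr.
exists (u, D) => //.
move=> e e0; have [K hK] := hlim e e0; exists K => n Kn; have [_] := hK n Kn; exact.
Qed.

Lemma Lint_BDS D v : LLv D -> (forall i, LL2 (fun x => B x ord0 i * v x)) ->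
 Lint (fun x => dotv (B x) (D x) * v x).
move=> LD Bv; rewrite (_ : (fun x => _) = fun x => \sum_(i < d) D x ord0 i * (B x ord0 i * v x)).
 by apply: Lint_sum => i; side.
by ext x; rewrite /dotv mulr_suml; apply: eq_bigr => i _; ring.
Qed.

(** Functions in this space may be unbounded, so w is replaced by [ident k] of w, a function of the
    class treated by [div_comp]. The integrand <B, Dw> w is integrable and dominates, and [ident k]
    tends to the identity. *)
Lemma skew_BD w : SW w -> Ig (fun x => dotv (B x) (w.2 x) * w.1 x) = 0.
move=> [S Bw]; have mw := Sob_meas S.
have mBD : mfunT (fun x => dotv (B x) (w.2 x)).
 by apply: measurable_sum => i; apply: measurable_funM => //; exact: LLv_meas (Sob_LLv S).
have mid k : mfunT (fun x => ident k (w.1 x)).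
 by have [_ m] := cfun_meas (cfun_ident R d k); apply: measurableT_comp.
have [|||_] := @Ig_DCT _ _ _ mu (fun k x => dotv (B x) (w.2 x) * ident k (w.1 x)) (fun x => dotv (B x) (w.2 x) * w.1 x) _ _ (Lint_abs (Lint_BDS (Sob_LLv S) Bw)).
- by move=> k; exact: measurable_funM.
- by move=> k x; rewrite normrM [leRHS]normrM; apply: ler_wpM2l => //; exact: ident_le.
- by move=> x; apply: cvgM; [exact: cvg_cst|exact: ident_cvg].
under eq_fun do rewrite (div_comp oV pV (cfun_ident R d _) (sqhk0 _ _) S).
have c0 : (fun _ : nat => 0 : R) @ \oo --> (0 : R) by exact: cvg_cst.
by move=> h; exact: (cvg_unique _ h c0).
Qed.

Lemma exists_eps f : LL2 f -> exists u D, [/\ Sob V u D, forall i, LL2 (fun x => B x ord0 i * u x) &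
 forall v F, Sob V v F -> (forall i, LL2 (fun x => B x ord0 i * v x)) ->
  Ig (fun x => wt x * (u x * v x)) + Ef D F - Ig (fun x => dotv (B x) (D x) * v x) = Ig (fun x => f x * v x)].
move=> Lf; have H := semihilbert_qW; have [c c0 hc] := A_ell pV.
pose s (w z : W) : R := - Ig (fun x => dotv (B x) (w.2 x) * z.1 x).
pose l (w : W) : R := Ig (fun x => f x * w.1 x).
have iBD (w z : W) : SW w -> SW z -> Lint (fun x => dotv (B x) (w.2 x) * z.1 x).
 by move=> [S1 _] [_ B2]; exact: Lint_BDS (Sob_LLv S1) B2.
have if_ (w : W) : SW w -> Lint (fun x => f x * w.1 x) by move=> [S1 _]; exact: LL2_mul Lf (Sob_L2 S1).
have qg (w : W) : SW w -> Ig (fun x => w.1 x ^+ 2) <= al^-1 * qW w w /\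
  (forall i, Ig (fun x => w.2 x ord0 i ^+ 2) <= 2 * c * qW w w) /\
  (forall i, Ig (fun x => (B x ord0 i * w.1 x) ^+ 2) <= ep^-1 * qW w w).
 move=> Sw; have iq := Lint_qW Sw Sw; have [S1 B1] := Sw; rewrite /qW -!IgZ//.
 have [_ i1] := Sob_L2 S1; split; [|split=> i].
 - apply: Ig_le => //; first side.
  by move=> x; rewrite ler_pdivlMl//; have [] := gauge_fst x (w.1 x) (w.2 x).
 - apply: Ig_le; [by have [] := Sob_LLv S1 i|side|move=> x].
  apply: (le_trans (coord_le_dotv _ i)); have [Vx|nV] := pselect (V x).
   have /andP[h _] := hc x (w.2 x) Vx; have g2 := gauge_snd x (w.1 x) (w.2 x).
   by rewrite mulrAC -ler_pdivrMr// mulrC; exact: le_trans h g2.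
  have g0 := gauge_ge0 x (w.1 x) (w.2 x).
  by rewrite (Sob_offD S1 nV) dotv0l -expr2 mulr_ge0 ?mulr_ge0 ?(ltW c0)//; move: g0; rewrite /gauge (Sob_offD S1 nV).
 - apply: Ig_le; [by have [] := B1 i|side|move=> x].
  rewrite ler_pdivlMl// exprMn mulrA; have [_ h] := gauge_fst x (w.1 x) (w.2 x); apply: le_trans h.
  by rewrite ler_wpM2r ?sqr_ge0// ler_wpM2l ?(ltW ep0)// coord_le_dotv.
(* Constants: ellipticity bounds each gradient component by the factor 2 c, the weight bounds each
   component of B times the function by ep^-1, and summing d components and squaring gives d^2. *)
have [|||||||w Sw hw] := @lax_milgram _ _ _ _ H qcomplete_qW s l (d%:R ^+ 2 * (2 * c * ep^-1)) (Ig (fun x => f x ^+ 2) * al^-1).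
- by rewrite !mulr_ge0 ?invr_ge0 ?(ltW c0) ?(ltW ep0).
- move=> t w z Sw Sz; rewrite /l -IgZ ?if_// -IgD ?if_//; last side.
 by congr Ig; ext x; rewrite W1; ring.
- move=> w Sw; have [h _] := qg w Sw; have [S1 _] := Sw.
 apply: (le_trans (Ig_CS Lf (Sob_L2 S1))); rewrite -mulrA ler_wpM2l// Ig_ge0// => x; exact: sqr_ge0.
- move=> t w z y Sw Sz Sy; rewrite /s mulrN -opprD -IgZ ?iBD// -IgD ?iBD//; last side.
 by congr (- Ig _); ext x; rewrite W2 dotvC dotvDl dotvZl !(dotvC _ (B x)); ring.
- move=> t w z y Sw Sz Sy; rewrite /s mulrN -opprD -IgZ ?iBD// -IgD ?iBD//; last side.
 by congr (- Ig _); ext x; rewrite W1; ring.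
- by move=> w Sw; rewrite /s skew_BD// oppr0.
- move=> w z Sw Sz; have [_ [h1 _]] := qg w Sw; have [_ [_ h2]] := qg z Sz.
 have [S1 _] := Sw; have [_ B2] := Sz.
 have qw0 := sh_ge0 H Sw; have qz0 := sh_ge0 H Sz.
 pose K := Num.sqrt (2 * c * ep^-1 * qW w w * qW z z).
 have K20 : 0 <= 2 * c * ep^-1 * qW w w * qW z z by rewrite !mulr_ge0 ?invr_ge0 ?(ltW c0) ?(ltW ep0).
 have hi i : `|Ig (fun x => w.2 x ord0 i * (B x ord0 i * z.1 x))| <= K.
  rewrite -sqrtr_sqr ler_wsqrtr// (le_trans (Ig_CS (Sob_LLv S1 i) (B2 i)))//.
  apply: (@le_trans _ _ (2 * c * qW w w * (ep^-1 * qW z z))).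
   by apply: ler_pM => //; apply: Ig_ge0 => x; exact: sqr_ge0.
  by apply: eq_ler; ring.
 have -> : s w z = - \sum_(i < d) Ig (fun x => w.2 x ord0 i * (B x ord0 i * z.1 x)).
  rewrite /s -Ig_sum; last by move=> i; apply: LL2_mul => //; exact: Sob_LLv S1 i.
  congr (- Ig _); ext x; rewrite /dotv mulr_suml; apply: eq_bigr => i _; ring.
 have h : `|\sum_(i < d) Ig (fun x => w.2 x ord0 i * (B x ord0 i * z.1 x))| <= d%:R * K.
  apply: (le_trans (ler_norm_sum _ _ _)); apply: (@le_trans _ _ (\sum_(i < d) K)); first by apply: ler_sum => i _.
  by rewrite sumr_const card_ord mulr_natl.
 rewrite sqrrN -(real_normK (num_real (\sum_(i < d) _))).
 have K0 : 0 <= d%:R * K by rewrite mulr_ge0 ?sqrtr_ge0.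
 apply: (@le_trans _ _ ((d%:R * K) ^+ 2)); first by rewrite lerXn2r.
 by rewrite exprMn sqr_sqrtr// !mulrA.
exists w.1, w.2; have [S1 B1] := Sw; split=> // v F Sv Bv.
by have := hw (v, F) (conj Sv Bv); rewrite qWE.
Qed.

End lax_milgram_eps.
End with_drift.

Lemma LL2_1 V : open V -> precompact V -> LL2 (\1_V : E -> R).
move=> oV pV; have i1 := Lint_1 oV pV; split; first exact: Lint_meas i1.
rewrite (_ : (fun x => _) = (\1_V : E -> R))//; ext x.
by rewrite indicE; case: (x \in V); rewrite ?expr1n ?expr0n.
Qed.

Lemma L1_L2 V u : open V -> precompact V -> LL2 u -> (forall x, ~ V x -> u x = 0) ->
 Ig (fun x => `|u x|) ^+ 2 <= Ig (\1_V) * Ig (fun x => u x ^+ 2).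
move=> oV pV Lu u0; have L1 := LL2_1 oV pV.
have Lau : LL2 (fun x => `|u x|).
 by apply: (LL2_dom _ _ Lu) => [|x]; [apply: measurableT_comp => //; exact: LL2_meas Lu|rewrite normr_id].
have := Ig_CS L1 Lau.
rewrite (_ : (fun x => \1_V x * `|u x|) = fun x => `|u x|); last first.
 ext x; rewrite indicE; have [Vx|nV] := pselect (V x); first by rewrite mem_set// mul1r.
 by rewrite u0// normr0 mulr0.
rewrite (_ : (fun x => \1_V x ^+ 2) = (\1_V : E -> R)); last first.
 by ext x; rewrite indicE; case: (x \in V); rewrite ?expr1n ?expr0n.
by under [X in _ <= _ * Ig X]eq_fun do rewrite real_normK ?num_real//.
Qed.

Lemma to0_L1_L2 V (u_ : nat -> E -> R) : open V -> precompact V -> (forall n, LL2 (u_ n)) ->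
 (forall n x, ~ V x -> u_ n x = 0) -> to0 (fun n => Ig (fun x => u_ n x ^+ 2)) ->
 to0 (fun n => Ig (fun x => `|u_ n x|)).
move=> oV pV Lu u0 h; apply: (@to0_sqr _ _ (fun n => Ig (\1_V) * Ig (fun x => u_ n x ^+ 2))).
 by move=> n; exact: (L1_L2 oV pV (Lu n) (u0 n)).
by apply: to0Z => //; apply: Ig_ge0.
Qed.

(** [bdd] is a bound at every point; u is modified on a null set to satisfy it while the gradient D
    is kept. *)
Lemma clip V u D (M : R) : Sob V u D -> 0 <= M -> {ae mu, forall x, `|u x| <= M} ->
 exists u', [/\ Sob V u' D, forall x, `|u' x| <= M & aeq u u'].
move=> S M0 uM; pose u' x := Num.max (- M) (Num.min M (u x)).
have e : aeq u u'.
 apply: filterS uM => x; rewrite ler_norml => /andP[h1 h2].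
 by rewrite /u' (min_idPr h2) (max_idPr h1).
exists u'; split=> //; last first.
 move=> x; rewrite /u' ler_norml le_max lexx /= ge_max ge_min lexx /= andbT.
 by rewrite (le_trans _ M0)// oppr_le0.
apply: (Sob_ae mu_fin S) => //.
- apply: measurable_maxr => //; apply: measurable_minr => //; exact: Sob_meas S.
- by move=> i; exact: LLv_meas (Sob_LLv S).
- exact: aeW.
- move=> x nV; rewrite (Sob_offD S nV) /u' (Sob_off S nV); split=> //.
 by rewrite (min_idPr M0) (max_idPr _)// oppr_le0.
Qed.

(** * Solutions of the regularised resolvent equation *)

Section with_drift.
Variable B : E -> E.
Hypothesis hB : drift mu B.
Let B_meas := dr_meas hB.

(** Weak form of (al + ep |B|^2 - L) u = f on V with Dirichlet condition, tested on those v for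
    which |B| v is square integrable. *)
Definition isol V (ep al : R) f u D := [/\ Sob V u D, forall i, LL2 (fun x => B x ord0 i * u x) &
 forall v F, Sob V v F -> (forall i, LL2 (fun x => B x ord0 i * v x)) ->
  Ig (fun x => (al + ep * dotv (B x) (B x)) * (u x * v x)) + Ef D F -
  Ig (fun x => dotv (B x) (D x) * v x) = Ig (fun x => f x * v x)].

Lemma LL2_Bv V v : open V -> precompact V -> mfunT v -> bdd v ->
 (forall x, ~ V x -> v x = 0) -> forall i, LL2 (fun x => B x ord0 i * v x).
move=> oV pV mv bv v0 i; have L := LLv_BV hB oV pV i.
rewrite (_ : (fun x => _) = fun x => BV B V x ord0 i * v x); first exact: LL2_mul_bdd.
ext x; rewrite mxE indicE; have [Vx|nV] := pselect (V x).
 by rewrite mem_set// mul1r.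
by rewrite v0// !mulr0.
Qed.

Lemma isol0 V ep al : isol V ep al (fun=> 0) (fun=> 0) (fun=> 0).
split; first exact: Sob0.
 by move=> i; under eq_fun do rewrite mulr0; side.
move=> v F Sv Bv; rewrite /Ef.
under eq_fun do rewrite mul0r mulr0; under [X in _ + _ * Ig X]eq_fun do rewrite aform0l.
under [X in _ - Ig X]eq_fun do rewrite dotvC dotv0l mul0r.
by under [X in _ = Ig X]eq_fun do rewrite mul0r; rewrite Ig_cst0 mulr0 addr0 subrr.
Qed.

Lemma isolZ V ep al f u D (t : R) : open V -> precompact V -> 0 < al -> 0 < ep -> LL2 f -> isol V ep al f u D ->
 isol V ep al (fun x => t * f x) (fun x => t * u x) (fun x => t *: D x).
move=> oV pV al0 ep0 Lf [S Bu eqn]; split; first exact: Sob_Z.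
 by move=> i; under eq_fun do rewrite mulrCA; side.
move=> v F Sv Bv; have := eqn v F Sv Bv => h.
have i1 := Lint_wt al ep (Sob_L2 S) (Sob_L2 Sv) Bu Bv.
have i2 := Lint_BDS (Sob_LLv S) Bv; have i3 := LL2_mul Lf (Sob_L2 Sv).
have -> : (fun x => t * f x * v x) = fun x => t * (f x * v x) by ext x; rewrite mulrA.
rewrite IgZ// -h.
have -> : (fun x => (al + ep * dotv (B x) (B x)) * (t * u x * v x)) = fun x => t * ((al + ep * dotv (B x) (B x)) * (u x * v x)).
 by ext x; ring.
have -> : (fun x => dotv (B x) (t *: D x) * v x) = fun x => t * (dotv (B x) (D x) * v x).
 by ext x; rewrite dotvC dotvZl dotvC mulrA.
have -> : Ef (fun x => t *: D x) F = t * Ef D F.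
 rewrite /Ef mulrCA; congr (_ * _); rewrite -IgZ; last exact: (Lint_a pV (Sob_LLv S) (Sob_LLv Sv) (fun=> Sob_offD S)).
 by congr Ig; ext x; rewrite aformZl.
by rewrite !IgZ//; ring.
Qed.

Lemma isol_exists V ep al f : open V -> precompact V -> 0 < al -> 0 < ep -> LL2 f ->
 exists u D, isol V ep al f u D.
move=> oV pV al0 ep0 Lf; have [u [D [S Bu h]]] := exists_eps hB oV pV al0 ep0 Lf.
by exists u, D.
Qed.

(** Both equations are tested on the smaller set V. Where u1 > u2 + m the weight is at least al, so
    wt (u1 - u2) exceeds al m, hence also f1 - f2, and the source h of the difference is negative:
    this is the situation of [cmp]. *)
Lemma isol_cmp V U ep al f1 f2 u1 u2 D1 D2 (m : R) : open V -> precompact V -> open U -> precompact U ->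
 V `<=` U -> 0 < al -> 0 < ep -> 0 < m -> LL2 f1 -> LL2 f2 ->
 isol V ep al f1 u1 D1 -> isol U ep al f2 u2 D2 -> {ae mu, forall x, 0 <= u2 x} ->
 (forall x, f1 x <= f2 x + al * m) -> {ae mu, forall x, u1 x <= u2 x + m}.
move=> oV pV oU pU VU al0 ep0 m0 Lf1 Lf2 [S1 B1 h1] [S2 B2 h2] u20 f12.
pose wt x := al + ep * dotv (B x) (B x).
have wt0 x : al <= wt x by rewrite /wt lerDl mulr_ge0 ?dotvv_ge0// ltW.
have L1 := LL2_1 oV pV.
have BL1 i : LL2 (fun x => B x ord0 i * \1_V x).
 by have := LLv_BV hB oV pV i; under eq_fun do rewrite mxE mulrC.
pose h x := (f1 x * \1_V x - f2 x * \1_V x) - (wt x * (u1 x * \1_V x) - wt x * (u2 x * \1_V x)).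
have k3 : Lint (fun x => wt x * (u1 x * \1_V x)) := Lint_wt al ep (Sob_L2 S1) L1 B1 BL1.
have k4 : Lint (fun x => wt x * (u2 x * \1_V x)) := Lint_wt al ep (Sob_L2 S2) L1 B2 BL1.
have ih : Lint h by apply: LintB; side.
apply: (cmp hB oV pV pU m0 S1 S2 u20 ih).
- move=> v F Sv bv _; have Sv' := Sob_W VU Sv.
 have v0 x : ~ V x -> v x = 0 := fun nV => Sob_off Sv nV.
 have mv := Sob_meas Sv.
 have Bv := LL2_Bv oV pV mv bv v0.
 have e1 := h1 v F Sv Bv; have e2 := h2 v F Sv' Bv.
 have j1 : Lint (fun x => dotv (B x) (D1 x) * v x) := Lint_BDS (Sob_LLv S1) Bv.
 have j2 : Lint (fun x => dotv (B x) (D2 x) * v x) := Lint_BDS (Sob_LLv S2) Bv.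
 rewrite (Ef_Bl pV (Sob_LLv S1) (Sob_LLv S2) (Sob_LLv Sv) (fun=> Sob_offD Sv)).
 have -> : (fun x => dotv (B x) (D1 x - D2 x) * v x) = fun x => dotv (B x) (D1 x) * v x - dotv (B x) (D2 x) * v x.
  ext x; rewrite dotvC dotvDl -scaleN1r dotvZl !(dotvC _ (B x)); ring.
 rewrite IgB//.
 have i1 : Lint (fun x => wt x * (u1 x * v x)) := Lint_wt al ep (Sob_L2 S1) (Sob_L2 Sv) B1 Bv.
 have i2 : Lint (fun x => wt x * (u2 x * v x)) := Lint_wt al ep (Sob_L2 S2) (Sob_L2 Sv) B2 Bv.
 have i3 := LL2_mul Lf1 (Sob_L2 Sv); have i4 := LL2_mul Lf2 (Sob_L2 Sv).
 have -> : (fun x => h x * v x) = fun x => (f1 x * v x - f2 x * v x) - (wt x * (u1 x * v x) - wt x * (u2 x * v x)).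
  ext x; rewrite /h indicE; have [Vx|nV] := pselect (V x).
   by rewrite mem_set//=; ring.
  by rewrite v0//; ring.
 rewrite IgB; [|side|side].
 rewrite !IgB// -e1 -e2 /wt.
 set a1 := Ig _; set a2 := Ig _; set a3 := Ig _; set a4 := Ig _; set a5 := Ef _ _; set a6 := Ef _ _.
 by apply: eq_ler; clear; ring.
- apply: filterS u20 => x u2x lt.
 have Vx : V x.
  have [//|nV] := pselect (V x); move: lt; rewrite (Sob_off S1 nV); lra.
 rewrite /h indicE mem_set// !mulr1 -mulrBr.
 have := f12 x; have : al * m < wt x * (u1 x - u2 x).
  apply: (@lt_le_trans _ _ (al * (u1 x - u2 x))); first by rewrite ltr_pM2l//; lra.
  by rewrite ler_wpM2r//; lra.
 by move: (wt x * _) => X; lra.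
Qed.

Lemma isol_le V ep al f u D (M : R) : open V -> precompact V -> 0 < al -> 0 < ep -> 0 < M -> LL2 f ->
 isol V ep al f u D -> (forall x, f x <= M) -> {ae mu, forall x, u x <= M / al}.
move=> oV pV al0 ep0 M0 Lf h fM.
have := @isol_cmp V V ep al f (fun=> 0) u (fun=> 0) D (fun=> 0) (M / al) oV pV oV pV (fun x => id) al0 ep0 _ Lf (@LL20 _ _ _ mu) h (isol0 V ep al).
case.
- by rewrite divr_gt0.
- exact: aeW.
- by move=> x; rewrite add0r mulrC divfK ?gt_eqF.
- by move=> N hN; exists N; move: hN => [? ? hN]; split=> // x /= hx; apply: hN => /=; rewrite add0r.
Qed.

Lemma ae_le_eps u v : (forall m : R, 0 < m -> {ae mu, forall x, u x <= v x + m}) -> {ae mu, forall x, u x <= v x}.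
move=> h; have : {ae mu, forall x, forall n : nat, u x <= v x + n.+1%:R^-1}.
 by apply: ae_foralln => n; apply: h.
apply: filterS => x hx; apply/ler_addgt0Pr => e e0.
have [N hN] := @to0_inv R e e0; apply: (le_trans (hx N)); rewrite lerD2l; side.
Qed.

Lemma isol_ge0 V ep al f u D : open V -> precompact V -> 0 < al -> 0 < ep -> LL2 f ->
 isol V ep al f u D -> (forall x, 0 <= f x) -> {ae mu, forall x, 0 <= u x}.
move=> oV pV al0 ep0 Lf h f0.
have : {ae mu, forall x, -1 * u x <= (fun=> 0) x}.
 apply: ae_le_eps => m m0.
 have hN := isolZ (-1) oV pV al0 ep0 Lf h.
 apply: (isol_cmp oV pV oV pV (fun x => id) al0 ep0 m0 _ (@LL20 _ _ _ mu) hN (isol0 V ep al)).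
 - side.
 - exact: aeW.
 - by move=> x; rewrite add0r mulN1r (@le_trans _ _ 0) ?oppr_le0// mulr_ge0// ltW.
by apply: filterS => x; rewrite mulN1r oppr_le0.
Qed.

Lemma isol_abs V ep al f u D (M : R) : open V -> precompact V -> 0 < al -> 0 < ep -> 0 < M -> LL2 f ->
 isol V ep al f u D -> (forall x, `|f x| <= M) -> {ae mu, forall x, `|u x| <= M / al}.
move=> oV pV al0 ep0 M0 Lf h fM.
have h1 := isol_le oV pV al0 ep0 M0 Lf h (fun x => le_trans (ler_norm _) (fM x)).
have h2 := isol_le oV pV al0 ep0 M0 (LL2Z (-1) Lf) (isolZ (-1) oV pV al0 ep0 Lf h).
have {}h2 : {ae mu, forall x, -1 * u x <= M / al}.
 by apply: h2 => x; rewrite mulN1r; have := fM x; rewrite ler_norml => /andP[]; lra.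
apply: filterS2 h1 h2 => x; rewrite mulN1r ler_norml => -> k; by rewrite andbT; lra.
Qed.

Lemma isol_mono V U ep al f1 f2 u1 u2 D1 D2 : open V -> precompact V -> open U -> precompact U ->
 V `<=` U -> 0 < al -> 0 < ep -> LL2 f1 -> LL2 f2 ->
 isol V ep al f1 u1 D1 -> isol U ep al f2 u2 D2 ->
 (forall x, 0 <= f2 x) -> (forall x, f1 x <= f2 x) -> {ae mu, forall x, u1 x <= u2 x}.
move=> oV pV oU pU VU al0 ep0 Lf1 Lf2 h1 h2 f0 f12; apply: ae_le_eps => m m0.
apply: (isol_cmp oV pV oU pU VU al0 ep0 m0 Lf1 Lf2 h1 h2).
- exact: isol_ge0 h2 f0.
- by move=> x; rewrite (le_trans (f12 x))// lerDl mulr_ge0// ltW.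
Qed.

Lemma isol_bdd V ep al f (M : R) : open V -> precompact V -> 0 < al -> 0 < ep -> 0 < M -> LL2 f ->
 (forall x, `|f x| <= M) -> exists u D, isol V ep al f u D /\ forall x, `|u x| <= M / al.
move=> oV pV al0 ep0 M0 Lf fM; have [u [D h]] := isol_exists oV pV al0 ep0 Lf.
have uM := isol_abs oV pV al0 ep0 M0 Lf h fM; have [S Bu hu] := h.
have [u' [S' u'M e]] := clip S (ltW (divr_gt0 M0 al0)) uM.
have bu' : bdd u' by exists (M / al).
have Bu' := LL2_Bv oV pV (Sob_meas S') bu' (fun x nV => Sob_off S' nV).
exists u', D; split=> //; split=> // v F Sv Bv; rewrite -(hu v F Sv Bv); congr (_ + _ - _).
apply: Ig_ae; first exact: (Lint_wt al ep (Sob_L2 S') (Sob_L2 Sv) Bu' Bv).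
 apply: Lint_meas (Lint_wt al ep (Sob_L2 S) (Sob_L2 Sv) Bu Bv).
by apply: filterS e => x ->.
Qed.

End with_drift.

Lemma drift0 : drift mu (fun=> 0 : E).
split.
- by move=> i chi _; under eq_fun do rewrite mxE mulr0; side.
- side.
- by move=> u _; under eq_fun do rewrite dotv0l; exact: Ig_cst0.
Qed.

(** For the zero drift the term ep |B|^2 vanishes, and the regularised equation is already that of
    the symmetric resolvent. *)
Lemma sym_res V (be : R) f : open V -> precompact V -> 0 < be -> LL2 f ->
 exists w W, Sob V w W /\ forall v F, Sob V v F -> be * Ig (fun x => w x * v x) + Ef W F = Ig (fun x => f x * v x).
move=> oV pV be0 Lf; have [w [W [S _ h]]] := isol_exists drift0 oV pV be0 ltr01 Lf.
exists w, W; split=> // v F Sv; rewrite -(h v F Sv); last first.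
 by move=> i; under eq_fun do rewrite mxE mul0r; side.
under [X in _ - Ig X]eq_fun do rewrite dotv0l mul0r.
rewrite Ig_cst0 subr0 -IgZ; last exact: LL2_mul (Sob_L2 S) (Sob_L2 Sv).
by congr (Ig _ + _); ext x; rewrite dotv0l mulr0 addr0.
Qed.

Lemma sym_res_bdd V (be M : R) f : open V -> precompact V -> 0 < be -> 0 < M -> LL2 f -> (forall x, `|f x| <= M) ->
 exists w W, [/\ Sob V w W, forall x, `|w x| <= M / be &
  forall v F, Sob V v F -> be * Ig (fun x => w x * v x) + Ef W F = Ig (fun x => f x * v x)].
move=> oV pV be0 M0 Lf fM; have [w [W [[S _ h] wM]]] := isol_bdd drift0 oV pV be0 ltr01 M0 Lf fM.
exists w, W; split=> // v F Sv; rewrite -(h v F Sv); last first.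
 by move=> i; under eq_fun do rewrite mxE mul0r; side.
under [X in _ - Ig X]eq_fun do rewrite dotv0l mul0r.
rewrite Ig_cst0 subr0 -IgZ; last exact: LL2_mul (Sob_L2 S) (Sob_L2 Sv).
by congr (Ig _ + _); ext x; rewrite dotv0l mulr0 addr0.
Qed.

Lemma dissip0 V u D g (al : R) : open V -> precompact V -> 0 < al -> Sob V u D -> Lint g ->
 (forall v F, Sob V v F -> bdd v -> Ef D F = Ig (fun x => g x * v x)) ->
 al * Ig (fun x => `|u x|) <= Ig (fun x => `|al * u x + g x|).
move=> oV pV al0 S ig h; apply: (dissip drift0 oV pV al0 S ig) => v F Sv bv.
rewrite -(h v F Sv bv); under [X in _ - Ig X]eq_fun do rewrite dotv0l mul0r.
by rewrite Ig_cst0 subr0.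
Qed.

(** * The local operator, its closure in L^1 and its resolvent *)

Variable B : E -> E.
Hypothesis hB : drift mu B.
Let B_meas := dr_meas hB.

(** The operator [L_loc] with all functions extended by 0 off V, pointwise bounds, and the gradient
    carried explicitly instead of through the choice [wgrad]. *)
Definition core V u h := exists D f, [/\ Sob V u D, bdd u, LL2 f /\ (forall x, ~ V x -> f x = 0),
 forall v F, Sob V v F -> Ef D F = - Ig (fun x => f x * v x) & h = fun x => f x + dotv (B x) (D x)].

Definition cl V u h := [/\ Lint u, Lint h & exists u_ h_ : nat -> E -> R, [/\ forall n, core V (u_ n) (h_ n),
 L1cv u_ u & L1cv h_ h]].

Lemma bdd_lin (t : R) u v : bdd u -> bdd v -> bdd (fun x => t * u x + v x).
move=> [M hM] [K hK]; exists (`|t| * M + K) => x.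
by rewrite (le_trans (ler_normD _ _))// lerD// normrM ler_wpM2l.
Qed.

Section on_V.
Variable V : set E.
Hypotheses (oV : open V) (pV : precompact V).

Lemma core_Lint u h : core V u h -> Lint u /\ Lint h.
move=> [D [f [S bu [Lf f0] _ ->]]]; split; first exact: (LL2_Lint oV pV (Sob_L2 S) (fun x => Sob_off S)).
apply: LintD; first exact: (LL2_Lint oV pV Lf f0).
exact: (Lint_BD hB oV pV (Sob_LLv S) (fun=> Sob_offD S)).
Qed.

Lemma core_lin (t : R) u h u' h' : core V u h -> core V u' h' ->
 core V (fun x => t * u x + u' x) (fun x => t * h x + h' x).
move=> [D [f [S bu [Lf f0] e ->]]] [D' [f' [S' bu' [Lf' f0'] e' ->]]].
exists (fun x => t *: D x + D' x), (fun x => t * f x + f' x); split.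
- exact: Sob_lin.
- exact: bdd_lin.
- split; first side.
 by move=> x nV; rewrite f0// f0'// mulr0 addr0.
- move=> v F Sv; rewrite (Ef_linl _ pV (Sob_LLv S) (Sob_LLv S') (Sob_LLv Sv) (fun=> Sob_offD Sv)).
 rewrite (e v F Sv) (e' v F Sv) mulrN -opprD -IgZ; last exact: LL2_mul Lf (Sob_L2 Sv).
 rewrite -IgD; [|by apply: LintZ; exact: LL2_mul Lf (Sob_L2 Sv)|exact: LL2_mul Lf' (Sob_L2 Sv)].
 by congr (- Ig _); ext x; ring.
- ext x; rewrite [dotv _ (_ + _)]dotvC dotvDl dotvZl !(dotvC _ (B x)); ring.
Qed.

Lemma core_dissip (al : R) u h : 0 < al -> core V u h -> al * N1 u <= Ig (fun x => `|al * u x - h x|).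
move=> al0 c; have [iu ih] := core_Lint c; have [D [f [S bu [Lf f0] e hE]]] := c.
apply: (dissip hB oV pV al0 S (LintN ih)) => v F Sv bv.
rewrite (e v F Sv) hE; have i1 := LL2_mul Lf (Sob_L2 Sv).
have i2 := Lint_BDv hB oV pV (Sob_LLv S) (fun=> Sob_offD S) (Sob_meas Sv) bv.
rewrite -opprD -IgD// -IgN; last side.
by congr Ig; ext x; ring.
Qed.

Lemma core_cl u h : core V u h -> cl V u h.
move=> c; have [iu ih] := core_Lint c; split=> //; exists (fun=> u), (fun=> h); split=> //.
 by rewrite (N1_ae iu iu (aeW _ (fun=> erefl))); exact: to0_cst0.
by rewrite (N1_ae ih ih (aeW _ (fun=> erefl))); exact: to0_cst0.
Qed.

Lemma core0 : core V (fun=> 0) (fun=> 0).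
exists (fun=> 0), (fun=> 0); split.
- exact: Sob0.
- by exists 0 => x; rewrite normr0.
- side.
- move=> v F _; rewrite /Ef; under eq_fun do rewrite aform0l.
 by under [X in _ = - Ig X]eq_fun do rewrite mul0r; rewrite Ig_cst0 mulr0 oppr0.
- by ext x; rewrite dotvC dotv0l addr0.
Qed.

Lemma cl_lin (t : R) u h u' h' : cl V u h -> cl V u' h' ->
 cl V (fun x => t * u x + u' x) (fun x => t * h x + h' x).
have key (f_ g_ : nat -> E -> R) f g : (forall n, Lint (f_ n)) -> (forall n, Lint (g_ n)) -> Lint f -> Lint g ->
  L1cv f_ f -> L1cv g_ g ->
  to0 (fun n => Ig (fun x => `|t * f_ n x + g_ n x - (t * f x + g x)|)).
 move=> if_ ig_ i j hf hg; apply: (to0_le _ (to0D (to0Z (normr_ge0 t) hf) hg)) => n.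
 rewrite -N1Z; last side.
 have := N1D (LintZ t (LintB (if_ n) i)) (LintB (ig_ n) j).
 by apply: le_trans; apply: eq_ler; congr Ig; ext x; congr (`|_|); ring.
move=> [iu ih [u_ [h_ [c cu ch]]]] [iu' ih' [u'_ [h'_ [c' cu' ch']]]]; split; [side|side|].
exists (fun n x => t * u_ n x + u'_ n x), (fun n x => t * h_ n x + h'_ n x); split.
- by move=> n; exact: core_lin.
- by apply: key => // n; [have [] := core_Lint (c n)|have [] := core_Lint (c' n)].
- by apply: key => // n; [have [] := core_Lint (c n)|have [] := core_Lint (c' n)].
Qed.

Lemma clB u h u' h' : cl V u h -> cl V u' h' -> cl V (fun x => u x - u' x) (fun x => h x - h' x).
move=> c c'; have := cl_lin (-1) c' c.
by under [X in cl _ X]eq_fun do rewrite mulN1r addrC; under [X in cl _ _ X]eq_fun do rewrite mulN1r addrC.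
Qed.

Lemma cl_dissip (al : R) u h : 0 < al -> cl V u h -> al * N1 u <= Ig (fun x => `|al * u x - h x|).
move=> al0 [iu ih [u_ [h_ [c cu ch]]]].
have := to0D (to0Z (ltW (mulr_gt0 (ltr0n _ 2) al0)) cu) ch; set b := fun n => _ => hb.
apply: (@to0_le_lim _ (fun=> al * N1 u) _ _ b) => //.
 by under eq_fun do rewrite subrr normr0; exact: to0_cst0.
move=> n; have [iun ihn] := core_Lint (c n); have h1 := core_dissip al0 (c n).
have h2 := N1_le iu iun; rewrite (N1C mu u) in h2.
have iv : Lint (fun x => al * u x - h x) by apply: LintB => //; side.
have ivn : Lint (fun x => al * u_ n x - h_ n x) by apply: LintB => //; side.
have h3 := N1_le ivn iv.
have h4 := N1D (LintZ al (LintB iun iu)) (LintN (LintB ihn ih)).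
rewrite (N1Z _ (LintB iun iu)) (gtr0_norm al0) in h4.
have e4 : Ig (fun x => `|al * u_ n x - h_ n x - (al * u x - h x)|) = Ig (fun x => `|al * (u_ n x - u x) + - (h_ n x - h x)|).
 by congr Ig; ext x; congr (`|_|); ring.
have e5 : Ig (fun x => `|- (h_ n x - h x)|) = Ig (fun x => `|h_ n x - h x|) by under eq_fun do rewrite normrN.
rewrite e4 in h3; rewrite e5 in h4; rewrite /b.
have h2' := ler_wpM2l (ltW al0) h2; move: h1 h2' h3 h4; clear.
move: (Ig _) (Ig _) (Ig _) (Ig _) (Ig _) (Ig _) (Ig _) => p q r s t w z; rewrite mulrDr -mulrA mulr_natl mulr2n; lra.
Qed.

Lemma cl_closed (u_ h_ : nat -> E -> R) u h : (forall n, cl V (u_ n) (h_ n)) -> Lint u -> Lint h ->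
 L1cv u_ u -> L1cv h_ h -> cl V u h.
move=> c iu ih cu ch; split=> //.
have /choice[w hw] : forall n, exists w : (E -> R) * (E -> R), [/\ core V w.1 w.2,
  Ig (fun x => `|w.1 x - u_ n x|) <= n.+1%:R^-1 & Ig (fun x => `|w.2 x - h_ n x|) <= n.+1%:R^-1].
 move=> n; have [_ _ [v_ [g_ [cc cv cg]]]] := c n.
 have p : 0 < n.+1%:R^-1 :> R by [].
 have [N1' h1] := cv _ p; have [N2 h2] := cg _ p; exists (v_ (maxn N1' N2), g_ (maxn N1' N2)).
 by split=> /=; [side|apply: h1; exact: leq_maxl|apply: h2; exact: leq_maxr].
exists (fun n => (w n).1), (fun n => (w n).2); split.
- by move=> n; have [] := hw n.
- apply: (to0_le _ (to0D (@to0_inv R) cu)) => n; have [cw h1 _] := hw n; have [i1 _] := core_Lint cw.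
 by have [i2 _ _] := c n; rewrite (le_trans (N1_tri i1 i2 iu))// lerD2r.
- apply: (to0_le _ (to0D (@to0_inv R) ch)) => n; have [cw _ h1] := hw n; have [_ i1] := core_Lint cw.
 by have [_ i2 _] := c n; rewrite (le_trans (N1_tri i1 i2 ih))// lerD2r.
Qed.

(** Dissipativity makes the solutions Cauchy as soon as the right sides converge, so the range of al
    minus the closed operator is closed. The last clause keeps limits at 0 off V. *)
Lemma cl_res_closed (al : R) (u_ f_ : nat -> E -> R) f : 0 < al ->
 (forall n, cl V (u_ n) (fun x => al * u_ n x - f_ n x)) -> Lint f -> (forall n, Lint (f_ n)) ->
 L1cv f_ f ->
 exists u, [/\ cl V u (fun x => al * u x - f x), L1cv u_ u &
  forall x, (forall n, u_ n x = 0) -> u x = 0].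
move=> al0 c if0 if_ hf.
have iu_ n : Lint (u_ n) by have [] := c n.
have cau : forall e : R, 0 < e -> exists K, forall n k, (K <= n)%N -> (K <= k)%N -> Ig (fun x => `|u_ n x - u_ k x|) <= e.
 move=> e e0; have p : 0 < al * e / 2 by rewrite !mulr_gt0.
 have [K hK] := hf _ p; exists K => n k Kn Kk.
 have := cl_dissip al0 (clB (c n) (c k)).
 have -> : (fun x => `|al * (u_ n x - u_ k x) - (al * u_ n x - f_ n x - (al * u_ k x - f_ k x))|) = fun x => `|f_ n x - f_ k x|.
  by ext x; congr (`|_|); ring.
 move=> /le_trans/(_ (N1_tri (if_ n) if0 (if_ k))); rewrite [X in _ <= _ + X]N1C => h.
 rewrite -(ler_pM2l al0) (le_trans h)// [X in _ <= X](_ : _ = al * e / 2 + al * e / 2) ?lerD ?hK//.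
 by field.
have [u iu [hu hu0]] := L1_complete iu_ cau.
exists u; split=> //.
apply: (cl_closed c) => //; first side.
apply: (to0_le _ (to0D (to0Z (ltW al0) hu) hf)) => n.
have := N1D (LintZ al (LintB (iu_ n) iu)) (LintN (LintB (if_ n) if0)).
rewrite (N1Z _ (LintB (iu_ n) iu)) (gtr0_norm al0).
have -> : Ig (fun x => `|- (f_ n x - f x)|) = Ig (fun x => `|f_ n x - f x|) by under eq_fun do rewrite normrN.
by apply: le_trans; apply: eq_ler; congr Ig; ext x; congr (`|_|); ring.
Qed.

Lemma cl_res_uniq (al : R) u u' f : 0 < al -> cl V u (fun x => al * u x - f x) -> cl V u' (fun x => al * u' x - f x) ->
 aeq u u'.
move=> al0 c c'; have [i _ _] := c; have [i' _ _] := c'; apply: N1_eq0 => //.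
rewrite -(ler_pM2l al0) mulr0 (le_trans (cl_dissip al0 (clB c c')))//.
apply: eq_ler; rewrite -[RHS](Ig_cst0 mu); congr Ig; ext x.
by rewrite (_ : _ - _ = 0) ?normr0//; ring.
Qed.

(* Yosida approximation: w = be G_be u for the symmetric resolvent converges to u strongly in H^{1,2}_0 *)
Lemma yosida_sym u D g : Sob V u D -> bdd u -> Lint g ->
 (forall v F, Sob V v F -> bdd v -> Ef D F = Ig (fun x => g x * v x)) ->
 exists w_ W_, [/\ forall n, Sob V (w_ n) (W_ n), forall n, bdd (w_ n),
  forall (n : nat) v F, Sob V v F -> n.+1%:R * Ig (fun x => w_ n x * v x) + Ef (W_ n) F = n.+1%:R * Ig (fun x => u x * v x),
  to0 (fun n => Ig (fun x => (w_ n x - u x) ^+ 2)) &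
  forall i, to0 (fun n => Ig (fun x => (W_ n x ord0 i - D x ord0 i) ^+ 2))].
move=> S [M0 uM0] ig hg.
pose M := `|M0| + 1; have M_gt0 : 0 < M by rewrite ltr_wpDl.
have uM x : `|u x| <= M by rewrite (le_trans (uM0 x))// /M (le_trans (ler_norm M0))// lerDl.
have Lu := Sob_L2 S; have LD := Sob_LLv S.
have /choice[w_ /choice[W_ hw]] : forall n : nat, exists w W, [/\ Sob V w W, forall x, `|w x| <= M &
  forall v F, Sob V v F -> n.+1%:R * Ig (fun x => w x * v x) + Ef W F = n.+1%:R * Ig (fun x => u x * v x)].
 move=> n; have be0 : 0 < n.+1%:R :> R by [].
 have [||w [W [Sw wM h]]] := @sym_res_bdd V n.+1%:R (n.+1%:R * M) (fun x => n.+1%:R * u x) oV pV be0 _ (LL2Z _ Lu).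
 - by rewrite mulr_gt0.
 - by move=> x; rewrite normrM ger0_norm// ler_wpM2l.
 exists w, W; split=> //.
  by move=> x; apply: (le_trans (wM x)); rewrite mulrAC divff ?mul1r//.
 move=> v F Sv; rewrite (h v F Sv) -IgZ; last exact: LL2_mul Lu (Sob_L2 Sv).
 by congr Ig; ext x; rewrite mulrA.
have Sw n : Sob V (w_ n) (W_ n) by have [] := hw n.
have wM n x : `|w_ n x| <= M by have [_ h _] := hw n.
have eqw n v F : Sob V v F -> n.+1%:R * Ig (fun x => w_ n x * v x) + Ef (W_ n) F = n.+1%:R * Ig (fun x => u x * v x).
 by have [_ _ h] := hw n; side.
pose e n x := w_ n x - u x; pose EE n x := W_ n x - D x.
have Se n : Sob V (e n) (EE n) := Sob_B mu_fin (Sw n) S.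
have eM n x : `|e n x| <= 2 * M.
 rewrite /e (le_trans (ler_normB _ _))//; have := wM n x; have := uM x; lra.
have be n : bdd (e n) by exists (2 * M).
have ie n : Lint (e n) := LL2_Lint oV pV (Sob_L2 (Se n)) (fun x => Sob_off (Se n)).
have ige n : Lint (fun x => g x * e n x) by apply: Lint_mul_bdd => //; exact: Sob_meas (Se n).
have [_ ie2] : True /\ forall n, Lint (fun x => e n x ^+ 2) by split=> // n; have [] := Sob_L2 (Se n).
(* Both equations are tested with the bounded error e = w_n - u. Bounding the right side crudely
   gives the L^2-norm of e squared as O(1/n); then e tends to 0 in L^1 and stays bounded, so the
   right side itself tends to 0 by [Ig_vanish], and with it the energy of e. *)
have energy n : Ef (EE n) (EE n) + n.+1%:R * Ig (fun x => e n x ^+ 2) = - Ig (fun x => g x * e n x).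
 rewrite -(hg _ _ (Se n) (be n)).
 have -> : Ef (EE n) (EE n) = Ef (W_ n) (EE n) - Ef D (EE n).
  exact: (Ef_Bl pV (Sob_LLv (Sw n)) LD (Sob_LLv (Se n)) (fun=> Sob_offD (Se n))).
 have := eqw n _ _ (Se n).
 have -> : (fun x => e n x ^+ 2) = fun x => w_ n x * e n x - u x * e n x by ext x; rewrite /e; ring.
 rewrite IgB; [|exact: LL2_mul (Sob_L2 (Sw n)) (Sob_L2 (Se n))|exact: LL2_mul Lu (Sob_L2 (Se n))].
 rewrite mulrBr; move: (n.+1%:R * _) (n.+1%:R * _) (Ef _ _) (Ef _ _) => p q r s.
 by move=> <-; ring.
have Ee0 n : 0 <= Ef (EE n) (EE n) := Ef_ge0 _.
have e20 n : 0 <= Ig (fun x => e n x ^+ 2) by apply: Ig_ge0 => x; exact: sqr_ge0.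
have ge n : - Ig (fun x => g x * e n x) <= Ig (fun x => `|g x| * `|e n x|).
 rewrite -IgN//; apply: Ig_le; [side|by under eq_fun do rewrite -normrM; side|].
 by move=> x; rewrite -normrM -normrN; exact: ler_norm.
have t2 : to0 (fun n => Ig (fun x => e n x ^+ 2)).
 have K0 : 0 <= 2 * M * N1 g by rewrite !mulr_ge0 ?N1_ge0 ?(ltW M_gt0).
 apply: (to0_le _ (to0Z K0 (@to0_inv R))) => n.
 rewrite ler_pdivlMr// mulrC (@le_trans _ _ (- Ig (fun x => g x * e n x)))//.
  by rewrite -(energy n) lerDr.
 apply: (le_trans (ge n)); rewrite -IgZ; last side.
 apply: Ig_le; [by under eq_fun do rewrite -normrM; side|side|].
 by move=> x; rewrite mulrC ler_wpM2r.
have t1 := to0_L1_L2 oV pV (fun n => Sob_L2 (Se n)) (fun n x => Sob_off (Se n)) t2.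
have tE : to0 (fun n => Ef (EE n) (EE n)).
 move=> t t0; have [del del0 hdel] := Ig_vanish (Lint_abs ig) (fun x => normr_ge0 _) (ltW (mulr_gt0 (ltr0n R 2) M_gt0)) t0.
 have [N hN] := t1 _ del0; exists N => n Nn.
 apply: (@le_trans _ _ (- Ig (fun x => g x * e n x))).
  by rewrite -(energy n) lerDl mulr_ge0.
 apply: (le_trans (ge n)); apply: (hdel (fun x => `|e n x|) _ _ _).2.
 - by move=> x; rewrite normr_ge0 eM.
 - side.
 - side.
exists w_, W_; split=> // [n|i]; first by exists M.
have [c c0 hc] := A_ell pV.
apply: (to0_le _ (to0Z (_ : 0 <= 2 * c) tE)) => [n|]; last by rewrite mulr_ge0 ?(ltW c0).
rewrite /Ef (_ : 2 * c * (2^-1 * _) = c * Ig (fun x => aform (A x) (EE n x) (EE n x))); last by field.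
have ia := Lint_a pV (Sob_LLv (Se n)) (Sob_LLv (Se n)) (fun=> Sob_offD (Se n)).
rewrite -IgZ//; apply: Ig_le; [|side|move=> x].
 by have [] := LL2B (Sob_LLv (Sw n) i) (LD i).
have [Vx|nV] := pselect (V x).
 have /andP[h _] := hc x (EE n x) Vx; rewrite -ler_pdivrMl// mulrC.
 apply: le_trans h; rewrite mulrC ler_wpM2l ?invr_ge0 ?(ltW c0)//.
 by have := coord_le_dotv (EE n x) i; rewrite /EE !mxE.
by rewrite (Sob_offD (Sw n) nV) (Sob_offD S nV) mxE subrr expr0n /= mulr_ge0 ?(ltW c0)// (a_ge0).
Qed.

Lemma N1_CS f g : LL2 f -> LL2 g -> Ig (fun x => `|f x * g x|) ^+ 2 <= Ig (fun x => f x ^+ 2) * Ig (fun x => g x ^+ 2).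
have La k : LL2 k -> LL2 (fun x => `|k x|).
 move=> Lk; apply: (LL2_dom _ _ Lk) => [|x]; last by rewrite normr_id.
 by apply: measurableT_comp => //; exact: LL2_meas Lk.
move=> /La Lf /La Lg; have := Ig_CS Lf Lg.
under eq_fun do rewrite -normrM.
by under [X in _ <= Ig X * _]eq_fun do rewrite real_normK ?num_real//; under [X in _ <= _ * Ig X]eq_fun do rewrite real_normK ?num_real//.
Qed.

Lemma EfZl (t : R) F H : LLv F -> LLv H -> (forall x, ~ V x -> H x = 0) -> Ef (fun x => t *: F x) H = t * Ef F H.
move=> LF LH H0; rewrite /Ef mulrCA; congr (_ * _); rewrite -IgZ; last exact: (Lint_ar pV LF LH H0).
by congr Ig; ext x; rewrite aformZl.
Qed.

Lemma sym_res_cvg eta : test V eta -> exists z_ Z_, [/\ forall n, Sob V (z_ n) (Z_ n),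
 forall (n : nat) v F, Sob V v F -> n.+1%:R * Ig (fun x => z_ n x * v x) + Ef (Z_ n) F = n.+1%:R * Ig (fun x => eta x * v x) &
 L1cv z_ eta].
move=> te; have Se := Sob_test mu_fin te; have Le := Sob_L2 Se; have LG := Sob_LLv Se.
have /choice[z_ /choice[Z_ hz]] : forall n : nat, exists z Z, Sob V z Z /\
  forall v F, Sob V v F -> n.+1%:R * Ig (fun x => z x * v x) + Ef Z F = n.+1%:R * Ig (fun x => eta x * v x).
 move=> n; have be0 : 0 < n.+1%:R :> R by [].
 have [z [Z [Sz h]]] := sym_res oV pV be0 (LL2Z n.+1%:R Le).
 exists z, Z; split=> // v F Sv; rewrite (h v F Sv) -IgZ; last exact: LL2_mul Le (Sob_L2 Sv).
 by congr Ig; ext x; rewrite mulrA.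
exists z_, Z_; have Sz n : Sob V (z_ n) (Z_ n) by have [] := hz n.
have eqz n v F : Sob V v F -> n.+1%:R * Ig (fun x => z_ n x * v x) + Ef (Z_ n) F = n.+1%:R * Ig (fun x => eta x * v x).
 by have [_ h] := hz n; side.
split=> //; have Sd n := Sob_B mu_fin (Sz n) Se.
apply: (to0_L1_L2 oV pV (fun n => Sob_L2 (Sd n)) (fun n x => Sob_off (Sd n))).
(* The equation tested with z_n - eta gives (n+1) |z_n - eta|^2 = - E(z_n, z_n - eta) <= E(eta, eta)
   / 2, since - a(z, z) + a(z, eta) <= a(eta, eta) / 2. *)
have K0 : 0 <= 2^-1 * Ef (grad eta) (grad eta) by apply: mulr_ge0 => //; exact: (Ef_ge0).
apply: (to0_le _ (to0Z K0 (@to0_inv R))) => n; rewrite ler_pdivlMr// mulrC.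
have -> : (fun x => (z_ n x - eta x) ^+ 2) = fun x => z_ n x * (z_ n x - eta x) - eta x * (z_ n x - eta x).
 by ext x; ring.
rewrite IgB; [|exact: LL2_mul (Sob_L2 (Sz n)) (Sob_L2 (Sd n))|exact: LL2_mul Le (Sob_L2 (Sd n))].
have := eqz n _ _ (Sd n); rewrite mulrBr => <-; rewrite opprD addrA subrr add0r.
have ia := Lint_ar pV (Sob_LLv (Sz n)) (Sob_LLv (Sd n)) (fun=> Sob_offD (Sd n)).
have ig := Lint_ar pV LG LG (fun=> Sob_offD Se).
rewrite /Ef -mulrN ler_wpM2l// -IgN// -IgZ//; apply: Ig_le; [side|side|move=> x].
have -> : Z_ n x - grad eta x = Z_ n x + (-1) *: grad eta x by rewrite scaleN1r.
rewrite (a_Dr) (a_Zr) mulN1r.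
have := a_abs x (Z_ n x) (grad eta x); rewrite ler_norml => /andP[_].
have := a_ge0 x (Z_ n x).
move: (aform _ _ _) (aform _ _ _) (aform _ _ _) => p q r; lra.
Qed.

(* L^1-closure lemma: duality is replaced by the contraction estimate dissip0 applied to
 y = be (u - w) - z, where w and z are the symmetric resolvents of u and of a test function. *)
Lemma weak_cl u D g : Sob V u D -> bdd u -> Lint g -> (forall x, ~ V x -> g x = 0) ->
 (forall v F, Sob V v F -> bdd v -> Ef D F = Ig (fun x => g x * v x)) ->
 cl V u (fun x => - g x + dotv (B x) (D x)).
move=> S bu ig g0 hg; have Lu := Sob_L2 S; have LD := Sob_LLv S.
have [w_ [W_ [Sw bw eqw t2 tD]]] := yosida_sym S bu ig hg.
have Sd n := Sob_B mu_fin (Sw n) S.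
pose f n x := n.+1%:R * (w_ n x - u x).
have Lf n : LL2 (f n) by apply: LL2Z; exact: Sob_L2 (Sd n).
have f0 n x : ~ V x -> f n x = 0 by move=> nV; rewrite /f (Sob_off (Sd n) nV) mulr0.
have cw n : core V (w_ n) (fun x => f n x + dotv (B x) (W_ n x)).
 exists (W_ n), (f n); split=> //; first side.
 move=> v F Sv.
 have := eqw n v F Sv => h.
 have -> : Ig (fun x => f n x * v x) = n.+1%:R * Ig (fun x => w_ n x * v x) - n.+1%:R * Ig (fun x => u x * v x).
  have i1 := LL2_mul (Sob_L2 (Sw n)) (Sob_L2 Sv); have i2 := LL2_mul Lu (Sob_L2 Sv).
  rewrite -mulrBr -IgB// -IgZ; last side.
  by congr Ig; ext x; rewrite /f; ring.
 by rewrite -h opprB addrAC subrr add0r.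
have iB : Lint (fun x => dotv (B x) (D x)) := Lint_BD hB oV pV LD (fun=> Sob_offD S).
split; [exact: (LL2_Lint oV pV Lu (fun x => Sob_off S))|side|].
exists w_, (fun n x => f n x + dotv (B x) (W_ n x)); split=> //.
 exact: (to0_L1_L2 oV pV (fun n => Sob_L2 (Sd n)) (fun n x => Sob_off (Sd n)) t2).
have tB : to0 (fun n => \sum_(i < d) Ig (fun x => `|BV B V x ord0 i * (W_ n x ord0 i - D x ord0 i)|)).
 apply: to0_sum => i; have LB := LLv_BV hB oV pV i.
 apply: (@to0_sqr _ _ (fun n => Ig (fun x => BV B V x ord0 i ^+ 2) * Ig (fun x => (W_ n x ord0 i - D x ord0 i) ^+ 2))).
  by move=> n; apply: N1_CS => //; exact: LL2B (Sob_LLv (Sw n) i) (LD i).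
 by apply: to0Z => //; apply: Ig_ge0 => x; exact: sqr_ge0.
have tf : to0 (fun n => Ig (fun x => `|f n x - - g x|)).
 move=> t t0; have t3 : 0 < t / 3 by rewrite divr_gt0.
 have [eta te heta] := test_L1dense mu_fin oV ig g0 t3.
 have [z_ [Z_ [Sz eqz tz]]] := sym_res_cvg te; have [N hN] := tz _ t3; exists N => n Nn.
 have Le := Sob_L2 (Sob_test mu_fin te).
 have ie : Lint eta := Lint_test mu_fin te.
 pose y x := n.+1%:R * (u x - w_ n x) - z_ n x.
 pose Y x := n.+1%:R *: (D x - W_ n x) - Z_ n x.
 have Sd' := Sob_B mu_fin S (Sw n).
 have Sy : Sob V y Y := Sob_B mu_fin (Sob_Z mu_fin n.+1%:R Sd') (Sz n).
 have iy : Lint y := LL2_Lint oV pV (Sob_L2 Sy) (fun x => Sob_off Sy).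
 have iz : Lint (z_ n) := LL2_Lint oV pV (Sob_L2 (Sz n)) (fun x => Sob_off (Sz n)).
 have be0 : 0 < n.+1%:R :> R by [].
 have ih : Lint (fun x => n.+1%:R * (g x - eta x - y x)) by apply: LintZ; apply: LintB => //; side.
 (* In operator form, (n+1) y - L^0 y = (n+1) (g - eta); hence [dissip0] bounds the L^1-norm of y by
    that of g - eta. *)
 have hy : forall v F, Sob V v F -> bdd v -> Ef Y F = Ig (fun x => n.+1%:R * (g x - eta x - y x) * v x).
  move=> v F Sv bv; have LF := Sob_LLv Sv; have F0 x : ~ V x -> F x = 0 := fun nV => Sob_offD Sv nV.
  have LdW := LLvB LD (Sob_LLv (Sw n)).
  have -> : Ef Y F = n.+1%:R * (Ef D F - Ef (W_ n) F) - Ef (Z_ n) F.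
   rewrite (Ef_Bl pV (Sob_LLv (Sob_Z mu_fin n.+1%:R Sd')) (Sob_LLv (Sz n)) LF F0).
   by rewrite EfZl// (Ef_Bl pV LD (Sob_LLv (Sw n)) LF F0).
  have i1 : Lint (fun x => g x * v x) := Lint_mul_bdd ig (Sob_meas Sv) bv.
  have i2 := LL2_mul Le (Sob_L2 Sv); have i3 := LL2_mul Lu (Sob_L2 Sv).
  have i4 := LL2_mul (Sob_L2 (Sw n)) (Sob_L2 Sv); have i5 := LL2_mul (Sob_L2 (Sz n)) (Sob_L2 Sv).
  have -> : (fun x => n.+1%:R * (g x - eta x - y x) * v x) = fun x =>
    n.+1%:R * ((g x * v x - eta x * v x) - (n.+1%:R * (u x * v x - w_ n x * v x) - z_ n x * v x)).
   by ext x; rewrite /y; ring.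
  have j1 := LintB i1 i2; have j2 := LintB i3 i4; have j3 := LintB (LintZ n.+1%:R j2) i5.
  rewrite IgZ; last side.
  rewrite (IgB j1 j3) (IgB i1 i2) (IgB (LintZ n.+1%:R j2) i5) (IgZ n.+1%:R j2) (IgB i3 i4).
  have e1 := eqw n v F Sv; have e2 := eqz n v F Sv; rewrite (hg v F Sv bv).
  move/(canRL (addKr _)): e1 => ->; move/(canRL (addKr _)): e2 => ->.
  ring.
 have := dissip0 oV pV be0 Sy ih hy.
 have -> : (fun x => `|n.+1%:R * y x + n.+1%:R * (g x - eta x - y x)|) = fun x => `|n.+1%:R * (g x - eta x)|.
  by ext x; congr (`|_|); ring.
 rewrite N1Z; last side.
 rewrite ger0_norm// ler_pM2l// => hy1.
 have -> : (fun x => `|f n x - - g x|) = fun x => `|(g x - eta x) - (y x + (z_ n x - eta x))|.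
  by ext x; congr (`|_|); rewrite /f /y; ring.
 have k1 := N1D (LintB ig ie) (LintN (LintD iy (LintB iz ie))).
 have k2 := N1D iy (LintB iz ie).
 have e3 : Ig (fun x => `|- (y x + (z_ n x - eta x))|) = Ig (fun x => `|y x + (z_ n x - eta x)|).
  by under eq_fun do rewrite normrN.
 rewrite e3 in k1; apply: (le_trans k1); have k3 := hN n Nn.
 rewrite [leRHS](_ : t = t / 3 + (t / 3 + t / 3)); last by field.
 apply: lerD => //; apply: (le_trans k2); apply: lerD => //; exact: le_trans hy1 heta.
apply: (to0_le _ (to0D tf tB)) => n.
have iBW : Lint (fun x => dotv (B x) (W_ n x)) := Lint_BD hB oV pV (Sob_LLv (Sw n)) (fun=> Sob_offD (Sw n)).
have iff : Lint (f n) := LL2_Lint oV pV (Lf n) (fun x => f0 n x).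
have -> : (fun x => `|f n x + dotv (B x) (W_ n x) - (- g x + dotv (B x) (D x))|) =
  fun x => `|(f n x - - g x) + (dotv (B x) (W_ n x) - dotv (B x) (D x))|.
 by ext x; congr (`|_|); ring.
apply: (le_trans (N1D (LintB iff (LintN ig)) (LintB iBW iB))); rewrite lerD2l.
have ii i : Lint (fun x => `|BV B V x ord0 i * (W_ n x ord0 i - D x ord0 i)|).
 by apply: Lint_abs; apply: LL2_mul; [exact: (LLv_BV hB oV pV i)|exact: (LL2B (Sob_LLv (Sw n) i) (LD i))].
rewrite -Ig_sum//; apply: Ig_le; [side|exact: Lint_sum|move=> x].
rewrite !(BV_dotv B (V := V)); [|by move=> nV; exact: Sob_offD S nV|by move=> nV; exact: Sob_offD (Sw n) nV].
rewrite /dotv -sumrB (le_trans (ler_norm_sum _ _ _))//; apply: ler_sum => i _.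
by rewrite mulrBr.
Qed.

(** For ep = 1 / (n+1) the solution is bounded by M / al whatever n is, so the error ep |B|^2 u_n
    tends to 0 in L^1; [weak_cl] places each u_n in the closure and [cl_res_closed] passes to the
    limit. The approximants are returned as well, because monotonicity, sup bounds and the energy
    estimate are read off from them. *)
Lemma res_bdd (al M : R) f : 0 < al -> 0 < M -> LL2 f -> (forall x, ~ V x -> f x = 0) -> (forall x, `|f x| <= M) ->
 exists (u_ : nat -> E -> R) (D_ : nat -> E -> E) u, [/\ forall n : nat, isol B V n.+1%:R^-1 al f (u_ n) (D_ n) /\ forall x, `|u_ n x| <= M / al,
  cl V u (fun x => al * u x - f x), L1cv u_ u,
  forall x, ~ V x -> u x = 0 &
  (forall n : nat, Lint (fun x => n.+1%:R^-1 * dotv (B x) (B x) * u_ n x)) /\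
  to0 (fun n => Ig (fun x => `|n.+1%:R^-1 * dotv (B x) (B x) * u_ n x|))].
move=> al0 M0 Lf f0 fM.
have /choice[u_ /choice[D_ hu]] : forall n : nat, exists u D, isol B V n.+1%:R^-1 al f u D /\ forall x, `|u x| <= M / al.
 by move=> n; apply: (isol_bdd hB oV pV).
have Su n : Sob V (u_ n) (D_ n) by have [[]] := hu n.
have uM n x : `|u_ n x| <= M / al by have [_] := hu n.
have bu n : bdd (u_ n) by exists (M / al).
have iff : Lint f := LL2_Lint oV pV Lf f0.
have LBV := LLv_BV hB oV pV; have iBB := Lint_dotv LBV LBV.
have BBE n x : dotv (B x) (B x) * u_ n x = dotv (BV B V x) (BV B V x) * u_ n x.
 rewrite /BV dotvZl dotvC dotvZl indicE; have [Vx|nV] := pselect (V x); first by rewrite mem_set//= !mul1r.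
 by rewrite (Sob_off (Su n) nV) !mulr0.
have iBu n : Lint (fun x => n.+1%:R^-1 * dotv (B x) (B x) * u_ n x).
 under eq_fun do rewrite -mulrA BBE; apply: LintZ; apply: Lint_mul_bdd => //; exact: Sob_meas (Su n).
have tBu : to0 (fun n => Ig (fun x => `|n.+1%:R^-1 * dotv (B x) (B x) * u_ n x|)).
 have K0 : 0 <= M / al * Ig (fun x => dotv (BV B V x) (BV B V x)).
  by rewrite mulr_ge0 ?divr_ge0 ?(ltW M0) ?(ltW al0)// Ig_ge0// => x; exact: dotvv_ge0.
 apply: (to0_le _ (to0Z K0 (@to0_inv R))) => n; rewrite mulrC -IgZ// -IgZ; last side.
 apply: Ig_le; [side|side|move=> x].
 rewrite -mulrA BBE normrM ger0_norm// ler_wpM2l// normrM mulrC ler_pM//.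
 by rewrite ger0_norm// dotvv_ge0.
have cu n : cl V (u_ n) (fun x => al * u_ n x - (f x - n.+1%:R^-1 * dotv (B x) (B x) * u_ n x)).
 have iBD : Lint (fun x => dotv (B x) (D_ n x)) := Lint_BD hB oV pV (Sob_LLv (Su n)) (fun=> Sob_offD (Su n)).
 have iu : Lint (u_ n) := LL2_Lint oV pV (Sob_L2 (Su n)) (fun x => Sob_off (Su n)).
 pose g x := dotv (B x) (D_ n x) + (f x - (al * u_ n x + n.+1%:R^-1 * dotv (B x) (B x) * u_ n x)).
 have ig : Lint g by apply: LintD => //; apply: LintB => //; apply: LintD => //; side.
 have := @weak_cl (u_ n) (D_ n) g (Su n) (bu n) ig.
 have -> : (fun x => - g x + dotv (B x) (D_ n x)) = fun x => al * u_ n x - (f x - n.+1%:R^-1 * dotv (B x) (B x) * u_ n x).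
  by ext x; rewrite /g; ring.
 apply.
  move=> x nV; rewrite /g (Sob_off (Su n) nV) (Sob_offD (Su n) nV) f0// dotvC dotv0l !mulr0; ring.
 move=> v F Sv bv; have [[_ Bu hn] _] := hu n.
 have Bv := LL2_Bv hB oV pV (Sob_meas Sv) bv (fun x => Sob_off Sv).
 have i1 := Lint_BDS (Sob_LLv (Su n)) Bv; have i2 := LL2_mul Lf (Sob_L2 Sv).
 have i3 := Lint_wt al n.+1%:R^-1 (Sob_L2 (Su n)) (Sob_L2 Sv) Bu Bv.
 have -> : (fun x => g x * v x) = fun x => dotv (B x) (D_ n x) * v x + (f x * v x - (al + n.+1%:R^-1 * dotv (B x) (B x)) * (u_ n x * v x)).
  by ext x; rewrite /g; ring.
 rewrite (IgD i1 (LintB i2 i3)) (IgB i2 i3) -(hn v F Sv Bv).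
 by move: (Ig _) (Ig _) (Ef _ _) => p q r; ring.
have [||u [c tu u0]] := cl_res_closed al0 cu iff.
- side.
- have -> : (fun n => Ig (fun x => `|f x - n.+1%:R^-1 * dotv (B x) (B x) * u_ n x - f x|)) =
  fun n => Ig (fun x => `|n.+1%:R^-1 * dotv (B x) (B x) * u_ n x|).
  by ext n; congr Ig; ext x; rewrite addrAC subrr sub0r normrN.
 by [].
exists u_, D_, u; split=> // x nV; apply: u0 => n; exact: Sob_off (Su n) nV.
Qed.

Definition cut_at (k : R) f : E -> R := fun x => Num.max (- k) (Num.min k (f x)).

Lemma cut_at_abs k f x : 0 <= k -> `|cut_at k f x| <= k.
move=> k0; rewrite /cut_at ler_norml le_max lexx /= ge_max ge_min lexx /= andbT.
by rewrite (le_trans _ k0)// oppr_le0.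
Qed.

Lemma cut_at_le k f x : 0 <= k -> `|cut_at k f x| <= `|f x|.
move=> k0; rewrite /cut_at ler_norml le_max ge_max ge_min le_min; have := ler_norm (f x); have := ler_norm (- f x); rewrite normrN => h1 h2.
rewrite h2 orbT andbT; apply/andP; split.
 by apply/orP; right; apply/andP; split; lra.
lra.
Qed.

Lemma cut_at_id k f x : `|f x| <= k -> cut_at k f x = f x.
by rewrite ler_norml => /andP[h1 h2]; rewrite /cut_at (min_idPr h2) (max_idPr h1). Qed.

Lemma cut_at_meas k f : mfunT f -> mfunT (cut_at k f).
by move=> mf; apply: measurable_maxr => //; exact: measurable_minr. Qed.

Lemma cut_at_cvg f : Lint f -> to0 (fun n : nat => Ig (fun x => `|cut_at n.+1%:R f x - f x|)).
move=> fi; have mf := Lint_meas fi.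
have [|||_] := @Ig_DCT _ _ _ mu (fun (n : nat) x => `|cut_at n.+1%:R f x - f x|) (fun=> 0) (fun x => 2 * `|f x|) _ (LintZ 2 (Lint_abs fi)).
- by move=> n; apply: measurableT_comp => //; apply: measurable_funB => //; exact: cut_at_meas.
- by move=> n x; rewrite normr_id (le_trans (ler_normB _ _))//; have := @cut_at_le n.+1%:R f x (ler0n _ _); lra.
- move=> x; apply/to0_cvgB => e e0; exists (Num.truncn `|f x|) => n fn.
 rewrite cut_at_id ?subrr ?subr0 ?(ltW e0) ?normr0 ?(ltW e0)//.
 by rewrite (le_trans (ltW (truncnS_gt _)))// ler_nat.
by rewrite Ig_cst0 => /cvg_to0.
Qed.

Lemma LL2_cut_at k f : 0 <= k -> mfunT f -> (forall x, ~ V x -> f x = 0) -> LL2 (cut_at k f) /\ forall x, ~ V x -> cut_at k f x = 0.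
move=> k0 mf f0; have z x : ~ V x -> cut_at k f x = 0.
 by move=> nV; rewrite cut_at_id ?f0// normr0.
split=> //; split; first exact: cut_at_meas.
apply: (bdd_Lint oV pV); first by apply: measurable_funX; exact: cut_at_meas.
- by exists (k ^+ 2) => x; rewrite normrX lerXn2r// cut_at_abs.
- by move=> x nV; rewrite z// expr0n.
Qed.

Lemma res_exists (al : R) f : 0 < al -> Lint f -> (forall x, ~ V x -> f x = 0) ->
 exists u, cl V u (fun x => al * u x - f x) /\ forall x, ~ V x -> u x = 0.
move=> al0 fi f0; have mf := Lint_meas fi.
have Lc n := LL2_cut_at (ler0n _ n.+1) mf f0.
have /choice[u_ hu] : forall n : nat, exists u, cl V u (fun x => al * u x - cut_at n.+1%:R f x) /\ forall x, ~ V x -> u x = 0.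
 move=> n; have [Lk k0] := Lc n; have p : 0 < n.+1%:R :> R by [].
 have [_ [_ [u [_ c _ u0 _]]]] := res_bdd al0 p Lk k0 (fun x => cut_at_abs f x (ltW p)).
 by exists u.
have [||u [c _ u0]] := cl_res_closed al0 (fun n => (hu n).1) fi.
- by move=> n; have [Lk k0] := Lc n; exact: (LL2_Lint oV pV Lk k0).
- exact: cut_at_cvg.
by exists u; split=> // x nV; apply: u0 => n; have [_] := hu n; exact.
Qed.

End on_V.

(** The positive part of u - v is bounded by the two errors, so its integral is 0; no a.e.
    convergent subsequence is extracted. *)
Lemma L1_le_ae (u_ v_ : nat -> E -> R) u v : (forall n, Lint (u_ n)) -> (forall n, Lint (v_ n)) -> Lint u -> Lint v ->
 L1cv u_ u -> L1cv v_ v ->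
 (forall n, {ae mu, forall x, u_ n x <= v_ n x}) -> {ae mu, forall x, u x <= v x}.
move=> iu_ iv_ iu iv hu hv le_.
pose w x := Num.max (u x - v x) 0.
have mw : mfunT w by apply: measurable_maxr => //; exact: Lint_meas (LintB iu iv).
have w0 x : 0 <= w x by rewrite le_max lexx orbT.
have iw : Lint w.
 apply: (Lint_dom mw _ (Lint_abs (LintB iu iv))) => x.
 by rewrite ger0_norm// /w ge_max ler_norm normr_ge0.
have w_le : Ig w <= 0.
 apply: (@to0_le_lim _ (fun=> Ig w) _ _ (fun n => Ig (fun x => `|u_ n x - u x|) + Ig (fun x => `|v_ n x - v x|))).
 - by under eq_fun do rewrite subrr normr0; exact: to0_cst0.
 - exact: to0D.
 move=> n; rewrite add0r; have i1 := Lint_abs (LintB (iu_ n) iu); have i2 := Lint_abs (LintB (iv_ n) iv).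
 rewrite -IgD//; apply: Ig_le_ae => //; first side.
 apply: filterS (le_ n) => x hx; rewrite /w ge_max addr_ge0// andbT.
 have := ler_norm (v_ n x - v x); have := ler_norm (- (u_ n x - u x)); rewrite normrN; lra.
have := Ig_eq0 iw (aeW _ w0) w_le; apply: filterS => x wx.
by rewrite -subr_le0 -wx /w le_max lexx.
Qed.

Lemma L1_abs_ae (M : R) (u_ : nat -> E -> R) u : 0 <= M -> (forall n, Lint (u_ n)) -> Lint u ->
 L1cv u_ u -> (forall n, {ae mu, forall x, `|u_ n x| <= M}) ->
 {ae mu, forall x, `|u x| <= M}.
move=> M0 iu_ iu hu le_; pose w x := Num.max (`|u x| - M) 0.
have iw : Lint w.
 have mu' := Lint_meas iu; apply: (Lint_dom _ _ (Lint_abs iu)).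
  by apply: measurable_maxr => //; apply: measurable_funB => //; exact: measurableT_comp.
 by move=> x; rewrite ger0_norm ?le_max ?lexx ?orbT// ge_max normr_ge0 andbT lerBlDr lerDl.
have w0 x : 0 <= w x by rewrite le_max lexx orbT.
have w_le : Ig w <= 0.
 apply: (@to0_le_lim _ (fun=> Ig w) _ _ _ _ hu).
  by under eq_fun do rewrite subrr normr0; exact: to0_cst0.
 move=> n; rewrite add0r; apply: Ig_le_ae => //; first side.
 apply: filterS (le_ n) => x hx; rewrite ge_max normr_ge0 andbT.
 by have := ler_normD (u_ n x) (- (u_ n x - u x)); rewrite normrN opprB addrC subrK; lra.
have := Ig_eq0 iw (aeW _ w0) w_le.
by apply: filterS => x wx; rewrite -subr_le0 -wx le_max lexx.
Qed.

Section on_V.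
Variable V : set E.
Hypotheses (oV : open V) (pV : precompact V).

Lemma res_contr (al : R) f f' u u' : 0 < al -> cl V u (fun x => al * u x - f x) ->
 cl V u' (fun x => al * u' x - f' x) -> al * Ig (fun x => `|u x - u' x|) <= Ig (fun x => `|f x - f' x|).
move=> al0 c c'; apply: (le_trans (cl_dissip oV pV al0 (clB oV pV c c'))).
apply: eq_ler; congr Ig; ext x; congr (`|_|); ring.
Qed.

Lemma res_contr0 (al : R) f u : 0 < al -> cl V u (fun x => al * u x - f x) -> al * N1 u <= N1 f.
move=> al0 c; apply: (le_trans (cl_dissip oV pV al0 c)).
apply: eq_ler; congr Ig; ext x; congr (`|_|); ring.
Qed.

Lemma cl_rhs (al : R) f u : cl V u (fun x => al * u x - f x) -> Lint u /\ Lint f.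
move=> [iu ih _]; split=> //; have := LintB (LintZ al iu) ih.
by under eq_fun do rewrite subKr.
Qed.

Lemma res_lin (al t : R) f f' u u' : cl V u (fun x => al * u x - f x) -> cl V u' (fun x => al * u' x - f' x) ->
 cl V (fun x => t * u x + u' x) (fun x => al * (t * u x + u' x) - (t * f x + f' x)).
move=> c c'; have := cl_lin oV pV t c c'; rewrite (_ : (fun x => t * (al * u x - f x) + _) = fun x => al * (t * u x + u' x) - (t * f x + f' x))//.
by ext x; ring.
Qed.

Lemma res_change (al be : R) f u : cl V u (fun x => al * u x - f x) ->
 cl V u (fun x => be * u x - ((be - al) * u x + f x)).
by rewrite (_ : (fun x => al * u x - f x) = fun x => be * u x - ((be - al) * u x + f x))//; ext x; ring. Qed.

Lemma res_abs (al M : R) f u : 0 < al -> 0 < M -> (forall x, ~ V x -> f x = 0) -> (forall x, `|f x| <= M) ->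
 cl V u (fun x => al * u x - f x) -> {ae mu, forall x, `|u x| <= M / al}.
move=> al0 M0 f0 fM c; have [iu iff] := cl_rhs c.
have Lf : LL2 f.
 have [Lc _] := LL2_cut_at oV pV (ltW M0) (Lint_meas iff) f0.
 by rewrite (_ : f = cut_at M f)//; ext x; rewrite cut_at_id.
have [u_ [D_ [w [hu cw tw _ _]]]] := res_bdd oV pV al0 M0 Lf f0 fM.
have iu_ n : Lint (u_ n) by have [[S _ _] _] := hu n; exact: (LL2_Lint oV pV (Sob_L2 S) (fun x => Sob_off S)).
have uw := cl_res_uniq oV pV al0 c cw; have [iw _] := cl_rhs cw.
have h : {ae mu, forall x, `|w x| <= M / al}.
 apply: (L1_abs_ae (ltW (divr_gt0 M0 al0)) iu_ iw tw) => n; apply: aeW; have [_] := hu n; exact.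
by apply: filterS2 uw h => x ->.
Qed.

End on_V.

Lemma res_mono_bdd V U (al M : R) f1 f2 u1 u2 : open V -> precompact V -> open U -> precompact U -> V `<=` U ->
 0 < al -> 0 < M -> (forall x, ~ V x -> f1 x = 0) -> (forall x, ~ U x -> f2 x = 0) ->
 (forall x, `|f1 x| <= M) -> (forall x, `|f2 x| <= M) -> (forall x, 0 <= f2 x) -> (forall x, f1 x <= f2 x) ->
 cl V u1 (fun x => al * u1 x - f1 x) -> cl U u2 (fun x => al * u2 x - f2 x) -> {ae mu, forall x, u1 x <= u2 x}.
move=> oV pV oU pU VU al0 M0 f10 f20 f1M f2M f2p f12 c1 c2.
have [iu1 if1] := cl_rhs c1; have [iu2 if2] := cl_rhs c2.
have LfV f W : open W -> precompact W -> Lint f -> (forall x, ~ W x -> f x = 0) -> (forall x, `|f x| <= M) -> LL2 f.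
 move=> oW pW i f0 fM; have [Lc _] := LL2_cut_at oW pW (ltW M0) (Lint_meas i) f0.
 by rewrite (_ : f = cut_at M f)//; ext x; rewrite cut_at_id.
have Lf1 := LfV _ _ oV pV if1 f10 f1M; have Lf2 := LfV _ _ oU pU if2 f20 f2M.
have [a_ [D_ [w [ha cw tw _ _]]]] := res_bdd oV pV al0 M0 Lf1 f10 f1M.
have [b_ [F_ [z [hb cz tz _ _]]]] := res_bdd oU pU al0 M0 Lf2 f20 f2M.
have ia n : Lint (a_ n) by have [[S _ _] _] := ha n; exact: (LL2_Lint oV pV (Sob_L2 S) (fun x => Sob_off S)).
have ib n : Lint (b_ n) by have [[S _ _] _] := hb n; exact: (LL2_Lint oU pU (Sob_L2 S) (fun x => Sob_off S)).
have [iw _] := cl_rhs cw; have [iz _] := cl_rhs cz.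
have wz : {ae mu, forall x, w x <= z x}.
 apply: (L1_le_ae ia ib iw iz tw tz) => n; have [h1 _] := ha n; have [h2 _] := hb n.
 have p : 0 < n.+1%:R^-1 :> R by [].
 exact: (isol_mono hB oV pV oU pU VU al0 p Lf1 Lf2 h1 h2 f2p f12).
apply: filterS3 wz (cl_res_uniq oV pV al0 c1 cw) (cl_res_uniq oU pU al0 c2 cz) => x k -> ->; side.
Qed.

Lemma cut_at_mono (k : R) f g x : f x <= g x -> cut_at k f x <= cut_at k g x.
move=> fg; have h : Num.min k (f x) <= Num.min k (g x) by rewrite le_min !ge_min lexx fg orbT.
by rewrite /cut_at ge_max !le_max lexx h orbT.
Qed.

Lemma res_mono V U (al : R) f1 f2 u1 u2 : open V -> precompact V -> open U -> precompact U -> V `<=` U ->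
 0 < al -> (forall x, ~ V x -> f1 x = 0) -> (forall x, ~ U x -> f2 x = 0) ->
 (forall x, 0 <= f2 x) -> (forall x, f1 x <= f2 x) ->
 cl V u1 (fun x => al * u1 x - f1 x) -> cl U u2 (fun x => al * u2 x - f2 x) -> {ae mu, forall x, u1 x <= u2 x}.
move=> oV pV oU pU VU al0 f10 f20 f2p f12 c1 c2.
have [iu1 if1] := cl_rhs c1; have [iu2 if2] := cl_rhs c2.
have app W f u : open W -> precompact W -> (forall x, ~ W x -> f x = 0) -> Lint f -> cl W u (fun x => al * u x - f x) ->
  exists v_ : nat -> E -> R, [/\ forall n : nat, cl W (v_ n) (fun x => al * v_ n x - cut_at n.+1%:R f x),
   forall n x, ~ W x -> cut_at n.+1%:R f x = 0 & L1cv v_ u].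
 move=> oW pW f0 i c; have z (n : nat) x : ~ W x -> cut_at n.+1%:R f x = 0.
  by move=> nW; rewrite cut_at_id ?f0// normr0.
 have ic (n : nat) : Lint (cut_at n.+1%:R f).
  apply: (Lint_dom _ _ (Lint_abs i)); first exact: cut_at_meas (Lint_meas i).
  by move=> x; exact: cut_at_le.
 have /choice[v_ hv] : forall n : nat, exists v, cl W v (fun x => al * v x - cut_at n.+1%:R f x).
  by move=> n; have [v [cv _]] := res_exists oW pW al0 (ic n) (z n); exists v.
 exists v_; split=> //.
 apply: (to0_le _ (to0Z (_ : 0 <= al^-1) (cut_at_cvg i))) => [n|]; last by rewrite invr_ge0 ltW.
 by rewrite ler_pdivlMl//; exact: (res_contr oW pW al0 (hv n) c).
have [a_ [ha za ta]] := app _ _ _ oV pV f10 if1 c1; have [b_ [hb zb tb]] := app _ _ _ oU pU f20 if2 c2.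
apply: (L1_le_ae (fun n => (cl_rhs (ha n)).1) (fun n => (cl_rhs (hb n)).1) iu1 iu2 ta tb) => n.
have p : 0 < n.+1%:R :> R by [].
apply: (res_mono_bdd oV pV oU pU VU al0 p (za n) (zb n) _ _ _ _ (ha n) (hb n)).
- by move=> x; apply: cut_at_abs.
- by move=> x; apply: cut_at_abs.
- by move=> x; rewrite /cut_at le_max le_min f2p (ltW p) orbT.
- by move=> x; exact: cut_at_mono.
Qed.

(** * Local resolvents and their limit over exhaustions *)

Definition resV V (al : R) f g := (forall x, ~ V x -> g x = 0) /\ cl V g (fun x => al * g x - (f \_ V) x).

Lemma Lint_restrict V f : open V -> Lint f -> Lint (f \_ V).
move=> oV i; apply: (Lint_dom _ (restrict_abs V f) (Lint_abs i)).
have -> : f \_ V = fun x => f x * \1_V x.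
 ext x; rewrite indicE; have [Vx|nV] := pselect (V x); first by rewrite restrict_in// mem_set// mulr1.
 by rewrite restrict_off// memNset// mulr0.
by apply: measurable_funM; [exact: Lint_meas i|exact: measurable_indic (open_rV_measurable oV)].
Qed.

Lemma resV_exists V (al : R) f : open V -> precompact V -> 0 < al -> Lint f -> exists g, resV V al f g.
move=> oV pV al0 i; have [g [c g0]] := res_exists oV pV al0 (Lint_restrict oV i) (restrict_off f (V := V)).
by exists g.
Qed.

Lemma resV_uniq V (al : R) f g g' : open V -> precompact V -> 0 < al -> resV V al f g -> resV V al f g' ->
 aeq g g'.
by move=> oV pV al0 [_ c] [_ c']; exact: (cl_res_uniq oV pV al0 c c'). Qed.

Lemma restrict_lin V (t : R) f f' x : ((fun y => t * f y + f' y) \_ V) x = t * (f \_ V) x + (f' \_ V) x.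
have [Vx|nV] := pselect (V x); first by rewrite !restrict_in.
by rewrite !restrict_off// mulr0 addr0.
Qed.

Lemma resV_lin V (al t : R) f f' g g' : open V -> precompact V -> resV V al f g -> resV V al f' g' ->
 resV V al (fun x => t * f x + f' x) (fun x => t * g x + g' x).
move=> oV pV [g0 c] [g0' c']; split; first by move=> x nV; rewrite g0// g0'// mulr0 addr0.
have -> : (fun x => al * (t * g x + g' x) - ((fun y => t * f y + f' y) \_ V) x) =
 fun x => al * (t * g x + g' x) - (t * (f \_ V) x + (f' \_ V) x) by ext x; rewrite restrict_lin.
exact: res_lin.
Qed.

Lemma resV_contr V (al : R) f f' g g' : open V -> precompact V -> 0 < al -> Lint f -> Lint f' ->
 resV V al f g -> resV V al f' g' -> al * Ig (fun x => `|g x - g' x|) <= Ig (fun x => `|f x - f' x|).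
move=> oV pV al0 i i' [_ c] [_ c']; apply: (le_trans (res_contr oV pV al0 c c')).
apply: Ig_le; [by apply: Lint_abs; apply: LintB; exact: Lint_restrict|side|].
move=> x; have [Vx|nV] := pselect (V x); first by rewrite !restrict_in.
by rewrite !restrict_off// subrr normr0.
Qed.

Lemma resV_bound V (al : R) f g : open V -> precompact V -> 0 < al -> Lint f -> resV V al f g -> al * N1 g <= N1 f.
move=> oV pV al0 i [_ c]; apply: (le_trans (res_contr0 oV pV al0 c)).
by apply: Ig_le; [apply: Lint_abs; exact: Lint_restrict|side|exact: restrict_abs].
Qed.

Lemma resV_Lint V (al : R) f g : resV V al f g -> Lint g. Proof. by case=> _ []. Qed.

Lemma resV_mono V U (al : R) f g g' : open V -> precompact V -> open U -> precompact U -> V `<=` U -> 0 < al ->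
 (forall x, 0 <= f x) -> resV V al f g -> resV U al f g' -> {ae mu, forall x, g x <= g' x}.
move=> oV pV oU pU VU al0 f0 [_ c] [_ c'].
apply: (res_mono oV pV oU pU VU al0 (restrict_off f (V := V)) (restrict_off f (V := U)) _ _ c c') => x.
 by have [/restrict_in ->//|/restrict_off ->] := pselect (U x).
have [Vx|nV] := pselect (V x); first by rewrite !restrict_in//; side.
by rewrite restrict_off//; have [/restrict_in ->//|/restrict_off ->] := pselect (U x).
Qed.

Lemma resV_ge0 V (al : R) f g : open V -> precompact V -> 0 < al ->
 (forall x, 0 <= f x) -> resV V al f g -> {ae mu, forall x, 0 <= g x}.
move=> oV pV al0 f0 [_ c].
have c0 : cl V (fun=> 0) (fun x => al * (fun=> 0) x - (fun=> 0) x).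
 by under [X in cl _ _ X]eq_fun do rewrite mulr0 subrr; apply: (core_cl oV pV); exact: core0.
have fV x : 0 <= (f \_ V) x by have [/restrict_in ->//|/restrict_off ->] := pselect (V x).
by have := res_mono oV pV oV pV (fun x => id) al0 (fun _ _ => erefl) (restrict_off f (V := V)) fV fV c0 c.
Qed.

Lemma resV_abs V (al M : R) f g : open V -> precompact V -> 0 < al -> 0 < M -> (forall x, `|f x| <= M) ->
 resV V al f g -> {ae mu, forall x, `|g x| <= M / al}.
move=> oV pV al0 M0 fM [_ c]; apply: (res_abs oV pV al0 M0 (restrict_off f (V := V)) _ c) => x.
exact: le_trans (restrict_abs V f x) (fM x).
Qed.

(** Quantifying over all exhaustions builds independence of the exhaustion into the definition;
    existence is then the statement with content. *)
Definition RG (al : R) f g := Lint g /\ forall (V : nat -> set E) (g_ : nat -> E -> R), exhaustion V -> (forall n : nat, resV (V n) al f (g_ n)) ->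
 L1cv g_ g.

(** For f >= 0 the local resolvents on balls increase and their integrals are bounded, so
    differences of integrals, which are L^1-distances here, become small. Another exhaustion is
    squeezed: each V_n lies in some ball, which bounds its resolvents by the limit, and contains a
    given ball for large n, which bounds them from below. *)
Lemma RG_exists_pos (al : R) f : 0 < al -> Lint f -> (forall x, 0 <= f x) -> exists g, RG al f g.
move=> al0 i f0; have oB := @open_balln R d; have pB := @precompact_balln R d.
have /choice[h_ hh] : forall n, exists g, resV (@balln R d n) al f g by move=> n; exact: resV_exists.
have ih n : Lint (h_ n) := resV_Lint (hh n).
have mono m n : (m <= n)%N -> {ae mu, forall x, h_ m x <= h_ n x}.
 by move=> mn; apply: (resV_mono _ _ _ _ (ballnS mn) al0 f0 (hh m) (hh n)).
have Imono m n : (m <= n)%N -> Ig (h_ m) <= Ig (h_ n) by move=> mn; apply: Ig_le_ae => //; side.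
have Ibd n : Ig (h_ n) <= al^-1 * N1 f.
 rewrite ler_pdivlMl// (le_trans _ (resV_bound (oB n) (pB n) al0 i (hh n)))// ler_wpM2l ?(ltW al0)//.
 by apply: Ig_le => //; [side|move=> x; exact: ler_norm].
have cvI : cvgn (fun n => Ig (h_ n)).
 apply: nondecreasing_is_cvgn => //.
 by exists (al^-1 * N1 f) => _ [n _ <-].
have dist m n : (m <= n)%N -> Ig (fun x => `|h_ n x - h_ m x|) = Ig (h_ n) - Ig (h_ m).
 move=> mn; rewrite -IgB//; apply: Ig_ae; [side|by apply: measurable_funB; exact: Lint_meas|].
 by apply: filterS (mono _ _ mn) => x hx; rewrite ger0_norm// subr_ge0.
have Imax n : Ig (h_ n) <= limn (fun n => Ig (h_ n)).
 by apply: nondecreasing_cvgn_le => // m k.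
have cau : forall e : R, 0 < e -> exists K, forall n k, (K <= n)%N -> (K <= k)%N -> Ig (fun x => `|h_ n x - h_ k x|) <= e.
 move=> e e0; have /to0_cvgB/(_ _ e0)[K hK] := cvI; exists K => n k Kn Kk.
 have key p q : (K <= p)%N -> (p <= q)%N -> Ig (fun x => `|h_ q x - h_ p x|) <= e.
  move=> Kp pq; rewrite dist//; have := hK _ Kp; rewrite ler_norml => /andP[h _].
  by have := Imax q; lra.
 by have [nk|/ltnW kn] := leqP n k; [rewrite N1C; side|side].
have [g ig [hg _]] := L1_complete ih cau; exists g; split=> // V g_ eV hg_.
have [oV _ UV] := eV; have ig_ n : Lint (g_ n) := resV_Lint (hg_ n).
have cstc (u : E -> R) : Lint u -> to0 (fun _ : nat => Ig (fun x => `|u x - u x|)).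
 by move=> iu; rewrite (N1_ae iu iu (aeW _ (fun=> erefl))); exact: to0_cst0.
have h_le m : {ae mu, forall x, h_ m x <= g x}.
 have hs : to0 (fun n => Ig (fun x => `|h_ (n + m)%N x - g x|)).
  by apply: (to0_shift (f := fun n => (n + m)%N) _ hg) => n; exact: leq_addr.
 by apply: (L1_le_ae (fun=> ih m) (fun n => ih (n + m)%N) (ih m) ig (cstc _ (ih m)) hs) => n; apply: mono; exact: leq_addl.
have g_le n : {ae mu, forall x, g_ n x <= g x}.
 have [oVn pVn] := oV n; have [K cK VK] := precompact_sub pVn.
 have [m Km] := compact_balln cK.
 have := resV_mono oVn pVn (oB m) (pB m) (fun x Vx => Km x (VK x Vx)) al0 f0 (hg_ n) (hh m).
 by move=> k; apply: filterS2 k (h_le m) => x; exact: le_trans.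
move=> e e0; have [m /(_ _ (leqnn m)) hm] := hg _ e0.
have [K cK bK] := precompact_sub (pB m); have [N KN] := exhaustion_compact eV cK.
exists N => n Nn; apply: le_trans hm; have [oVn pVn] := oV n.
have h_g : {ae mu, forall x, h_ m x <= g_ n x}.
 apply: (resV_mono (oB m) (pB m) oVn pVn _ al0 f0 (hh m) (hg_ n)) => x /bK/KN.
 exact: exhaustion_mono.
apply: Ig_le_ae; [side|side|].
apply: filterS2 h_g (g_le n) => x k1 k2; rewrite !(distrC _ (g x)) !ger0_norm ?subr_ge0//; last exact: le_trans k1 k2.
by rewrite lerD2l lerN2.
Qed.

Lemma RG_approx (al : R) f g : 0 < al -> Lint f -> RG al f g -> exists g_ : nat -> E -> R,
 (forall n, resV (@balln R d n) al f (g_ n)) /\ L1cv g_ g.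
move=> al0 i [_ h]; have /choice[h_ hh] : forall n, exists g, resV (@balln R d n) al f g.
 by move=> n; apply: resV_exists => //; [exact: open_balln|exact: precompact_balln].
by exists h_; split=> //; exact: h (@exhaustion_balln R d) hh.
Qed.

Lemma RG_contr (al : R) f f' g g' : 0 < al -> Lint f -> Lint f' -> RG al f g -> RG al f' g' ->
 al * Ig (fun x => `|g x - g' x|) <= Ig (fun x => `|f x - f' x|).
move=> al0 i i' G G'; have [g_ [hg tg]] := RG_approx al0 i G; have [g'_ [hg' tg']] := RG_approx al0 i' G'.
have ig := G.1; have ig' := G'.1; have ig_ n := resV_Lint (hg n); have ig'_ n := resV_Lint (hg' n).
apply: (@to0_le_lim _ (fun=> al * Ig (fun x => `|g x - g' x|)) _ _ _ _ (to0Z (ltW al0) (to0D tg tg'))).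
 by under eq_fun do rewrite subrr normr0; exact: to0_cst0.
move=> n; have := resV_contr (@open_balln R d n) (@precompact_balln R d n) al0 i i' (hg n) (hg' n).
have h1 := N1_tri ig (ig_ n) ig'; have h2 := N1_tri (ig_ n) (ig'_ n) ig'.
rewrite N1C in h1; have h3 : Ig (fun x => `|g x - g' x|) <= Ig (fun x => `|g_ n x - g x|) + (Ig (fun x => `|g_ n x - g'_ n x|) + Ig (fun x => `|g'_ n x - g' x|)).
 by apply: (le_trans (N1_tri ig (ig_ n) ig')); rewrite [X in X + _]N1C lerD2l.
have := ler_wpM2l (ltW al0) h3; rewrite !mulrDr.
by move=> h5 h4; apply: (le_trans h5); rewrite addrCA lerD2r.
Qed.

Lemma RG_uniq (al : R) f g g' : 0 < al -> Lint f -> RG al f g -> RG al f g' -> aeq g g'.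
move=> al0 i G G'; apply: N1_eq0; [exact: G.1|exact: G'.1|].
by rewrite -(ler_pM2l al0) mulr0 (le_trans (RG_contr al0 i i G G'))// N1_ae//; exact: aeW.
Qed.

Lemma RG_lim (al : R) (f_ g_ : nat -> E -> R) f g : 0 < al -> (forall n, RG al (f_ n) (g_ n)) -> (forall n, Lint (f_ n)) ->
 Lint f -> Lint g -> L1cv f_ f -> L1cv g_ g ->
 RG al f g.
move=> al0 G if_ i ig hf hg; split=> // V h_ eV hh; have [oV _ _] := eV.
(* On V_n the resolvents of f and f_k differ by at most 1 / al times the distance of f and f_k,
   uniformly in n; the factor al in the tolerance compensates. *)
move=> e e0; have e1 : 0 < al * (e / 4) by rewrite mulr_gt0// divr_gt0.
have e2 : 0 < e / 4 by rewrite divr_gt0.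
have [N hN] := hf _ e1; have [M hM] := hg _ e2; pose k := maxn N M.
have /choice[k_ hk] : forall n, exists h, resV (V n) al (f_ k) h.
 by move=> n; have [oVn pVn] := oV n; exact: resV_exists.
have [_ Gk] := G k; have [P hP] := Gk V k_ eV hk _ e2; exists P => n Pn; have [oVn pVn] := oV n.
have ih := resV_Lint (hh n); have ik := resV_Lint (hk n); have igk := (G k).1.
have c := resV_contr oVn pVn al0 i (if_ k) (hh n) (hk n).
have c2 : Ig (fun x => `|h_ n x - k_ n x|) <= e / 4.
 rewrite -(ler_pM2l al0) (le_trans c)// N1C; apply: hN; exact: leq_maxl.
have c3 := hP n Pn; have c4 : Ig (fun x => `|g_ k x - g x|) <= e / 4 by apply: hM; exact: leq_maxr.
apply: (le_trans (N1_tri ih ik ig)); have := N1_tri ik igk ig.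
move: c2 c3 c4; move: (Ig _) (Ig _) (Ig _) (Ig _) => p q r s; lra.
Qed.

Lemma RG_lin (al t : R) f f' g g' : 0 < al -> Lint f -> Lint f' -> RG al f g -> RG al f' g' ->
 RG al (fun x => t * f x + f' x) (fun x => t * g x + g' x).
move=> al0 i i' [ig G] [ig' G']; split; first side.
move=> V h_ eV hh; have [oV _ _] := eV.
have /choice[g_ hg] : forall n, exists h, resV (V n) al f h by move=> n; have [oVn pVn] := oV n; exact: resV_exists.
have /choice[g'_ hg'] : forall n, exists h, resV (V n) al f' h by move=> n; have [oVn pVn] := oV n; exact: resV_exists.
apply: (to0_le _ (to0D (to0Z (normr_ge0 t) (G V g_ eV hg)) (G' V g'_ eV hg'))) => n.
have [oVn pVn] := oV n; have ig_ := resV_Lint (hg n); have ig'_ := resV_Lint (hg' n).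
have e := resV_uniq oVn pVn al0 (hh n) (resV_lin t oVn pVn (hg n) (hg' n)).
rewrite -N1Z; last side.
apply: le_trans (N1D (LintZ t (LintB ig_ ig)) (LintB ig'_ ig')).
have j : Lint (fun x => t * g x + g' x) by apply: LintD => //; side.
have j' : Lint (fun x => t * (g_ n x - g x) + (g'_ n x - g' x)).
 side.
apply: Ig_le_ae; [by apply: Lint_abs; apply: LintB => //; exact: resV_Lint (hh n)|side|].
apply: filterS e => x ->; apply: eq_ler; congr (`|_|); ring.
Qed.

Lemma RG_exists (al : R) f : 0 < al -> Lint f -> exists g, RG al f g.
move=> al0 i; pose fp x := Num.max (f x) 0; pose fm x := Num.max (- f x) 0.
have mf := Lint_meas i.
have ifp : Lint fp.
 apply: (Lint_dom _ _ (Lint_abs i)); first exact: measurable_maxr.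
 by move=> x; rewrite ger0_norm ?le_max ?lexx ?orbT// ge_max ler_norm normr_ge0.
have ifm : Lint fm.
 apply: (Lint_dom _ _ (Lint_abs i)); first by apply: measurable_maxr => //; exact: measurableT_comp.
 by move=> x; rewrite ger0_norm ?le_max ?lexx ?orbT// ge_max normr_ge0 -normrN ler_norm.
have fp0 x : 0 <= fp x by rewrite le_max lexx orbT.
have fm0 x : 0 <= fm x by rewrite le_max lexx orbT.
have [g G] := RG_exists_pos al0 ifp fp0.
have [g' G'] := RG_exists_pos al0 ifm fm0.
exists (fun x => -1 * g' x + g x); have := RG_lin (-1) al0 ifm ifp G' G.
rewrite (_ : (fun x => -1 * fm x + fp x) = f)//; ext x; rewrite /fm /fp.
by have [h|h] := leP (f x) 0; have [k|k] := leP (- f x) 0; lra.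
Qed.

(** The resolvent identity in the form G_al f = G_be ((be - al) G_al f + f). It holds exactly on
    each V_n, and the contraction estimate lets the inner local resolvent be replaced by its
    limit. *)
Lemma RG_change (al be : R) f g : 0 < al -> 0 < be -> Lint f -> RG al f g -> RG be (fun x => (be - al) * g x + f x) g.
move=> al0 be0 i G; have [ig _] := G; split=> // V h_ eV hh; have [oV _ _] := eV.
have /choice[g_ hg] : forall n, exists h, resV (V n) al f h by move=> n; have [oVn pVn] := oV n; exact: resV_exists.
have tg := G.2 V g_ eV hg.
have K0 : 0 <= be^-1 * `|be - al| + 1 by rewrite addr_ge0// mulr_ge0// invr_ge0 ltW.
apply: (to0_le _ (to0Z K0 tg)) => n; have [oVn pVn] := oV n.
have ig_ := resV_Lint (hg n); have ih := resV_Lint (hh n).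
have hn : resV (V n) be (fun x => (be - al) * g_ n x + f x) (g_ n).
 have [g0 c] := hg n; split=> //; have := res_change be c.
 rewrite (_ : (fun x => be * g_ n x - ((be - al) * g_ n x + (f \_ (V n)) x)) = fun x => be * g_ n x - ((fun x => (be - al) * g_ n x + f x) \_ (V n)) x)//.
 ext x; have [Vx|nV] := pselect (V n x); first by rewrite !restrict_in.
 by rewrite !restrict_off// g0// !mulr0 addr0.
have j k : Lint k -> Lint (fun x => (be - al) * k x + f x) by move=> ik; apply: LintD => //; side.
have := resV_contr oVn pVn be0 (j _ ig) (j _ ig_) (hh n) hn.
have -> : (fun x => `|(be - al) * g x + f x - ((be - al) * g_ n x + f x)|) = fun x => `|(be - al) * (g x - g_ n x)|.
 by ext x; congr (`|_|); ring.
rewrite N1Z; last side.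
rewrite -ler_pdivlMl// mulrA => c; apply: (le_trans (N1_tri ih ig_ ig)).
by rewrite mulrDl mul1r lerD2r [X in _ <= _ * X]N1C.
Qed.

Lemma RG_ae (al : R) f g f' g' : 0 < al -> RG al f g -> Lint f -> Lint f' -> Lint g' -> aeq f f' ->
 aeq g g' -> RG al f' g'.
move=> al0 G i i' ig' ef eg; have ig := G.1.
apply: (@RG_lim al (fun=> f) (fun=> g)) => //; by rewrite N1_ae//; exact: to0_cst0.
Qed.

Lemma RG_ge0 (al : R) f g : 0 < al -> Lint f -> {ae mu, forall x, 0 <= f x} -> RG al f g -> {ae mu, forall x, 0 <= g x}.
move=> al0 i f0 G; pose f' x := Num.max (f x) 0.
have e : aeq f f' by apply: filterS f0 => x h; rewrite /f' (max_idPl h).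
have mf := Lint_meas i.
have i' : Lint f' by apply: Lint_ae e i; exact: measurable_maxr.
have f'0 x : 0 <= f' x by rewrite le_max lexx orbT.
have G' := RG_ae al0 G i i' G.1 e (aeW _ (fun=> erefl)).
have [g_ [hg tg]] := RG_approx al0 i' G'.
have i0 : Lint (fun=> 0) := Lint0 mu.
have t0 : to0 (fun _ : nat => Ig (fun x => `|(fun=> 0 : R) x - (fun=> 0) x|)).
 by rewrite (N1_ae i0 i0 (aeW _ (fun=> erefl))); exact: to0_cst0.
apply: (L1_le_ae (fun=> i0) (fun n => resV_Lint (hg n)) i0 G.1 t0 tg) => n.
exact: (resV_ge0 (@open_balln R d n) (@precompact_balln R d n) al0 f'0 (hg n)).
Qed.

Lemma RG_le (al M : R) f g : 0 < al -> 0 < M -> Lint f -> {ae mu, forall x, `|f x| <= M} -> RG al f g -> {ae mu, forall x, `|g x| <= M / al}.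
move=> al0 M0 i fM G; pose f' := cut_at M f.
have e : aeq f f' by apply: filterS fM => x h; rewrite /f' cut_at_id.
have mf := Lint_meas i.
have i' : Lint f' by apply: Lint_ae e i; exact: cut_at_meas.
have G' := RG_ae al0 G i i' G.1 e (aeW _ (fun=> erefl)).
have [g_ [hg tg]] := RG_approx al0 i' G'; have ig := G.1.
have ig_ n := resV_Lint (hg n).
have hn n : {ae mu, forall x, `|g_ n x| <= M / al}.
 by apply: (resV_abs (@open_balln R d n) (@precompact_balln R d n) al0 M0 _ (hg n)) => x; apply: cut_at_abs; side.
exact: (L1_abs_ae (ltW (divr_gt0 M0 al0)) ig_ ig tg hn).
Qed.

(** The extension is defined through its resolvent at 1: u = (1 - Lbar)^{-1} (u - h). The factor 1
    matches the form al u - h used for general al. *)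
Definition Lb u h := [/\ Lint u, Lint h & RG 1 (fun x => 1 * u x - h x) u].

Lemma Lb_RG (al : R) u h : 0 < al -> Lb u h -> RG al (fun x => al * u x - h x) u.
move=> al0 [iu ih G]; have i : Lint (fun x => 1 * u x - h x) by apply: LintB => //; side.
have := RG_change ltr01 al0 i G.
by rewrite (_ : (fun x => _) = fun x => al * u x - h x)//; ext x; ring.
Qed.

Lemma RG_Lb (al : R) f u : 0 < al -> Lint f -> RG al f u -> Lb u (fun x => al * u x - f x).
move=> al0 i G; have iu := G.1; split=> //; first side.
have := RG_change al0 ltr01 i G.
by rewrite (_ : (fun x => _ + f x) = fun x => 1 * u x - (al * u x - f x))//; ext x; ring.
Qed.

Lemma RG_scale (al t : R) f g f' g' : 0 < al -> Lint f -> RG al f g -> (forall x, f' x = t * f x) ->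
 (forall x, g' x = t * g x) -> RG al f' g'.
move=> al0 i G ef eg; have := RG_lin (t - 1) al0 i i G G.
rewrite (_ : (fun x => (t - 1) * f x + f x) = f'); last by ext x; rewrite ef; ring.
by rewrite (_ : (fun x => (t - 1) * g x + g x) = g')//; ext x; rewrite eg; ring.
Qed.

Lemma Lb_lin (t : R) u v f g : Lb u f -> Lb v g -> Lb (fun x => t * u x + v x) (fun x => t * f x + g x).
move=> [iu jf G] [iv jg G']; split; [side|side|].
have i1 : Lint (fun x => 1 * u x - f x) by apply: LintB => //; side.
have i2 : Lint (fun x => 1 * v x - g x) by apply: LintB => //; side.
have := RG_lin t ltr01 i1 i2 G G'.
by rewrite (_ : (fun x => t * (1 * u x - f x) + _) = fun x => 1 * (t * u x + v x) - (t * f x + g x))//; ext x; ring.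
Qed.

Lemma to0_lin1 (t : R) (f_ g_ : nat -> E -> R) f g : (forall n, Lint (f_ n)) -> (forall n, Lint (g_ n)) -> Lint f -> Lint g ->
 L1cv f_ f -> L1cv g_ g ->
 to0 (fun n => Ig (fun x => `|t * f_ n x - g_ n x - (t * f x - g x)|)).
move=> if_ ig_ i j hf hg; apply: (to0_le _ (to0D (to0Z (normr_ge0 t) hf) hg)) => n.
rewrite -N1Z; last side.
have e : Ig (fun x => `|- (g_ n x - g x)|) = Ig (fun x => `|g_ n x - g x|) by under eq_fun do rewrite normrN.
rewrite -e; have := N1D (LintZ t (LintB (if_ n) i)) (LintN (LintB (ig_ n) j)).
by apply: le_trans; apply: eq_ler; congr Ig; ext x; congr (`|_|); ring.
Qed.

Lemma Lb_closed (u_ h_ : nat -> E -> R) u h : (forall n, Lb (u_ n) (h_ n)) -> Lint u -> Lint h ->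
 L1cv u_ u -> L1cv h_ h -> Lb u h.
move=> L iu ih hu hh; split=> //.
have iu_ n : Lint (u_ n) by have [] := L n.
have ih_ n : Lint (h_ n) by have [] := L n.
have G n : RG 1 (fun x => 1 * u_ n x - h_ n x) (u_ n) by have [] := L n.
apply: (RG_lim ltr01 G) => //.
- side.
- side.
- exact: to0_lin1.
Qed.

Lemma Lb_ae u h u' h' : Lb u h -> Lint u' -> Lint h' -> aeq u u' ->
 aeq h h' -> Lb u' h'.
move=> L iu' ih' eu eh; have [iu ih _] := L.
by apply: (@Lb_closed (fun=> u) (fun=> h)) => //; rewrite N1_ae//; exact: to0_cst0.
Qed.

Lemma Lb0 : Lb (fun=> 0) (fun=> 0).
have i0 := Lint0 mu; have [g G] := RG_exists ltr01 i0; have L := RG_Lb ltr01 i0 G.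
have := Lb_lin (-1) L L; rewrite (_ : (fun x => -1 * g x + g x) = fun=> 0); last by ext x; ring.
by rewrite (_ : (fun x => _ + _) = fun=> 0)//; ext x; ring.
Qed.

(** If u lies in the local domain of every V containing K, with the same h, then u is its own local
    resolvent of u - h on V_n for all large n, and the defining sequence is a.e. eventually
    constant. *)
Lemma Lb_core u h K : compact K -> (forall V, open V -> precompact V -> K `<=` V -> core V u h) -> Lb u h.
move=> cK c; have [m Km] := compact_balln cK.
have cm := c _ (@open_balln R d m) (@precompact_balln R d m) Km.
have [iu ih] := core_Lint (@open_balln R d m) (@precompact_balln R d m) cm.
split=> //; split=> // V g_ eV hg; have [oV _ _] := eV; have [N KN] := exhaustion_compact eV cK.
move=> e e0; exists N => n Nn; have [oVn pVn] := oV n.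
have KVn : K `<=` V n by move=> x /KN; exact: exhaustion_mono.
have cn := c _ oVn pVn KVn; have c2 := core_cl oVn pVn cn.
have [_ cg] := hg n; have c3 : cl (V n) u (fun x => 1 * u x - ((fun x => 1 * u x - h x) \_ (V n)) x).
 rewrite (_ : (fun x => _) = h)//; ext x; have [Vx|nV] := pselect (V n x).
  by rewrite restrict_in//; ring.
 have [D [f [S _ [_ f0] _ ->]]] := cn.
 by rewrite restrict_off// (Sob_off S nV) (Sob_offD S nV) f0// dotvC dotv0l; ring.
have ae := cl_res_uniq oVn pVn ltr01 cg c3.
by rewrite N1_ae ?(ltW e0)//; exact: resV_Lint (hg n).
Qed.

(** Enters through the density of the domain, hence through strong continuity. It is discharged at
    the end, where C_0^oo is shown to lie in the local cores. *)
Hypothesis Htest : forall u, test setT u -> exists h, Lb u h.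

(** * Strong continuity, the semigroup and its generator *)

Lemma Lb_dense f (e : R) : Lint f -> 0 < e -> exists u h, Lb u h /\ Ig (fun x => `|f x - u x|) <= e.
move=> i e0; have [u tu hu] := test_L1dense mu_fin openT i (fun x (h : ~ setT x) => False_ind _ (h I)) e0.
by have [h L] := Htest tu; exists u, h.
Qed.

(** For u in the domain, be G_be u - u = G_be (Lbar u) has norm at most |Lbar u| / be; contractivity
    and density extend the convergence to every f. *)
Lemma RG_C0 f (e : R) : Lint f -> 0 < e -> exists2 b0 : R, 0 < b0 & forall be g, b0 <= be -> RG be f g ->
 Ig (fun x => `|be * g x - f x|) <= e.
move=> i e0; have e3 : 0 < e / 3 by rewrite divr_gt0.
have [u [h [L hu]]] := Lb_dense i e3; have [iu ih _] := L.
exists (N1 h / (e / 3) + 1); first by rewrite ltr_wpDl// divr_ge0 ?N1_ge0// ltW.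
move=> be g hbe G; have be0 : 0 < be.
 by apply: lt_le_trans hbe; rewrite ltr_wpDl// divr_ge0 ?N1_ge0// ltW.
have ig := G.1; have [g' G'] := RG_exists be0 iu; have ig' := G'.1.
have c1 := RG_contr be0 i iu G G'.
have Gu := Lb_RG be0 L.
have j1 : Lint (fun x => be * u x - h x) by apply: LintB => //; side.
have G2 : RG be (fun x => be * u x) (fun x => be * g' x).
 exact: (RG_scale be0 iu G' (t := be)).
have c2 := RG_contr be0 (LintZ be iu) j1 G2 Gu.
have e4 : Ig (fun x => `|be * u x - (be * u x - h x)|) = N1 h by under eq_fun do rewrite subKr.
rewrite e4 in c2.
have c3 : Ig (fun x => `|be * g' x - u x|) <= e / 3.
 rewrite -(ler_pM2l be0) (le_trans c2)// -ler_pdivrMr//.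
 by apply: le_trans hbe; rewrite lerDl.
have ibg := LintZ be ig; have ibg' := LintZ be ig'.
have c4 : Ig (fun x => `|be * g x - be * g' x|) <= e / 3.
 have -> : (fun x => `|be * g x - be * g' x|) = fun x => `|be * (g x - g' x)| by ext x; rewrite mulrBr.
 rewrite N1Z; last side.
 by rewrite gtr0_norm// (le_trans c1).
have t1 := N1_tri ibg ibg' i; have t2 := N1_tri ibg' iu i.
rewrite [X in _ <= _ + X]N1C in t2.
apply: (le_trans t1); apply: (@le_trans _ _ (e / 3 + (e / 3 + e / 3))).
 by rewrite lerD// (le_trans t2)// lerD.
by apply: eq_ler; field.
Qed.

(** Single-valuedness comes from strong continuity: if k = h - h' is an image of 0, then be G_be k =
    0 for every be > 0, while be G_be k tends to k. *)
Lemma Lb_fun u h h' : Lb u h -> Lb u h' -> aeq h h'.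
move=> L L'; have [_ ih _] := L; have [_ ih' _] := L'.
have L0 : Lb (fun=> 0) (fun x => -1 * h' x + h x).
 by have := Lb_lin (-1) L' L; rewrite (_ : (fun x => -1 * u x + u x) = fun=> 0)//; ext x; ring.
have ik : Lint (fun x => -1 * h' x + h x) by have [] := L0.
apply: N1_eq0 => //; apply/ler_addgt0Pr => e e0; rewrite add0r.
have [b0 b00 hb] := RG_C0 ik e0; have G := Lb_RG b00 L0.
have G1 : RG b0 (fun x => -1 * h' x + h x) (fun=> 0).
 have j : Lint (fun x => b0 * (fun=> 0 : R) x - (-1 * h' x + h x)) by apply: LintB => //; apply: LintZ; side.
 by apply: (RG_scale b00 j G (t := -1)) => x; ring.
have := hb b0 _ (lexx _) G1; rewrite (_ : (fun x => `|b0 * 0 - _|) = fun x => `|h x - h' x|)//.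
by ext x; rewrite -normrN; congr (`|_|); ring.
Qed.

Definition Gb (al : R) f : E -> R := get [set g | RG al f g].

Lemma GbP (al : R) f : 0 < al -> Lint f -> RG al f (Gb al f).
by move=> al0 i; have [g G] := RG_exists al0 i; exact: (getPex (ex_intro _ g G)). Qed.

Lemma Gb_Lint (al : R) f : 0 < al -> Lint f -> Lint (Gb al f).
by move=> al0 i; exact: (GbP al0 i).1. Qed.

Lemma Gb_lin (al t : R) f g : 0 < al -> Lint f -> Lint g ->
 {ae mu, forall x, Gb al (fun x => t * f x + g x) x = t * Gb al f x + Gb al g x}.
move=> al0 i j; have k : Lint (fun x => t * f x + g x) by apply: LintD => //; side.
exact: (RG_uniq al0 k (GbP al0 k) (RG_lin t al0 i j (GbP al0 i) (GbP al0 j))).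
Qed.

Lemma Gb_bound (al : R) f : 0 < al -> Lint f -> al * N1 (Gb al f) <= N1 f.
move=> al0 i; have i0 := Lint0 mu; have := Lb_RG al0 Lb0.
rewrite (_ : (fun x => al * 0 - 0) = fun=> 0); last by ext x; ring.
move=> G0; have := RG_contr al0 i i0 (GbP al0 i) G0.
by under eq_fun do rewrite subr0; under [X in _ <= Ig X -> _]eq_fun do rewrite subr0.
Qed.

Local Notation NN := (fun f : E -> R => N1 f).
Local Notation SS := ([set f : E -> R | Lint f]).
Lemma aeT f g : aeq f g <-> f = g %[ae mu].
by split; apply: filterS => x // h; exact: h. Qed.

Definition JJ (h : R) f : E -> R := fun x => h^-1 * Gb h^-1 f x.

Lemma sn_L1 : seminormed SS NN.
split.
- exact: Lint0.
- by move=> a x y i j; apply: LintD => //; side.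
- by move=> a x i; exact: N1Z.
- by move=> x y i j; exact: N1D.
Qed.

Lemma neq_ae f g : Lint f -> Lint g -> neq NN f g <-> aeq f g.
by move=> i j; split=> [h|]; [apply: N1_eq0 => //; rewrite h|exact: N1_ae]. Qed.

Lemma JJ_Lint (h : R) f : 0 < h -> Lint f -> Lint (JJ h f).
by move=> h0 i; apply: LintZ; apply: Gb_Lint => //; rewrite invr_gt0. Qed.

Lemma HY_LS u g : Lb u g -> Lint u /\ Lint g. Proof. by case. Qed.

Lemma HY_neq u u' g g' : Lint u' -> Lint g' -> neq NN u u' -> neq NN g g' -> Lb u g -> Lb u' g'.
by move=> iu' ig' e1 e2 L; have [iu ig _] := L; apply: (Lb_ae L) => //; exact/neq_ae. Qed.

Lemma HY_JP (h a : R) x y : 0 < h -> Lint x -> Lint y ->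
 neq NN (JJ h (fun s => a * x s + y s)) (fun s => a * JJ h x s + JJ h y s).
move=> h0 i j; have h0' : 0 < h^-1 by rewrite invr_gt0.
apply/neq_ae; [by apply: JJ_Lint => //; apply: LintD => //; side|by apply: LintD; [apply: LintZ|]; exact: JJ_Lint|].
by apply: filterS (Gb_lin a h0' i j) => s e; rewrite /JJ e; ring.
Qed.

Lemma HY_JN (h : R) x : 0 < h -> Lint x -> NN (JJ h x) <= NN x.
move=> h0 i; have h0' : 0 < h^-1 by rewrite invr_gt0.
by rewrite /= N1Z ?gtr0_norm ?Gb_bound//; exact: Gb_Lint.
Qed.

Lemma HY_LJ (h : R) f : 0 < h -> Lint f -> Lb (JJ h f) (fun s => h^-1 * (JJ h f s - f s)).
move=> h0 i; have h0' : 0 < h^-1 by rewrite invr_gt0.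
have L := RG_Lb h0' i (GbP h0' i); have := Lb_lin (h^-1 - 1) L L.
rewrite (_ : (fun x => (h^-1 - 1) * Gb h^-1 f x + Gb h^-1 f x) = JJ h f); last by ext x; rewrite /JJ; ring.
by rewrite (_ : (fun x => _ + _) = fun s => h^-1 * (JJ h f s - f s))//; ext x; rewrite /JJ; ring.
Qed.

Lemma HY_JL (h : R) u g : 0 < h -> Lb u g -> neq NN (JJ h (fun s => - h * g s + u s)) u.
move=> h0 L; have h0' : 0 < h^-1 by rewrite invr_gt0.
have [iu ig _] := L; have hn0 : h != 0 by rewrite gt_eqF.
have j : Lint (fun x => h^-1 * u x - g x) by apply: LintB => //; side.
have k : Lint (fun s => - h * g s + u s) by apply: LintD => //; side.
have G := Lb_RG h0' L; have := RG_lin (h - 1) h0' j j G G.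
rewrite (_ : (fun x => (h - 1) * (h^-1 * u x - g x) + _) = fun s => - h * g s + u s); last by ext x; field.
rewrite (_ : (fun x => (h - 1) * u x + u x) = fun x => h * u x); last by ext x; ring.
move=> G'; have := RG_uniq h0' k (GbP h0' k) G' => e.
apply/neq_ae => //; first exact: JJ_Lint.
by apply: filterS e => x ex; rewrite /JJ ex mulKf.
Qed.

Lemma HY_complete : ncomplete SS NN.
move=> z Sz cz; have [u iu [hu _]] := L1_complete Sz cz.
by exists u.
Qed.

Definition Tt : R -> (E -> R) -> E -> R := sg SS NN JJ.

Lemma Tt_P t f : 0 <= t -> Lint f -> Lint (Tt t f) /\ to0 (fun n => Ig (fun x => `|euler JJ n t f x - Tt t f x|)).
move=> t0 i; exact: (sgP sn_L1 HY_LS HY_neq JJ_Lint HY_JP HY_JN HY_LJ HY_JL Lb_dense HY_complete t0 i).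
Qed.

Lemma JJ_01 (h : R) f : 0 < h -> Lint f -> {ae mu, forall x, 0 <= f x <= 1} -> {ae mu, forall x, 0 <= JJ h f x <= 1}.
move=> h0 i f01; have h0' : 0 < h^-1 by rewrite invr_gt0.
have f0 : {ae mu, forall x, 0 <= f x} by apply: filterS f01 => x /andP[].
have p := RG_ge0 h0' i f0 (GbP h0' i).
have f1 : {ae mu, forall x, `|f x| <= 1} by apply: filterS f01 => x /andP[k1 k2]; rewrite ger0_norm.
have q := RG_le h0' ltr01 i f1 (GbP h0' i).
apply: filterS2 p q => x g0 g1; rewrite /JJ mulr_ge0 ?(ltW h0')//=.
by move: g1; rewrite ger0_norm// mul1r invrK => g1; rewrite ler_pdivrMl// mulr1.
Qed.

Lemma Tt_01 t f : 0 < t -> Lint f -> {ae mu, forall x, 0 <= f x <= 1} -> {ae mu, forall x, 0 <= Tt t f x <= 1}.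
move=> t0 i f01; have [iT hT] := Tt_P (ltW t0) i.
have it n (h : R) : 0 < h -> Lint (iter n (JJ h) f) /\ {ae mu, forall x, 0 <= iter n (JJ h) f x <= 1}.
 move=> h0; elim: n => [//|n [ih1 ih2]]; split; first exact: JJ_Lint.
 exact: JJ_01.
have ie n : Lint (euler JJ n t f) by have [] := it (nk n t) (hk R n) (hk0 _ _).
have e01 n : {ae mu, forall x, 0 <= euler JJ n t f x <= 1} by have [] := it (nk n t) (hk R n) (hk0 _ _).
have i0 := Lint0 mu; have t00 : to0 (fun _ : nat => Ig (fun x => `|(fun=> 0 : R) x - (fun=> 0) x|)).
 by rewrite (N1_ae i0 i0 (aeW _ (fun=> erefl))); exact: to0_cst0.
have h1 : {ae mu, forall x, 0 <= Tt t f x}.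
 apply: (L1_le_ae (fun=> i0) ie i0 iT t00 hT) => n.
 by apply: filterS (e01 n) => x /andP[].
have h2 : {ae mu, forall x, `|Tt t f x| <= 1}.
 apply: (L1_abs_ae ler01 ie iT hT) => n.
 by apply: filterS (e01 n) => x /andP[k1 k2]; rewrite ger0_norm.
by apply: filterS2 h1 h2 => x k1; rewrite k1 ger0_norm.
Qed.

Lemma L1_EFin f g : Lint f -> Lint g -> ((\int[mu]_x (`|f x|)%:E <= \int[mu]_x (`|g x|)%:E)%E <-> N1 f <= N1 g).
by move=> i j; rewrite !Ig_EFin//; side. Qed.

Lemma at_right_cvg (z : R -> E -> R) : (forall t, 0 < t -> Lint (z t)) ->
 (forall e : R, 0 < e -> exists2 del : R, 0 < del & forall t, 0 < t <= del -> N1 (z t) <= e) <->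
 ((\int[mu]_x (`|z t x|)%:E)%E @[t --> 0^'+] --> 0%E).
move=> iz; have E1 t : 0 < t -> (\int[mu]_x (`|z t x|)%:E)%E = (N1 (z t))%:E.
 by move=> t0; rewrite Ig_EFin//; apply: Lint_abs; side.
have E2 : \forall t \near 0^'+, (N1 (z t))%:E = (\int[mu]_x (`|z t x|)%:E)%E.
 by near=> t; rewrite E1//.
split=> [h|h e e0].
 apply: cvg_trans (near_eq_cvg E2) _; apply: cvg_EFin; first exact: nearW.
 apply/cvgrPdist_le => e e0; have [del del0 hdel] := h e e0; near=> t.
 rewrite sub0r normrN /= ger0_norm ?N1_ge0//; apply: hdel; apply/andP; split; near: t.
  exact: nbhs_right_gt.
 exact: nbhs_right_le.
have /fine_cvgP[_ /cvgrPdist_le/(_ _ e0)] := h.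
move=> /nbhs_ballP[del /= del0 hdel]; exists (del / 2); first by rewrite divr_gt0.
move=> t /andP[t0 td]; have := hdel t; rewrite /ball /= sub0r normrN gtr0_norm// => k.
have := k _ t0; rewrite sub0r normrN E1//= ger0_norm ?N1_ge0//; apply.
by rewrite (le_lt_trans td)// ltr_pdivrMr// ltr_pMr// ltr1n.
Unshelve. all: by end_near. Qed.

Lemma at_infty_cvg (z : R -> E -> R) : (forall t, 0 < t -> Lint (z t)) ->
 (forall e : R, 0 < e -> exists2 b : R, 0 < b & forall t, b <= t -> N1 (z t) <= e) ->
 ((\int[mu]_x (`|z t x|)%:E)%E @[t --> +oo%R] --> 0%E).
move=> iz h; have E1 t : 0 < t -> (\int[mu]_x (`|z t x|)%:E)%E = (N1 (z t))%:E.
 by move=> t0; rewrite Ig_EFin//; apply: Lint_abs; side.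
have E2 : \forall t \near +oo%R, (N1 (z t))%:E = (\int[mu]_x (`|z t x|)%:E)%E.
 by near=> t; rewrite E1//.
apply: cvg_trans (near_eq_cvg E2) _; apply: cvg_EFin; first exact: nearW.
apply/cvgrPdist_le => e e0; have [b b0 hb] := h e e0; near=> t.
rewrite sub0r normrN /= ger0_norm ?N1_ge0//; apply: hb; near: t.
by apply: nbhs_pinfty_ge; exact: num_real.
Unshelve. all: by end_near. Qed.

Lemma Tt_semigroup : C0_contraction_semigroup mu Tt.
split.
- move=> t t0; have t0' := ltW t0; split.
 + by move=> f i; have [] := Tt_P t0' i.
 + move=> a f g i j; have k : Lint (fun x => a * f x + g x) by apply: LintD => //; side.
  have [i' _] := Tt_P t0' i; have [j' _] := Tt_P t0' j; have [k' _] := Tt_P t0' k.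
  apply/aeT; apply/neq_ae => //; first side.
  exact: (sg_lin sn_L1 HY_LS HY_neq JJ_Lint HY_JP HY_JN HY_LJ HY_JL Lb_dense HY_complete).
 + move=> f i; have [i' _] := Tt_P t0' i; apply/L1_EFin => //.
  exact: (sgN sn_L1 HY_LS HY_neq JJ_Lint HY_JP HY_JN HY_LJ HY_JL Lb_dense HY_complete).
- move=> s t f s0 t0 i; have [i1 _] := Tt_P (ltW t0) i; have [i2 _] := Tt_P (ltW s0) i1.
 have [i3 _] := Tt_P (ltW (addr_gt0 s0 t0)) i.
 apply/aeT; apply/neq_ae => //; apply: (sg_add sn_L1 HY_LS HY_neq JJ_Lint HY_JP HY_JN HY_LJ HY_JL Lb_dense HY_complete) => //; side.
- move=> f i; apply: (proj1 (at_right_cvg _)).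
  by move=> t t0; apply: LintB => //; have [] := Tt_P (ltW t0) i.
 move=> e e0; have [del del0 hdel] := sg_cont sn_L1 HY_LS HY_neq JJ_Lint HY_JP HY_JN HY_LJ HY_JL Lb_dense HY_complete i e0.
 by exists del => // t /andP[t0 td]; apply: hdel; rewrite ltW.
Qed.

Lemma Tt_generator : semigroup_generator mu Tt Lb.
have iz u f t : 0 < t -> Lint u -> Lint f -> Lint (fun x => (Tt t u x - u x) / t - f x).
 move=> t0 iu jf; have [iT _] := Tt_P (ltW t0) iu; apply: LintB => //.
 by under eq_fun do rewrite mulrC; apply: LintZ; side.
move=> u f; split=> [L|[iu jf h]].
 have [iu jf _] := L; split=> //; apply: (proj1 (at_right_cvg _)); first side.
 move=> e e0; exact: (sg_gen sn_L1 HY_LS HY_neq JJ_Lint HY_JP HY_JN HY_LJ HY_JL Lb_dense HY_complete L e0).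
apply: (gen_sg sn_L1 HY_LS HY_neq JJ_Lint HY_JP HY_JN HY_LJ HY_JL Lb_dense HY_complete) => //.
by move: h => /(proj2 (at_right_cvg (fun t t0 => iz u f t t0 iu jf))).
Qed.

Lemma Lb_L1_operator : closed_operator mu Lb.
split; first split.
- by move=> u f [].
- by move=> u u' f f' iu' if' /aeT eu /aeT ef L; exact: Lb_ae L iu' if' eu ef.
- by move=> u f f' L L'; apply/aeT; exact: Lb_fun L L'.
- exact: Lb0.
- by move=> a u v f g; exact: Lb_lin.
move=> u_ f_ u f L [_ iu hu] [_ jf hf]; apply: (Lb_closed L) => //.
 apply/EFin_to0; first by move=> n; exact: N1_ge0.
 apply: cvg_trans hu; apply: near_eq_cvg; apply: nearW => n.
 by rewrite Ig_EFin//; apply: Lint_abs; apply: LintB => //; have [] := L n.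
apply/EFin_to0; first by move=> n; exact: N1_ge0.
apply: cvg_trans hf; apply: near_eq_cvg; apply: nearW => n.
by rewrite Ig_EFin//; apply: Lint_abs; apply: LintB => //; have [] := L n.
Qed.

Lemma Gb_is_resolvent al : 0 < al -> is_resolvent_of mu Lb al (Gb al).
move=> al0; split=> [f i|u f L]; first exact: RG_Lb al0 i (GbP al0 i).
have [iu jf _] := L; have i : Lint (fun x => al * u x - f x) by apply: LintB => //; side.
by apply/aeT; exact: (RG_uniq al0 i (GbP al0 i) (Lb_RG al0 L)).
Qed.

Lemma Gb_generator : resolvent_generator mu Gb Lb.
move=> al al0 u f; split=> [L|[iu jf e]].
 by have [iu jf _] := L; split=> //; have [_] := Gb_is_resolvent al0; apply.
have i : Lint (fun x => al * u x - f x) by apply: LintB => //; side.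
move/aeT: e => e; apply: (Lb_ae (RG_Lb al0 i (GbP al0 i))) => //.
by apply: filterS e => x ->; ring.
Qed.

Lemma Gb_sub_markovian al : 0 < al -> sub_markovian mu (fun f x => al * Gb al f x).
move=> al0 f i f01; have h0 : 0 < al^-1 by rewrite invr_gt0.
by have := JJ_01 h0 i f01; rewrite /JJ invrK.
Qed.

Lemma Gb_C0 : C0_contraction_resolvent mu Gb.
split.
- move=> a a0; split.
 + by move=> f i; apply: LintZ; exact: Gb_Lint.
 + by move=> t f g i j; apply/aeT; apply: filterS (Gb_lin t a0 i j) => x ->; ring.
 + move=> f i; apply/L1_EFin => //; first by apply: LintZ; exact: Gb_Lint.
  by rewrite N1Z ?gtr0_norm ?Gb_bound//; exact: Gb_Lint.
- move=> a b f a0 b0 i; have G := GbP a0 i; have G' := GbP b0 i.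
 have ib := Gb_Lint b0 i; have G2 := GbP a0 ib.
 have Gc := RG_change b0 a0 i G'.
 have k : Lint (fun x => (a - b) * Gb b f x + f x) by apply: LintD => //; side.
 have e := RG_uniq a0 k Gc (RG_lin (a - b) a0 ib i G2 G).
 by apply/aeT; apply: filterS e => x ->; ring.
- move=> f i; apply: at_infty_cvg; first by move=> t t0; apply: LintB => //; apply: LintZ; exact: Gb_Lint.
 move=> e e0; have [b b0 hb] := RG_C0 i e0; exists b => // t bt.
 by apply: hb => //; apply: GbP => //; exact: lt_le_trans bt.
Qed.

(** * The global energy space *)

Local Notation W := ((E -> R^o) * (E -> E))%type.

Definition LA D := mvec D /\ Lint (fun x => a x (D x) (D x)).

Lemma LA_mul D F : LA D -> LA F -> Lint (fun x => a x (D x) (F x)).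
move=> [mD iD] [mF iF]; apply: (Lint_dom (a_meas mD mF) _ (LintZ 2^-1 (LintD iD iF))) => x.
exact: (a_abs).
Qed.

Lemma LA_lin (t : R) D F : LA D -> LA F -> LA (fun x => t *: D x + F x).
move=> hD hF; split.
 move=> i; under eq_fun do rewrite mxE [X in X + _]mxE.
 by apply: measurable_funD; [apply: measurable_funM => //; exact: hD.1|exact: hF.1].
rewrite (_ : (fun x => _) = fun x => (t * t * a x (D x) (D x) + 2 * t * a x (D x) (F x)) + a x (F x) (F x)).
 apply: LintD; [apply: LintD|exact: hF.2]; apply: LintZ; [exact: hD.2|exact: LA_mul].
ext x; rewrite !(a_Dr, a_Zr, aformDl, aformZl) [a x (F x) (D x)](a_C); ring.
Qed.

Lemma LA_Sob V u D : precompact V -> Sob V u D -> LA D.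
move=> pV S; split; first by move=> i; exact: LLv_meas (Sob_LLv S).
exact: (Lint_a pV (Sob_LLv S) (Sob_LLv S) (fun=> Sob_offD S)).
Qed.

(** The ambient space in which the form is closed. Gradients are measured by A alone, since A is
    comparable to the Euclidean norm only on bounded sets. *)
Definition HA : set W := [set w | LL2 w.1 /\ LA w.2].
Definition qA (w z : W) : R := Ig (fun x => w.1 x * z.1 x) + Ef w.2 z.2.

Lemma Ef_lin (t : R) D F H : LA D -> LA F -> LA H -> Ef (fun x => t *: D x + F x) H = t * Ef D H + Ef F H.
move=> hD hF hH; rewrite /Ef; under eq_fun do rewrite aformDl aformZl.
rewrite IgD ?LintZ ?LA_mul// IgZ ?LA_mul//; ring.
Qed.

Lemma HA_lin (t : R) (w z : W) : HA w -> HA z -> HA (t *: w + z).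
move=> [h1 h2] [k1 k2]; split; last exact: LA_lin.
by apply: LL2D => //; exact: LL2Z.
Qed.

Lemma semihilbert_qA : semihilbert HA qA.
split.
- split; first side.
 split=> [i|]//.
 by under eq_fun do rewrite aform0l; side.
- exact: HA_lin.
- by move=> w z _ _; rewrite /qA (EfC); congr (Ig _ + _); ext x; rewrite mulrC.
- move=> t w z y [w1 w2] [z1 z2] [y1 y2]; rewrite /qA Ef_lin//.
 rewrite (_ : (fun x => _) = fun x => t * (w.1 x * y.1 x) + z.1 x * y.1 x); last first.
  by ext x; rewrite mulrA -mulrDl.
 rewrite IgD; [|side|side].
 rewrite IgZ; last side.
 by move: (Ig _) (Ig _) (Ef _ _) (Ef _ _) => p q r s; ring.
- move=> w _; apply: addr_ge0; last exact: (Ef_ge0).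
 by apply: Ig_ge0 => x; rewrite -expr2 sqr_ge0.
Qed.

Lemma qAE (w : W) : HA w -> qA w w = Ig (fun x => gauge (fun=> 0) 1 1 x (w.1 x) (w.2 x)).
move=> [w1 w2]; rewrite /qA /Ef /gauge -IgZ; last exact: LA_mul.
rewrite -IgD; [|side|by apply: LintZ; exact: LA_mul].
by congr Ig; ext x; rewrite dotv0l mulr0 addr0 mul1r.
Qed.

Lemma qA_parts (w : W) : Ig (fun x => w.1 x ^+ 2) <= qA w w /\ Ef w.2 w.2 <= qA w w.
rewrite /qA; have e0 := Ef_ge0 w.2; have i0 : 0 <= Ig (fun x => w.1 x ^+ 2) by apply: Ig_ge0 => x; exact: sqr_ge0.
by split; [rewrite lerDl|rewrite lerDr].
Qed.

Lemma HA_B (w z : W) : HA w -> HA z -> HA (w - z).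
exact: (shB semihilbert_qA). Qed.

(** Reuses the gauge of the regularised problem with zero drift and al = ep = 1, for which it is u^2
    + a(D, D) / 2. *)
Lemma qcomplete_qA : qcomplete HA qA.
move=> z Sz cz; have g0 := gauge_ge0 (fun=> 0) ltr01 ltr01.
have h0 (i : 'I_d) : mfunT (fun x => (fun=> 0 : E) x ord0 i).
 side.
have hgm := gauge_meas drift0 1 1.
have iG (w : W) : HA w -> Lint (fun x => gauge (fun=> 0) 1 1 x (w.1 x) (w.2 x)).
 move=> [w1 w2]; apply: LintD; last by apply: LintZ; exact: LA_mul.
 by under eq_fun do rewrite dotv0l mulr0 addr0 mul1r; exact: w1.2.
have [|||||||u [D [mu' mD u0 D0 hlim]]] := @riesz_fischer _ _ _ d mu (gauge (fun=> 0) 1 1) g0 _ _ _ (fun n => (z n).1) (fun n => (z n).2).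
- side.
- exact: gauge_cont.
- exact: (gauge_low (fun=> 0) ltr01 ltr01).
- by move=> n; exact: (Sz n).1.1.
- by move=> n i; exact: (Sz n).2.1.
- by move=> n k; exact: (iG _ (HA_B (Sz n) (Sz k))).
- by move=> e e0; have [K hK] := cz e e0; exists K => n k Kn Kk; have := hK n k Kn Kk; rewrite qAE//; exact: HA_B.
have Hd N : Lint (fun x => gauge (fun=> 0) 1 1 x ((z N).1 x - u x) ((z N).2 x - D x)) -> HA (z N - (u, D)).
 move=> iN; have mdD i : mfunT (fun x => ((z N).2 x - D x) ord0 i).
  by under eq_fun do rewrite mxE [X in _ + X]mxE; apply: measurable_funB => //; exact: (Sz N).2.1.
 split=> /=.
  have m1 : mfunT (fun x => (z N).1 x - u x) by apply: measurable_funB => //; exact: (Sz N).1.1.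
  split=> //; apply: (Lint_dom _ _ iN); first side.
  move=> x; rewrite ger0_norm ?sqr_ge0//.
  by have [h _] := gauge_fst (fun=> 0) ltr01 ltr01 x ((z N).1 x - u x) ((z N).2 x - D x); rewrite mul1r in h.
 split=> //; apply: (Lint_dom _ _ (LintZ 2 iN)); first exact: (a_meas).
 by move=> x; rewrite ger0_norm ?(a_ge0)//; exact: gauge_snd.
have [N hN] := hlim 1 ltr01; have [iN _] := hN N (leqnn N).
have Hu : HA (u, D) by have := HA_B (Sz N) (Hd N iN); rewrite subKr.
exists (u, D) => // e e0; have [K hK] := hlim e e0; exists K => n Kn; have [_] := hK n Kn.
by rewrite qAE//; exact: HA_B.
Qed.

(** The domain of E^0 with its gradient made explicit: the closure of C_0^oo in the energy norm
    [qA]. *)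
Definition EG u D := HA (u, D) /\ exists u_ : nat -> E -> R, (forall n, test setT (u_ n)) /\
 to0 (fun n => qA ((u_ n, grad (u_ n)) - (u, D)) ((u_ n, grad (u_ n)) - (u, D))).

Lemma HA_Sob V u D : precompact V -> Sob V u D -> HA (u, D).
by move=> pV S; split; [exact: Sob_L2 S|exact: LA_Sob pV S]. Qed.

Lemma test_ball u : test setT u -> exists n, test (@balln R d n) u.
by move=> [su [K [cK _ u0]]]; have [n Kn] := compact_balln cK; exists n; split=> //; exists K. Qed.

Lemma HA_test u : test setT u -> HA (u, grad u).
by move=> /test_ball[n t]; exact: HA_Sob (@precompact_balln R d n) (Sob_test mu_fin t). Qed.

Lemma EG_Sob V u D : open V -> precompact V -> Sob V u D -> EG u D.
move=> oV pV S; split; first exact: HA_Sob pV S.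
have [_ _ _ [v_ [tv hv]]] := S; have [c c0 hc] := cf_ell hA pV.
have tT n : test setT (v_ n) by have [sv [K [cK _ k0]]] := tv n; split=> //; exists K.
exists v_; split=> //; have K0 : 0 <= 1 + c by rewrite addr_ge0// ltW.
apply: (to0_le _ (to0Z K0 hv)) => n; have Sd := Sob_B mu_fin (Sob_test mu_fin (tv n)) S.
have Hn := HA_B (HA_test (tT n)) (HA_Sob pV S).
have id := Lint_q0 (Sob_L2 Sd) (Sob_LLv Sd).
have i2 := LintZ 2^-1 (LA_mul Hn.2 Hn.2); have i1 := LL2_mul Hn.1 Hn.1.
rewrite /qA /= -IgZ// /Ef -IgZ; last exact: LA_mul Hn.2 Hn.2.
rewrite -IgD//; apply: Ig_le; [side|side|move=> x].
have s : a x (grad (v_ n) x - D x) (grad (v_ n) x - D x) <= c * dotv (grad (v_ n) x - D x) (grad (v_ n) x - D x).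
 have [Vx|nV] := pselect (V x); first by have /andP[_] := hc x (grad (v_ n) x - D x) Vx.
 by rewrite (Sob_offD Sd nV) aform0l dotv0l mulr0.
have a0 := a_ge0 x (grad (v_ n) x - D x); have q := dotvv_ge0 (grad (v_ n) x - D x).
have p := sqr_ge0 (v_ n x - u x); have r := mulr_ge0 (ltW c0) p.
suff : (v_ n x - u x) ^+ 2 + 2^-1 * a x (grad (v_ n) x - D x) (grad (v_ n) x - D x) <=
 (1 + c) * ((v_ n x - u x) ^+ 2 + dotv (grad (v_ n) x - D x) (grad (v_ n) x - D x)) by [].
rewrite mulrDl mul1r mulrDr.
move: (a x _ _) (dotv _ _) (c * dotv _ _) (_ ^+ 2) (c * _ ^+ 2) r p q s a0 => X1 X2 X3 X4 X5 *; lra.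
Qed.

(** The function p = u + G_be h equals be G_be u. It is a resolvent of the function be u, so for
    bounded u it is a limit of bounded local solutions, while its image be (p - u) = be G_be h is
    close to h by strong continuity. *)
Lemma Lb_mean u h (e : R) : Lb u h -> 0 < e -> exists (be : R) p, [/\ 1 <= be, Lint p, RG be (fun x => be * u x) p,
 Ig (fun x => `|be * (p x - u x) - h x|) <= e & Ig (fun x => `|p x - u x|) <= e].
move=> L e0; have [iu ih _] := L; have [b0 b00 hb] := RG_C0 ih e0.
(* b0 serves the strong continuity at h, the last summand makes |p - u| <= |h| / be at most e, and
   the 1 gives be >= 1. *)
pose be := b0 + 1 + N1 h / e; have q0 : 0 <= N1 h / e by rewrite divr_ge0 ?N1_ge0// ltW.
have be1 : b0 + 1 <= be by rewrite lerDl.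
have be0 : 0 < be by apply: lt_le_trans be1; rewrite addr_gt0.
have G := GbP be0 ih; have G' := Lb_RG be0 L.
exists be, (fun x => u x + Gb be h x); split.
- by apply: le_trans be1; rewrite lerDr ltW.
- by apply: LintD => //; exact: G.1.
- have i : Lint (fun x => be * u x - h x) by apply: LintB => //; side.
 have := RG_lin 1 be0 i ih G' G.
 rewrite (_ : (fun x => 1 * _ + h x) = fun x => be * u x); last by ext x; ring.
 rewrite (_ : (fun x => 1 * u x + _) = fun x => u x + Gb be h x)//.
 by ext x; rewrite mul1r.
- rewrite (_ : (fun x => _) = fun x => `|be * Gb be h x - h x|); last first.
  by ext x; congr (`|_|); ring.
 by apply: hb G; apply: le_trans be1; rewrite lerDl.
- rewrite (_ : (fun x => _) = fun x => `|Gb be h x|); last by ext x; congr (`|_|); ring.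
 rewrite -(ler_pM2l be0) (le_trans (Gb_bound be0 ih))// -ler_pdivrMr//.
 by rewrite /be lerDr addr_ge0// ltW.
Qed.

(** The chain of approximation is u, then be G_be u, then its local version on a ball, then a
    regularised solution w on that ball. The data be u are bounded by be M and the resolvent at be
    divides by be, so w keeps the bound M; its image g contains the regularising term, which is
    small in L^1. *)
Lemma energy_approx u h (M e : R) n : Lb u h -> 0 < M -> (forall x, `|u x| <= M) -> 0 < e ->
 exists k w D g, (n <= k)%N /\ [/\ Sob (balln k) w D, forall x, `|w x| <= M,
  Lint g /\ weq B (balln k) D (fun x => - g x),
  Ig (fun x => `|g x - h x|) <= e & Ig (fun x => `|w x - u x|) <= e].
move=> L M0 uM e0; have e8 : 0 < e / 8 by rewrite divr_gt0.
have [be [p [be1 ip G hp hpu]]] := Lb_mean L e8; have [iu ih _] := L.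
have be0 : 0 < be := lt_le_trans ltr01 be1.
have i := LintZ be iu; have [g_ [hg tg]] := RG_approx be0 i G.
(* Errors in w enter g multiplied by be, hence the division. *)
have del0 : 0 < e / 8 / be by rewrite divr_gt0.
have [k0 hk] := tg _ del0; pose k := maxn n k0; have hk' := hk _ (leq_maxr n k0).
have oV := @open_balln R d k; have pV := @precompact_balln R d k.
have [gk0 gkcl] := hg k; have igk := resV_Lint (hg k).
have fM x : `|((fun x => be * u x) \_ (balln k)) x| <= be * M.
 by rewrite (le_trans (restrict_abs _ _ _))// normrM gtr0_norm// ler_wpM2l// ltW.
have Lf : LL2 ((fun x => be * u x) \_ (balln k)).
 have r0 x : ~ balln k x -> ((fun x => be * u x) \_ (balln k)) x = 0 by exact: restrict_off.
 have bM : 0 <= be * M by rewrite mulr_ge0 ?ltW.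
 have [] := LL2_cut_at oV pV bM (Lint_meas (Lint_restrict oV i)) r0.
 rewrite (_ : cut_at _ _ = ((fun x => be * u x) \_ (balln k)))//; ext x; rewrite cut_at_id//.
have [u_ [D_ [u' [hi c' hu' u'0 [iep hep]]]]] := res_bdd oV pV be0 (mulr_gt0 be0 M0) Lf (fun x => @restrict_off _ _ (balln k) (fun x => be * u x) x) fM.
have ae := cl_res_uniq oV pV be0 c' gkcl.
have [j1 hj1] := hu' _ del0; have [j2 hj2] := hep _ e8; pose j := maxn j1 j2.
have hj1' := hj1 _ (leq_maxl j1 j2); have hj2' := hj2 _ (leq_maxr j1 j2).
have [[S Bw hw] wM] := hi j; have Lw := LL2_Lint oV pV (Sob_L2 S) (fun x nV => Sob_off S nV).
have wM' x : `|u_ j x| <= M by have := wM x; rewrite mulrC mulKf ?gt_eqF.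
have iu' : Lint u' by have [? _] := cl_rhs c'.
have wg : Ig (fun x => `|u_ j x - g_ k x|) <= e / 8 / be.
 apply: (le_trans (N1_tri Lw iu' igk)); rewrite (N1_ae iu' igk ae) addr0; side.
have bw : be * Ig (fun x => `|u_ j x - g_ k x|) <= e / 8 by rewrite -ler_pdivlMl// mulrC.
have bg : be * Ig (fun x => `|g_ k x - p x|) <= e / 8 by rewrite -ler_pdivlMl// mulrC.
have N1b f : Lint f -> Ig (fun x => `|be * f x|) = be * N1 f by move=> jf; rewrite N1Z ?gtr0_norm.
pose g x := be * u_ j x - be * u x + j.+1%:R^-1 * dotv (B x) (B x) * u_ j x.
have ie := iep j; have ig : Lint g by apply: LintD => //; apply: LintB => //; side.
have i1 : Lint (fun x => u_ j x - g_ k x) := LintB Lw igk.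
have i2 : Lint (fun x => g_ k x - p x) := LintB igk ip.
have i3 : Lint (fun x => p x - u x) := LintB ip iu.
exists k, (u_ j), (D_ j), g; split; first exact: leq_maxl.
split=> //.
- split=> // v F Sv bv; have mv := Sob_meas Sv.
 have Bv := LL2_Bv hB oV pV mv bv (fun x nV => Sob_off Sv nV).
 have h1 := hw v F Sv Bv.
 have k1 : Lint (fun x => (be + j.+1%:R^-1 * dotv (B x) (B x)) * (u_ j x * v x)).
  exact: (Lint_wt be _ (Sob_L2 S) (Sob_L2 Sv) Bw Bv).
 have k2 := LL2_mul Lf (Sob_L2 Sv).
 transitivity (Ig (fun x => ((fun x => be * u x) \_ (balln k)) x * v x) -
   Ig (fun x => (be + j.+1%:R^-1 * dotv (B x) (B x)) * (u_ j x * v x))).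
  by rewrite -h1; move: (Ig _) (Ef _ _) (Ig _) => X Y Z; ring.
 rewrite -IgB//; congr Ig; ext x; rewrite /g.
 have [Vx|nV] := pselect (balln k x); first by rewrite restrict_in//; ring.
 by rewrite (Sob_off Sv nV); ring.
- have j1' := LintZ be i1; have j2' := LintZ be i2; have j3 : Lint (fun x => be * (p x - u x) - h x) := LintB (LintZ be i3) ih.
 rewrite (_ : (fun x => _) = fun x => `|be * (u_ j x - g_ k x) + (be * (g_ k x - p x) + ((be * (p x - u x) - h x) + j.+1%:R^-1 * dotv (B x) (B x) * u_ j x))|); last first.
  by ext x; congr (`|_|); rewrite /g; ring.
 apply: (le_trans (N1D j1' (LintD j2' (LintD j3 ie)))).
 have t2 := N1D j2' (LintD j3 ie); have t3 := N1D j3 ie.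
 rewrite !N1b// in t2 *; rewrite [e]splitr.
 move: (Ig _) (Ig _) (Ig _) (Ig _) (Ig _) t2 t3 bw bg hp hj2' => *; lra.
- rewrite (_ : (fun x => _) = fun x => `|(u_ j x - g_ k x) + ((g_ k x - p x) + (p x - u x))|); last first.
  by ext x; congr (`|_|); ring.
 apply: (le_trans (N1D i1 (LintD i2 i3))); have t2 := N1D i2 i3.
 have d8 : e / 8 / be <= e / 8 by rewrite ler_pdivrMr// ler_peMr// ltW.
 have hk8 := le_trans hk' d8; have wg8 := le_trans wg d8.
 move: (Ig _) (Ig _) (Ig _) (Ig _) t2 hk8 wg8 hpu => X1 X2 X3 X4 *; lra.
Qed.

Lemma LA_loc V : open V -> precompact V -> exists2 c : R, 0 <= c & forall D, LA D ->
 LLv (fun x => (\1_V x : R) *: D x) /\ forall i, Ig (fun x => (\1_V x * D x ord0 i) ^+ 2) <= c * Ef D D.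
move=> oV pV; have [c c0 hc] := cf_ell hA pV; exists (2 * c); first by rewrite mulr_ge0// ltW.
move=> D [mD iD].
have mV : mfunT (\1_V : E -> R) by exact: Lint_meas (Lint_1 oV pV).
have m1 i : mfunT (fun x => \1_V x * D x ord0 i) by apply: measurable_funM.
have le i x : (\1_V x * D x ord0 i) ^+ 2 <= c * aform (A x) (D x) (D x).
 have p : 0 <= c * aform (A x) (D x) (D x) by rewrite mulr_ge0 ?(a_ge0)// ltW.
 have [Vx|nV] := pselect (V x); last by rewrite indicE memNset// mul0r expr0n.
 rewrite indicE mem_set// mul1r (le_trans (coord_le_dotv _ _))// -ler_pdivrMl//.
 by have /andP[] := hc x (D x) Vx.
have i2 i : Lint (fun x => (\1_V x * D x ord0 i) ^+ 2).
 apply: (Lint_dom _ _ (LintZ c iD)); first side.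
 by move=> x; rewrite ger0_norm ?sqr_ge0.
split=> [i|i].
 rewrite (_ : (fun x => _) = fun x => \1_V x * D x ord0 i)//.
 by ext x; rewrite mxE.
rewrite /Ef (_ : 2 * c * _ = c * Ig (fun x => aform (A x) (D x) (D x))); last by field.
by rewrite -IgZ//; apply: Ig_le => //; side.
Qed.

Lemma EG_closed (z : nat -> W) u D : (forall n, EG (z n).1 (z n).2) -> HA (u, D) ->
 to0 (fun n => qA (z n - (u, D)) (z n - (u, D))) -> EG u D.
move=> hz hw tz; split=> //.
have ex n : exists t, test setT t /\ qA ((t, grad t) - z n) ((t, grad t) - z n) <= n.+1%:R^-1.
 have [_ [t_ [tt ht]]] := hz n; have n0 : 0 < n.+1%:R^-1 :> R by [].
 have [N hN] := ht _ n0; exists (t_ N); split => //.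
 side.
have [t ht] := choice ex; exists t; split; first by move=> n; have [] := ht n.
have T := to0D (to0Z (ler0n R 2) (@to0_inv R)) (to0Z (ler0n R 2) tz).
apply: (to0_le _ T) => n.
have [tn qn] := ht n; have Hz : HA (z n) by have [+ _] := hz n; case: (z n).
have SH := semihilbert_qA.
have := q_near SH (HA_B (HA_test tn) hw) (HA_B (HA_test tn) Hz).
have e (x y w : W) : x - y - (x - w) = w - y by rewrite opprB addrC addrA addrNK.
by rewrite e => h; apply: le_trans h _; apply: lerD => //; rewrite ler_wpM2l.
Qed.

(** * Near-minimisers of the energy *)

Section minimizing.
Variables (u h : E -> R) (M : R).
Hypotheses (L : Lb u h) (M0 : 0 < M) (uM : forall x, `|u x| <= M).
Let iu : Lint u. Proof. by have [] := L. Qed.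
Let ih : Lint h. Proof. by have [] := L. Qed.

Definition Phi D v F := Ef D F - Ig (fun x => dotv (B x) (D x) * v x).
(** Approximate solutions at level n: the bound M, L^1-closeness to u, and the weak equation up to K
    / (n+1) against functions on [balln n] bounded by K. Each condition survives midpoints and
    weakens as n decreases, which is what [mazur] asks for. *)
Definition Cn (n : nat) : set W := [set w | [/\ exists k, Sob (balln k) w.1 w.2, forall x, `|w.1 x| <= M,
 Ig (fun x => `|w.1 x - u x|) <= n.+1%:R^-1 &
 forall v F (K : R), Sob (balln n) v F -> 0 <= K -> (forall x, `|v x| <= K) ->
  `|Phi w.2 v F + Ig (fun x => h x * v x)| <= K * n.+1%:R^-1]].
(** The limit of [qA] along good approximants: their energy is - int g w, and the pair (w, g)
    approaches (u, h). *)
Definition Mb := Ig (fun x => u x ^+ 2) - Ig (fun x => h x * u x).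

Lemma Phi_lin n (t : R) D H v F : LA D -> LA H -> LLv D -> LLv H -> Sob (balln n) v F -> bdd v ->
 Phi (fun x => t *: D x + H x) v F = t * Phi D v F + Phi H v F.
move=> hD hH LD LH Sv bv; have oV := @open_balln R d n; have pV := @precompact_balln R d n.
have v0 x : ~ balln n x -> v x = 0 := fun nV => Sob_off Sv nV.
rewrite /Phi (Ef_lin)//; last exact: (LA_Sob pV Sv).
rewrite (_ : (fun x => dotv (B x) (t *: D x + H x) * v x) = fun x => t * (dotv (B x) (D x) * v x) + dotv (B x) (H x) * v x); last first.
 by ext x; rewrite dotvC dotvDl dotvZl !(dotvC _ (B x)); ring.
have i1 := Lint_BDv' hB oV pV LD (Sob_meas Sv) bv v0; have i2 := Lint_BDv' hB oV pV LH (Sob_meas Sv) bv v0.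
rewrite IgD//; last side.
by rewrite IgZ//; move: (Ef _ _) (Ef _ _) (Ig _) (Ig _) => *; ring.
Qed.

Lemma Cn_HA n : Cn n `<=` HA.
by move=> w [[k S] _ _ _]; have := HA_Sob (@precompact_balln R d k) S. Qed.

Lemma Cn_mono n : Cn n.+1 `<=` Cn n.
move=> w [eS wM wu hw]; have le : n.+2%:R^-1 <= n.+1%:R^-1 :> R by rewrite lef_pV2 ?posrE// ler_nat.
split=> //; first exact: le_trans wu le.
move=> v F K Sv K0 vK; apply: le_trans (hw v F K (Sob_W (@ballnS R d _ _ (leqnSn n)) Sv) K0 vK) _.
exact: ler_wpM2l.
Qed.

Lemma Cn_mid n w z : Cn n w -> Cn n z -> Cn n (2^-1 *: (w + z)).
move=> [[k S] wM wu hw] [[k' S'] zM zu hz]; have S1 := Sob_W (@ballnS R d _ _ (leq_maxl k k')) S.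
have S2 := Sob_W (@ballnS R d _ _ (leq_maxr k k')) S'; have pV := @precompact_balln R d (maxn k k').
have oV := @open_balln R d (maxn k k').
have e1 x : (2^-1 *: (w + z)).1 x = 2^-1 * (w.1 x + z.1 x) by [].
have e2 x : (2^-1 *: (w + z)).2 x = 2^-1 *: (w.2 x - z.2 x) + z.2 x.
 rewrite [LHS](_ : _ = 2^-1 *: (w.2 x + z.2 x))//; apply/rowP => i; rewrite !mxE.
 by move: (w.2 x ord0 i) (z.2 x ord0 i) => p q; field.
have := Sob_D mu_fin (Sob_Z mu_fin 2^-1 (Sob_B mu_fin S1 S2)) S2 => S3.
have S4 : Sob (balln (maxn k k')) (2^-1 *: (w + z)).1 (2^-1 *: (w + z)).2.
 rewrite (_ : (2^-1 *: (w + z)).2 = fun x => 2^-1 *: (w.2 x - z.2 x) + z.2 x); last by apply/funext.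
 rewrite (_ : (2^-1 *: (w + z)).1 = fun x => 2^-1 * (w.1 x - z.1 x) + z.1 x)//.
 by ext x; rewrite e1; field.
have iw := LL2_Lint oV pV (Sob_L2 S1) (fun x nV => Sob_off S1 nV).
have iz := LL2_Lint oV pV (Sob_L2 S2) (fun x nV => Sob_off S2 nV).
split; first by exists (maxn k k').
- move=> x; rewrite e1 normrM gtr0_norm ?invr_gt0// ler_pdivrMl// (le_trans (ler_normD _ _))//.
 by rewrite mulr_natl mulr2n lerD.
- rewrite (_ : (fun x => _) = fun x => `|2^-1 * (w.1 x - u x) + 2^-1 * (z.1 x - u x)|); last first.
  by ext x; rewrite e1; congr (`|_|); field.
 have i1 := LintB iw iu; have i2 := LintB iz iu.
 apply: (le_trans (N1D (LintZ _ i1) (LintZ _ i2))); rewrite !N1Z// gtr0_norm ?invr_gt0//.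
 by move: (n.+1%:R^-1) (Ig _) (Ig _) wu zu => N X Y *; lra.
- move=> v F K Sv K0 vK; have h1 := hw v F K Sv K0 vK; have h2 := hz v F K Sv K0 vK.
 have bv : bdd v by exists K.
 rewrite (_ : (2^-1 *: (w + z)).2 = fun x => 2^-1 *: (-1 *: z.2 x + w.2 x) + z.2 x); last first.
  by ext x; rewrite e2 scaleN1r [- _ + _]addrC.
 have A1 := LA_Sob pV S1; have A2 := LA_Sob pV S2; have A3 := LA_lin (-1) A2 A1.
 have L3 := LLv_lin (-1) (Sob_LLv S2) (Sob_LLv S1).
 rewrite (Phi_lin _ A3 A2 L3 (Sob_LLv S2) Sv bv) (Phi_lin _ A2 A1 (Sob_LLv S2) (Sob_LLv S1) Sv bv).
 move: h1 h2; rewrite !ler_norml; move: (Phi _ _ _) (Phi _ _ _) (Ig _) (K * _) => X Y Z T.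
 by move=> /andP[? ?] /andP[? ?]; apply/andP; split; lra.
Qed.
Lemma skew_bdd n w D : Sob (balln n) w D -> bdd w -> Ig (fun x => dotv (B x) (D x) * w x) = 0.
move=> S bw; have oV := @open_balln R d n; have pV := @precompact_balln R d n.
have Bw := LL2_Bv hB oV pV (Sob_meas S) bw (fun x nV => Sob_off S nV).
exact: (@skew_BD B hB (balln n) oV pV (w, D) (conj S Bw)).
Qed.

Lemma Ig_bdd_le f v (K : R) : Lint f -> mfunT v -> (forall x, `|v x| <= K) ->
 Lint (fun x => f x * v x) /\ `|Ig (fun x => f x * v x)| <= K * N1 f.
move=> jf mv vK; have i := Lint_mul_bdd jf mv (ex_intro _ K vK); split=> //.
rewrite -IgZ; last exact: Lint_abs.
apply: Ig_dom; [exact: (Lint_meas i)|by apply: LintZ; exact: Lint_abs|move=> x].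
by rewrite normrM mulrC ler_wpM2r.
Qed.

Lemma Cn_exists n (e : R) : 0 < e -> exists2 w, Cn n w & qA w w <= Mb + e.
move=> e0; have M20 : 0 <= 2 * M by rewrite mulr_ge0// ltW.
have e3 : 0 < e / 3 by rewrite divr_gt0.
have [del del0 hdel] := Ig_vanish (Lint_abs ih) (fun x => normr_ge0 _) M20 e3.
have e9 : 0 < e / (9 * M) by rewrite divr_gt0// mulr_gt0.
have n0 : 0 < n.+1%:R^-1 :> R by rewrite invr_gt0.
(* The three tolerances give membership in [Cn n], the bound e / 3 from uniform integrability of h,
   and e / 9 for each of the three errors weighted by M. *)
pose e' := Num.min (n.+1%:R^-1) (Num.min del (e / (9 * M))).
have e'0 : 0 < e' by rewrite !lt_min n0 del0 e9.
have [k [w [D [g [nk [S wM [ig hw] gh wu]]]]]] := energy_approx n L M0 uM e'0.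
have oV := @open_balln R d k; have pV := @precompact_balln R d k.
have iw := LL2_Lint oV pV (Sob_L2 S) (fun x nV => Sob_off S nV); have mw := Sob_meas S.
have bw : bdd w by exists M.
have id := LintB iw iu; have idg := LintB ig ih.
have e'n : e' <= n.+1%:R^-1 by rewrite ge_min lexx.
have e'd : e' <= del by rewrite !ge_min lexx orbT.
have e'9 : M * e' <= e / 9.
 by rewrite -ler_pdivlMl// mulrC -mulrA -invfM [leRHS]mulrC !ge_min mulrC lexx !orbT.
exists (w, D).
 split=> /=; [by exists k|by []|exact: le_trans wu e'n|].
 move=> v F K Sv K0 vK; have Sv' := Sob_W (@ballnS R d _ _ nk) Sv.
 have mv := Sob_meas Sv; have bv : bdd v by exists K.
 rewrite /Phi hw// -IgD; [|by apply: Lint_mul_bdd => //; exact: LintN|exact: Lint_mul_bdd].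
 rewrite (_ : (fun x => _) = fun x => - ((g x - h x) * v x)); last by ext x; ring.
 have [i1 i2] := Ig_bdd_le idg mv vK; rewrite IgN// normrN (le_trans i2)// ler_wpM2l//.
 exact: le_trans gh e'n.
have hE : Ef D D = - Ig (fun x => g x * w x).
 have := hw w D S bw; rewrite (skew_bdd S bw) subr0 => ->.
 rewrite -IgN; last exact: Lint_mul_bdd.
 by congr Ig; ext x; ring.
rewrite /qA /= hE /Mb.
have mu' := Lint_meas iu; have bu : bdd u by exists M.
have [j1 k1] := Ig_bdd_le idg mw wM; have [j2 k2] := Ig_bdd_le id mw wM; have [j3 k3] := Ig_bdd_le id mu' uM.
have j4 := Lint_mul_bdd iu mu' bu; have j5 := Lint_mul_bdd ih mw bw; have j6 := Lint_mul_bdd ih mu' bu.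
have j7 : Lint (fun x => h x * (w x - u x)) by under eq_fun do rewrite mulrBr; exact: LintB.
have E1 : Ig (fun x => w x * w x) = Ig (fun x => u x ^+ 2) + (Ig (fun x => (w x - u x) * w x) + Ig (fun x => (w x - u x) * u x)).
 rewrite -!IgD//; last exact: LintD.
 by congr Ig; ext x; ring.
have E2 : Ig (fun x => g x * w x) = Ig (fun x => h x * u x) + (Ig (fun x => (g x - h x) * w x) + Ig (fun x => h x * (w x - u x))).
 rewrite -!IgD//; last exact: LintD.
 by congr Ig; ext x; ring.
have j8 : Lint (fun x => `|w x - u x|) := Lint_abs id.
have [l1 l2] : Lint (fun x => `|h x| * `|w x - u x|) /\ Ig (fun x => `|h x| * `|w x - u x|) <= e / 3.
 apply: hdel => //; last exact: le_trans wu e'd.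
 by move=> x; rewrite normr_ge0 (le_trans (ler_normB _ _))// mulr_natl mulr2n lerD.
have k4 : `|Ig (fun x => h x * (w x - u x))| <= e / 3.
 by apply: le_trans l2; apply: Ig_dom => //; [exact: (Lint_meas j7)|move=> x; rewrite normrM].
have P (t : R) : t <= e' -> M * t <= e / 9 by move=> te; apply: le_trans e'9; rewrite ler_wpM2l// ltW.
have {}k1 := le_trans k1 (P _ gh); have {}k2 := le_trans k2 (P _ wu); have {}k3 := le_trans k3 (P _ wu).
rewrite E1 E2; move: k1 k2 k3 k4; rewrite !ler_norml.
move: (Ig _) (Ig _) (Ig _) (Ig _) (Ig _) (Ig _) => X1 X2 X3 X4 X5 X6.
move=> /andP[? ?] /andP[? ?] /andP[? ?] /andP[? ?]; lra.
Qed.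
End minimizing.

(** The sequence from [mazur] converges strongly in energy, and its limit has first component u a.e.
    The bound by [Mb] survives, where the integral of u^2 cancels and leaves the energy estimate;
    the defects in the weak equation tend to 0, and strong convergence carries the drift term
    over. *)
Lemma energy u h (M : R) : Lb u h -> 0 < M -> (forall x, `|u x| <= M) -> exists D, [/\ EG u D,
 Ef D D <= - Ig (fun x => h x * u x) &
 forall n v F, Sob (balln n) v F -> bdd v ->
  Ef D F - Ig (fun x => dotv (B x) (D x) * v x) = - Ig (fun x => h x * v x)].
move=> L M0 uM; have [iu ih _] := L; have SH := semihilbert_qA.
have [z [zC cz zM]] := mazur SH (@Cn_HA u h M) (@Cn_mono u h M) (@Cn_mid u h M L) (Cn_exists L M0 uM).
have Hz n : HA (z n) := Cn_HA (zC n).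
have [[u' D] H' tz'] := qcomplete_qA Hz cz.
have Lz n : LL2 (z n).1 := (Hz n).1; have Lu' : LL2 u' := H'.1.
have tz2 : to0 (fun n => Ig (fun x => ((z n).1 x - u' x) ^+ 2)).
 by apply: (to0_le _ tz') => n; have [] := qA_parts (z n - (u', D)).
(* The sequence tends to u in L^1 and to u' in L^2. Both limits are compared by integrating against
   test functions. *)
have uu' : aeq u u'.
 have : {ae mu, forall x, setT x -> u x - u' x = 0}.
  apply: (fundamental_lemma openT).
   by apply: measurable_funB; [exact: Lint_meas iu|exact: Lu'.1].
  move=> t tt; have Lt := LL2_test mu_fin tt; have [K K0 tK] := test_bounded tt.
  have mt := test_meas tt; have i1 := Lint_mul_bdd iu mt (ex_intro _ K tK); have i2 := LL2_mul Lu' Lt.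
  have -> : (fun x => (u x - u' x) * t x) = fun x => u x * t x - u' x * t x by ext x; rewrite mulrBl.
  split; first exact: LintB.
  rewrite IgB//; apply/eqP; rewrite subr_eq0; apply/eqP.
  have zl1 : to0 (fun n => `|Ig (fun x => (z n).1 x * t x) - Ig (fun x => u x * t x)|).
   apply: (to0_le _ (to0Z K0 (@to0_inv R))) => n; have [[k S] _ zu _] := zC n.
   have iz := LL2_Lint (@open_balln R d k) (@precompact_balln R d k) (Sob_L2 S) (fun x nV => Sob_off S nV).
   rewrite -IgB//; last exact: LL2_mul (Lz n) Lt.
   have [_ k1] := Ig_bdd_le (LintB iz iu) mt tK; under eq_fun do rewrite -mulrBl.
   by rewrite (le_trans k1)// ler_wpM2l.
  apply: (to0_uniq zl1 (L2_lim_mul Lz Lu' Lt tz2)).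
  by under eq_fun do rewrite subrr normr0; exact: to0_cst0.
 by apply: filterS => x /(_ I)/eqP; rewrite subr_eq0 => /eqP.
have mu' := Lint_meas iu.
have Lu : LL2 u by apply: LL2_ae mu' _ Lu'; apply: filterS uu' => x ->.
have Hw : HA (u, D) by split; [|exact: H'.2].
have tz : to0 (fun n => qA (z n - (u, D)) (z n - (u, D))).
 apply: (to0_le _ tz') => n; apply: eq_ler; rewrite /qA /=; congr (_ + _).
 have Hn := HA_B (Hz n) Hw; apply: Ig_ae; first exact: LL2_mul Hn.1 Hn.1.
  have Hn' := HA_B (Hz n) H'; exact: Lint_meas (LL2_mul Hn'.1 Hn'.1).
 by apply: filterS uu' => x e; rewrite /GRing.add /= /GRing.opp /= e.
exists D; split.
- apply: (EG_closed _ Hw tz) => n; have [[k S] _ _ _] := zC n.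
 exact: (EG_Sob (@open_balln R d k) (@precompact_balln R d k) S).
- have l1 := q_lim SH Hz Hw Hw tz.
 (* From q (z - w) >= 0 one has 2 q (z, w) <= q (z, z) + q (w, w), and the left side is continuous
    in z. *)
 have : 2 * qA (u, D) (u, D) <= Mb u h + qA (u, D) (u, D).
  have T := to0D (to0Z (ler0n R 2) l1) (@to0_inv R).
  apply/ler_addgt0Pr => e e0; have [N /(_ _ (leqnn N)) hN] := T e e0.
  have := sh_ge0 SH (HA_B (Hz N) Hw); rewrite (qqB SH (Hz N) Hw).
  have := zM N; have := ler_norm (qA (u, D) (u, D) - qA (z N) (u, D)); rewrite distrC.
  move: hN; move: (N.+1%:R^-1) (qA _ _) (qA _ _) (qA _ _) `|_| => *; lra.
 rewrite /Mb /qA /=.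
 have -> : Ig (fun x => u x * u x) = Ig (fun x => u x ^+ 2) by [].
 by move: (Ig _) (Ig _) (Ef _ _) => *; lra.
- move=> n v F Sv [K hK]; have K0 : 0 <= K := le_trans (normr_ge0 _) (hK 0).
 have bv : bdd v by exists K.
 have oV := @open_balln R d n; have pV := @precompact_balln R d n; have v0 x : ~ balln n x -> v x = 0 := fun nV => Sob_off Sv nV.
 have mv := Sob_meas Sv; have LAF := LA_Sob pV Sv.
 have HF : HA ((fun=> 0 : R^o) : E -> R^o, F) by split => //; exact: LL20.
 have c1 : to0 (fun k => `|Ef (z k).2 F - Ef D F|).
  have := q_lim SH Hz Hw HF tz; rewrite /qA /=.
  under [X in to0 X -> _]eq_fun => k do (under eq_fun do rewrite mulr0; under [X in _ - (Ig X + _)]eq_fun do rewrite mulr0; rewrite !Ig_cst0 !add0r).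
  by [].
 have [c cc hc] := LA_loc oV pV.
 have Bv := LL2_Bv hB oV pV mv bv v0.
 have Hd k : LA (fun x => (z k).2 x - D x) := (HA_B (Hz k) Hw).2.
 have [_ cE] := hc _ Hw.2; have [LD _] := hc _ Hw.2.
 have Lzk k i : LL2 (fun x => \1_(balln n) x * (z k).2 x ord0 i).
  by have [L1 _] := hc _ (Hz k).2; have := L1 i; under eq_fun do rewrite mxE.
 have LDi i : LL2 (fun x => \1_(balln n) x * D x ord0 i) by have := LD i; under eq_fun do rewrite mxE.
 have BvE (F' : E -> E) : (forall i, LL2 (fun x => \1_(balln n) x * F' x ord0 i)) ->
   Ig (fun x => dotv (B x) (F' x) * v x) = \sum_(i < d) Ig (fun x => (\1_(balln n) x * F' x ord0 i) * (B x ord0 i * v x)).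
  move=> LF; rewrite -(Ig_sum _ (F := fun i x => (\1_(balln n) x * F' x ord0 i) * (B x ord0 i * v x))); last by move=> i; exact: LL2_mul.
  congr Ig; ext x; rewrite /dotv mulr_suml; apply: eq_bigr => i _.
  have [Vx|nV] := pselect (balln n x); first by rewrite indicE mem_set//= ; ring.
  by rewrite v0//; ring.
 have c2 : to0 (fun k => `|Ig (fun x => dotv (B x) ((z k).2 x) * v x) - Ig (fun x => dotv (B x) (D x) * v x)|).
  apply/to0_cvgB; rewrite BvE//; under eq_fun => k do rewrite BvE//.
  apply: cvg_osum => i; apply/to0_cvgB; apply: L2_lim_mul => //.
  apply: (to0_le _ (to0Z cc tz)) => k; have [_ k1] := hc _ (Hd k).
  have [_ k2] := qA_parts (z k - (u, D)); apply: le_trans (ler_wpM2l cc k2).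
  apply: le_trans (k1 i); apply: eq_ler; congr Ig.
  by ext x; congr (_ ^+ 2); rewrite -mulrBr; congr (_ * _); rewrite [RHS]mxE [X in _ = _ + X]mxE.
 have c3 : to0 (fun k => `|Phi (z k).2 v F - Phi D v F|).
  apply: (to0_le _ (to0D c1 c2)) => k; rewrite /Phi.
  rewrite (_ : _ - (_ - _) = (Ef (z k).2 F - Ef D F) + - (Ig (fun x => dotv (B x) ((z k).2 x) * v x) - Ig (fun x => dotv (B x) (D x) * v x))).
   by rewrite (le_trans (ler_normD _ _))// normrN.
  by move: (Ef _ _) (Ef _ _) (Ig _) (Ig _) => *; ring.
 apply: (to0_uniq c3 (b := fun k => Phi (z k).2 v F)); last by under eq_fun do rewrite subrr normr0; exact: to0_cst0.
 move=> e e0; have [N hN] := to0Z K0 (@to0_inv R) e0; exists (maxn n N) => k; rewrite geq_max => /andP[nk Nk].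
 rewrite opprK; apply: le_trans (hN k Nk); have [_ _ _ hz] := zC k.
 by apply: hz => //; exact: Sob_W (@ballnS R d _ _ nk) Sv.
Qed.

(** * Identification with the Dirichlet form E^0 *)

Local Notation T := (setT : set E).
Let SH := semihilbert_qA.

Variable b : 'I_d -> E -> R.
Hypothesis bL2 : forall i chi, test setT chi -> LL2 (fun x => chi x * b i x).
Hypothesis b_ibp : forall i u, test setT u -> Ig (pderiv i u) = - Ig (fun x => u x * b i x).

Lemma EG_LocS u D : EG u D -> LocS mu u D.
move=> [Hu [v_ [tv hv]]]; have [Lu hD] := Hu; have [mu' mD] := (Lu.1, hD.1).
have Dchi F chi i : LA F -> test T chi -> LL2 (fun x => chi x * F x ord0 i).
 move=> hF tc; have [n tn] := test_ball tc; have [c _ hc] := LA_loc (@open_balln R d n) (@precompact_balln R d n).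
 have [L _] := hc _ hF; have [M M0 hM] := test_bounded tc.
 have := LL2_bounded (test_meas tc) hM (L i); under eq_fun do rewrite mxE.
 rewrite (_ : (fun x => _) = fun x => chi x * F x ord0 i)//; ext x.
 have [nx|nx] := pselect (balln n x); first by rewrite indicE mem_set// mul1r.
 by rewrite (test_off tn nx) !mul0r.
split=> //.
- by move=> chi tc; have [M M0 hM] := test_bounded tc; split=> [|i]; [exact: (LL2_bounded (test_meas tc) hM Lu)|side].
- exists v_; split=> // chi tc; have [n tn] := test_ball tc; have [M M0 hM] := test_bounded tc.
 have [c c0 hc] := LA_loc (@open_balln R d n) (@precompact_balln R d n).
 have K0 : 0 <= M ^+ 2 * (1 + d%:R * c) by rewrite mulr_ge0 ?sqr_ge0// addr_ge0 ?mulr_ge0.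
 apply: (to0_le _ (to0Z K0 hv)) => k; have Hk := HA_B (HA_test (tv k)) Hu.
 have [q1 q2] := qA_parts ((v_ k, grad (v_ k)) - (u, D)).
 have [L le] := hc _ Hk.2; have L1 i : LL2 (fun x => \1_(balln n) x * (grad (v_ k) x - D x) ord0 i).
  by have := L i; under eq_fun do rewrite mxE.
 have i2 : Lint (fun x => \sum_(i < d) (\1_(balln n) x * (grad (v_ k) x - D x) ord0 i) ^+ 2).
  by apply: (Lint_sum _ (F := fun i x => (\1_(balln n) x * (grad (v_ k) x - D x) ord0 i) ^+ 2)) => i; exact: (L1 i).2.
 have i1 : Lint (fun x => (v_ k x - u x) ^+ 2) := Hk.1.2.
 apply: (@le_trans _ _ (Ig (fun x => M ^+ 2 * ((v_ k x - u x) ^+ 2 + \sum_(i < d) (\1_(balln n) x * (grad (v_ k) x - D x) ord0 i) ^+ 2)))).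
  apply: Ig_le; last move=> x.
  - apply: Lint_q0; first exact: (LL2_bounded (test_meas tc) hM Hk.1).
   by move=> i; under eq_fun do rewrite mxE; exact: Dchi Hk.2 tc.
  - side.
  - have c2 : chi x ^+ 2 <= M ^+ 2 by rewrite -(real_normK (num_real (chi x))) ler_sqr.
   rewrite [leRHS]mulrDr; apply: lerD; first by rewrite exprMn ler_wpM2r ?sqr_ge0.
   rewrite mulr_sumr; apply: ler_sum => i _.
   rewrite mxE; have [nx|nx] := pselect (balln n x); last first.
    by rewrite (test_off tn nx) !mul0r mulr_ge0 ?sqr_ge0.
   by rewrite indicE mem_set// mul1r -expr2 exprMn ler_wpM2r ?sqr_ge0.
 rewrite IgZ; last side.
 rewrite -[leRHS]mulrA; apply: ler_wpM2l; first side.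
 rewrite IgD// [leRHS]mulrDl mul1r lerD//.
 rewrite (Ig_sum _ (F := fun i x => (\1_(balln n) x * (grad (v_ k) x - D x) ord0 i) ^+ 2)); last by move=> i; exact: (L1 i).2.
 apply: (@le_trans _ _ (\sum_(i < d) c * qA ((v_ k, grad (v_ k)) - (u, D)) ((v_ k, grad (v_ k)) - (u, D)))).
  by apply: ler_sum => i _; apply: le_trans (le i) _; rewrite ler_wpM2l.
 by rewrite sumr_const card_ord -mulrA mulr_natl.
Qed.

Lemma EG_wgrad u D : EG u D -> H12_loc_grad mu T u (wgrad mu T u) /\ {ae mu, forall x, wgrad mu T u x = D x}.
move=> h; have L := EG_LocS h; have [_ mD _ _] := L.
have [h1 h2] := wgradP mu_fin bL2 b_ibp openT mD (LocS_Sloc mu_fin L).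
by split=> //; apply: filterS h2 => x; exact.
Qed.

Lemma EG_uniq u D D' : EG u D -> EG u D' -> aeq D D'.
by move=> /EG_wgrad[_ h] /EG_wgrad[_ h']; apply: filterS2 h h' => x <-. Qed.

Lemma qA_ae (z : W) u D u' D' : HA z -> HA (u, D) -> HA (u', D') -> aeq u u' ->
 aeq D D' -> qA (z - (u, D)) (z - (u, D)) = qA (z - (u', D')) (z - (u', D')).
move=> hz h h' eu eD; have h1 := HA_B hz h; have h1' := HA_B hz h'; congr (_ + _ * _).
 apply: Ig_ae; [exact: LL2_mul h1.1 h1.1|exact: Lint_meas (LL2_mul h1'.1 h1'.1)|].
 apply: filterS eu => x e; change ((z.1 x - u x) * (z.1 x - u x) = (z.1 x - u' x) * (z.1 x - u' x)).
 by rewrite e.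
apply: Ig_ae; [exact: (LA_mul h1.2 h1.2)|exact: (Lint_meas (LA_mul h1'.2 h1'.2))|].
apply: filterS eD => x e.
change (aform (A x) (z.2 x - D x) (z.2 x - D x) = aform (A x) (z.2 x - D' x) (z.2 x - D' x)).
by rewrite e.
Qed.

Lemma HA_ae u D u' D' : HA (u, D) -> mfunT u' -> mvec D' ->
 aeq u u' -> aeq D D' -> HA (u', D').
move=> [Lu [mD iD]] mu' mD' eu eD; split; first exact: LL2_ae mu' eu Lu.
split=> //; apply: Lint_ae iD; first exact: (a_meas).
by apply: filterS eD => x e; rewrite /= e.
Qed.

Lemma EG_ae u D u' D' : EG u D -> mfunT u' -> mvec D' ->
 aeq u u' -> aeq D D' -> EG u' D'.
move=> [h [v_ [tv hv]]] m1 m2 eu eD; have h' := HA_ae h m1 m2 eu eD; split=> //; exists v_; split=> //.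
by apply: (to0_le _ hv) => n; rewrite (qA_ae (HA_test (tv n)) h h' eu eD).
Qed.

Lemma pre_formE u v : pre_form mu A u v = Ef (grad u) (grad v). Proof. by []. Qed.

Lemma pre_formB u v : smooth u -> smooth v ->
 pre_form mu A (u \- v) (u \- v) = Ef (fun x => grad u x - grad v x) (fun x => grad u x - grad v x).
by move=> su sv; rewrite pre_formE (_ : grad (u \- v) = fun x => grad u x - grad v x)//; ext x; exact: gradB. Qed.

Lemma L2_cvg_to0 (u_ : nat -> E -> R) u : L2_cvg mu T u_ u <->
 [/\ forall n, LL2 (u_ n), LL2 u & to0 (fun n => Ig (fun x => (u_ n x - u x) ^+ 2))].
have key : (forall n, LL2 (u_ n)) -> LL2 u -> (fun n => \int[mu]_(x in T) ((u_ n x - u x) ^+ 2)%:E)%E =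
 fun n => (Ig (fun x => (u_ n x - u x) ^+ 2))%:E.
 by move=> i j; ext n; rewrite -Ig_EFin//; exact: (LL2B (i n) j).2.
have p n : 0 <= Ig (fun x => (u_ n x - u x) ^+ 2) by apply: Ig_ge0 => x; exact: sqr_ge0.
split=> -[i j h]; split=> //; first by apply/EFin_to0 => //; rewrite -key.
by rewrite key//; exact/EFin_to0.
Qed.

Lemma approx_EG u (u_ : nat -> E -> R) : form_approx mu A u u_ -> exists D, EG u D /\
 to0 (fun n => qA ((u_ n, grad (u_ n)) - (u, D)) ((u_ n, grad (u_ n)) - (u, D))).
move=> [tu /L2_cvg_to0[Ln Lu hu] hc]; pose z n : W := (u_ n, grad (u_ n)).
have Hz n : HA (z n) := HA_test (tu n).
have cz : qcauchy qA z.
 move=> e e0; have e2 : 0 < e / 2 by rewrite divr_gt0.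
 have e8 : 0 < e / 8 by rewrite divr_gt0.
 have [K1 hK1] := hc _ e2; have [N2 hN2] := hu _ e8; exists (maxn K1 N2) => n m.
 rewrite !geq_max => /andP[n1 n2] /andP[m1 m2]; rewrite [e]splitr; apply: lerD; last first.
  by have := hK1 n m n1 m1; rewrite (pre_formB (test_smooth (tu n)) (test_smooth (tu m))) => /ltW.
 have e2' : e / 2 = 2 * (e / 8) + 2 * (e / 8) by field.
 have k1 := hN2 n n2; have k2 := hN2 m m2; rewrite e2'.
 have i1 := (LL2B (Ln n) Lu).2; have i2 := (LL2B (Ln m) Lu).2.
 apply: (@le_trans _ _ (Ig (fun x => 2 * (u_ n x - u x) ^+ 2 + 2 * (u_ m x - u x) ^+ 2))).
  apply: Ig_le; [exact: (LL2B (Ln n) (Ln m)).2|side|move=> x].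
  have -> : (z n - z m).1 x * (z n - z m).1 x = (u_ n x - u_ m x) ^+ 2 by [].
  rewrite (_ : u_ n x - u_ m x = (u_ n x - u x) - (u_ m x - u x)); last by ring.
  by move: (u_ n x - u x) (u_ m x - u x) => p q; have := sqr_ge0 (p + q); rewrite sqrrD sqrrB; lra.
 by rewrite IgD; [rewrite !IgZ// lerD// ler_wpM2l|side|side].
have [[u' D] H' hz] := qcomplete_qA Hz cz.
have uu : aeq u' u.
 have hu' : to0 (fun n => Ig (fun x => (u_ n x - u' x) ^+ 2)).
  by apply: (to0_le _ hz) => n; have [] := qA_parts (z n - (u', D)).
 have Ld := LL2B H'.1 Lu; have h0 : Ig (fun x => (u' x - u x) ^+ 2) <= 0.
  apply/ler_addgt0Pr => e e0; rewrite add0r; have [N /(_ _ (leqnn N)) hN] := to0D (to0Z (ler0n R 2) hu') (to0Z (ler0n R 2) hu) e0.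
  apply: le_trans hN; have i1 := (LL2B (Ln N) Lu).2; have i2 := (LL2B (Ln N) H'.1).2.
  rewrite -!IgZ// -IgD; [|side|side].
  apply: Ig_le; [exact: Ld.2|side|move=> x].
  rewrite (_ : u' x - u x = (u_ N x - u x) - (u_ N x - u' x)); last by ring.
  by move: (u_ N x - u x) (u_ N x - u' x) => p q; have := sqr_ge0 (p + q); rewrite sqrrD sqrrB; lra.
 have := Ig_eq0 Ld.2 (aeW _ (fun x => sqr_ge0 _)) h0.
 by apply: filterS => x /eqP; rewrite sqrf_eq0 subr_eq0 => /eqP.
have Hw : HA (u, D) by split; [|exact: H'.2].
have tz : to0 (fun n => qA (z n - (u, D)) (z n - (u, D))).
 by apply: (to0_le _ hz) => n; rewrite (qA_ae (Hz n) H' Hw uu)//; exact: aeW.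
by exists D; split=> //; split=> //; exists u_.
Qed.

Lemma EG_approx u D (u_ : nat -> E -> R) : EG u D -> (forall n, test T (u_ n)) ->
 to0 (fun n => qA ((u_ n, grad (u_ n)) - (u, D)) ((u_ n, grad (u_ n)) - (u, D))) -> form_approx mu A u u_.
move=> [Hu _] tu hz; pose z n : W := (u_ n, grad (u_ n)); have Hz n : HA (z n) := HA_test (tu n).
split=> //.
 apply/L2_cvg_to0; split; [by move=> n; exact: (Hz n).1|exact: Hu.1|].
 by apply: (to0_le _ hz) => n; have [] := qA_parts (z n - (u, D)).
move=> e e0; have e8 : 0 < e / 8 by rewrite divr_gt0.
have [N hN] := hz _ e8; exists N => m n Nm Nn.
rewrite (pre_formB (test_smooth (tu m)) (test_smooth (tu n))).
have [_ q2] := qA_parts (z m - z n); apply: (@le_lt_trans _ _ (qA (z m - z n) (z m - z n))) => //.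
apply: le_lt_trans (q_near SH (HA_B (Hz m) (Hz n)) (HA_B (Hz m) Hu)) _.
have e' (x y w : W) : x - y - (x - w) = w - y by rewrite opprB addrC addrA addrNK.
rewrite e' (qqBC SH Hu (Hz n)); have := hN m Nm; have := hN n Nn; rewrite -!/(z _).
by move: (qA _ _) (qA _ _) => *; lra.
Qed.

(** Replacing the function components by 0 turns [qA] into the pure form [Ef], so the continuity of
    the semi-inner product applies to the gradients alone. *)
Lemma Ef_lim (z y : nat -> W) (w x : W) : (forall n, HA (z n)) -> (forall n, HA (y n)) -> HA w -> HA x ->
 to0 (fun n => qA (z n - w) (z n - w)) -> to0 (fun n => qA (y n - x) (y n - x)) ->
 to0 (fun n => `|Ef (z n).2 (y n).2 - Ef w.2 x.2|).
move=> Hz Hy Hw Hx hz hy; pose o (w : W) : W := ((fun=> 0 : R^o), w.2).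
have Ho w' : HA w' -> HA (o w') by move=> h; split; [side|exact: h.2].
have qo w' x' : qA (o w') (o x') = Ef w'.2 x'.2.
 by rewrite /qA /=; under eq_fun do rewrite mulr0; rewrite Ig_cst0 add0r.
have ho (t : nat -> W) s : to0 (fun n => qA (t n - s) (t n - s)) -> to0 (fun n => qA (o (t n) - o s) (o (t n) - o s)).
 move=> h; apply: (to0_le _ h) => n; have [_] := qA_parts (t n - s); apply: le_trans.
 rewrite /qA /= (_ : (fun x => _) = fun=> 0) ?Ig_cst0 ?add0r//.
 apply/funext => s'; change ((- 0) * (- 0) = 0 :> R); by rewrite oppr0 mulr0.
have Hoz n := Ho _ (Hz n); have Hoy n := Ho _ (Hy n); have Hox := Ho _ Hx; have How := Ho _ Hw.
have l1 := q_lim SH Hoz How Hox (ho _ _ hz); have l2 := q_lim SH Hoy Hox How (ho _ _ hy).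
have S := to0D (to0D l1 l2) (to0D (to0Z (ltW (ltr0Sn R 0)) (ho _ _ hz)) (to0Z (ltW (ltr0Sn R 0)) (ho _ _ hy))).
apply: (to0_le _ S) => n; rewrite -!qo.
have Hd1 := HA_B (Hoz n) How; have Hd2 := HA_B (Hoy n) Hox.
have e : qA (o (z n)) (o (y n)) - qA (o w) (o x) = qA (o (z n) - o w) (o (y n) - o x) +
  ((qA (o (z n)) (o x) - qA (o w) (o x)) + (qA (o (y n)) (o w) - qA (o x) (o w))).
 rewrite (qBl SH (Hoz n) How Hd2) !(qBr SH (Hoy n) Hox)// (shC SH (Hoy n) How) (shC SH Hox How).
 by move: (qA _ _) (qA _ _) (qA _ _) (qA _ _) => *; ring.
rewrite e; apply: le_trans (ler_normD _ _) _; rewrite addrC; apply: lerD; first exact: ler_normD.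
rewrite !mulr1n !mul1r; have := sh_ge0 SH (HA_B Hd1 Hd2); have := sh_ge0 SH (shD SH Hd1 Hd2).
rewrite (qqB SH Hd1 Hd2) (qqD SH Hd1 Hd2) ler_norml.
have := sh_ge0 SH Hd1; have := sh_ge0 SH Hd2.
by move: (qA _ _) (qA _ _) (qA _ _) => X Y Z *; apply/andP; split; lra.
Qed.

Lemma dom_E0_EG u : dom_E0 mu A u <-> exists D, EG u D.
split=> [[u_ /approx_EG[D [h _]]]|[D h]]; first by exists D.
by have [_ [u_ [tu hu]]] := h; exists u_; exact: EG_approx h tu hu.
Qed.

(** [E0] is a chosen limit along some pair of approximating sequences. Every such limit is the form
    evaluated at the limiting gradients, and these are a.e. unique. *)
Lemma E0_EG u v D F : EG u D -> EG v F -> E0 mu A u v = Ef D F.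
move=> hu hv; have [Hu [u_ [tu lu]]] := hu; have [Hv [v_ [tv lv]]] := hv.
pose S := [set e : R | exists u_ v_ : nat -> E -> R, [/\ form_approx mu A u u_, form_approx mu A v v_ &
   (fun n => pre_form mu A (u_ n) (v_ n)) @ \oo --> e]].
have : S (E0 mu A u v).
 apply: (@getPex _ S); exists (Ef D F), u_, v_; split; [exact: EG_approx hu tu lu|exact: EG_approx hv tv lv|].
 apply/to0_cvgB; exact: (Ef_lim (fun n => HA_test (tu n)) (fun n => HA_test (tv n)) Hu Hv lu lv).
move=> [p_ [q_ [ap aq /to0_cvgB lim]]]; have [D' [h1 l1]] := approx_EG ap; have [F' [h2 l2]] := approx_EG aq.
have [tp _ _] := ap; have [tq _ _] := aq.
have l3 := Ef_lim (fun n => HA_test (tp n)) (fun n => HA_test (tq n)) h1.1 h2.1 l1 l2.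
have -> : Ef D F = Ef D' F'.
 congr (_ * _); apply: Ig_ae; [exact: (LA_mul Hu.2 Hv.2)|exact: (Lint_meas (LA_mul h1.1.2 h2.1.2))|].
 by apply: filterS2 (EG_uniq hu h1) (EG_uniq hv h2) => x -> ->.
by apply: (to0_uniq lim l3); under eq_fun do rewrite pre_formE subrr normr0; exact: to0_cst0.
Qed.

(** * Identification with the local operators and resolvents *)

Section on_V.
Variable V : set E.
Hypotheses (oV : open V) (pV : precompact V).
Let mV : measurable V := open_rV_measurable oV.

Lemma restrict_idem f : (forall x, ~ V x -> f x = 0) -> f \_ V = f.
by move=> f0; ext x; have [Vx|nV] := pselect (V x); [rewrite restrict_in|rewrite restrict_off// f0]. Qed.

Lemma rv_idem D : (forall x, ~ V x -> D x = 0) -> rv V D = D.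
by move=> D0; ext x; have [Vx|nV] := pselect (V x); [rewrite rv_in|rewrite rv_off// D0]. Qed.

Lemma Sob_wgrad u D : Sob V (u \_ V) D -> Sob V (u \_ V) (rv V (wgrad mu V u)) /\ {ae mu, forall x, D x = rv V (wgrad mu V u) x}.
move=> S; have mD i : measurable_fun V (fun x => D x ord0 i) by apply: measurable_funTS; exact: LLv_meas (Sob_LLv S).
have Sl : Sloc mu V u D.
 by apply: (Sob_Sloc mu_fin S) => // x Vx; rewrite restrict_in.
have [[mw _] ae] := wgradP mu_fin bL2 b_ibp oV mD Sl.
have e : {ae mu, forall x, D x = rv V (wgrad mu V u) x}.
 apply: filterS ae => x h; have [Vx|nV] := pselect (V x); first by rewrite rv_in// h.
 by rewrite rv_off// (Sob_offD S nV).
split=> //; apply: (Sob_ae mu_fin S (Sob_meas S) _ (aeW _ (fun=> erefl)) e).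
 by move=> i; rewrite rv_coord; apply/(measurable_restrictT _ mV).
by move=> x nV; rewrite restrict_off ?rv_off.
Qed.

Lemma H12_0_Sob u : H12_0 mu V u -> Sob V (u \_ V) (rv V (wgrad mu V u)).
by move=> [D /(H12_Sob mu_fin oV) /Sob_wgrad[]]. Qed.

Lemma Sob_H12_0 u D : Sob V (u \_ V) D -> H12_0 mu V u.
move=> S; exists D; apply/(H12_Sob mu_fin oV); rewrite rv_idem// => x; exact: Sob_offD S.
Qed.

Lemma grad_form_rv F H : grad_form mu A V F H = Ef (rv V F) (rv V H).
congr (_ * _); rewrite Rintegral_mkcond; congr Ig; ext x.
by have [Vx|nV] := pselect (V x); [rewrite restrict_in// !rv_in|rewrite restrict_off// rv_off// aform0l].
Qed.

Lemma Rint_restrict f g : \int[mu]_(x in V) (f x * g x) = Ig (fun x => (f \_ V) x * (g \_ V) x).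
rewrite Rintegral_mkcond; congr Ig; ext x.
by have [Vx|nV] := pselect (V x); [rewrite !restrict_in|rewrite !restrict_off// mulr0].
Qed.

Lemma Ef_ae D D' F F' : LLv D -> LLv F -> LLv D' -> LLv F' -> (forall x, ~ V x -> D x = 0) -> (forall x, ~ V x -> D' x = 0) ->
 aeq D D' -> aeq F F' -> Ef D F = Ef D' F'.
move=> LD LF LD' LF' D0 D0' eD eF; congr (_ * _); apply: Ig_ae; first exact: (Lint_a pV LD LF D0).
 exact: Lint_meas (Lint_a pV LD' LF' D0').
by apply: filterS2 eD eF => x -> ->.
Qed.

Lemma L_loc_core u g : L_loc mu A B V u g -> exists u' g', [/\ core V u' g',
 {ae mu, forall x, u' x = (u \_ V) x} & {ae mu, forall x, g' x = (g \_ V) x}].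
move=> [f [[hu /(L2_on mu oV) Lf hf] [M hM] ->]]; have S := H12_0_Sob hu.
have uM : {ae mu, forall x, `|(u \_ V) x| <= Num.max 0 M}.
 apply: filterS hM => x h; have [Vx|nV] := pselect (V x); last by rewrite restrict_off// normr0 le_max lexx.
 by rewrite restrict_in// le_max h ?orbT.
have M0 : 0 <= Num.max 0 M by rewrite le_max lexx.
have [u' [S' bu' e]] := clip S M0 uM.
exists u', (fun x => (f \_ V) x + dotv (B x) (rv V (wgrad mu V u) x)); split.
- exists (rv V (wgrad mu V u)), (f \_ V); split=> //; first by exists (Num.max 0 M).
  by split=> // x nV; exact: restrict_off.
 move=> v F Sv; have ev : v \_ V = v by apply: restrict_idem => x; exact: Sob_off Sv.
 have Sv' : Sob V (v \_ V) F by rewrite ev.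
 have [Sw aeF] := Sob_wgrad Sv'; have := hf v (Sob_H12_0 Sv').
 rewrite grad_form_rv Rint_restrict ev => <-.
 by apply: (Ef_ae (Sob_LLv S) (Sob_LLv Sv) (Sob_LLv S) (Sob_LLv Sw) _ _ _ aeF); [move=> x; exact: Sob_offD S|move=> x; exact: Sob_offD S|exact: aeW].
- by apply: filterS e => x.
- apply: aeW => x; have [Vx|nV] := pselect (V x); first by rewrite !restrict_in// rv_in.
 by rewrite !restrict_off// rv_off// dotvC dotv0l addr0.
Qed.

Lemma core_L_loc u h : core V u h -> exists g, [/\ L_loc mu A B V u g, u \_ V = u,
 mfunT (g \_ V) & {ae mu, forall x, (g \_ V) x = h x}].
move=> [D [f [S [M bM] [Lf f0] hf ->]]]; have eu : u \_ V = u by apply: restrict_idem => x; exact: Sob_off S.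
have ef : f \_ V = f by exact: restrict_idem.
have Su : Sob V (u \_ V) D by rewrite eu.
have [Sw aeD] := Sob_wgrad Su.
exists (fun x => f x + dotv (B x) (wgrad mu V u x)); split=> //.
- exists f; split=> //; last by exists M; apply: aeW.
 split; [exact: Sob_H12_0 Su|by apply/(L2_on mu oV); rewrite ef|].
 move=> v /H12_0_Sob Sv; rewrite grad_form_rv Rint_restrict ef -(hf _ _ Sv).
 by apply: (Ef_ae (Sob_LLv Sw) (Sob_LLv Sv) (Sob_LLv S) (Sob_LLv Sv)); [move=> x; exact: Sob_offD Sw|move=> x; exact: Sob_offD S|apply: filterS aeD => x|exact: aeW].
- rewrite (_ : _ \_ V = fun x => f x + dotv (B x) (rv V (wgrad mu V u) x)).
  apply: measurable_funD; first exact: Lf.1.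
  exact: Lint_meas (Lint_BD hB oV pV (Sob_LLv Sw) (fun=> Sob_offD Sw)).
 ext x; have [Vx|nV] := pselect (V x); first by rewrite restrict_in// rv_in.
 by rewrite restrict_off// f0// rv_off// dotvC dotv0l addr0.
- apply: filterS aeD => x e; have [Vx|nV] := pselect (V x); first by rewrite restrict_in// e rv_in.
 by rewrite restrict_off// f0// (Sob_offD S nV) dotvC dotv0l addr0.
Qed.

Lemma N1_sub_ae f g f' : Lint f -> Lint f' -> Lint g -> aeq f f' ->
 Ig (fun x => `|f x - g x|) = Ig (fun x => `|f' x - g x|).
move=> i i' j e; apply: Ig_ae; [side|exact: Lint_meas (Lint_abs (LintB i' j))|].
by apply: filterS e => x ->.
Qed.

Lemma L1_closure_cl u h : L1_closure mu V (L_loc mu A B V) u h <-> cl V (u \_ V) (h \_ V).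
split.
 move=> [u_ [h_ [hL /(L1_cvg_on mu oV)[iu_ iu cu] /(L1_cvg_on mu oV)[ih_ ih ch]]]].
 have /choice[u' /choice[h' hc]] : forall n, exists u' g', [/\ core V u' g',
  {ae mu, forall x, u' x = (u_ n \_ V) x} & {ae mu, forall x, g' x = (h_ n \_ V) x}] by move=> n; exact: L_loc_core.
 split=> //; exists u', h'; split; first by move=> n; have [] := hc n.
  apply: (to0_le _ cu) => n; have [c e _] := hc n; have [i _] := core_Lint oV pV c.
  by rewrite (N1_sub_ae i (iu_ n) iu e).
 apply: (to0_le _ ch) => n; have [c _ e] := hc n; have [_ i] := core_Lint oV pV c.
 by rewrite (N1_sub_ae i (ih_ n) ih e).
move=> [iu ih [u_ [h_ [hc cu ch]]]].
have /choice[g hg] : forall n, exists g, [/\ L_loc mu A B V (u_ n) g, u_ n \_ V = u_ n,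
  mfunT (g \_ V) & {ae mu, forall x, (g \_ V) x = h_ n x}].
 by move=> n; exact: core_L_loc.
exists u_, g; split; first by move=> n; have [] := hg n.
 apply/(L1_cvg_on mu oV); split=> //.
  by move=> n; have [_ -> _ _] := hg n; have [] := core_Lint oV pV (hc n).
 by apply: (to0_le _ cu) => n; have [_ -> _ _] := hg n.
have ig n : Lint (g n \_ V).
 have [_ _ m e] := hg n; have [_ i] := core_Lint oV pV (hc n).
 by apply: Lint_ae m _ i; apply: filterS e => x.
apply/(L1_cvg_on mu oV); split=> //.
apply: (to0_le _ ch) => n; have [_ _ _ e] := hg n; have [_ i] := core_Lint oV pV (hc n).
by rewrite (N1_sub_ae (ig n) i ih e).
Qed.

Lemma G_locP (al : R) f : 0 < al -> Lint f -> resV V al f (G_loc mu A B V al f).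
move=> al0 i; have key g : (forall x, ~ V x -> g x = 0) ->
  L1_closure mu V (L_loc mu A B V) g (fun x => al * g x - (f \_ V) x) <-> cl V g (fun x => al * g x - (f \_ V) x).
 move=> g0; rewrite -[X in cl V X _](restrict_idem g0) -[X in cl V _ X]restrict_idem; last first.
  by move=> x nV; rewrite g0// restrict_off// mulr0 subrr.
 exact: L1_closure_cl.
have [g [g0 c]] := resV_exists oV pV al0 i.
have ex : [set g | (forall x, ~ V x -> g x = 0) /\
  L1_closure mu V (L_loc mu A B V) g (fun x => al * g x - (f \_ V) x)] g by split=> //; exact/key.
have [G0 C] := getPex (ex_intro _ g ex); by split=> //; apply/key.
Qed.
End on_V.

(** A cutoff equal to 1 on the support changes u on a null set only, after which a pointwise
    truncation makes it bounded. The pair (u', D') is the same for every open V containing K, as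
    [Lb_core] requires. *)
Lemma compact_clip u D : LocS mu u D -> LL2 u -> compact_supp mu u -> ess_bounded mu T u -> exists K u' D',
 [/\ compact K, bdd u', aeq u u', aeq D D' &
  forall V, open V -> K `<=` V -> Sob V u' D'].
move=> L Lu cK [M hM]; have [chi [tc _ c1]] := cutoff cK openT (fun x _ => I).
have ae := compact_supp_ae Lu; have [sc [K [cK' _ k0]]] := tc.
have M0 : 0 <= Num.max 0 M by rewrite le_max lexx.
have uchi : {ae mu, forall x, u x = u x * chi x}.
 apply: filterS ae => x h; have [Kx|/h ->] := pselect (msupp (fun U => (\int[mu]_(x in U) (`|u x|)%:E)%E) x); last by rewrite mul0r.
 by rewrite c1// mulr1.
have ST := LocS_cut mu_fin L tc.
have ucut : {ae mu, forall x, u x * chi x = cut_at (Num.max 0 M) (fun y => u y * chi y) x}.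
 by apply: filterS2 uchi hM => x e /(_ I) h; rewrite cut_at_id// -e le_max h orbT.
exists K, (cut_at (Num.max 0 M) (fun y => u y * chi y)), (fun x => chi x *: D x + u x *: grad chi x); split=> //.
- by exists (Num.max 0 M) => x; exact: cut_at_abs.
- by apply: filterS2 uchi ucut => x <-.
- have := WG_uniq mu_fin bL2 openT (LocS_WG mu_fin bL2 b_ibp L) (Sob_WG mu_fin bL2 b_ibp ST).
 case; first by apply: filterS uchi => x.
 by move=> N [mN N0 hN]; exists N; split=> // x /= nx; apply: hN => /= k; apply: nx; side.
- move=> V oV KV; have tV : test V chi by split=> //; exists K.
 have S := LocS_cut mu_fin L tV; apply: (Sob_ae mu_fin S _ _ ucut (aeW _ (fun=> erefl))).
 + by apply: cut_at_meas; exact: Sob_meas S.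
 + by move=> i; exact: LLv_meas (Sob_LLv S).
 + move=> x nV; split; last exact: Sob_offD S nV.
  by have e : u x * chi x = 0 := Sob_off S nV; rewrite cut_at_id e// normr0.
Qed.

Lemma L_op_Lb u g : L_op mu A B u g -> Lb u g.
move=> [f [[/(dom_E0_EG)[D hD] [mf if2] hf] cs eb ->]]; have Lf : LL2 f by split.
have L := EG_LocS hD; have Lu := hD.1.1.
have [K [u' [D' [cK bu' eu eD S]]]] := compact_clip L Lu cs eb.
have [[mw _] ew] := EG_wgrad hD; have mK := compact_meas_rV cK.
have [n Kn] := compact_balln cK; have oVn := @open_balln R d n; have pVn := @precompact_balln R d n.
(* The pair belongs to H^{1,2}_0(V) for every open V containing K, in particular for V the
   complement of the point x. *)
have Sn := S _ oVn Kn; have D'0 x : ~ K x -> D' x = 0.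
 move=> nK; have [V [oV KV nV]] : exists V : set E, [/\ open V, K `<=` V & ~ V x].
  by exists (~` [set x]); split; [by apply: closed_openC; apply: rV_compact_closed; exact: compact_set1|move=> y Ky /= yx; apply: nK; rewrite -yx|move=> /(_ erefl)].
 exact: Sob_offD (S _ oV KV) nV.
have HD' : HA (u', D') := (EG_Sob oVn pVn Sn).1.
have EfD v F : EG v F -> Ef D' F = - Ig (fun x => f x * v x).
 move=> hv; have hv' : dom_E0 mu A v by apply/(dom_E0_EG); exists F.
 have := hf v hv'; rewrite (E0_EG hD hv) => <-; congr (_ * _); apply: Ig_ae.
 - exact: (LA_mul HD'.2 hv.1.2).
 - exact: (Lint_meas (LA_mul hD.1.2 hv.1.2)).
 - by apply: filterS eD => x ->.
(* Locality of L^0: the form of D' against a test function supported off K is 0, so f vanishes a.e.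
   off K. *)
have f0 : {ae mu, forall x, f x = (f \_ K) x}.
 have oK : open (~` K) by apply: closed_openC; exact: rV_compact_closed.
 have : {ae mu, forall x, (~` K) x -> f x = 0}.
  apply: (fundamental_lemma oK mf) => v tv; have tT := testW (@subsetT _ (~` K)) tv.
  split; first exact: LL2_mul Lf (LL2_test mu_fin tT).
  have [m tm] := test_ball tT; have := EfD v _ (EG_Sob (@open_balln R d m) (@precompact_balln R d m) (Sob_test mu_fin tm)).
  rewrite /Ef (_ : (fun x => _) = fun=> 0) ?Ig_cst0 ?mulr0; first by move=> /esym/eqP; rewrite oppr_eq0 => /eqP.
  ext x; have [Kx|nK] := pselect (K x); last by rewrite D'0// aform0l.
  by rewrite (grad_off tv (fun q => q Kx)) (a_C) aform0l.
 by apply: filterS => x h; have [Kx|nK] := pselect (K x); [rewrite restrict_in|rewrite restrict_off// h].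
have Lf' : LL2 (f \_ K).
 by apply: (LL2_dom _ (restrict_abs K f) Lf); apply/(measurable_restrictT _ mK); exact: measurable_funTS.
have c V : open V -> precompact V -> K `<=` V -> core V u' (fun x => (f \_ K) x + dotv (B x) (D' x)).
 move=> oV pV KV; exists D', (f \_ K); split=> //; first side.
  by split=> // x nV; rewrite restrict_off// => /KV.
 move=> v F Sv; rewrite (EfD _ _ (EG_Sob oV pV Sv)); congr (- _); apply: Ig_ae.
 - exact: LL2_mul Lf (Sob_L2 Sv).
 - exact: Lint_meas (LL2_mul Lf' (Sob_L2 Sv)).
 - by apply: filterS f0 => x ->.
have Lb' := Lb_core cK c; have [iu ih] := core_Lint oVn pVn (c _ oVn pVn Kn).
have eh : {ae mu, forall x, (f \_ K) x + dotv (B x) (D' x) = f x + dotv (B x) (wgrad mu T u x)}.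
 have e2 : {ae mu, forall x, D' x = wgrad mu T u x} by apply: filterS2 eD ew => x <- ->.
 by apply: filterS2 f0 e2 => x <- <-.
have eu' : aeq u' u by apply: filterS eu => x.
apply: (Lb_ae Lb' _ _ eu' eh); first exact: Lint_ae Lu.1 eu' iu.
apply: Lint_ae _ eh ih; apply: measurable_funD => //; apply: measurable_sum => i.
by apply: measurable_funM => //; exact: dr_meas hB i.
Qed.

(** [energy] asks for a bound at every point, so u is first truncated on a null set. Uniqueness of
    gradients then lets its D stand for [wgrad] and for the gradient inside [E0]; a compactly
    supported v is likewise replaced by a bounded version living on a ball. *)
Lemma Lb_energy u h : Lb u h -> ess_bounded mu T u -> [/\ dom_E0 mu A u,
 forall v, H12_0 mu T v -> compact_supp mu v -> ess_bounded mu T v ->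
  E0 mu A u v - \int[mu]_x (dotv (B x) (wgrad mu T u x) * v x) = - \int[mu]_x (h x * v x) &
 E0 mu A u u <= - \int[mu]_x (h x * u x)].
move=> L [M0 hM]; have [iu ih _] := L; pose M := Num.max 1 M0.
have M1 : 0 < M by rewrite lt_max ltr01.
have uc : {ae mu, forall x, u x = cut_at M u x}.
 by apply: filterS hM => x /(_ I) k; rewrite cut_at_id// le_max k orbT.
have cu : {ae mu, forall x, cut_at M u x = u x} by apply: filterS uc => x.
have mc := cut_at_meas M (Lint_meas iu); have ic := Lint_ae mc uc iu.
have Lc := Lb_ae L ic ih uc (aeW _ (fun=> erefl)).
have [D [hc eD hD]] := energy Lc M1 (fun x => cut_at_abs u x (ltW M1)).
have hu := EG_ae hc (Lint_meas iu) hc.1.2.1 cu (aeW _ (fun=> erefl)).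
have [[mw _] ew] := EG_wgrad hu.
split; first by apply/(dom_E0_EG); exists D.
- move=> v [F /(H12_SobT mu_fin) SF] cs eb; have LF := Sob_LocS mu_fin SF.
 have [K [v' [F' [cK bv' ev eF S]]]] := compact_clip LF (Sob_L2 SF) cs eb.
 have [n Kn] := compact_balln cK; have oV := @open_balln R d n; have pV := @precompact_balln R d n.
 have Sn := S _ oV Kn; have mv' := Sob_meas Sn.
 have ev' : aeq v' v by apply: filterS ev => x.
 have eF' : aeq F' F by apply: filterS eF => x.
 have hv := EG_ae (EG_Sob oV pV Sn) (Sob_meas SF) (fun i => LLv_meas i (Sob_LLv SF)) ev' eF'.
 have v0 x : ~ balln n x -> v' x = 0 := fun nV => Sob_off Sn nV.
 rewrite (E0_EG hu hv).
 have -> : Ef D F = Ef D F'.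
  congr (_ * _); apply: Ig_ae; [exact: (LA_mul hu.1.2 hv.1.2)|exact: (Lint_meas (LA_mul hu.1.2 (LA_Sob pV Sn)))|].
  by apply: filterS eF => x ->.
 have [c _ hcV] := LA_loc oV pV; have [LD _] := hcV _ hu.1.2.
 have iB : Lint (fun x => dotv (B x) (D x) * v' x).
  have := Lint_BDv' hB oV pV LD mv' bv' v0; rewrite (_ : (fun x => _) = fun x => dotv (B x) (D x) * v' x)//.
  ext x; have [Vx|nV] := pselect (balln n x); last by rewrite v0// !mulr0.
  by rewrite indicE mem_set// scale1r.
 have -> : \int[mu]_x (dotv (B x) (wgrad mu T u x) * v x) = Ig (fun x => dotv (B x) (D x) * v' x).
  apply/esym; apply: Ig_ae => //; last by apply: filterS2 ew ev => x -> ->.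
  apply: measurable_funM; last exact: Sob_meas SF.
  by apply: measurable_sum => i; apply: measurable_funM => //; exact: dr_meas hB i.
 rewrite (hD n _ _ Sn bv'); congr (- _); apply: Ig_ae.
 - exact: Lint_mul_bdd ih mv' bv'.
 - by apply: measurable_funM; [exact: Lint_meas ih|exact: Sob_meas SF].
 - by apply: filterS ev => x ->.
- rewrite (E0_EG hu hu); apply: le_trans eD _; apply: eq_ler.
 congr (- _); apply: Ig_ae; [|by apply: measurable_funM; [exact: Lint_meas ih|exact: Lint_meas iu]|by apply: filterS cu => x ->].
 by apply: (Lint_mul_bdd ih mc); exists M => x; exact: (cut_at_abs u x (ltW M1)).
Qed.

End operator.

(** * The density rho = phi^2 and its logarithmic derivative *)

Section density_derivative.
Variables (R : realType) (d : nat).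
Local Notation E := 'rV[R]_d.
Local Notation leb := (lebesgue_rV R d).
Local Notation T := (setT : set E).
Implicit Types (u v f g h chi eta : E -> R) (D F H : E -> E).

Let l0 (i : 'I_d) chi : test T chi -> LL2 leb (fun x => chi x * 0).
by move=> _; under eq_fun do rewrite mulr0; side. Qed.
Let lI (i : 'I_d) u : test T u -> Ig leb (pderiv i u) = - Ig leb (fun x => u x * 0).
by move=> t; rewrite leb_test_div0//; under eq_fun do rewrite mulr0; rewrite Ig_cst0 oppr0. Qed.
Let lfin K : compact K -> (leb K < +oo)%E. Proof. exact: leb_compact. Qed.

Lemma loc_integrableW f : mfunT f -> (forall chi, test T chi -> Lint leb (fun x => chi x ^+ 2 * f x)) ->
 loc_integrable f.
move=> mf hf; split=> // K cK; have mK := compact_meas_rV cK.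
have [chi [tc _ c1]] := cutoff cK openT (fun x _ => I).
apply/(integrable_mkcond _ mK); rewrite restrict_EFin; apply: (Lint_dom _ _ (Lint_abs (hf _ tc))).
 by apply/(measurable_restrictT _ mK); exact: measurable_funTS.
move=> x; have [Kx|nK] := pselect (K x); first by rewrite restrict_in// c1// expr1n mul1r.
by rewrite restrict_off// normr0.
Qed.

Lemma loc_integrable_test f eta : loc_integrable f -> test T eta -> Lint leb (fun x => f x * eta x).
move=> [mf hf] te; have [M M0 hM] := test_bounded te; have [_ [K [cK _ k0]]] := te.
have mK := compact_meas_rV cK; have := hf K cK => /(integrable_mkcond _ mK); rewrite restrict_EFin => i.
apply: (Lint_dom _ _ (LintZ M (Lint_abs i))); first by apply: measurable_funM => //; exact: test_meas te.
move=> x; have [Kx|nK] := pselect (K x); last by rewrite k0// mulr0 normr0 mulr_ge0.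
by rewrite restrict_in// normrM mulrC ler_wpM2r.
Qed.

Lemma weak_pderiv_uniq i f g g' : is_weak_pderiv i f g -> is_weak_pderiv i f g' -> {ae leb, forall x, g x = g' x}.
move=> [_ ig h] [_ ig' h']; have : {ae leb, forall x, T x -> g x - g' x = 0}.
 apply: (fundamental_lemma openT); first by apply: measurable_funB; [exact: ig.1|exact: ig'.1].
 move=> eta te; have i1 := loc_integrable_test ig te; have i2 := loc_integrable_test ig' te.
 have -> : (fun x => (g x - g' x) * eta x) = fun x => g x * eta x - g' x * eta x by ext x; rewrite mulrBl.
 split; first side.
 by rewrite IgB//; apply/eqP; rewrite subr_eq0 -[X in X == _]opprK -h// h'// opprK.
by apply: filterS => x /(_ I)/eqP; rewrite subr_eq0 => /eqP.
Qed.

Lemma leb_ibp u1 D1 u2 D2 i : Sob leb T u1 D1 -> Sob leb T u2 D2 ->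
 Ig leb (fun x => u1 x * D2 x ord0 i + D1 x ord0 i * u2 x) = 0.
move=> S1 S2; have [_ _ _ hW] := Sob_WG lfin l0 lI S1.
have [L2' LD2 _ [v_ [tv hv]]] := S2; have L1' := Sob_L2 S1; have LD1 := Sob_LLv S1.
have Lv n : LL2 leb (v_ n) := LL2_test lfin (tv n); have Lg n : LLv leb (grad (v_ n)) := LLv_grad lfin (tv n).
have k1 : to0 (fun n => `|Ig leb (fun x => v_ n x * D1 x ord0 i) - Ig leb (fun x => u2 x * D1 x ord0 i)|).
 by apply: L2_lim_mul => //; apply: (to0_le _ hv) => n; apply: q0_fst; [side|exact: LLvB].
have k2 : to0 (fun n => `|Ig leb (fun x => grad (v_ n) x ord0 i * u1 x) - Ig leb (fun x => D2 x ord0 i * u1 x)|).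
 apply: L2_lim_mul => //; first by move=> n; exact: Lg.
 apply: (to0_le _ hv) => n; have := @q0_coord _ _ leb _ _ i (LL2B (Lv n) L2') (LLvB (Lg n) LD2).
 by apply: le_trans; apply: eq_ler; congr Ig; ext x; rewrite [in RHS]mxE [X in _ = (_ + X) ^+ 2]mxE.
rewrite IgD; [|side|side].
have k3 : to0 (fun n => `|- Ig leb (fun x => grad (v_ n) x ord0 i * u1 x) - - Ig leb (fun x => D2 x ord0 i * u1 x)|).
 by apply: (to0_le _ k2) => n; rewrite -opprD normrN.
have e : Ig leb (fun x => u2 x * D1 x ord0 i) = - Ig leb (fun x => D2 x ord0 i * u1 x).
 apply: (to0_uniq k1 k3); rewrite (_ : (fun n => _) = fun=> 0); first exact: to0_cst0.
 ext n; have := hW i _ (tv n).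
 rewrite (_ : (fun x => D1 x ord0 i * v_ n x) = fun x => v_ n x * D1 x ord0 i); last by ext x; rewrite mulrC.
 rewrite (_ : (fun x => u1 x * _) = fun x => grad (v_ n) x ord0 i * u1 x); first by move=> ->; rewrite subrr normr0.
 by ext x; rewrite mul0r addr0 [in RHS]mxE mulrC.
rewrite (_ : (fun x => D1 x ord0 i * u2 x) = fun x => u2 x * D1 x ord0 i); last by ext x; rewrite mulrC.
rewrite (_ : (fun x => u1 x * D2 x ord0 i) = fun x => D2 x ord0 i * u1 x); last by ext x; rewrite mulrC.
by rewrite e subrr.
Qed.

Lemma rv_lin_coord (a c : R) (x y : E) i : (a *: x + c *: y) ord0 i = a * x ord0 i + c * y ord0 i.
by rewrite !mxE. Qed.

Lemma grad_coord u x i : grad u x ord0 i = pderiv i u x.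
by rewrite mxE. Qed.

Variables (phi rho : E -> R).
Hypothesis phi_loc : H12_loc leb T phi.
Hypothesis rhoE : rho = fun x => phi x ^+ 2.

(** The product rule for phi^2. With eta = 1 on the support of chi, phi chi and phi eta both lie in
    H^{1,2}_0 for Lebesgue measure and their product is rho chi, so [leb_ibp] gives the weak
    derivative 2 phi D. *)
Lemma rho_weak : exists D : E -> E, [/\ loc_integrable rho, forall i chi, test T chi -> LL2 leb (fun x => chi x * D x ord0 i) &
 forall i, is_weak_pderiv i rho (fun x => 2 * phi x * D x ord0 i)].
have [D [W S _ _]] := H12_loc_WG lfin l0 lI phi_loc; have [mphi mD LL _] := W.
have ir : loc_integrable rho.
 rewrite rhoE; apply: loc_integrableW; first exact: measurable_funX.
 by move=> chi tc; have [[_ l] _] := LL _ tc; under eq_fun do rewrite -exprMn.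
exists D; split=> // [i chi /LL[]//|i]; have ig : loc_integrable (fun x => 2 * phi x * D x ord0 i).
 apply: loc_integrableW; first by apply: measurable_funM => //; exact: measurable_funM.
 move=> chi tc; have [l1 l2] := LL _ tc; have := LintZ 2 (LL2_mul l1 (l2 i)).
 by rewrite (_ : (fun x => _) = fun x => chi x ^+ 2 * (2 * phi x * D x ord0 i))//; ext x; ring.
split=> // chi tc; have [eta [te _ e1 e2]] := cut1 openT tc.
have := leb_ibp i (S _ tc) (S _ te).
rewrite (_ : (fun x => _) = fun x => rho x * pderiv i chi x + 2 * phi x * D x ord0 i * chi x).
 rewrite IgD; [|exact: loc_integrable_test ir (test_pderiv i tc)|exact: loc_integrable_test ig tc].
 by move/eqP; rewrite addr_eq0 => /eqP.
ext x; have := pderivM i x (test_smooth te) (test_smooth tc).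
rewrite (_ : (fun y => eta y * chi y) = chi); last by ext y.
rewrite e2 -[LHS]addr0 => /addrI/esym k; rewrite rhoE !rv_lin_coord !grad_coord.
have e1' := e1 x; have e2' := e2 i x.
transitivity (phi x ^+ 2 * (chi x * pderiv i eta x) + phi x ^+ 2 * (eta x * pderiv i chi x) + 2 * phi x * D x ord0 i * (eta x * chi x)); first by ring.
by rewrite k e1' e2' mulr0 add0r.
Qed.

Variable mu : {measure set E -> \bar R}.
Hypothesis mu_rho : has_density mu rho.
Definition logd (i : 'I_d) (x : E) : R := weak_pderiv i rho x / rho x.

Let rho0 x : 0 <= rho x. Proof. by rewrite rhoE sqr_ge0. Qed.

Lemma weak_pderiv_rho i : is_weak_pderiv i rho (weak_pderiv i rho).
by have [D [_ _ h]] := rho_weak; exact: getPex (ex_intro _ _ (h i)). Qed.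

Lemma rho_loc : loc_integrable rho. Proof. by have [D []] := rho_weak. Qed.

Lemma density_fin K : compact K -> (mu K < +oo)%E.
move=> cK; have mK := compact_meas_rV cK; rewrite mu_rho//; have [_ h] := rho_loc.
have /integrableP[_] := h K cK; rewrite (_ : (fun x => `|(EFin \o rho) x|)%E = fun x => (rho x)%:E)//.
by ext x; rewrite /= ger0_norm.
Qed.

Lemma logd_meas i : mfunT (logd i).
have [_ [mg _] _] := weak_pderiv_rho i; have [mr _] := rho_loc.
apply: measurable_funM => //; rewrite (_ : (fun x => (rho x)^-1) = fun x => rho x `^ (-1)).
 by apply: (measurableT_comp (@measurable_powR R (-1))).
by ext x; rewrite powR_inv1.
Qed.

(** Since (grad rho / rho)^2 rho = 4 |grad phi|^2, local square integrability of grad phi for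
    Lebesgue measure is that of the logarithmic derivative for mu. Where phi = 0 the convention x /
    0 = 0 makes the left side vanish. *)
Lemma logd_L2 i chi : test T chi -> LL2 mu (fun x => chi x * logd i x).
move=> tc; have [D [[mr ir] LD h]] := rho_weak; have ae := weak_pderiv_uniq (weak_pderiv_rho i) (h i).
have m : mfunT (fun x => chi x * logd i x) by apply: measurable_funM; [exact: test_meas tc|exact: logd_meas].
split=> //; apply/(Lint_density rho0 mr mu_rho); first side.
apply: (Lint_ae_dom _ _ (LintZ 4 (LD i chi tc).2)).
 by apply: measurable_funM => //; side.
apply: filterS ae => x e; have p : 0 <= (chi x * logd i x) ^+ 2 * rho x by rewrite mulr_ge0// sqr_ge0.
rewrite ger0_norm// /logd e rhoE.
have [->|p0] := eqVneq (phi x) 0; first by rewrite [0 ^+ 2]expr2 !(mulr0, mul0r) mulr_ge0// sqr_ge0.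
by apply: eq_ler; field.
Qed.

(** Integration by parts for rho against Lebesgue measure, rewritten with the density. The
    factorisation of the weak derivative as (grad rho / rho) rho also holds a.e. where rho = 0,
    because there 2 phi D is 0. *)
Lemma logd_ibp i u : test T u -> Ig mu (pderiv i u) = - Ig mu (fun x => u x * logd i x).
move=> tu; have [D [[mr ir] LD h]] := rho_weak; have ae := weak_pderiv_uniq (weak_pderiv_rho i) (h i).
have [_ ig hg] := weak_pderiv_rho i; have tp := test_pderiv i tu.
rewrite (Ig_density rho0 mr mu_rho (Lint_test density_fin tp)).
have il : Lint mu (fun x => u x * logd i x).
 have [eta [te _ e1 _]] := cut1 openT tu.
 have := LL2_mul (LL2_test density_fin tu) (logd_L2 i te).
 by rewrite (_ : (fun x => _) = fun x => u x * logd i x)//; ext x; rewrite mulrCA mulrA e1.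
rewrite (Ig_density rho0 mr mu_rho il).
have -> : (fun x => pderiv i u x * rho x) = fun x => rho x * pderiv i u x by ext x; rewrite mulrC.
rewrite [LHS]hg//; congr (- _); apply: Ig_ae; first exact: loc_integrable_test ig tu.
 by apply: measurable_funM => //; exact: Lint_meas il.
apply: filterS ae => x e; rewrite /logd e rhoE.
have [->|p0] := eqVneq (phi x) 0; first by rewrite expr2 !(mulr0, mul0r).
by field.
Qed.
End density_derivative.

(** * Divergence form of the operator on test functions *)

Section divergence_form.
Variables (R : realType) (d : nat).
Local Notation E := 'rV[R]_d.
Local Notation T := (setT : set E).
Variable mu : {measure set E -> \bar R}.
Variable A : E -> 'M[R]_d.
Hypothesis hA : coefs mu A.
Let mu_fin := cf_fin hA.
Variable b : 'I_d -> E -> R.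
Hypothesis bL2 : forall i chi, test setT chi -> LL2 mu (fun x => chi x * b i x).
Variable wa : 'I_d -> 'I_d -> E -> E.
Hypothesis hwa : forall i j, WG mu b (fun x => A x i j) (wa i j).
Implicit Types (u v f g h chi eta : E -> R) (D F H : E -> E) (V : set E).
Local Notation Lint := (Lint mu).
Local Notation Ig := (Ig mu).
Local Notation LL2 := (LL2 mu).
Local Notation Ef := (Ef mu A).

Definition betab : E -> E := fun x => \row_i (2^-1 * \sum_(j < d) (wa i j x ord0 j + A x i j * b j x)).

Lemma A_bound V : precompact V -> exists2 c : R, 0 <= c & forall x i j, V x -> `|A x i j| <= c.
move=> pV; have [c c0 hc] := cf_ell hA pV; exists c; first side.
have de (i j : 'I_d) : (delta_mx ord0 i : E) ord0 j = (i == j)%:R by rewrite mxE eqxx /= eq_sym.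
have dd i : dotv (delta_mx ord0 i : E) (delta_mx ord0 i) = 1.
 rewrite /dotv (bigD1 i)//= big1 ?addr0 => [|j ij]; first by rewrite de eqxx mulr1.
 by rewrite de eq_sym (negbTE ij) mul0r.
move=> x i j Vx; have -> : A x i j = aform (A x) (delta_mx ord0 j) (delta_mx ord0 i).
 rewrite aformE (bigD1 i)//= [X in _ + X]big1 ?addr0.
  rewrite (bigD1 j)//= big1 ?addr0 => [|k kj]; first by rewrite !de !eqxx mul1r mulr1.
  by rewrite de eq_sym (negbTE kj) !mul0r.
 by move=> k ki; rewrite big1// => l _; rewrite [X in _ * X]de eq_sym (negbTE ki) mulr0.
apply: le_trans (a_abs hA _ _ _) _.
have := hc x (delta_mx ord0 j) Vx; have := hc x (delta_mx ord0 i) Vx; rewrite !dd mulr1 mulr1.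
rewrite /aform; move: (dotv _ _) (dotv _ _) => X Y /andP[_ h1] /andP[_ h2]; lra.
Qed.

Lemma AbL2 i j chi : test T chi -> LL2 (fun x => A x i j * b j x * chi x).
move=> tc; have [eta [te e01 e1 _]] := cut1 openT tc.
have [m te'] := test_ball te; have [c' c'0 hc'] := A_bound (@precompact_balln R d m).
rewrite (_ : (fun x => _) = fun x => (eta x * A x i j) * (chi x * b j x)); last first.
 by ext x; rewrite -[in LHS]e1; ring.
apply: (@LL2_bounded _ _ _ _ c'); last side.
 by apply: measurable_funM; [exact: test_meas te|exact: cf_measA hA i j].
move=> x; have [mx|nx] := pselect (balln m x); last by rewrite (test_off te' nx) mul0r normr0.
have /andP[p q] := e01 x; rewrite normrM ger0_norm// (le_trans _ (hc' x i j mx))//.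
by rewrite ler_piMl.
Qed.

(** The three product-rule terms of rho^-1 d_j (rho a_ij d_i u) v. *)
Let P u v i j x := wa i j x ord0 j * (pderiv i u x * v x) + A x i j * (pderiv j (pderiv i u) x * v x) + A x i j * (b j x * (pderiv i u x * v x)).

Lemma P_ibp u v i j : test T u -> smooth v ->
 [/\ Lint (fun x => A x i j * (pderiv i u x * pderiv j v x)), Lint (P u v i j) &
   Ig (fun x => A x i j * (pderiv i u x * pderiv j v x)) = - Ig (P u v i j)].
move=> tu sv; have tp := test_pderiv i tu; have te := testMl tp sv.
have [i0 i1 i3] := WG_int mu_fin bL2 j (hwa i j) te; have [_ _ LL hW] := hwa i j.
have LA' chi : test T chi -> LL2 (fun x => chi x * A x i j) by case/LL.
have i2 : Lint (fun x => A x i j * (pderiv i u x * pderiv j v x)).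
 exact: (loc_Lint mu_fin LA' (testMl tp (smooth_pderiv j sv))).
have i1' : Lint (fun x => A x i j * (pderiv j (pderiv i u) x * v x)).
 exact: (loc_Lint mu_fin LA' (testMl (test_pderiv j tp) sv)).
have iP : Lint (P u v i j) by apply: LintD => //; side.
split=> //; have := hW j _ te.
rewrite (_ : (fun x => _ * (_ + _)) = fun x => A x i j * (pderiv i u x * pderiv j v x) + (A x i j * (pderiv j (pderiv i u) x * v x) + A x i j * (b j x * (pderiv i u x * v x)))); last first.
 by ext x; rewrite (pderivM j x (test_smooth tp) sv); ring.
rewrite IgD ?LintD// IgD// => e; rewrite /P IgD ?LintD// IgD// e.
by move: (Ig _) (Ig _) (Ig _) => *; ring.
Qed.

Lemma sum_swap (M q : 'I_d -> 'I_d -> R) : (forall i j, M j i = M i j) ->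
 \sum_(i < d) \sum_(j < d) M i j * q i j = \sum_(i < d) \sum_(j < d) M i j * q j i.
by move=> Ms; rewrite exchange_big; apply: eq_bigr => i _; apply: eq_bigr => j _; rewrite Ms.
Qed.

Lemma nondiv_P u v x : nondiv_op A betab u x * v x = 2^-1 * \sum_(i < d) \sum_(j < d) P u v i j x.
rewrite /nondiv_op /dotv.
have -> : \sum_(i < d) betab x ord0 i * grad u x ord0 i =
  2^-1 * \sum_(i < d) \sum_(j < d) (wa i j x ord0 j + A x i j * b j x) * pderiv i u x.
 rewrite mulr_sumr; apply: eq_bigr => i _; rewrite mxE grad_coord -mulrA mulr_suml.
 by [].
rewrite (_ : \sum_(i < d) _ = \sum_(i < d) \sum_(j < d) A x i j * pderiv j (pderiv i u) x); last first.
 exact: (sum_swap (fun i j => pderiv i (pderiv j u) x) (cf_sym hA x)).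
rewrite -mulrDr -big_split -mulrA; congr (_ * _); rewrite mulr_suml; apply: eq_bigr => i _.
by rewrite -big_split mulr_suml; apply: eq_bigr => j _; rewrite /P /=; ring.
Qed.

(** Summing the identities of [P_ibp] shows that on C_0^oo the generator L^0 is a_ij d_ij / 2 plus
    the field beta. The function v ranges over all smooth functions, so v = 1 is available and gives
    that L^0 u has integral 0. *)
Lemma nondiv_ibp u v : test T u -> smooth v -> [/\ Lint (fun x => nondiv_op A betab u x * v x),
 Lint (fun x => aform (A x) (grad u x) (grad v x)) & Ef (grad u) (grad v) = - Ig (fun x => nondiv_op A betab u x * v x)].
move=> tu sv; have aE : (fun x => aform (A x) (grad u x) (grad v x)) =
  fun x => \sum_(i < d) \sum_(j < d) A x i j * (pderiv i u x * pderiv j v x).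
 ext x; rewrite aformE exchange_big; apply: eq_bigr => i _; apply: eq_bigr => j _.
 by rewrite !grad_coord (cf_sym hA) mulrAC mulrA [_ * A _ _ _]mulrC -mulrA.
have h i j := P_ibp i j tu sv.
have i1 i : Lint (fun x => \sum_(j < d) A x i j * (pderiv i u x * pderiv j v x)).
 by apply: (Lint_sum _ (F := fun j x => A x i j * (pderiv i u x * pderiv j v x))) => j; have [] := h i j.
have i2 i : Lint (fun x => \sum_(j < d) P u v i j x) by apply: (Lint_sum _ (F := fun j x => P u v i j x)) => j; have [] := h i j.
have i3 : Lint (fun x => \sum_(i < d) \sum_(j < d) P u v i j x) by apply: (Lint_sum _ (F := fun i x => \sum_(j < d) P u v i j x)).
have nE : (fun x => nondiv_op A betab u x * v x) = fun x => 2^-1 * \sum_(i < d) \sum_(j < d) P u v i j x.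
 by ext x; exact: nondiv_P.
split; [by rewrite nE; side|by rewrite aE; apply: (Lint_sum _ (F := fun i x => \sum_(j < d) _))|].
rewrite /Ef aE nE IgZ// -mulrN; congr (_ * _).
rewrite (Ig_sum _ (F := fun i x => \sum_(j < d) A x i j * (pderiv i u x * pderiv j v x)))//.
rewrite (Ig_sum _ (F := fun i x => \sum_(j < d) P u v i j x))// -sumrN; apply: eq_bigr => i _.
rewrite (Ig_sum _ (F := fun j x => A x i j * (pderiv i u x * pderiv j v x))); last by move=> j; have [] := h i j.
rewrite (Ig_sum _ (F := fun j x => P u v i j x)); last by move=> j; have [] := h i j.
by rewrite -sumrN; apply: eq_bigr => j _; have [] := h i j.
Qed.

Lemma nondiv_L2 u : test T u -> LL2 (nondiv_op A betab u).
move=> tu; have -> : nondiv_op A betab u = fun x => 2^-1 * \sum_(i < d) \sum_(j < d) P u (fun=> 1) i j x.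
 by ext x; rewrite -nondiv_P mulr1.
apply: LL2Z; apply: (LL2_sum _ (F := fun i x => \sum_(j < d) P u (fun=> 1) i j x)) => i.
apply: (LL2_sum _ (F := fun j x => P u (fun=> 1) i j x)) => j.
have [_ _ LL _] := hwa i j; have tp := test_pderiv i tu; have [_ l1] := LL _ tp; have [l2 _] := LL _ (test_pderiv j tp).
rewrite /P; apply: LL2D; [apply: LL2D|].
- by have := l1 j; under eq_fun do rewrite mulrC; under [X in LL2 X -> _]eq_fun do rewrite -[pderiv _ _ _]mulr1.
- by under eq_fun do rewrite mulrC mulr1.
- by have := AbL2 i j tp; under eq_fun do rewrite -mulrA; under [X in LL2 X -> _]eq_fun do rewrite -[pderiv _ _ _]mulr1.
Qed.
Hypothesis b_meas : forall i, mfunT (b i).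
Variable G : E -> E.
Hypothesis G_loc2 : L2_loc_vec mu G.
Hypothesis G_inv : forall u, test T u -> \int[mu]_x nondiv_op A G u x = 0.
Local Notation Sob := (Sob mu).
Let B : E -> E := fun x => G x - betab x.

Let B_coord i x : B x ord0 i = G x ord0 i - betab x ord0 i.
by rewrite mxE [X in _ + X]mxE. Qed.

Lemma beta_L2 i chi : test T chi -> LL2 (fun x => chi x * betab x ord0 i).
move=> tc; have -> : (fun x => chi x * betab x ord0 i) =
  fun x => 2^-1 * \sum_(j < d) (chi x * wa i j x ord0 j + A x i j * b j x * chi x).
 by ext x; rewrite mxE mulrCA mulr_sumr; congr (_ * _); apply: eq_bigr => j _; ring.
apply: LL2Z; apply: (LL2_sum _ (F := fun j x => chi x * wa i j x ord0 j + A x i j * b j x * chi x)) => j.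
have [_ _ LL _] := hwa i j; apply: LL2D; first by have [_ l] := LL _ tc.
exact: (AbL2).
Qed.

Lemma B_drift_L2 i chi : test T chi -> LL2 (fun x => chi x * B x ord0 i).
move=> tc; under eq_fun do rewrite B_coord mulrBr; apply: LL2B; last exact: beta_L2.
have [M M0 hM] := test_bounded tc; have [_ [K [cK _ k0]]] := tc; have mK := compact_meas_rV cK.
have [mG hG] := G_loc2 i; have [_ /(integrable_mkcond _ mK)] := hG K cK; rewrite restrict_EFin => iG.
rewrite (_ : (fun x => chi x * G x ord0 i) = fun x => chi x * ((fun x => G x ord0 i) \_ K) x); last first.
 by ext x; have [Kx|nK] := pselect (K x); [rewrite restrict_in|rewrite k0// !mul0r].
apply: (LL2_bounded (test_meas tc) hM); split; last by rewrite -(restrict_op _ (op := fun t => t ^+ 2)) ?expr0n.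
by apply/(measurable_restrictT _ mK); exact: measurable_funTS.
Qed.

Lemma nondivE u x : nondiv_op A G u x = nondiv_op A betab u x + dotv (B x) (grad u x).
rewrite /nondiv_op -addrA; congr (_ + _); rewrite -dotvDl; congr dotv.
by rewrite /B addrC subrK.
Qed.

Lemma B_meas i : mfunT (fun x => B x ord0 i).
under eq_fun do rewrite B_coord; apply: measurable_funB; first by have [] := G_loc2 i.
rewrite (_ : (fun x => betab x ord0 i) = fun x => 2^-1 * \sum_(j < d) (wa i j x ord0 j + A x i j * b j x)); last first.
 by ext x; rewrite mxE.
apply: measurable_funM => //; apply: measurable_sum => j; have [_ mw _ _] := hwa i j.
by apply: measurable_funD => //; apply: measurable_funM => //; exact: cf_measA hA i j.
Qed.

(** Infinitesimal invariance says that the full operator applied to u has integral 0, and so has its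
    symmetric part by [nondiv_ibp] with v = 1. The difference is the integral of <B, grad u>. *)
Lemma drift_B : drift mu B.
split; [exact: B_drift_L2|exact: B_meas|].
move=> u tu; have [i1 _] := nondiv_ibp tu (@smooth_cst R d 1).
rewrite (_ : (fun x => nondiv_op A betab u x * 1) = nondiv_op A betab u); last by ext x; rewrite mulr1.
move=> e1.
have e2 : Ef (grad u) (grad (fun=> 1)) = 0.
 rewrite (EfC hA) /Ef (_ : (fun x => _) = fun=> 0) ?Ig_cst0 ?mulr0//; ext x.
 rewrite (_ : grad _ x = 0) ?aform0l//; apply/rowP => i; rewrite !mxE.
 by rewrite (pderivE (du := fun=> 0))// => y.
have [eta [te _ h1 h2]] := cut1 openT tu.
have i2 : Lint (fun x => dotv (B x) (grad u x)).
 apply: (Lint_sum _ (F := fun i x => B x ord0 i * grad u x ord0 i)) => i.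
 have := LL2_mul (B_drift_L2 i te) (LL2_test mu_fin (test_pderiv i tu)).
 by rewrite (_ : (fun x => _) = fun x => B x ord0 i * grad u x ord0 i)//; ext x; rewrite grad_coord -[in RHS]h2; ring.
have := G_inv tu; under eq_Rintegral do rewrite nondivE.
have i1' : Lint (nondiv_op A betab u)
 by move: i1; rewrite (_ : (fun x => _ * 1) = nondiv_op A betab u)//; ext x; rewrite mulr1.
rewrite [LHS](IgD i1' i2) => <-; move/eqP: e1; rewrite e2 eq_sym oppr_eq0 => /eqP ->.
by rewrite add0r.
Qed.

(** [nondiv_ibp] covers smooth v; a general v in H^{1,2}_0(V) is reached by approximation in energy,
    since the symmetric part of the operator is in L^2 on test functions. *)
Lemma nondiv_core u V : open V -> precompact V -> test V u -> core mu A B V u (nondiv_op A G u).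
move=> oV pV tu; have tT := testW (@subsetT _ V) tu; have Lf := nondiv_L2 tT.
exists (grad u), (nondiv_op A betab u); split.
- exact: (Sob_test mu_fin tu).
- by have [M M0 hM] := test_bounded tu; exists M.
- split=> // x nV; rewrite /nondiv_op (grad_off tu nV) dotvC dotv0l addr0 big1 ?mulr0// => i _.
 by rewrite big1// => j _; rewrite (test_off (test_pderiv i (test_pderiv j tu)) nV) mulr0.
- move=> v F Sv; have [Hv [v_ [tv hv]]] := EG_Sob hA oV pV Sv.
 have Hn n := HA_test hA (tv n); have SH := semihilbert_qA hA.
 have H0 : HA mu A ((fun=> 0 : R^o), grad u) by split; [side|exact: (HA_test hA tT).2].
 have c1 : to0 (fun n => `|Ef (grad u) (grad (v_ n)) - Ef (grad u) F|).
  have := q_lim SH Hn Hv H0 hv; rewrite /qA /=.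
  under [X in to0 X -> _]eq_fun => k do (under eq_fun do rewrite mulr0; under [X in _ - (Ig X + _)]eq_fun do rewrite mulr0; rewrite !Ig_cst0 !add0r !(EfC hA _ (grad u))).
  by [].
 have c2 : to0 (fun n => `|Ig (fun x => v_ n x * nondiv_op A betab u x) - Ig (fun x => v x * nondiv_op A betab u x)|).
  apply: L2_lim_mul => //; [by move=> n; exact: (Hn n).1|exact: Hv.1|].
  by apply: (to0_le _ hv) => n; have [] := qA_parts hA ((v_ n, grad (v_ n)) - (v, F)).
 have c3 : to0 (fun n => `|- Ig (fun x => v_ n x * nondiv_op A betab u x) - - Ig (fun x => v x * nondiv_op A betab u x)|).
  by apply: (to0_le _ c2) => n; rewrite -opprD normrN.
 under [X in - Ig X]eq_fun do rewrite mulrC.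
 apply: (to0_uniq c1 c3); rewrite (_ : (fun n => _) = fun=> 0); first exact: to0_cst0.
 ext n; have [_ _ ->] := nondiv_ibp tT (test_smooth (tv n)).
 by under [X in - Ig X - _]eq_fun do rewrite mulrC; rewrite subrr normr0.
- by ext x; exact: nondivE.
Qed.
End divergence_form.

Lemma WG_ae (R : realType) (d : nat) (mu : {measure set 'rV[R]_d -> \bar R}) b u (D D' : 'rV[R]_d -> 'rV[R]_d) : WG mu b u D -> mvec D' ->
 {ae mu, forall x, D' x = D x} -> (forall K, compact K -> (mu K < +oo)%E) ->
 (forall i chi, test setT chi -> LL2 mu (fun x => chi x * b i x)) -> WG mu b u D'.
move=> W mD' e mu_fin bL2; have [mu' mD LL h] := W; split=> //.
 move=> chi tc; have [l1 l2] := LL _ tc; split=> // i; apply: (LL2_ae _ _ (l2 i)).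
  by apply: measurable_funM => //; exact: test_meas tc.
 by apply: filterS e => x ->.
move=> i eta te; rewrite -h//; have [j _ _] := WG_int mu_fin bL2 i W te.
apply/esym; apply: Ig_ae => //; first by apply: measurable_funM => //; exact: test_meas te.
by apply: filterS e => x ->.
Qed.

Theorem theorem2p5 (R : realType) (d : nat)
  (mu : {measure set 'rV[R]_d -> \bar R}) (phi rho : 'rV[R]_d -> R)
  (A : 'rV[R]_d -> 'M[R]_d) (G B : 'rV[R]_d -> 'rV[R]_d)
  (d_ge1 : (1 <= d)%N)
  (phi_loc : H12_loc (lebesgue_rV R d) setT phi)
  (rhoE : rho = fun x => phi x ^+ 2)
  (mu_rho : has_density mu rho)
  (mu_supp : msupp mu = setT)
  (A_sym : forall x i j, A x j i = A x i j)
  (A_loc : forall i j, H12_loc mu setT (fun x => A x i j))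
  (A_ell : loc_strictly_elliptic A)
  (G_loc2 : L2_loc_vec mu G)
  (G_inv : forall u, test setT u -> \int[mu]_x nondiv_op A G u x = 0)
  (BE : B = Bfield A mu rho G) :
  exists Lbar : ('rV[R]_d -> R) -> ('rV[R]_d -> R) -> Prop,
  [/\ closed_operator mu Lbar /\ extends Lbar (L_op mu A B),
      (exists T : R -> ('rV[R]_d -> R) -> 'rV[R]_d -> R,
         [/\ C0_contraction_semigroup mu T,
             forall t, 0 < t -> sub_markovian mu (T t) &
             semigroup_generator mu T Lbar]) /\
      (forall u, test setT u -> Lbar u (nondiv_op A G u)),
      forall V : nat -> set 'rV[R]_d, exhaustion V ->
      exists Gbar : R -> ('rV[R]_d -> R) -> 'rV[R]_d -> R,
        [/\ forall alpha f, 0 < alpha -> L1 mu setT f ->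
              L1_cvg mu setT (fun n => G_loc mu A B (V n) alpha f)
                (Gbar alpha f),
            forall alpha, 0 < alpha ->
              is_resolvent_of mu Lbar alpha (Gbar alpha),
            C0_contraction_resolvent mu Gbar,
            forall alpha, 0 < alpha ->
              sub_markovian mu (fun f x => alpha * Gbar alpha f x) &
            resolvent_generator mu Gbar Lbar] &
      forall u h, Lbar u h -> ess_bounded mu setT u ->
        [/\ dom_E0 mu A u,
            forall v, H12_0 mu setT v -> compact_supp mu v ->
              ess_bounded mu setT v ->
              E0 mu A u v - \int[mu]_x (dotv (B x) (wgrad mu setT u x) * v x)
                = - \int[mu]_x (h x * v x) &
            E0 mu A u u <= - \int[mu]_x (h x * u x)]].
Proof.
have mu_fin := density_fin phi_loc rhoE mu_rho.
have bL2 := logd_L2 phi_loc rhoE mu_rho; have b_ibp := logd_ibp phi_loc rhoE mu_rho.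
have bm := logd_meas phi_loc rhoE.
(* The versions of the gradients of a_ij are those chosen by [wgrad], so that [betab] coincides by
   computation with the field [beta] in the definition of B. *)
pose wa i j := wgrad mu setT (fun x => A x i j).
have hwa i j : WG mu (logd rho) (fun x => A x i j) (wa i j).
 have [D [W _ [mw _] e]] := H12_loc_WG mu_fin bL2 b_ibp (A_loc i j).
 exact: WG_ae W mw e mu_fin bL2.
have hA : coefs mu A.
 by split=> // i j; have [? _ _ _] := hwa i j.
have BE' : B = fun x => G x - betab A (logd rho) wa x by [].
have hB : drift mu B by rewrite BE'; exact: (drift_B hA bL2 hwa bm G_loc2 G_inv).
have Hcore u : test setT u -> Lb mu A B u (nondiv_op A G u).
 move=> tu; have [su [K [cK _ k0]]] := tu; apply: (Lb_core hA hB cK) => V oV pV KV.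
 rewrite BE'; apply: (nondiv_core hA bL2 hwa G oV pV).
 by split=> //; exists K.
have Htest u : test setT u -> exists h, Lb mu A B u h by move=> tu; exists (nondiv_op A G u); side.
exists (Lb mu A B); split.
- split; first exact: (Lb_L1_operator hA hB Htest).
 by move=> u g; exact: (L_op_Lb hA hB bL2 b_ibp).
- split=> //; exists (Tt mu A B); split.
 + exact: (Tt_semigroup hA hB Htest).
 + by move=> t t0 f; exact: (Tt_01 hA hB Htest t0).
 + exact: (Tt_generator hA hB Htest).
- move=> V eV; exists (Gb mu A B); split.
 + move=> al f al0 i; have [oV _ _] := eV.
  have hg n : resV mu A B (V n) al f (G_loc mu A B (V n) al f).
   by have [oVn pVn] := oV n; exact: (G_locP hA hB bL2 b_ibp oVn pVn al0 i).
  have [ig lim] := GbP hA hB al0 i.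
  apply/(L1_cvg_on mu openT); rewrite restrictT; split=> //.
   by move=> n; rewrite restrictT; exact: resV_Lint (hg n).
  by apply: (to0_le _ (lim V _ eV hg)) => n; rewrite restrictT.
 + by move=> al al0; exact: (Gb_is_resolvent hA hB al0).
 + exact: (Gb_C0 hA hB Htest).
 + by move=> al al0; exact: (Gb_sub_markovian hA hB al0).
 + exact: (Gb_generator hA hB).
- by move=> u h L eb; exact: (Lb_energy hA hB Htest bL2 b_ibp L eb).
Qed.
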